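(* Let $\alpha,\beta\in\mathbb{C}\setminus\{0,-1,-2,\ldots\}$ with $\alpha+\beta\notin\{-2,-3,-4,\ldots\}$, and let $w$, $p_n$, $a_n$ be as in the context. Let $\Omega\subset\mathbb{C}$ be the interior of an ellipse with foci $0$ and $1$, and let $f$ be analytic in $\Omega$. Then $$f(x)=\sum_{n=0}^\infty f_n\,p_n(x)\quad (x\in\Omega),\qquad f_n=a_n^{-1}\,\mathcal{H}\!\int_0^1 f(x)\,p_n(x)\,w(x)\,dx,$$ and the series converges absolutely and uniformly on every compact subset of $\Omega$.
   Context: $w(x)=x^\alpha(1-x)^\beta$, $q(x)=x(1-x)$, $p_n(x)=\frac{1}{w(x)}\frac{d^n}{dx^n}\big(q(x)^n w(x)\big)$ for $n=0,1,2,\ldots$ (a polynomial of degree $n$), and $a_n=\frac{n!\,\Gamma(n+\alpha+1)\,\Gamma(n+\beta+1)}{(2n+\alpha+\beta+1)\,\Gamma(n+\alpha+\beta+1)}$. $\mathcal{H}\int_0^1$ denotes the Hadamard finite part of the integral: for $F$ analytic at $0$ with Taylor series $F(t)=\sum_{m\ge0}c_m t^m$ and $\gamma\notin\{0,-1,-2,\ldots\}$, $\mathcal{H}\int_0^x t^{\gamma-1}F(t)\,dt:=\sum_{m\ge0}\frac{c_m}{m+\gamma}x^{m+\gamma}$ (for small $x>0$); for $h$ analytic near $[0,1]$, $\mathcal{H}\int_0^1 x^\alpha(1-x)^\beta h(x)\,dx$ is obtained by splitting at $\tfrac12$ and applying this definition at each endpoint (at $1$ after substituting $t=1-x$). Equivalently,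 it is the analytic continuation in $(\alpha,\beta)$ of the ordinary integral from $\Re\alpha,\Re\beta>-1$. *)

(* Defs.v *)
From Stdlib Require Import Arith Reals Lra Lia ClassicalEpsilon.
Open Scope R_scope.

Definition Cplx := (R * R)%type.
Definition RtoC (r : R) : Cplx := (r, 0).
Definition C0 : Cplx := (0, 0).
Definition C1 : Cplx := (1, 0).
Definition Cadd (z w : Cplx) : Cplx := (fst z + fst w, snd z + snd w).
Definition Copp (z : Cplx) : Cplx := (- fst z, - snd z).
Definition Csub (z w : Cplx) : Cplx := Cadd z (Copp w).
Definition Cmul (z w : Cplx) : Cplx :=
  (fst z * fst w - snd z * snd w, fst z * snd w + snd z * fst w).
Definition Cinv (z : Cplx) : Cplx :=
  (fst z / (fst z ^ 2 + snd z ^ 2), - snd z / (fst z ^ 2 + snd z ^ 2)).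
Definition Cdiv (z w : Cplx) : Cplx := Cmul z (Cinv w).
Definition Cnorm (z : Cplx) : R := sqrt (fst z ^ 2 + snd z ^ 2).
Fixpoint Cpow (z : Cplx) (n : nat) : Cplx :=
  match n with O => C1 | S k => Cmul z (Cpow z k) end.
Definition Cexp (z : Cplx) : Cplx := (exp (fst z) * cos (snd z), exp (fst z) * sin (snd z)).
Definition Cpow_pos (x : R) (z : Cplx) : Cplx := Cexp (Cmul z (RtoC (ln x))).
Fixpoint Csum (u : nat -> Cplx) (n : nat) : Cplx :=
  match n with O => u O | S k => Cadd (Csum u k) (u (S k)) end.
Fixpoint Cprod (u : nat -> Cplx) (n : nat) : Cplx :=
  match n with O => u O | S k => Cmul (Cprod u k) (u (S k)) end.

Definition Ccv (u : nat -> Cplx) (l : Cplx) : Prop :=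
  forall eps, 0 < eps -> exists N, forall n, (N <= n)%nat -> Cnorm (Csub (u n) l) < eps.
Definition Ccv_series (u : nat -> Cplx) (l : Cplx) : Prop := Ccv (Csum u) l.

(* ---------- Gamma function (Gauss' product limit), defined for z not in {0,-1,-2,...} ---------- *)
Definition gauss_seq (z : Cplx) (m : nat) : Cplx :=
  Cdiv (Cmul (RtoC (INR (Factorial.fact m))) (Cpow_pos (INR m) z))
       (Cprod (fun j => Cadd z (RtoC (INR j))) m).
Definition CGamma (z : Cplx) : Cplx := epsilon (inhabits C0) (Ccv (gauss_seq z)).

Definition wt (al be : Cplx) (x : R) : Cplx := Cmul (Cpow_pos x al) (Cpow_pos (1 - x) be).
Definition qf (x : R) : R := x * (1 - x).

Definition has_deriv_RC (g : R -> Cplx) (g' : Cplx) (x : R) : Prop :=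
  forall eps, 0 < eps -> exists del, 0 < del /\
    forall h, h <> 0 -> Rabs h < del ->
      Cnorm (Csub (Cmul (RtoC (/ h)) (Csub (g (x + h)) (g x))) g') < eps.

Definition is_poly_le (n : nat) (p : Cplx -> Cplx) : Prop :=
  exists c : nat -> Cplx, forall z, p z = Csum (fun k => Cmul (c k) (Cpow z k)) n.

(* Rodrigues formula: w(x) p(x) = d^n/dx^n ( q(x)^n w(x) ) on (0,1),
   expressed through a chain d 0 = q^n w, d (k+1) = (d k)', d n = w p. *)
Definition is_rodrigues (al be : Cplx) (n : nat) (p : Cplx -> Cplx) : Prop :=
  is_poly_le n p /\
  exists d : nat -> R -> Cplx,
    (forall x, 0 < x < 1 -> d O x = Cmul (RtoC (qf x ^ n)) (wt al be x)) /\
    (forall k x, (k < n)%nat -> 0 < x < 1 -> has_deriv_RC (d k) (d (S k) x) x) /\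
    (forall x, 0 < x < 1 -> d n x = Cmul (wt al be x) (p (RtoC x))).

Definition pn (al be : Cplx) (n : nat) : Cplx -> Cplx :=
  epsilon (inhabits (fun _ : Cplx => C0)) (is_rodrigues al be n).

Definition a_coef (al be : Cplx) (n : nat) : Cplx :=
  let s := Cadd (Cadd al be) (RtoC (INR (2 * n + 1))) in
  if Req_EM_T (fst s) 0 then
    if Req_EM_T (snd s) 0 then
      (* removable singularity: only n = 0, alpha+beta = -1; value
         Gamma(alpha+1) Gamma(beta+1) / Gamma(alpha+beta+2) *)
      Cdiv (Cmul (CGamma (Cadd al C1)) (CGamma (Cadd be C1)))
           (CGamma (Cadd (Cadd al be) (RtoC 2)))
    else
      Cdiv (Cmul (RtoC (INR (Factorial.fact n)))
                 (Cmul (CGamma (Cadd al (RtoC (INR (n + 1)))))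
                       (CGamma (Cadd be (RtoC (INR (n + 1)))))))
           (Cmul s (CGamma (Cadd (Cadd al be) (RtoC (INR (n + 1))))))
  else
    Cdiv (Cmul (RtoC (INR (Factorial.fact n)))
               (Cmul (CGamma (Cadd al (RtoC (INR (n + 1)))))
                     (CGamma (Cadd be (RtoC (INR (n + 1)))))))
         (Cmul s (CGamma (Cadd (Cadd al be) (RtoC (INR (n + 1)))))).

Definition is_RInt_C (g : R -> Cplx) (a b : R) (I : Cplx) : Prop :=
  exists (pr1 : Riemann_integrable (fun t => fst (g t)) a b)
         (pr2 : Riemann_integrable (fun t => snd (g t)) a b),
    RiemannInt pr1 = fst I /\ RiemannInt pr2 = snd I.

Definition series_rep (c : nat -> Cplx) (F : R -> Cplx) (r : R) : Prop :=
  forall t, 0 <= t < r -> Ccv_series (fun m => Cmul (c m) (Cpow (RtoC t) m)) (F t).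

(* Hadamard finite part  H int_0^1 x^al (1-x)^be h(x) dx = V, split at 1/2:
   near 0:  x^al F_L(x),  F_L(x) = (1-x)^be h(x) = sum cL_m x^m,
            H int_0^{1/2} = sum cL_m/(m+al+1) x0^(m+al+1) + int_{x0}^{1/2};
   near 1 (t = 1-x): t^be F_R(t), F_R(t) = (1-t)^al h(1-t) = sum cR_m t^m,
            H int_{1/2}^1 = sum cR_m/(m+be+1) x0^(m+be+1) + int_{1/2}^{1-x0}. *)
Definition is_HInt (al be : Cplx) (h : Cplx -> Cplx) (V : Cplx) : Prop :=
  exists (r x0 : R) (cL cR : nat -> Cplx) (SL SR IL IR : Cplx),
    0 < r /\ 0 < x0 /\ x0 < r /\ x0 < 1/2 /\
    series_rep cL (fun t => Cmul (Cpow_pos (1 - t) be) (h (RtoC t))) r /\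
    series_rep cR (fun t => Cmul (Cpow_pos (1 - t) al) (h (RtoC (1 - t)))) r /\
    Ccv_series (fun m => Cmul (Cdiv (cL m) (Cadd (RtoC (INR m)) (Cadd al C1)))
                              (Cpow_pos x0 (Cadd (RtoC (INR m)) (Cadd al C1)))) SL /\
    Ccv_series (fun m => Cmul (Cdiv (cR m) (Cadd (RtoC (INR m)) (Cadd be C1)))
                              (Cpow_pos x0 (Cadd (RtoC (INR m)) (Cadd be C1)))) SR /\
    is_RInt_C (fun x => Cmul (wt al be x) (h (RtoC x))) x0 (1/2) IL /\
    is_RInt_C (fun x => Cmul (wt al be x) (h (RtoC x))) (1/2) (1 - x0) IR /\
    V = Cadd (Cadd SL IL) (Cadd SR IR).

Definition HInt (al be : Cplx) (h : Cplx -> Cplx) : Cplx := epsilon (inhabits C0) (is_HInt al be h).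

Definition fcoef (al be : Cplx) (f : Cplx -> Cplx) (n : nat) : Cplx :=
  Cmul (Cinv (a_coef al be n)) (HInt al be (fun z => Cmul (f z) (pn al be n z))).

Definition holomorphic_on (Om : Cplx -> Prop) (f : Cplx -> Cplx) : Prop :=
  forall z, Om z -> exists f' : Cplx, forall eps, 0 < eps -> exists del, 0 < del /\
    forall u, Om u -> u <> z -> Cnorm (Csub u z) < del ->
      Cnorm (Csub (Cdiv (Csub (f u) (f z)) (Csub u z)) f') < eps.

Definition ellipse_interior (rho : R) (z : Cplx) : Prop :=
  Cnorm z + Cnorm (Csub z C1) < rho.

Definition compact_C (K : Cplx -> Prop) : Prop :=
  forall u : nat -> Cplx, (forall k, K (u k)) ->
    exists (phi : nat -> nat) (l : Cplx),
      (forall k, (phi k < phi (S k))%nat) /\ K l /\ Ccv (fun k => u (phi k)) l.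

Fixpoint Rsum_range (g : nat -> R) (m len : nat) : R :=
  match len with O => g m | S l => Rsum_range g m l + g (m + S l)%nat end.

(* Main.v *)
(* Proof idea.  The map [jouk u = (2 + u + 1/u)/4] sends [|u| = r] onto an ellipse with foci 0 and 1,
   so [f o jouk] extends to an annulus (in the coordinate [zeta = log u], a strip, where it is even and
   2 pi i-periodic); Goursat's theorem on rectangles and pointwise convergence of Fourier series give
   the Chebyshev expansion [f (jouk u) = sum c_k (u^k + u^-k)] with [c_k] of exponential decay on every
   smaller ellipse.  The Hadamard finite part is a continuous functional for a norm made of the sup norm
   on [0,1] and weighted l^1 norms of the Taylor coefficients at the two endpoints, so it may be applied
   to the Chebyshev expansion term by term.  Moment recurrences show that it annihilates [p_n] times a
   polynomial of degree < n and that it takes the value [a_n] on [p_n^2]; the latter needs the Beta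
   integral, obtained by shifting the parameters towards Gauss' product.  Hence each Chebyshev
   polynomial [T_k] is a finite combination of [p_0, ..., p_k] whose coefficients are finite parts.
   The finite parts of [T_k p_n], the ratio [n!^2 / a_n] and (through the three-term recurrence) the
   growth of [p_n / n!] on ellipses exceed their natural sizes only by factors [q^k], [q^n] with [q > 1]
   arbitrary, so the double series [sum_k sum_(n <= k)] converges geometrically and may be summed over
   [k] first. *)

(* Outside the range of convergence the weight is not integrable, and for complex parameters the
   pairing given by the finite part is not positive; no Hilbert space argument is available. What is
   known of the pairing therefore comes from two sources: algebraic recurrences of its moments, and
   continuity for a norm strong enough to control Hadamard's sums. That norm sees the Taylor
   coefficients at the endpoints, and the coefficients of p_n are exponentially larger than n!.
   Weighting the j-th coefficient by rho^j with a small rho brings the excess down to q^n, but rho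
   then depends on q; hence the importance of knowing that the finite part does not depend on the
   radius or on the splitting point. The condition on alpha + beta keeps the degree of p_n equal to
   n and the denominators of the three-term recurrence nonzero. All losses are paid from the decay
   of the Chebyshev coefficients: on a compact part of the ellipse there is a gap between the radius
   of the evaluation point and the admissible decay rate, and q is taken as a root of the quotient
   of the two radii. *)
From Stdlib Require Import Arith ZArith Reals Lra Lia ClassicalEpsilon.
Require Import Defs.
From Coquelicot Require Import Coquelicot.
Open Scope R_scope.

(** * Complex sequences, series and powers *)

(* [Cplx] and Coquelicot's [C] are both [R * R] with convertible operations; [toC] and [as_C] move a goal
   to Coquelicot's names, where [ring] and [field] apply. *)
Ltac toC :=
  change Cadd with Cplus in *; change Cmul with Cmult in *;
  change Csub with Cminus in *; change Defs.RtoC with RtoC in *;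
  change Cdiv with Complex.Cdiv in *; change Cinv with Complex.Cinv in *;
  change Defs.Cinv with Complex.Cinv in *; change Defs.Cdiv with Complex.Cdiv in *;
  change Defs.Copp with Complex.Copp in *; change Cnorm with Cmod in *;
  change C0 with (RtoC 0) in *; change C1 with (RtoC 1) in *.
Ltac as_C :=
  cbv beta;
  toC;
  repeat match goal with
  | |- context [?t] =>
      let T := type of t in constr_eq T Cplx;
      let v := fresh "v" in pose (v := (t : C)); change t with v
  end;
  try match goal with |- @eq _ ?a ?b => change (@eq C a b) end.
Ltac cring := as_C; ring.
Ltac cfield := as_C; field.

Lemma Csum_ext (u v : nat -> C) (n : nat) :
  (forall k, (k <= n)%nat -> u k = v k) -> Csum u n = Csum v n.
Proof.
  induction n as [|n IH]; intros H; simpl; [now apply H|].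
  rewrite IH by (intros; apply H; lia). now rewrite (H (S n)) by lia.
Qed.

Lemma Csum_plus (u v : nat -> C) (n : nat) :
  Csum (fun k => u k + v k)%C n = (Csum u n + Csum v n)%C.
Proof.
  induction n as [|n IH]; simpl; [reflexivity|]. rewrite IH.
  cring.
Qed.

Lemma Csum_scal (c : C) (u : nat -> C) (n : nat) :
  Csum (fun k => c * u k)%C n = (c * Csum u n)%C.
Proof.
  induction n as [|n IH]; simpl; [reflexivity|]. rewrite IH.
  cring.
Qed.

Lemma Csum_scal_r (c : C) (u : nat -> C) (n : nat) :
  Csum (fun k => u k * c)%C n = (Csum u n * c)%C.
Proof.
  rewrite (Csum_ext _ (fun k => c * u k)%C) by (intros; cring).
  rewrite Csum_scal. cring.
Qed.

Lemma Csum_minus (u v : nat -> C) (n : nat) :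
  Csum (fun k => u k - v k)%C n = (Csum u n - Csum v n)%C.
Proof.
  induction n as [|n IH]; simpl; [reflexivity|]. rewrite IH.
  cring.
Qed.

Lemma Csum_0 (n : nat) (u : nat -> C) :
  (forall k, (k <= n)%nat -> u k = 0) -> Csum u n = RtoC 0.
Proof.
  induction n as [|n IH]; intros H; simpl; [now apply H|].
  rewrite IH by (intros; apply H; lia). rewrite (H (S n)) by lia.
  cring.
Qed.

Lemma Csum_shift (u : nat -> C) (n : nat) :
  Csum u (S n) = (u O + Csum (fun k => u (S k)) n)%C.
Proof.
  induction n as [|n IH]; [reflexivity|].
  change (Csum u (S (S n))) with (Csum u (S n) + u (S (S n)))%C. rewrite IH.
  simpl. cring.
Qed.

Lemma Csum_extend (u : nat -> C) (n m : nat) :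
  (n <= m)%nat -> (forall k, (n < k <= m)%nat -> u k = 0) -> Csum u m = Csum u n.
Proof.
  intros Hnm H. induction Hnm as [|m Hnm IH]; [reflexivity|].
  simpl. rewrite IH by (intros; apply H; lia). rewrite (H (S m)) by lia.
  cring.
Qed.

Lemma Csum_single (u : nat -> C) (n j : nat) :
  (j <= n)%nat -> (forall k, (k <= n)%nat -> k <> j -> u k = 0) -> Csum u n = u j.
Proof.
  induction n as [|n IH]; intros Hj H.
  - now replace j with O by lia.
  - simpl. destruct (Nat.eq_dec j (S n)) as [->|Hne].
    + rewrite (Csum_0 n) by (intros; apply H; lia). cring.
    + rewrite IH by (try lia; intros; apply H; lia).
      rewrite (H (S n)) by lia. cring.
Qed.

Lemma Csum_swap (a : nat -> nat -> C) (n m : nat) :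
  Csum (fun i => Csum (fun j => a i j) m) n = Csum (fun j => Csum (fun i => a i j) n) m.
Proof.
  induction n as [|n IH]; [reflexivity|].
  simpl. rewrite IH. change Cadd with Cplus. now rewrite <- Csum_plus.
Qed.

Lemma Cmod_Csum (u : nat -> C) (n : nat) :
  Cmod (Csum u n) <= sum_f_R0 (fun k => Cmod (u k)) n.
Proof.
  induction n as [|n IH]; simpl; [lra|].
  eapply Rle_trans; [apply Cmod_triangle|lra].
Qed.

Lemma Re_Csum (u : nat -> C) (n : nat) : fst (Csum u n) = sum_f_R0 (fun k => fst (u k)) n.
Proof. induction n as [|n IH]; simpl; [reflexivity|now rewrite IH]. Qed.

Lemma Im_Csum (u : nat -> C) (n : nat) : snd (Csum u n) = sum_f_R0 (fun k => snd (u k)) n.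
Proof. induction n as [|n IH]; simpl; [reflexivity|now rewrite IH]. Qed.

Lemma Rabs_fst_le (z : C) : Rabs (fst z) <= Cmod z.
Proof. exact (re_le_Cmod z). Qed.

Lemma Rabs_snd_le (z : C) : Rabs (snd z) <= Cmod z.
Proof. eapply Rle_trans; [apply Rmax_r|apply (Rmax_Cmod z)]. Qed.

Lemma Cmod_le_sum (z : C) : Cmod z <= Rabs (fst z) + Rabs (snd z).
Proof.
  apply Rsqr_incr_0_var; [|pose proof (Rabs_pos (fst z)); pose proof (Rabs_pos (snd z)); lra].
  rewrite !Rsqr_pow2, Cmod2_alt. unfold Re, Im.
  rewrite <- (pow2_abs (fst z)), <- (pow2_abs (snd z)).
  pose proof (Rabs_pos (fst z)); pose proof (Rabs_pos (snd z)); nra.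
Qed.

Lemma Cmod_minus_sym (z w : C) : Cmod (z - w) = Cmod (w - z).
Proof. rewrite <- Cmod_opp. f_equal. cring. Qed.

Lemma Cmod_triangle_minus (z w : C) : Cmod (z - w) <= Cmod z + Cmod w.
Proof. unfold Cminus. eapply Rle_trans; [apply Cmod_triangle|]. rewrite Cmod_opp. lra. Qed.

Lemma Cmod_le_minus (z w : C) : Cmod z <= Cmod w + Cmod (z - w).
Proof. replace z with (w + (z - w))%C at 1 by cring. apply Cmod_triangle. Qed.

Lemma Cmod_le_eps_0 (z : C) : (forall eps, 0 < eps -> Cmod z <= eps) -> z = 0.
Proof.
  intros H. apply Cmod_eq_0. pose proof (Cmod_ge_0 z).
  destruct (Rle_lt_dec (Cmod z) 0) as [Hz|Hz]; [lra|].
  specialize (H (Cmod z / 2)). lra.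
Qed.

(** * Convergence of complex sequences and series *)

Lemma Ccv_components (u : nat -> C) (l : C) :
  Ccv u l <-> is_lim_seq (fun n => fst (u n)) (fst l) /\ is_lim_seq (fun n => snd (u n)) (snd l).
Proof.
  rewrite !is_lim_seq_Reals. split.
  - intros H; split; intros eps He; destruct (H eps He) as [N HN]; exists N; intros n Hn;
      (eapply Rle_lt_trans; [|apply (HN n); lia]).
    + exact (Rabs_fst_le (u n - l)%C).
    + exact (Rabs_snd_le (u n - l)%C).
  - intros [H1 H2] eps He.
    destruct (H1 (eps/2)) as [N1 HN1]; [lra|]. destruct (H2 (eps/2)) as [N2 HN2]; [lra|].
    exists (max N1 N2). intros n Hn. specialize (HN1 n ltac:(lia)). specialize (HN2 n ltac:(lia)).
    unfold Rdist in *.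
    eapply Rle_lt_trans; [apply (Cmod_le_sum (u n - l)%C)|].
    simpl. unfold Rminus in *. lra.
Qed.

Lemma Ccv_unique (u : nat -> C) (l l' : C) : Ccv u l -> Ccv u l' -> l = l'.
Proof.
  rewrite !Ccv_components. intros [H1 H2] [H3 H4].
  apply is_lim_seq_unique in H1, H2, H3, H4.
  rewrite H1 in H3; rewrite H2 in H4. destruct l, l'; simpl in *. congruence.
Qed.

Lemma Ccv_ext_loc (u v : nat -> C) (l : C) (N : nat) :
  (forall n, (N <= n)%nat -> u n = v n) -> Ccv u l -> Ccv v l.
Proof.
  intros H Hu eps He. destruct (Hu eps He) as [M HM]. exists (max N M). intros n Hn.
  rewrite <- H by lia. apply HM; lia.
Qed.

Lemma Ccv_ext (u v : nat -> C) (l : C) : (forall n, u n = v n) -> Ccv u l -> Ccv v l.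
Proof. intros H. apply (Ccv_ext_loc u v l 0). auto. Qed.

Lemma Ccv_const (l : C) : Ccv (fun _ => l) l.
Proof.
  intros eps He. exists O. intros n _. change (Cmod (l - l) < eps).
  replace (l - l)%C with (RtoC 0) by cring. now rewrite Cmod_0.
Qed.

Lemma Ccv_plus (u v : nat -> C) (l m : C) :
  Ccv u l -> Ccv v m -> Ccv (fun n => u n + v n)%C (l + m)%C.
Proof.
  rewrite !Ccv_components. intros [H1 H2] [H3 H4]. split; simpl.
  - exact (is_lim_seq_plus' _ _ _ _ H1 H3).
  - exact (is_lim_seq_plus' _ _ _ _ H2 H4).
Qed.

Lemma Ccv_mult (u v : nat -> C) (l m : C) :
  Ccv u l -> Ccv v m -> Ccv (fun n => u n * v n)%C (l * m)%C.
Proof.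
  rewrite !Ccv_components. intros [H1 H2] [H3 H4]. split; simpl.
  - apply is_lim_seq_minus'; now apply is_lim_seq_mult'.
  - apply is_lim_seq_plus'; now apply is_lim_seq_mult'.
Qed.

Lemma Ccv_scal (c : C) (u : nat -> C) (l : C) : Ccv u l -> Ccv (fun n => c * u n)%C (c * l)%C.
Proof. intros H. apply Ccv_mult; [apply Ccv_const|exact H]. Qed.

Lemma Ccv_minus (u v : nat -> C) (l m : C) :
  Ccv u l -> Ccv v m -> Ccv (fun n => u n - v n)%C (l - m)%C.
Proof.
  intros H1 H2. apply Ccv_plus; [exact H1|].
  eapply Ccv_ext; [|replace (- m)%C with ((-(1)) * m)%C by cring; apply Ccv_scal, H2].
  intros n; simpl. cring.
Qed.

Lemma Ccv_Cmod (u : nat -> C) (l : C) : Ccv u l -> is_lim_seq (fun n => Cmod (u n)) (Cmod l).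
Proof.
  intros H. apply is_lim_seq_Reals. intros eps He. destruct (H eps He) as [N HN].
  exists N. intros n Hn. specialize (HN n Hn). change (Cmod (u n - l) < eps) in HN.
  unfold Rdist. apply Rabs_def1.
  - pose proof (Cmod_le_minus (u n) l). lra.
  - pose proof (Cmod_le_minus l (u n)) as Hl. rewrite Cmod_minus_sym in Hl. lra.
Qed.

Lemma Ccv_Cmod_le (u : nat -> C) (l : C) (M : R) :
  Ccv u l -> (forall n, Cmod (u n) <= M) -> Cmod l <= M.
Proof.
  intros H HM. apply Ccv_Cmod in H.
  exact (is_lim_seq_le _ _ _ _ HM H (is_lim_seq_const M)).
Qed.

Lemma Ccv_subseq_shift (u : nat -> C) (l : C) (k : nat) : Ccv u l -> Ccv (fun n => u (n + k)%nat) l.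
Proof. intros H eps He. destruct (H eps He) as [N HN]. exists N. intros n Hn. apply HN. lia. Qed.

Lemma Ccv_unshift (u : nat -> C) (l : C) (k : nat) : Ccv (fun n => u (n + k)%nat) l -> Ccv u l.
Proof.
  intros H eps He. destruct (H eps He) as [N HN]. exists (N + k)%nat. intros n Hn.
  replace n with ((n - k) + k)%nat by lia. apply HN. lia.
Qed.

Lemma abs_bounded_sum_converges (v : nat -> R) (M : R) :
  (forall n, sum_f_R0 (fun k => Rabs (v k)) n <= M) ->
  exists l : R, is_lim_seq (sum_f_R0 v) l.
Proof.
  intros H. assert (E : ex_series (fun k => Rabs (v k))).
  { destruct (ex_finite_lim_seq_incr (sum_n (fun k => Rabs (v k))) M) as [l Hl].
    - intros n. rewrite !sum_n_Reals. simpl. pose proof (Rabs_pos (v (S n))). lra.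
    - intros n. rewrite sum_n_Reals. apply H.
    - exists l. exact Hl. }
  apply ex_series_Rabs in E. destruct E as [l Hl]. exists l.
  apply is_lim_seq_ext with (sum_n v); [intros; apply sum_n_Reals|]. exact Hl.
Qed.

Lemma Cseries_abs (u : nat -> C) (M : R) :
  (forall n, sum_f_R0 (fun k => Cmod (u k)) n <= M) -> exists l, Ccv_series u l.
Proof.
  intros H.
  destruct (abs_bounded_sum_converges (fun k => fst (u k)) M) as [l1 H1].
  { intros n. eapply Rle_trans; [|apply (H n)]. apply sum_Rle. intros; apply Rabs_fst_le. }
  destruct (abs_bounded_sum_converges (fun k => snd (u k)) M) as [l2 H2].
  { intros n. eapply Rle_trans; [|apply (H n)]. apply sum_Rle. intros; apply Rabs_snd_le. }
  exists (l1, l2). apply Ccv_components. split; simpl.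
  - eapply is_lim_seq_ext; [|exact H1]. intros; now rewrite Re_Csum.
  - eapply is_lim_seq_ext; [|exact H2]. intros; now rewrite Im_Csum.
Qed.

Lemma Csum_diff_le (u : nat -> C) (n m : nat) :
  (n <= m)%nat ->
  Cmod (Csum u m - Csum u n) <=
    sum_f_R0 (fun k => Cmod (u k)) m - sum_f_R0 (fun k => Cmod (u k)) n.
Proof.
  intros H. induction H as [|m H IH].
  - replace (Csum u n - Csum u n)%C with (RtoC 0) by cring. rewrite Cmod_0. lra.
  - simpl. change Cadd with Cplus.
    replace (Csum u m + u (S m) - Csum u n)%C with ((Csum u m - Csum u n) + u (S m))%C by cring.
    eapply Rle_trans; [apply Cmod_triangle|]. lra.
Qed.

Lemma sum_f_R0_nonneg_mono (v : nat -> R) (n m : nat) :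
  (forall k, 0 <= v k) -> (n <= m)%nat -> sum_f_R0 v n <= sum_f_R0 v m.
Proof.
  intros Hv H. induction H as [|m H IH]; [lra|]. simpl. specialize (Hv (S m)). lra.
Qed.

(** The limit of the absolute series is never formed: any bound [M] of its partial sums takes its
    place. *)
Lemma Cseries_tail (u : nat -> C) (l : C) (M : R) (n : nat) :
  (forall k, sum_f_R0 (fun k => Cmod (u k)) k <= M) -> Ccv_series u l ->
  Cmod (l - Csum u n) <= M - sum_f_R0 (fun k => Cmod (u k)) n.
Proof.
  intros HM Hl.
  assert (H : Ccv (fun k => Csum u (k + n) - Csum u n)%C (l - Csum u n)%C).
  { apply Ccv_minus; [|apply Ccv_const]. apply Ccv_subseq_shift with (u := Csum u). exact Hl. }
  apply (Ccv_Cmod_le _ _ _ H). intros k. eapply Rle_trans; [apply Csum_diff_le; lia|].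
  specialize (HM (k + n)%nat). lra.
Qed.

Lemma Cseries_bound (u : nat -> C) (l : C) (M : R) :
  (forall k, sum_f_R0 (fun k => Cmod (u k)) k <= M) -> Ccv_series u l -> Cmod l <= M.
Proof.
  intros HM Hl. apply (Ccv_Cmod_le _ _ _ Hl). intros n.
  eapply Rle_trans; [apply Cmod_Csum|apply HM].
Qed.

Lemma Ccv_series_scal (c : C) (u : nat -> C) (l : C) :
  Ccv_series u l -> Ccv_series (fun k => c * u k)%C (c * l)%C.
Proof.
  intros H. eapply Ccv_ext; [|apply Ccv_scal, H]. intros n. now rewrite Csum_scal.
Qed.

Lemma Ccv_series_plus (u v : nat -> C) (l m : C) :
  Ccv_series u l -> Ccv_series v m -> Ccv_series (fun k => u k + v k)%C (l + m)%C.
Proof.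
  intros H1 H2. eapply Ccv_ext; [|apply Ccv_plus; [exact H1|exact H2]].
  intros n. now rewrite Csum_plus.
Qed.

Lemma Ccv_series_ext (u v : nat -> C) (l : C) :
  (forall k, u k = v k) -> Ccv_series u l -> Ccv_series v l.
Proof. intros H. apply Ccv_ext. intros n. apply Csum_ext. auto. Qed.

Lemma Ccv_series_finite (u : nat -> C) (n : nat) :
  (forall k, (n < k)%nat -> u k = 0) -> Ccv_series u (Csum u n).
Proof.
  intros H. apply (Ccv_ext_loc (fun _ => Csum u n) _ _ n); [|apply Ccv_const].
  intros m Hm. symmetry. apply Csum_extend; [lia|]. intros; apply H; lia.
Qed.

Lemma Ccv_series_shift (u : nat -> C) (l : C) :
  Ccv_series (fun k => u (S k)) l -> Ccv_series u (u O + l)%C.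
Proof.
  intros H. apply (Ccv_unshift _ _ 1).
  eapply Ccv_ext; [|apply Ccv_plus; [apply Ccv_const|exact H]].
  intros n; simpl. rewrite Nat.add_1_r. now rewrite Csum_shift.
Qed.

Lemma sum_geom_le (th : R) (n : nat) : 0 <= th < 1 -> sum_f_R0 (pow th) n <= / (1 - th).
Proof.
  intros H. rewrite tech3 by lra.
  apply Rmult_le_reg_r with (1 - th); [lra|].
  unfold Rdiv. rewrite Rmult_assoc, Rinv_l by lra.
  pose proof (pow_le th (S n) (proj1 H)). lra.
Qed.

(** * The exponential and complex powers of positive reals *)

Lemma Cexp_plus (z w : C) : Cexp (z + w)%C = (Cexp z * Cexp w)%C.
Proof.
  unfold Cexp, Cmult, Cplus; simpl. rewrite exp_plus, cos_plus, sin_plus.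
  f_equal; cring.
Qed.

Lemma Cexp_0 : Cexp (RtoC 0) = RtoC 1.
Proof. unfold Cexp; simpl. rewrite exp_0, cos_0, sin_0. unfold RtoC. f_equal; cring. Qed.

Lemma Cmod_Cexp (z : C) : Cmod (Cexp z) = exp (fst z).
Proof.
  unfold Cmod, Cexp; simpl.
  replace (_ + _) with (exp (fst z) * exp (fst z) * ((sin (snd z))² + (cos (snd z))²)) by (unfold Rsqr; cring).
  rewrite sin2_cos2, Rmult_1_r. apply sqrt_square. left; apply exp_pos.
Qed.

Lemma Cexp_neq_0 (z : C) : Cexp z <> RtoC 0.
Proof. apply Cmod_gt_0. rewrite Cmod_Cexp. apply exp_pos. Qed.

Lemma Cexp_opp (z : C) : Cexp (- z)%C = (/ Cexp z)%C.
Proof.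
  assert (H : (Cexp (- z) * Cexp z)%C = 1).
  { rewrite <- Cexp_plus. replace (- z + z)%C with (RtoC 0) by cring. apply Cexp_0. }
  transitivity ((Cexp (- z) * Cexp z) * / Cexp z)%C; [cfield; apply Cexp_neq_0|].
  rewrite H. cring.
Qed.

Lemma Cexp_RtoC (x : R) : Cexp (RtoC x) = RtoC (exp x).
Proof. unfold Cexp; simpl. rewrite cos_0, sin_0. unfold RtoC. f_equal; cring. Qed.

Lemma Cexp_nat (z : C) (n : nat) : Cexp (INR n * z)%C = (Cexp z ^ n)%C.
Proof.
  induction n as [|n IH].
  - simpl. replace (0 * z)%C with (RtoC 0) by cring. apply Cexp_0.
  - rewrite S_INR, RtoC_plus. replace ((INR n + 1) * z)%C with (z + INR n * z)%C by cring.
    rewrite Cexp_plus, IH. reflexivity.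
Qed.

Lemma Cpow_pos_plus (x : R) (a b : C) : Cpow_pos x (a + b)%C = (Cpow_pos x a * Cpow_pos x b)%C.
Proof.
  unfold Cpow_pos. rewrite <- Cexp_plus. f_equal.
  change Cmul with Cmult; change Defs.RtoC with RtoC. cring.
Qed.

Lemma Cpow_pos_nat (x : R) (n : nat) : 0 < x -> Cpow_pos x (RtoC (INR n)) = RtoC (x ^ n).
Proof.
  intros Hx. unfold Cpow_pos. change Cmul with Cmult; change Defs.RtoC with RtoC.
  rewrite <- RtoC_mult, Cexp_RtoC. f_equal.
  rewrite <- Rpower_pow by exact Hx. reflexivity.
Qed.

Lemma Cmod_Cpow_pos (x : R) (a : C) : Cmod (Cpow_pos x a) = Rpower x (fst a).
Proof.
  unfold Cpow_pos. rewrite Cmod_Cexp. unfold Rpower. f_equal. simpl. cring.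
Qed.

Lemma Cpow_pos_neq_0 (x : R) (a : C) : Cpow_pos x a <> RtoC 0.
Proof. apply Cexp_neq_0. Qed.

Lemma Cpow_pos_mult (x y : R) (a : C) :
  0 < x -> 0 < y -> Cpow_pos (x * y) a = (Cpow_pos x a * Cpow_pos y a)%C.
Proof.
  intros Hx Hy. unfold Cpow_pos. rewrite <- Cexp_plus. f_equal.
  change Cmul with Cmult; change Defs.RtoC with RtoC. rewrite ln_mult by assumption.
  rewrite RtoC_plus. cring.
Qed.

Lemma Cpow_pos_1 (a : C) : Cpow_pos 1 a = RtoC 1.
Proof.
  unfold Cpow_pos. rewrite ln_1. change Cmul with Cmult; change Defs.RtoC with RtoC.
  replace (a * 0)%C with (RtoC 0) by cring. apply Cexp_0.
Qed.

Lemma Cpow_pos_1_r (x : R) : 0 < x -> Cpow_pos x (RtoC 1) = RtoC x.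
Proof. intros Hx. rewrite <- (pow_1 x) at 2. rewrite <- Cpow_pos_nat by exact Hx. reflexivity. Qed.

Lemma Defs_Cpow (z : C) (n : nat) : Defs.Cpow z n = (z ^ n)%C.
Proof. induction n as [|n IH]; [reflexivity|]. simpl. now rewrite IH. Qed.

(** * Calculus of complex functions of a real variable *)

Definition contC (g : R -> C) (x : R) : Prop :=
  continuous (fun t => fst (g t)) x /\ continuous (fun t => snd (g t)) x.

Definition derC (g : R -> C) (x : R) (l : C) : Prop :=
  is_derive (fun t => fst (g t)) x (fst l) /\ is_derive (fun t => snd (g t)) x (snd l).

Lemma continuous_R_eps (f : R -> R) (x : R) :
  continuous f x <->
  forall eps, 0 < eps -> exists del, 0 < del /\ forall y, Rabs (y - x) < del -> Rabs (f y - f x) < eps.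
Proof.
  split.
  - intros H eps He. apply continuity_pt_filterlim in H.
    destruct (H eps He) as [d [Hd Hy]]. exists d. split; [exact Hd|]. intros y Hyx.
    destruct (Req_dec y x) as [->|Hne].
    + unfold Rminus. rewrite Rplus_opp_r, Rabs_R0. exact He.
    + apply (Hy y). split; [|exact Hyx]. split; [exact I|auto].
  - intros H. apply continuity_pt_filterlim. intros eps He. destruct (H eps He) as [d [Hd Hy]].
    exists d. split; [exact Hd|]. intros y [_ Hyx]. apply Hy. exact Hyx.
Qed.

Lemma contC_eps (g : R -> C) (x : R) :
  contC g x <->
  forall eps, 0 < eps -> exists del, 0 < del /\ forall y, Rabs (y - x) < del -> Cmod (g y - g x) < eps.
Proof.
  unfold contC. rewrite !continuous_R_eps. split.
  - intros [H1 H2] eps He. destruct (H1 (eps/2)) as [d1 [Hd1 K1]]; [lra|].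
    destruct (H2 (eps/2)) as [d2 [Hd2 K2]]; [lra|].
    exists (Rmin d1 d2). split; [now apply Rmin_pos|]. intros y Hy.
    specialize (K1 y (Rlt_le_trans _ _ _ Hy (Rmin_l _ _))).
    specialize (K2 y (Rlt_le_trans _ _ _ Hy (Rmin_r _ _))).
    eapply Rle_lt_trans; [apply Cmod_le_sum|]. simpl. unfold Rminus in *. lra.
  - intros H. split; intros eps He; destruct (H eps He) as [d [Hd K]]; exists d; (split; [exact Hd|]);
      intros y Hy; (eapply Rle_lt_trans; [|apply (K y Hy)]).
    + exact (Rabs_fst_le (g y - g x)%C).
    + exact (Rabs_snd_le (g y - g x)%C).
Qed.

Lemma contC_ext_loc (f g : R -> C) (x : R) (d : R) :
  0 < d -> (forall y, Rabs (y - x) < d -> f y = g y) -> contC f x -> contC g x.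
Proof.
  intros Hd H. rewrite !contC_eps. intros Hf eps He. destruct (Hf eps He) as [e [He' K]].
  exists (Rmin d e). split; [now apply Rmin_pos|]. intros y Hy.
  rewrite <- !H.
  - apply K. eapply Rlt_le_trans; [exact Hy|apply Rmin_r].
  - unfold Rminus. now rewrite Rplus_opp_r, Rabs_R0.
  - eapply Rlt_le_trans; [exact Hy|apply Rmin_l].
Qed.

Lemma contC_ext (f g : R -> C) (x : R) : (forall y, f y = g y) -> contC f x -> contC g x.
Proof. intros H. apply (contC_ext_loc f g x 1); [lra|auto]. Qed.

Lemma contC_const (c : C) (x : R) : contC (fun _ => c) x.
Proof. split; apply continuous_const. Qed.

Lemma contC_RtoC (f : R -> R) (x : R) : continuous f x -> contC (fun t => RtoC (f t)) x.
Proof. intros H; split; simpl; [exact H|apply continuous_const]. Qed.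

Lemma contC_plus (f g : R -> C) (x : R) : contC f x -> contC g x -> contC (fun t => f t + g t)%C x.
Proof.
  intros [H1 H2] [H3 H4]. split; simpl.
  - now apply (continuous_plus (fun t => fst (f t)) (fun t => fst (g t))).
  - now apply (continuous_plus (fun t => snd (f t)) (fun t => snd (g t))).
Qed.

Lemma contC_mult (f g : R -> C) (x : R) : contC f x -> contC g x -> contC (fun t => f t * g t)%C x.
Proof.
  intros [H1 H2] [H3 H4]. split; simpl.
  - apply (continuous_minus (fun t => fst (f t) * fst (g t)) (fun t => snd (f t) * snd (g t)));
      now apply (continuous_mult (K := R_AbsRing)).
  - apply (continuous_plus (fun t => fst (f t) * snd (g t)) (fun t => snd (f t) * fst (g t)));
      now apply (continuous_mult (K := R_AbsRing)).
Qed.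

Lemma contC_opp (f : R -> C) (x : R) : contC f x -> contC (fun t => - f t)%C x.
Proof.
  intros H. apply contC_ext with (fun t => (-(1)) * f t)%C; [intros; ring|].
  apply contC_mult; [apply contC_const|exact H].
Qed.

Lemma contC_minus (f g : R -> C) (x : R) : contC f x -> contC g x -> contC (fun t => f t - g t)%C x.
Proof. intros H1 H2. apply contC_plus; [exact H1|]. now apply contC_opp. Qed.

Lemma contC_comp (f : R -> C) (p : R -> R) (x : R) :
  continuous p x -> contC f (p x) -> contC (fun t => f (p t)) x.
Proof.
  intros Hp [H1 H2]. split.
  - exact (continuous_comp p (fun t => fst (f t)) x Hp H1).
  - exact (continuous_comp p (fun t => snd (f t)) x Hp H2).
Qed.

Lemma contC_Csum (f : nat -> R -> C) (n : nat) (x : R) :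
  (forall k, (k <= n)%nat -> contC (f k) x) -> contC (fun t => Csum (fun k => f k t) n) x.
Proof.
  induction n as [|n IH]; intros H; simpl; [apply (H O); lia|].
  apply contC_plus; [apply IH; intros; apply H; lia|apply H; lia].
Qed.

Lemma contC_pow (f : R -> C) (n : nat) (x : R) : contC f x -> contC (fun t => f t ^ n)%C x.
Proof.
  intros H. induction n as [|n IH]; simpl; [apply contC_const|]. now apply contC_mult.
Qed.

Lemma derC_contC (g : R -> C) (x : R) (l : C) : derC g x l -> contC g x.
Proof.
  intros [H1 H2]; split; apply (ex_derive_continuous (V := R_NormedModule)); eexists; [exact H1|exact H2].
Qed.

Lemma derC_ext_loc (f g : R -> C) (x d : R) (l : C) :
  0 < d -> (forall y, Rabs (y - x) < d -> f y = g y) -> derC f x l -> derC g x l.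
Proof.
  intros Hd H [H1 H2].
  split; [apply is_derive_ext_loc with (2 := H1)|apply is_derive_ext_loc with (2 := H2)];
    exists (mkposreal d Hd); intros y Hy; now rewrite H.
Qed.

Lemma derC_ext (f g : R -> C) (x : R) (l : C) : (forall y, f y = g y) -> derC f x l -> derC g x l.
Proof. intros H. apply (derC_ext_loc f g x 1); [lra|auto]. Qed.

Lemma derC_eq (g : R -> C) (x : R) (l l' : C) : derC g x l -> l = l' -> derC g x l'.
Proof. now intros H <-. Qed.

Lemma derC_unique (g : R -> C) (x : R) (l l' : C) : derC g x l -> derC g x l' -> l = l'.
Proof.
  intros [H1 H2] [H3 H4]. apply is_derive_unique in H1, H2, H3, H4.
  destruct l, l'; simpl in *. congruence.
Qed.

Lemma is_derive_eq (f : R -> R) (x l l' : R) : is_derive f x l -> l = l' -> is_derive f x l'.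
Proof. now intros H <-. Qed.

Lemma derC_const (c : C) (x : R) : derC (fun _ => c) x 0.
Proof. split; apply @is_derive_const. Qed.

Lemma derC_RtoC (f : R -> R) (x l : R) : is_derive f x l -> derC (fun t => RtoC (f t)) x l.
Proof. intros H; split; simpl; [exact H|apply @is_derive_const]. Qed.

Lemma derC_id (x : R) : derC (fun t => RtoC t) x 1.
Proof. apply (derC_RtoC (fun t => t) x 1). exact (is_derive_id x). Qed.

Lemma derC_plus (f g : R -> C) (x : R) (l m : C) :
  derC f x l -> derC g x m -> derC (fun t => f t + g t)%C x (l + m)%C.
Proof.
  intros [H1 H2] [H3 H4]; split; simpl.
  - exact (is_derive_plus _ _ _ _ _ H1 H3).
  - exact (is_derive_plus _ _ _ _ _ H2 H4).
Qed.

Lemma derC_mult (f g : R -> C) (x : R) (l m : C) :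
  derC f x l -> derC g x m -> derC (fun t => f t * g t)%C x (l * g x + f x * m)%C.
Proof.
  intros [H1 H2] [H3 H4]; split; simpl.
  - pose proof (is_derive_minus _ _ _ _ _ (is_derive_mult _ _ _ _ _ H1 H3 Rmult_comm)
       (is_derive_mult _ _ _ _ _ H2 H4 Rmult_comm)) as H.
    replace (_ + _) with (minus (plus (mult (fst l) (fst (g x))) (mult (fst (f x)) (fst m)))
       (plus (mult (snd l) (snd (g x))) (mult (snd (f x)) (snd m)))).
    + exact H.
    + unfold minus, plus, opp, mult; simpl. unfold mult; simpl. ring.
  - pose proof (is_derive_plus _ _ _ _ _ (is_derive_mult _ _ _ _ _ H1 H4 Rmult_comm)
       (is_derive_mult _ _ _ _ _ H2 H3 Rmult_comm)) as H.
    replace (_ + _) with (plus (plus (mult (fst l) (snd (g x))) (mult (fst (f x)) (snd m)))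
       (plus (mult (snd l) (fst (g x))) (mult (snd (f x)) (fst m)))).
    + exact H.
    + unfold plus, mult; simpl. unfold mult; simpl. ring.
Qed.

Lemma derC_scal (c : C) (g : R -> C) (x : R) (l : C) : derC g x l -> derC (fun t => c * g t)%C x (c * l)%C.
Proof.
  intros H. eapply derC_eq; [apply (derC_mult (fun _ => c) g); [apply derC_const|exact H]|]. ring.
Qed.

Lemma derC_opp (g : R -> C) (x : R) (l : C) : derC g x l -> derC (fun t => - g t)%C x (- l)%C.
Proof.
  intros H. apply derC_ext with (fun t => (-(1)) * g t)%C; [intros; ring|].
  eapply derC_eq; [apply derC_scal, H|]. ring.
Qed.

Lemma derC_minus (f g : R -> C) (x : R) (l m : C) :
  derC f x l -> derC g x m -> derC (fun t => f t - g t)%C x (l - m)%C.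
Proof. intros H1 H2. apply derC_plus; [exact H1|]. now apply derC_opp. Qed.

Lemma derC_comp (g : R -> C) (p : R -> R) (x d : R) (l : C) :
  is_derive p x d -> derC g (p x) l -> derC (fun t => g (p t)) x (d * l)%C.
Proof.
  intros Hp [H1 H2]; split.
  - pose proof (is_derive_comp (fun t => fst (g t)) p x _ _ H1 Hp) as H.
    replace (fst (d * l)%C) with (scal d (fst l)); [exact H|].
    simpl. unfold scal; simpl. unfold mult; simpl. ring.
  - pose proof (is_derive_comp (fun t => snd (g t)) p x _ _ H2 Hp) as H.
    replace (snd (d * l)%C) with (scal d (snd l)); [exact H|].
    simpl. unfold scal; simpl. unfold mult; simpl. ring.
Qed.

Lemma derC_Csum (f : nat -> R -> C) (l : nat -> C) (n : nat) (x : R) :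
  (forall k, (k <= n)%nat -> derC (f k) x (l k)) ->
  derC (fun t => Csum (fun k => f k t) n) x (Csum l n).
Proof.
  induction n as [|n IH]; intros H; simpl; [apply (H O); lia|].
  apply derC_plus; [apply IH; intros; apply H; lia|apply H; lia].
Qed.

Lemma derC_Cexp (w : R -> C) (x : R) (l : C) :
  derC w x l -> derC (fun t => Cexp (w t)) x (l * Cexp (w x))%C.
Proof.
  intros [H1 H2]; split; simpl.
  - pose proof (is_derive_mult _ _ _ _ _ (is_derive_comp exp _ x _ _ (is_derive_exp _) H1)
      (is_derive_comp cos _ x _ _ (is_derive_cos _) H2) Rmult_comm) as H.
    eapply is_derive_eq; [exact H|]. unfold plus, scal, mult; simpl. unfold mult; simpl. ring.
  - pose proof (is_derive_mult _ _ _ _ _ (is_derive_comp exp _ x _ _ (is_derive_exp _) H1)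
      (is_derive_comp sin _ x _ _ (is_derive_sin _) H2) Rmult_comm) as H.
    eapply is_derive_eq; [exact H|]. unfold plus, scal, mult; simpl. unfold mult; simpl. ring.
Qed.

Lemma derC_Cpow_pos (a : C) (x : R) :
  0 < x -> derC (fun t => Cpow_pos t a) x (a * Cpow_pos x (a - 1))%C.
Proof.
  intros Hx. unfold Cpow_pos. toC. eapply derC_eq.
  - apply derC_Cexp. apply derC_scal. apply derC_RtoC. apply is_derive_ln. exact Hx.
  - replace ((a - 1) * ln x)%C with (a * ln x + - RtoC (ln x))%C by ring.
    rewrite Cexp_plus, Cexp_opp, Cexp_RtoC, exp_ln by exact Hx.
    rewrite RtoC_inv by lra. cfield. intros H. apply RtoC_inj in H. lra.
Qed.

Lemma derC_pow (n : nat) (x : R) :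
  derC (fun t => RtoC t ^ n)%C x (INR n * RtoC x ^ (pred n))%C.
Proof.
  eapply derC_ext; [intros y; apply RtoC_pow|].
  rewrite <- RtoC_pow, <- RtoC_mult. apply derC_RtoC.
  auto_derive; [exact I|ring].
Qed.

Lemma contC_Cpow_pos (a : C) (x : R) : 0 < x -> contC (fun t => Cpow_pos t a) x.
Proof. intros Hx. eapply derC_contC, derC_Cpow_pos, Hx. Qed.

Lemma derC_iff (g : R -> C) (x : R) (l : C) : has_deriv_RC g l x <-> derC g x l.
Proof.
  unfold has_deriv_RC, derC. rewrite !is_derive_Reals.
  split.
  - intros H. split; intros eps He; destruct (H eps He) as [d [Hd K]]; exists (mkposreal d Hd);
      intros h Hh Hhd; specialize (K h Hh Hhd); (eapply Rle_lt_trans; [|exact K]).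
    + eapply Rle_trans; [|apply Rabs_fst_le]. right. simpl. f_equal. field. exact Hh.
    + eapply Rle_trans; [|apply Rabs_snd_le]. right. simpl. f_equal. field. exact Hh.
  - intros [H1 H2] eps He.
    destruct (H1 (eps/2)) as [[d1 Hd1] K1]; [lra|]. destruct (H2 (eps/2)) as [[d2 Hd2] K2]; [lra|].
    simpl in *. exists (Rmin d1 d2). split; [now apply Rmin_pos|]. intros h Hh Hhd.
    specialize (K1 h Hh (Rlt_le_trans _ _ _ Hhd (Rmin_l _ _))).
    specialize (K2 h Hh (Rlt_le_trans _ _ _ Hhd (Rmin_r _ _))).
    eapply Rle_lt_trans; [apply Cmod_le_sum|]. simpl.
    replace (_ + _) with (Rabs ((fst (g (x + h)) - fst (g x)) / h - fst l) +
       Rabs ((snd (g (x + h)) - snd (g x)) / h - snd l)).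
    + lra.
    + f_equal; f_equal; field; exact Hh.
Qed.

(** Rotates [D] onto the nonnegative real axis, so that estimates of a modulus become estimates of a
    real part; the bound on [c] preserves majorants. *)
Lemma Cunit_align (D : C) : exists c : C, Cmod c <= 1 /\ (c * D)%C = Cmod D.
Proof.
  destruct (Req_dec (Cmod D) 0) as [H|H].
  - exists 0. rewrite Cmod_0. split; [lra|]. rewrite H. ring.
  - exists (Cconj D / Cmod D)%C. assert (H' : RtoC (Cmod D) <> 0) by (intros E; apply RtoC_inj in E; lra).
    split.
    + rewrite Cmod_div, Cmod_conj, Cmod_R by exact H'.
      rewrite Rabs_pos_eq by apply Cmod_ge_0. right; field; exact H.
    + replace (Cconj D / Cmod D * D)%C with ((D * Cconj D) / Cmod D)%C by (field; exact H').
      rewrite <- Cmod2_conj. rewrite RtoC_pow. cfield. exact H'.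
Qed.

(** A complex-valued function has no mean value point. The increment is rotated to be real, and the
    real theorem is applied to [psi] minus the real part of [c * Phi], whose derivative is
    nonnegative. *)
Lemma derC_mean_value (Phi phi : R -> C) (psi psi' : R -> R) (a b : R) :
  a <= b ->
  (forall x, a <= x <= b -> derC Phi x (phi x)) ->
  (forall x, a <= x <= b -> is_derive psi x (psi' x)) ->
  (forall x, a <= x <= b -> Cmod (phi x) <= psi' x) ->
  Cmod (Phi b - Phi a) <= psi b - psi a.
Proof.
  intros Hab HP Hp Hle.
  destruct (Cunit_align (Phi b - Phi a)) as [c [Hc HD]].
  pose (chi := fun t => psi t - fst (c * Phi t)%C).
  assert (Hchi : forall x, a <= x <= b -> is_derive chi x (psi' x - fst (c * phi x)%C)).
  { intros x Hx. apply (is_derive_minus (V := R_NormedModule)); [now apply Hp|].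
    exact (proj1 (derC_scal c _ _ _ (HP x Hx))). }
  destruct (MVT_gen chi a b (fun x => psi' x - fst (c * phi x)%C)) as [xi [Hxi E]].
  - intros x Hx. rewrite Rmin_left, Rmax_right in Hx by exact Hab. apply Hchi; lra.
  - intros x Hx. rewrite Rmin_left, Rmax_right in Hx by exact Hab.
    apply continuity_pt_filterlim. apply (ex_derive_continuous (V := R_NormedModule)).
    eexists. now apply Hchi.
  - rewrite Rmin_left, Rmax_right in Hxi by exact Hab.
    assert (H0 : 0 <= psi' xi - fst (c * phi xi)%C).
    { pose proof (Rabs_fst_le (c * phi xi)%C) as H1. rewrite Cmod_mult in H1.
      pose proof (Rle_abs (fst (c * phi xi)%C)). pose proof (Hle xi Hxi).
      pose proof (Cmod_ge_0 (phi xi)). nra. }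
    assert (H1 : chi a <= chi b) by nra.
    unfold chi in H1.
    assert (H2 : fst (c * (Phi b - Phi a))%C = Cmod (Phi b - Phi a)) by (rewrite HD; reflexivity).
    simpl in H1, H2. rewrite <- H2. simpl. lra.
Qed.

Lemma derC_zero_const (Phi : R -> C) (a b : R) :
  a <= b -> (forall x, a <= x <= b -> derC Phi x 0) -> Phi a = Phi b.
Proof.
  intros Hab H.
  pose proof (derC_mean_value Phi (fun _ => RtoC 0) (fun _ => 0) (fun _ => 0) a b Hab H) as K.
  assert (E : (Phi b - Phi a)%C = 0).
  { apply Cmod_eq_0. apply Rle_antisym; [|apply Cmod_ge_0].
    eapply Rle_trans; [apply K|lra].
    - intros; apply @is_derive_const.
    - intros. rewrite Cmod_0. lra. }
  transitivity (Phi b - (Phi b - Phi a))%C; [ring|]. rewrite E. ring.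
Qed.

(** * Riemann integrals of complex-valued functions *)

Definition is_RIC (g : R -> C) (a b : R) (I : C) : Prop :=
  is_RInt (fun t => fst (g t)) a b (fst I) /\ is_RInt (fun t => snd (g t)) a b (snd I).

Lemma is_RIC_iff (g : R -> C) (a b : R) (I : C) : is_RInt_C g a b I <-> is_RIC g a b I.
Proof.
  split.
  - intros [p1 [p2 [H1 H2]]]. split.
    + rewrite <- H1, <- RInt_Reals. apply (RInt_correct (V := R_CompleteNormedModule)), ex_RInt_Reals_1, p1.
    + rewrite <- H2, <- RInt_Reals. apply (RInt_correct (V := R_CompleteNormedModule)), ex_RInt_Reals_1, p2.
  - intros [H1 H2].
    assert (E1 : ex_RInt (fun t => fst (g t)) a b) by (eexists; exact H1).
    assert (E2 : ex_RInt (fun t => snd (g t)) a b) by (eexists; exact H2).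
    exists (ex_RInt_Reals_0 _ _ _ E1), (ex_RInt_Reals_0 _ _ _ E2).
    rewrite <- !RInt_Reals. split; apply (is_RInt_unique (V := R_CompleteNormedModule)); assumption.
Qed.

Lemma is_RIC_unique (g : R -> C) (a b : R) (I J : C) : is_RIC g a b I -> is_RIC g a b J -> I = J.
Proof.
  intros [H1 H2] [H3 H4]. apply (is_RInt_unique (V := R_CompleteNormedModule)) in H1, H2, H3, H4. destruct I, J; simpl in *. congruence.
Qed.

Lemma is_RIC_eq (g : R -> C) (a b : R) (I J : C) : is_RIC g a b I -> I = J -> is_RIC g a b J.
Proof. now intros H <-. Qed.

Lemma is_RIC_ext (f g : R -> C) (a b : R) (I : C) :
  (forall x, Rmin a b < x < Rmax a b -> f x = g x) -> is_RIC f a b I -> is_RIC g a b I.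
Proof.
  intros H [H1 H2]. split; (eapply is_RInt_ext; [|eassumption]); intros x Hx; simpl; now rewrite H.
Qed.

Lemma is_RIC_plus (f g : R -> C) (a b : R) (I J : C) :
  is_RIC f a b I -> is_RIC g a b J -> is_RIC (fun t => f t + g t)%C a b (I + J)%C.
Proof.
  intros [H1 H2] [H3 H4]; split; simpl.
  - exact (is_RInt_plus _ _ _ _ _ _ H1 H3).
  - exact (is_RInt_plus _ _ _ _ _ _ H2 H4).
Qed.

Lemma is_RIC_scal (c : C) (g : R -> C) (a b : R) (I : C) :
  is_RIC g a b I -> is_RIC (fun t => c * g t)%C a b (c * I)%C.
Proof.
  intros [H1 H2]; split; simpl.
  - exact (is_RInt_minus _ _ _ _ _ _ (is_RInt_scal _ _ _ (fst c) _ H1) (is_RInt_scal _ _ _ (snd c) _ H2)).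
  - exact (is_RInt_plus _ _ _ _ _ _ (is_RInt_scal _ _ _ (fst c) _ H2) (is_RInt_scal _ _ _ (snd c) _ H1)).
Qed.

Lemma is_RIC_minus (f g : R -> C) (a b : R) (I J : C) :
  is_RIC f a b I -> is_RIC g a b J -> is_RIC (fun t => f t - g t)%C a b (I - J)%C.
Proof.
  intros [H1 H2] [H3 H4]; split; simpl.
  - exact (is_RInt_minus _ _ _ _ _ _ H1 H3).
  - exact (is_RInt_minus _ _ _ _ _ _ H2 H4).
Qed.

Lemma is_RIC_Chasles (g : R -> C) (a b c : R) (I J : C) :
  is_RIC g a b I -> is_RIC g b c J -> is_RIC g a c (I + J)%C.
Proof.
  intros [H1 H2] [H3 H4]; split; simpl.
  - exact (is_RInt_Chasles _ _ _ _ _ _ H1 H3).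
  - exact (is_RInt_Chasles _ _ _ _ _ _ H2 H4).
Qed.

Lemma is_RIC_swap (g : R -> C) (a b : R) (I : C) : is_RIC g a b I -> is_RIC g b a (- I)%C.
Proof. intros [H1 H2]; split; simpl; [exact (is_RInt_swap _ _ _ _ H1)|exact (is_RInt_swap _ _ _ _ H2)]. Qed.

Lemma is_RIC_comp_lin (g : R -> C) (u v a b : R) (I : C) :
  is_RIC g (u * a + v) (u * b + v) I -> is_RIC (fun y => u * g (u * y + v)%R)%C a b I.
Proof.
  intros [H1 H2]; split; simpl.
  - apply is_RInt_comp_lin in H1. eapply is_RInt_ext; [|exact H1].
    intros; simpl. unfold scal; simpl. unfold mult; simpl. ring.
  - apply is_RInt_comp_lin in H2. eapply is_RInt_ext; [|exact H2].
    intros; simpl. unfold scal; simpl. unfold mult; simpl. ring.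
Qed.

Lemma is_RIC_const (c : C) (a b : R) : is_RIC (fun _ => c) a b ((b - a)%R * c)%C.
Proof.
  split; simpl.
  - replace (_ - _) with (scal (b - a) (fst c)); [exact (is_RInt_const a b (fst c))|].
    unfold scal; simpl. unfold mult; simpl. ring.
  - replace (_ + _) with (scal (b - a) (snd c)); [exact (is_RInt_const a b (snd c))|].
    unfold scal; simpl. unfold mult; simpl. ring.
Qed.

Lemma ex_RIC (g : R -> C) (a b : R) :
  (forall x, Rmin a b <= x <= Rmax a b -> contC g x) -> exists I, is_RIC g a b I.
Proof.
  intros H.
  destruct (ex_RInt_continuous (V := R_CompleteNormedModule) (fun t => fst (g t)) a b) as [I1 H1];
    [intros; now apply H|].
  destruct (ex_RInt_continuous (V := R_CompleteNormedModule) (fun t => snd (g t)) a b) as [I2 H2];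
    [intros; now apply H|].
  now exists (I1, I2).
Qed.

Lemma is_RIC_derive (Phi phi : R -> C) (a b : R) :
  (forall x, Rmin a b <= x <= Rmax a b -> derC Phi x (phi x)) ->
  (forall x, Rmin a b <= x <= Rmax a b -> contC phi x) ->
  is_RIC phi a b (Phi b - Phi a)%C.
Proof.
  intros H1 H2. split.
  - apply (is_RInt_derive (fun t => fst (Phi t)) (fun t => fst (phi t))); intros; [now apply H1|now apply H2].
  - apply (is_RInt_derive (fun t => snd (Phi t)) (fun t => snd (phi t))); intros; [now apply H1|now apply H2].
Qed.

Lemma is_RIC_bound (g : R -> C) (a b M : R) (I : C) :
  a <= b -> (forall x, a <= x <= b -> Cmod (g x) <= M) -> is_RIC g a b I ->
  Cmod I <= (b - a) * M.
Proof.
  intros Hab HM HI. destruct (Cunit_align I) as [c [Hc HD]].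
  pose proof (proj1 (is_RIC_scal c _ _ _ _ HI)) as H1.
  rewrite HD in H1. simpl in H1.
  pose proof (is_RInt_const a b M) as H2. change (scal (b - a) M) with ((b - a) * M) in H2.
  eapply is_RInt_le; [exact Hab|exact H1|exact H2|].
  intros x Hx. pose proof (Rabs_fst_le (c * g x)%C) as H3. rewrite Cmod_mult in H3.
  pose proof (Rle_abs (fst (c * g x)%C)). pose proof (HM x ltac:(lra)).
  pose proof (Cmod_ge_0 (g x)). simpl in *. nra.
Qed.

(** * Rodrigues polynomials *)

Lemma RtoC_INR_S (n : nat) : RtoC (INR (S n)) = (INR n + 1)%C.
Proof. now rewrite S_INR, RtoC_plus. Qed.

Lemma RtoC_INR_plus (n m : nat) : RtoC (INR (n + m)) = (INR n + INR m)%C.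
Proof. now rewrite plus_INR, RtoC_plus. Qed.

Lemma RtoC_INR_mult (n m : nat) : RtoC (INR (n * m)) = (INR n * INR m)%C.
Proof. now rewrite mult_INR, RtoC_mult. Qed.

Lemma RtoC_fact_S (n : nat) : RtoC (INR (fact (S n))) = ((INR n + 1) * INR (fact n))%C.
Proof. now rewrite fact_simpl, RtoC_INR_mult, RtoC_INR_S. Qed.

Lemma RtoC_neq_0 (x : R) : x <> 0 -> RtoC x <> 0.
Proof. intros H E. apply RtoC_inj in E. contradiction. Qed.

Lemma RtoC_fact_neq_0 (n : nat) : RtoC (INR (fact n)) <> 0.
Proof. apply RtoC_neq_0, INR_fact_neq_0. Qed.

Lemma RtoC_INR_S_neq_0 (n : nat) : (INR n + 1)%C <> 0.
Proof. rewrite <- RtoC_INR_S. apply RtoC_neq_0, not_0_INR. lia. Qed.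

(** * Pochhammer symbols and the coefficients of the polynomials *)

Fixpoint poch (z : C) (n : nat) : C :=
  match n with O => RtoC 1 | S k => (poch z k * (z + INR k))%C end.

Lemma poch_S (z : C) (n : nat) : poch z (S n) = (poch z n * (z + INR n))%C.
Proof. reflexivity. Qed.

Lemma poch_S_l (z : C) (n : nat) : poch z (S n) = (z * poch (z + 1) n)%C.
Proof.
  induction n as [|n IH]; [simpl; cring|].
  rewrite poch_S, IH, poch_S, RtoC_INR_S. ring.
Qed.

Lemma poch_add (z : C) (n m : nat) : poch z (n + m) = (poch z n * poch (z + INR n) m)%C.
Proof.
  induction m as [|m IH].
  - rewrite Nat.add_0_r. simpl. ring.
  - rewrite Nat.add_succ_r, !poch_S, IH, RtoC_INR_plus. ring.
Qed.

Lemma poch_neq_0 (z : C) (n : nat) : (forall k, (k < n)%nat -> (z + INR k)%C <> 0) -> poch z n <> 0.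
Proof.
  induction n as [|n IH]; intros H; simpl.
  - apply RtoC_neq_0. lra.
  - apply Cmult_neq_0; [apply IH; intros; apply H; lia|apply H; lia].
Qed.

(* Coefficients of [p_n]: the recursion is [p_(n+1)^(a,b) = x(1-x) p' + ((a+1)(1-x) - (b+1)x) p] with
   [p = p_n^(a+1,b+1)], i.e. the derivative of [q w p] for the weight [w = x^a (1-x)^b]. *)
Fixpoint pc (n : nat) (a b : C) (k : nat) : C :=
  match n with
  | O => match k with O => RtoC 1 | S _ => RtoC 0 end
  | S m => ((INR k + a + 1) * pc m (a + 1) (b + 1) k -
            match k with
            | O => RtoC 0
            | S j => (INR j + a + b + 2) * pc m (a + 1) (b + 1) j
            end)%C
  end.

Lemma pc_zero (n : nat) : forall (a b : C) (k : nat), (n < k)%nat -> pc n a b k = 0.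
Proof.
  induction n as [|n IH]; intros a b k Hk; destruct k as [|k]; try lia; simpl pc; [reflexivity|].
  rewrite !IH by lia. ring.
Qed.

Lemma pc_S_0 (n : nat) (a b : C) : pc (S n) a b 0 = ((a + 1) * pc n (a + 1) (b + 1) 0)%C.
Proof. simpl. cring. Qed.

Lemma pc_S_S (n : nat) (a b : C) (k : nat) :
  pc (S n) a b (S k) =
  ((INR k + 1 + a + 1) * pc n (a + 1) (b + 1) (S k) - (INR k + a + b + 2) * pc n (a + 1) (b + 1) k)%C.
Proof. cbn [pc]. now rewrite RtoC_INR_S. Qed.

(** These are the coefficients of (a+1)_n 2F1(-n, n+a+b+1; a+1; x). The induction keeps [a] and [b]
    general because the recursion raises both, and [r] stands for n - k to avoid truncated
    subtraction. *)
Lemma pc_explicit (n : nat) : forall (a b : C) (k r : nat), n = (k + r)%nat ->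
  pc n a b k =
  ((-(1)) ^ k * INR (fact n) / (INR (fact k) * INR (fact r)) *
     poch (a + b + INR n + 1) k * poch (a + INR k + 1) r)%C.
Proof.
  induction n as [|n IH]; intros a b k r Hn.
  - assert (k = O) by lia. assert (r = O) by lia. subst. simpl. cfield.
  - destruct k as [|k].
    + rewrite pc_S_0, (IH _ _ O n) by reflexivity.
      simpl in Hn; subst r. rewrite (poch_S_l (a + INR 0 + 1)). simpl (fact 0). simpl (INR 0). simpl (INR 1).
      simpl poch. simpl Cpow. rewrite RtoC_fact_S.
      replace (a + 1 + 0 + 1)%C with (a + 0 + 1 + 1)%C by ring.
      field. repeat split; try apply RtoC_fact_neq_0; try apply RtoC_INR_S_neq_0; try (apply RtoC_neq_0; lra).
    + rewrite pc_S_S. destruct r as [|r].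
      * rewrite (pc_zero n) by lia. assert (k = n) by lia. subst k.
        rewrite (IH _ _ n O) by lia. rewrite (poch_S_l (a + b + INR (S n) + 1)).
        rewrite !RtoC_fact_S, !RtoC_INR_S. simpl (fact 0). simpl (INR 1). simpl (poch _ 0). rewrite Cpow_S.
        replace (a + 1 + (b + 1) + INR n + 1)%C with (a + b + (INR n + 1) + 1 + 1)%C by ring.
        field. repeat split; try apply RtoC_fact_neq_0; try apply RtoC_INR_S_neq_0; try (apply RtoC_neq_0; lra).
      * rewrite (IH _ _ (S k) r) by lia. rewrite (IH _ _ k (S r)) by lia.
        rewrite (poch_S_l (a + b + INR (S n) + 1)).
        rewrite (poch_S (a + 1 + (b + 1) + INR n + 1)).
        rewrite (poch_S_l (a + 1 + INR k + 1)), (poch_S_l (a + INR (S k) + 1)).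
        rewrite !RtoC_fact_S, !RtoC_INR_S, Cpow_S.
        replace (a + 1 + (b + 1) + INR n + 1)%C with (a + b + (INR n + 1) + 1 + 1)%C by ring.
        replace (a + 1 + (INR k + 1) + 1)%C with (a + INR k + 1 + 1 + 1)%C by ring.
        replace (a + (INR k + 1) + 1 + 1)%C with (a + INR k + 1 + 1 + 1)%C by ring.
        replace (a + 1 + INR k + 1 + 1)%C with (a + INR k + 1 + 1 + 1)%C by ring.
        assert (E : RtoC (INR n) = (INR k + 1 + INR r)%C).
        { assert (n = S k + r)%nat by lia. subst n. now rewrite RtoC_INR_plus, RtoC_INR_S. }
        rewrite !E.
        field. repeat split; try apply RtoC_fact_neq_0; try apply RtoC_INR_S_neq_0.
Qed.

Lemma pc_lead (n : nat) (a b : C) : pc n a b n = ((-(1)) ^ n * poch (a + b + INR n + 1) n)%C.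
Proof.
  rewrite (pc_explicit n a b n 0) by lia. simpl (fact 0). simpl (INR 1). simpl (poch _ 0).
  field. apply RtoC_fact_neq_0.
Qed.

Lemma sgn_neq_0 (k : nat) : ((-(1)) ^ k)%C <> 0.
Proof.
  apply Cpow_nz. intros H. apply (f_equal fst) in H. simpl in H. lra.
Qed.

(** In classical notation n! P_n^(a,b)(1 - 2z), with P_n^(a,b) the Jacobi polynomial. *)
Definition pfun (n : nat) (a b z : C) : C := Csum (fun k => pc n a b k * z ^ k)%C n.

Lemma pfun_extend (n m : nat) (a b z : C) :
  (n <= m)%nat -> pfun n a b z = Csum (fun k => pc n a b k * z ^ k)%C m.
Proof.
  intros H. symmetry. apply Csum_extend; [exact H|]. intros k Hk. rewrite pc_zero by lia. ring.
Qed.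

Lemma pfun_0 (a b z : C) : pfun 0 a b z = 1.
Proof. unfold pfun; simpl. cring. Qed.

Lemma pfun_step (n : nat) (a b z : C) :
  (z * (1 - z) * Csum (fun k => pc n (a + 1) (b + 1) k * (INR k * z ^ pred k)) n +
   ((a + 1) * (1 - z) - (b + 1) * z) * pfun n (a + 1) (b + 1) z)%C = pfun (S n) a b z.
Proof.
  unfold pfun at 1. rewrite <- !Csum_scal, <- Csum_plus.
  transitivity (Csum (fun k => (INR k + a + 1) * pc n (a + 1) (b + 1) k * z ^ k -
     (INR k + a + b + 2) * pc n (a + 1) (b + 1) k * z ^ S k)%C n).
  { apply Csum_ext. intros k _. destruct k as [|k].
    - simpl. cring.
    - rewrite RtoC_INR_S, !Cpow_S. simpl pred. cring. }
  rewrite Csum_minus. unfold pfun.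
  rewrite <- (Csum_extend (fun k => (INR k + a + 1) * pc n (a + 1) (b + 1) k * z ^ k)%C n (S n));
    [|lia|intros k Hk; rewrite pc_zero by lia; cring].
  rewrite !(Csum_shift _ n). rewrite pc_S_0.
  transitivity ((a + 1) * pc n (a + 1) (b + 1) 0 * z ^ 0 +
    Csum (fun k => (INR (S k) + a + 1) * pc n (a + 1) (b + 1) (S k) * z ^ S k
     - (INR k + a + b + 2) * pc n (a + 1) (b + 1) k * z ^ S k) n)%C.
  - rewrite Csum_minus. simpl (INR 0). cring.
  - f_equal. apply Csum_ext. intros k _. rewrite pc_S_S, RtoC_INR_S. cring.
Qed.

Lemma derC_pfun (n : nat) (a b : C) (x : R) :
  derC (fun t => pfun n a b (RtoC t)) x (Csum (fun k => pc n a b k * (INR k * RtoC x ^ pred k)) n)%C.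
Proof.
  unfold pfun. apply derC_Csum. intros k _. apply derC_scal, derC_pow.
Qed.

Lemma derC_wt (a b : C) (x : R) : 0 < x < 1 ->
  derC (wt (a + 1)%C (b + 1)%C) x (((a + 1) * (1 - x)%R - (b + 1) * x) * wt a b x)%C.
Proof.
  intros Hx. unfold wt. toC. eapply derC_eq.
  - apply derC_mult; [apply derC_Cpow_pos; lra|].
    apply (derC_comp (fun t => Cpow_pos t (b + 1)%C) (fun t => 1 - t) x (-1)).
    + auto_derive; [exact I|ring].
    + apply derC_Cpow_pos; lra.
  - cbv beta. replace (a + 1 - 1)%C with a by cring. replace (b + 1 - 1)%C with b by cring.
    rewrite !Cpow_pos_plus, !Cpow_pos_1_r by lra. rewrite RtoC_minus. cring.
Qed.

(** One derivative lowers both exponents by one and raises the degree by one; the recursion of [pc]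
    is designed for this. *)
Lemma derC_rodrigues_step (n : nat) (a b : C) (x : R) : 0 < x < 1 ->
  derC (fun t => wt (a + 1)%C (b + 1)%C t * pfun n (a + 1) (b + 1) t)%C x
       (wt a b x * pfun (S n) a b x)%C.
Proof.
  intros Hx. eapply derC_eq.
  - apply derC_mult; [apply derC_wt, Hx|apply derC_pfun].
  - rewrite <- pfun_step. unfold wt at 2. toC.
    rewrite !Cpow_pos_plus, !Cpow_pos_1_r by lra. unfold wt. toC. rewrite !RtoC_minus. cring.
Qed.

(** * Uniqueness of power series and of Rodrigues polynomials *)

Lemma Ccv_bounded (u : nat -> C) (l : C) : Ccv u l -> exists B, 0 < B /\ forall n, Cmod (u n) <= B.
Proof.
  intros H. destruct (H 1 ltac:(lra)) as [N HN].
  pose proof (cond_pos_sum (fun k => Cmod (u k)) N (fun k => Cmod_ge_0 _)) as HP.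
  exists (Cmod l + 1 + sum_f_R0 (fun k => Cmod (u k)) N). pose proof (Cmod_ge_0 l). split; [lra|].
  intros n. destruct (le_lt_dec n N) as [Hn|Hn].
  - pose proof (sum_f_R0_nonneg_mono (fun k => Cmod (u k)) n N (fun k => Cmod_ge_0 _) Hn) as H2.
    assert (H3 : Cmod (u n) <= sum_f_R0 (fun k => Cmod (u k)) n).
    { destruct n; simpl; [lra|].
      pose proof (cond_pos_sum (fun k => Cmod (u k)) n (fun k => Cmod_ge_0 _)). lra. }
    lra.
  - specialize (HN n ltac:(lia)). change (Cmod (u n - l) < 1) in HN.
    pose proof (Cmod_le_minus (u n) l). lra.
Qed.

Lemma Cseries_terms_bounded (u : nat -> C) (l : C) :
  Ccv_series u l -> exists B, 0 < B /\ forall n, Cmod (u n) <= B.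
Proof.
  intros H. destruct (Ccv_bounded _ _ H) as [B [HB Hu]]. exists (B + B). split; [lra|].
  intros [|n]; [specialize (Hu O); simpl in Hu; lra|].
  pose proof (Cmod_triangle_minus (Csum u (S n)) (Csum u n)) as T.
  replace (Csum u (S n) - Csum u n)%C with (u (S n)) in T by (simpl; cring).
  pose proof (Hu n). pose proof (Hu (S n)). lra.
Qed.

(** The first nonzero coefficient would be the limit at 0 of the sum divided by a power of t;
    continuity of the sum is replaced by the boundedness of the terms at [r / 2]. *)
Lemma power_series_unique (c : nat -> C) (r : R) :
  0 < r -> (forall t, 0 < t < r -> Ccv_series (fun m => c m * RtoC t ^ m)%C (RtoC 0)) ->
  forall m, c m = 0.
Proof.
  intros Hr H m. induction m as [m IH] using lt_wf_ind.
  assert (HS : forall t, 0 < t < r -> Ccv_series (fun k => c (m + k)%nat * RtoC t ^ k)%C (RtoC 0)).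
  { intros t Ht. specialize (H t Ht).
    assert (Ht0 : (RtoC t ^ m)%C <> 0) by (apply Cpow_nz, RtoC_neq_0; lra).
    apply (Ccv_subseq_shift _ _ m) in H.
    apply (Ccv_scal (/ (RtoC t ^ m))%C) in H.
    replace (/ RtoC t ^ m * 0)%C with (RtoC 0) in H by ring.
    eapply Ccv_ext; [|exact H]. intros n. simpl.
    assert (E : Csum (fun k => c k * RtoC t ^ k)%C (n + m) =
      (RtoC t ^ m * Csum (fun k => c (m + k)%nat * RtoC t ^ k) n)%C).
    { clear H. induction n as [|n IHn].
      - simpl. rewrite (Csum_single _ m m) by (try lia; intros k Hk Hne; rewrite IH by lia; cring).
        rewrite Nat.add_0_r. cring.
      - change (S n + m)%nat with (S (n + m)). simpl. rewrite IHn. toC.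
        replace (m + S n)%nat with (S (n + m)) by lia.
        rewrite Cpow_add_r. cring. }
    rewrite E. cfield. exact Ht0. }
  destruct (Cseries_terms_bounded _ _ (HS (r / 2) ltac:(lra))) as [B [HB0 HB]].
  apply Cmod_le_eps_0. intros eps He.
  (* At [th * (r / 2)] the terms after the first add up to at most B th / (1 - th), hence to at most
     2 B th because [th] is at most 1/2; the second argument makes this at most [eps]. *)
  set (th := Rmin (1 / 2) (eps / (2 * B))).
  assert (Hth : 0 < th <= 1 / 2).
  { unfold th. split; [apply Rmin_pos; [lra|apply Rdiv_lt_0_compat; lra]|apply Rmin_l]. }
  assert (Hth2 : 2 * B * th <= eps).
  { apply Rle_trans with (2 * B * (eps / (2 * B))); [|right; field; lra].
    apply Rmult_le_compat_l; [lra|apply Rmin_r]. }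
  specialize (HS (th * (r / 2)) ltac:(nra)).
  (* The unsimplified right side is the form in which [Cseries_tail] at index 0 delivers the
     bound. *)
  assert (Hb : Cmod (0 - Csum (fun k => c (m + k)%nat * RtoC (th * (r / 2)) ^ k)%C 0) <=
    2 * B * th + Cmod (c m) - Cmod (c m)).
  { eapply Rle_trans.
    - apply (Cseries_tail _ _ (2 * B * th + Cmod (c m)) 0); [|exact HS].
      intros k. destruct k as [|k].
      + simpl. rewrite Cmult_1_r, Nat.add_0_r. nra.
      + rewrite decomp_sum by lia. simpl pred.
        replace (c (m + 0)%nat * RtoC (th * (r / 2)) ^ 0)%C with (c m) by (rewrite Nat.add_0_r; cring).
        apply Rle_trans with (Cmod (c m) + sum_f_R0 (fun i => pow th i * (B * th)) k).
        * apply Rplus_le_compat_l. apply sum_Rle. intros i _.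
          rewrite RtoC_mult, Cpow_mult_l.
          replace (c (m + S i)%nat * (RtoC th ^ S i * RtoC (r / 2) ^ S i))%C with
            (RtoC th ^ S i * (c (m + S i)%nat * RtoC (r / 2) ^ S i))%C by cring.
          rewrite Cmod_mult, <- RtoC_pow, Cmod_R, Rabs_pos_eq by (apply pow_le; lra).
          specialize (HB (S i)). pose proof (pow_lt th i (proj1 Hth)). simpl pow.
          apply Rle_trans with (th * th ^ i * B); [|right; ring].
          apply Rmult_le_compat_l; [nra|exact HB].
        * rewrite <- scal_sum. pose proof (sum_geom_le th k ltac:(lra)) as Hg.
          assert (/ (1 - th) <= 2).
          { rewrite <- (Rinv_inv 2). apply Rinv_le_contravar; lra. }
          assert (0 <= B * th) by nra. nra.
    - simpl. rewrite Cmult_1_r, Nat.add_0_r. lra. }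
  simpl in Hb. rewrite Nat.add_0_r, Cmult_1_r in Hb.
  replace (0 - c m)%C with (- c m)%C in Hb by ring. rewrite Cmod_opp in Hb. lra.
Qed.

Lemma poly_zero_unique (c : nat -> C) (n : nat) (r : R) :
  0 < r -> (forall t, 0 < t < r -> Csum (fun k => c k * RtoC t ^ k)%C n = RtoC 0) ->
  forall k, (k <= n)%nat -> c k = 0.
Proof.
  intros Hr H k Hk.
  set (d := fun k => if le_dec k n then c k else RtoC 0).
  assert (Hd : forall m, d m = 0).
  { apply (power_series_unique d r Hr). intros t Ht.
    rewrite <- (H t Ht). eapply Ccv_series_ext; [intros; reflexivity|].
    rewrite (Csum_ext _ (fun k => d k * RtoC t ^ k)%C).
    - apply Ccv_series_finite. intros j Hj. unfold d. destruct (le_dec j n); [lia|cring].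
    - intros j Hj. unfold d. destruct (le_dec j n); [reflexivity|lia]. }
  specialize (Hd k). unfold d in Hd. destruct (le_dec k n); [exact Hd|lia].
Qed.

Lemma wt_neq_0 (a b : C) (x : R) : wt a b x <> RtoC 0.
Proof. apply Cmult_neq_0; apply Cpow_pos_neq_0. Qed.

(** [pn] is a choice among solutions, so identifying it requires uniqueness: the derivatives agree
    on (0,1), the weight has no zero there, and a polynomial is determined by its values on
    (0,1). *)
Lemma rodrigues_unique (al be : C) (n : nat) (p q : C -> C) :
  is_rodrigues al be n p -> is_rodrigues al be n q -> forall z, p z = q z.
Proof.
  intros [[c Hc] [d [d0 [dS dn]]]] [[c' Hc'] [e [e0 [eS en]]]] z.
  assert (Hde : forall k, (k <= n)%nat -> forall x, 0 < x < 1 -> d k x = e k x).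
  { induction k as [|k IH]; intros Hk x Hx; [now rewrite d0, e0|].
    pose proof (dS k x ltac:(lia) Hx) as D1. pose proof (eS k x ltac:(lia) Hx) as D2.
    apply derC_iff in D1, D2.
    apply (derC_unique (e k) x); [|exact D2].
    apply (derC_ext_loc (d k) (e k) x (Rmin x (1 - x))); [apply Rmin_pos; lra| |exact D1].
    intros y Hy. apply IH; [lia|].
    pose proof (Rmin_l x (1 - x)); pose proof (Rmin_r x (1 - x)).
    apply Rabs_def2 in Hy. lra. }
  assert (Hpq : forall x, 0 < x < 1 -> p (RtoC x) = q (RtoC x)).
  { intros x Hx. pose proof (Hde n (le_n n) x Hx) as E. rewrite dn, en in E by exact Hx. toC.
    pose proof (wt_neq_0 al be x) as Hw. toC.
    transitivity (wt al be x * p (RtoC x) / wt al be x)%C; [cfield; exact Hw|].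
    rewrite E. cfield. exact Hw. }
  assert (Hcc : forall k, (k <= n)%nat -> (c k - c' k)%C = 0).
  { apply (poly_zero_unique (fun k => c k - c' k)%C n 1); [lra|]. intros t Ht.
    pose proof (Hpq t Ht) as E. rewrite Hc, Hc' in E. toC.
    rewrite (Csum_ext _ (fun k => c k * RtoC t ^ k - c' k * RtoC t ^ k)%C) by (intros; cring).
    rewrite Csum_minus.
    rewrite (Csum_ext _ (fun k => c k * RtoC t ^ k)%C) in E by (intros; now rewrite Defs_Cpow).
    rewrite E.
    rewrite (Csum_ext _ (fun k => c' k * RtoC t ^ k)%C) by (intros; now rewrite Defs_Cpow).
    cring. }
  rewrite Hc, Hc'. apply Csum_ext. intros k Hk. f_equal.
  transitivity (c k - (c k - c' k))%C; [rewrite Hcc by exact Hk|]; cring.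
Qed.

Lemma pfun_is_rodrigues (al be : C) (n : nat) : is_rodrigues al be n (pfun n al be).
Proof.
  split.
  - exists (pc n al be). intros z. apply Csum_ext. intros k _. reflexivity.
  (* After [k] derivatives the exponents exceed [al] and [be] by n - k, and the polynomial factor is
     p_k for these shifted parameters. *)
  - exists (fun k x => wt (al + INR (n - k))%C (be + INR (n - k))%C x *
                       pfun k (al + INR (n - k)) (be + INR (n - k)) x)%C.
    split; [|split].
    + intros x Hx. rewrite pfun_0, Nat.sub_0_r. unfold wt, qf. toC.
      rewrite !Cpow_pos_plus, !Cpow_pos_nat, Rpow_mult_distr, RtoC_mult by lra. cring.
    + intros k x Hk Hx. apply derC_iff.
      assert (E : forall a : C, (a + INR (n - k))%C = (a + INR (n - S k) + 1)%C).
      { intros a. replace (n - k)%nat with (S (n - S k)) by lia. rewrite RtoC_INR_S. ring. }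
      rewrite !E. apply derC_rodrigues_step, Hx.
    + intros x Hx. rewrite Nat.sub_diag. simpl INR.
      replace (al + 0)%C with al by ring. replace (be + 0)%C with be by ring. reflexivity.
Qed.

Lemma pn_eq (al be : C) (n : nat) (z : C) : pn al be n z = pfun n al be z.
Proof.
  apply (rodrigues_unique al be n); [|apply pfun_is_rodrigues].
  unfold pn. apply epsilon_spec. exists (pfun n al be). apply pfun_is_rodrigues.
Qed.

(** * The reflection x -> 1 - x *)

Lemma is_poly_le_eq (n : nat) (p q : C -> C) :
  (forall z, p z = q z) -> is_poly_le n p -> is_poly_le n q.
Proof. intros H [c Hc]. exists c. intros z. now rewrite <- H. Qed.

Lemma is_poly_le_mono (n m : nat) (p : C -> C) : (n <= m)%nat -> is_poly_le n p -> is_poly_le m p.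
Proof.
  intros H [c Hc]. exists (fun k => if le_dec k n then c k else RtoC 0). intros z.
  rewrite Hc. symmetry. rewrite (Csum_extend _ n m H).
  - apply Csum_ext. intros k Hk. destruct (le_dec k n); [reflexivity|lia].
  - intros k Hk. destruct (le_dec k n); [lia|cring].
Qed.

Lemma is_poly_le_plus (n : nat) (p q : C -> C) :
  is_poly_le n p -> is_poly_le n q -> is_poly_le n (fun z => p z + q z)%C.
Proof.
  intros [c Hc] [d Hd]. exists (fun k => c k + d k)%C. intros z. rewrite Hc, Hd. toC.
  rewrite <- Csum_plus. apply Csum_ext. intros; cring.
Qed.

Lemma is_poly_le_scal (n : nat) (a : C) (p : C -> C) :
  is_poly_le n p -> is_poly_le n (fun z => a * p z)%C.
Proof.
  intros [c Hc]. exists (fun k => a * c k)%C. intros z. rewrite Hc. toC.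
  rewrite <- Csum_scal. apply Csum_ext. intros; cring.
Qed.

Lemma is_poly_le_const (n : nat) (a : C) : is_poly_le n (fun _ => a).
Proof.
  apply (is_poly_le_mono 0); [lia|]. exists (fun _ => a). intros z. simpl. cring.
Qed.

Lemma is_poly_le_mult_X (n : nat) (p : C -> C) :
  is_poly_le n p -> is_poly_le (S n) (fun z => z * p z)%C.
Proof.
  intros [c Hc]. exists (fun k => match k with O => RtoC 0 | S j => c j end). intros z.
  rewrite Csum_shift, Hc, <- Csum_scal.
  transitivity (0 + Csum (fun k => z * Cmul (c k) (Defs.Cpow z k)) n)%C; [cring|].
  f_equal; [cring|]. apply Csum_ext. intros k _. simpl. cring.
Qed.

Lemma is_poly_le_Csum (n m : nat) (p : nat -> C -> C) :
  (forall k, (k <= m)%nat -> is_poly_le n (p k)) -> is_poly_le n (fun z => Csum (fun k => p k z) m).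
Proof.
  induction m as [|m IH]; intros H; simpl; [apply (H O); lia|].
  apply is_poly_le_plus; [apply IH; intros; apply H; lia|apply H; lia].
Qed.

Lemma is_poly_le_reflect (n : nat) (p : C -> C) :
  is_poly_le n p -> is_poly_le n (fun z => p (1 - z)%C).
Proof.
  intros [c Hc]. apply (is_poly_le_eq _ (fun z => Csum (fun k => c k * (1 - z) ^ k)%C n)).
  { intros z. rewrite Hc. apply Csum_ext. intros k _. reflexivity. }
  apply is_poly_le_Csum. intros k Hk. apply is_poly_le_scal.
  apply (is_poly_le_mono k); [exact Hk|]. clear Hk. induction k as [|k IH].
  - exact (is_poly_le_const 0 (RtoC 1)).
  - apply (is_poly_le_eq _ (fun z => (1 - z) ^ k + (-(1)) * (z * (1 - z) ^ k))%C).
    + intros z. rewrite Cpow_S. ring.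
    + apply is_poly_le_plus; [apply (is_poly_le_mono k); [lia|exact IH]|].
      apply is_poly_le_scal, is_poly_le_mult_X, IH.
Qed.

(** The substitution x -> 1 - x exchanges the exponents, and each derivative contributes a factor
    -1. With uniqueness this gives the symmetry of the Jacobi polynomials without touching their
    coefficients. *)
Lemma is_rodrigues_reflect (al be : C) (n : nat) (p : C -> C) :
  is_rodrigues be al n p -> is_rodrigues al be n (fun z => (-(1)) ^ n * p (1 - z))%C.
Proof.
  intros [Hp [d [d0 [dS dn]]]]. split; [now apply is_poly_le_scal, is_poly_le_reflect|].
  exists (fun k x => (-(1)) ^ k * d k (1 - x)%R)%C. split; [|split].
  - intros x Hx. rewrite d0 by lra. unfold wt, qf. toC. replace (1 - (1 - x)) with x by ring.
    replace ((1 - x) * x) with (x * (1 - x)) by ring. simpl. cring.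
  - intros k x Hk Hx. apply derC_iff.
    assert (Hx' : 0 < 1 - x < 1) by lra.
    pose proof (dS k (1 - x) Hk Hx') as D. apply derC_iff in D.
    eapply derC_eq.
    + apply derC_scal. apply (derC_comp (d k) (fun t => 1 - t) x (-1)); [|exact D].
      auto_derive; [exact I|ring].
    + rewrite Cpow_S. cring.
  - intros x Hx. rewrite dn by lra. unfold wt. toC.
    replace (1 - (1 - x)) with x by ring. rewrite RtoC_minus. cring.
Qed.

Lemma pfun_reflect (al be : C) (n : nat) (z : C) :
  pfun n al be z = ((-(1)) ^ n * pfun n be al (1 - z))%C.
Proof.
  apply (rodrigues_unique al be n (pfun n al be) (fun z => (-(1)) ^ n * pfun n be al (1 - z))%C).
  - apply pfun_is_rodrigues.
  - apply is_rodrigues_reflect, pfun_is_rodrigues.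
Qed.

(** * Moments and the three-term recurrence *)

(* The recurrence of [mu j = B(a+j+1, b+1)], which is all that orthogonality uses. *)
Definition moment_rec (a b : C) (mu : nat -> C) : Prop :=
  forall j, ((INR j + a + 1) * mu j = (INR j + a + b + 2) * mu (S j))%C.

Definition pmoment (n : nat) (a b : C) (mu : nat -> C) (j : nat) : C :=
  Csum (fun k => pc n a b k * mu (k + j)%nat)%C n.

(** If [mu] are the moments of x^a (1-x)^b, the new sequence consists of those of x^(a+1)
    (1-x)^(b+1), since x^k x (1-x) = x^(k+1) - x^(k+2). *)
Lemma moment_rec_step (a b : C) (mu : nat -> C) :
  moment_rec a b mu -> moment_rec (a + 1) (b + 1) (fun k => mu (S k) - mu (S (S k)))%C.
Proof.
  intros H j. pose proof (H (S j)) as H1. pose proof (H (S (S j))) as H2.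
  repeat rewrite RtoC_INR_S in H1; repeat rewrite RtoC_INR_S in H2.
  transitivity ((b + 1) * mu (S (S j)))%C.
  - transitivity ((INR j + 1 + a + 1) * mu (S j) - (INR j + 1 + a + 1) * mu (S (S j)))%C; [ring|].
    rewrite H1. ring.
  - transitivity ((INR j + a + b + 4) * mu (S (S j)) - (INR j + 1 + 1 + a + b + 2) * mu (S (S (S j))))%C;
      [|ring].
    rewrite <- H2. ring.
Qed.

(** Integration by parts in algebraic form: w p_(n+1) is the derivative of q w p_n with raised
    parameters, so testing against x^(j+1) yields -(j+1) times a moment of p_n for the weight q w,
    and testing against 1 yields 0. *)
Lemma pmoment_step (n : nat) (a b : C) (mu : nat -> C) (j : nat) :
  moment_rec a b mu ->
  pmoment (S n) a b mu (S j) =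
  (- (INR j + 1) * pmoment n (a + 1) (b + 1) (fun k => mu (S k) - mu (S (S k))) j)%C /\
  pmoment (S n) a b mu 0 = 0.
Proof.
  intros H.
  (* Shifting the index in the second half of the recursion of [pc] transfers it from the
     coefficients to the moments. *)
  assert (E : forall i, pmoment (S n) a b mu i =
    Csum (fun k => pc n (a + 1) (b + 1) k *
       ((INR k + a + 1) * mu (k + i)%nat - (INR k + a + b + 2) * mu (S (k + i))))%C n).
  { intros i. unfold pmoment. rewrite Csum_shift, pc_S_0.
    rewrite (Csum_ext (fun k => pc (S n) a b (S k) * mu (S k + i)%nat)%C
      (fun k => (INR (S k) + a + 1) * pc n (a + 1) (b + 1) (S k) * mu (S k + i)%nat -
         (INR k + a + b + 2) * pc n (a + 1) (b + 1) k * mu (S (k + i)))%C).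
    2:{ intros k _. rewrite pc_S_S, RtoC_INR_S. change (S k + i)%nat with (S (k + i)); cring. }
    rewrite Csum_minus.
    etransitivity; [|symmetry; etransitivity;
      [apply (Csum_ext _ (fun k => (INR k + a + 1) * pc n (a + 1) (b + 1) k * mu (k + i)%nat -
       (INR k + a + b + 2) * pc n (a + 1) (b + 1) k * mu (S (k + i)))%C n); intros; cring
      |apply Csum_minus]].
    rewrite <- (Csum_extend (fun k => (INR k + a + 1) * pc n (a + 1) (b + 1) k * mu (k + i)%nat)%C n (S n));
      [|lia|intros k Hk; rewrite pc_zero by lia; cring].
    rewrite Csum_shift. simpl (INR 0). cring. }
  split.
  - rewrite E. unfold pmoment. rewrite <- Csum_scal. apply Csum_ext. intros k _.
    replace (k + S j)%nat with (S (k + j)) by lia.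
    pose proof (H (S (k + j))) as H1. rewrite !RtoC_INR_S, RtoC_INR_plus in H1.
    transitivity (pc n (a + 1) (b + 1) k *
      (((INR k + INR j + 1 + a + 1) * mu (S (k + j)) - (INR j + 1) * mu (S (k + j))) -
       (INR k + a + b + 2) * mu (S (S (k + j)))))%C; [cring|].
    rewrite H1. cring.
  - rewrite E. apply Csum_0. intros k _. rewrite Nat.add_0_r, H. cring.
Qed.

Lemma pmoment_orth (n : nat) : forall (a b : C) (mu : nat -> C) (j : nat),
  moment_rec a b mu -> (j < n)%nat -> pmoment n a b mu j = 0.
Proof.
  induction n as [|n IH]; intros a b mu j H Hj; [lia|].
  destruct j as [|j]; [now apply pmoment_step|].
  rewrite (proj1 (pmoment_step n a b mu j H)), IH; [ring|now apply moment_rec_step|lia].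
Qed.

(** After n integrations by parts only (-1)^n n! B(a+n+1, b+n+1) is left, and this Beta value is
    [mu 0] times (a+1)_n (b+1)_n / (a+b+2)_(2n). The denominator is kept on the left so that nothing
    has to be nonzero. *)
Lemma pmoment_diag (n : nat) : forall (a b : C) (mu : nat -> C),
  moment_rec a b mu ->
  (poch (a + b + 2) (2 * n) * pmoment n a b mu n =
   (-(1)) ^ n * INR (fact n) * poch (a + 1) n * poch (b + 1) n * mu O)%C.
Proof.
  induction n as [|n IH]; intros a b mu H.
  - unfold pmoment; simpl. cring.
  - rewrite (proj1 (pmoment_step n a b mu n H)).
    specialize (IH _ _ _ (moment_rec_step _ _ _ H)).
    replace (2 * S n)%nat with (S (S (2 * n))) by lia.
    rewrite !(poch_S_l (a + b + 2)), (poch_S_l (a + b + 2 + 1)), (poch_S_l (a + 1)), (poch_S_l (b + 1)).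
    replace (a + b + 2 + 1 + 1)%C with (a + 1 + (b + 1) + 2)%C by ring.
    rewrite RtoC_fact_S, Cpow_S.
    transitivity (- (INR n + 1) * ((a + b + 2) * (a + b + 2 + 1)) * (poch (a + 1 + (b + 1) + 2) (2 * n) *
      pmoment n (a + 1) (b + 1) (fun k => mu (S k) - mu (S (S k))) n))%C; [ring|].
    rewrite IH.
    pose proof (H O) as H0. pose proof (H 1%nat) as H1. simpl INR in H0, H1.
    assert (E : ((a + b + 2) * (a + b + 2 + 1) * (mu 1%nat - mu 2%nat))%C = ((a + 1) * (b + 1) * mu O)%C).
    { transitivity ((a + b + 2) * ((a + b + 3) * mu 1%nat - (1 + a + b + 2) * mu 2%nat))%C; [ring|].
      rewrite <- H1. transitivity ((b + 1) * ((0 + a + b + 2) * mu 1%nat))%C; [ring|].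
      rewrite <- H0. ring. }
    transitivity (- (INR n + 1) * ((-(1)) ^ n * INR (fact n) * poch (a + 1 + 1) n * poch (b + 1 + 1) n) *
      ((a + b + 2) * (a + b + 2 + 1) * (mu 1%nat - mu 2%nat)))%C; [ring|].
    rewrite E. ring.
Qed.

(** * The three-term recurrence *)

Lemma poch_0 (z : C) : poch z 0 = 1.
Proof. reflexivity. Qed.

Lemma poch_1 (z : C) : poch z 1 = z.
Proof. simpl. ring. Qed.

(** Boundary values of [k] are separated because the closed form needs a complementary index [r] for
    each of the three degrees involved. *)
Lemma pc_three_term (m : nat) (a b : C) (k : nat) :
  let n := (INR m + 1)%C in
  (2 * (n + a + b + 1) * (2 * n + a + b) * pc (S (S m)) a b k =
   (2 * n + a + b + 1) * (((2 * n + a + b + 2) * (2 * n + a + b) + (a * a - b * b)) * pc (S m) a b k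
      - 2 * ((2 * n + a + b + 2) * (2 * n + a + b)) * match k with O => 0 | S j => pc (S m) a b j end)
   - 2 * n * (n + a) * (n + b) * (2 * n + a + b + 2) * pc m a b k)%C.
Proof.
  intros n. unfold n; clear n.
  destruct k as [|k].
  - rewrite (pc_explicit (S (S m)) a b 0 (S (S m))), (pc_explicit (S m) a b 0 (S m)),
      (pc_explicit m a b 0 m) by reflexivity.
    rewrite !poch_S. simpl (fact 0). simpl (INR 0). change (INR 1) with 1.
    rewrite !RtoC_fact_S. repeat rewrite RtoC_INR_S.
    simpl (poch _ 0). simpl Cpow.
    field. repeat split; try apply RtoC_fact_neq_0; try apply RtoC_INR_S_neq_0.
    rewrite <- RtoC_INR_S; apply RtoC_INR_S_neq_0.
  - destruct (le_lt_dec k (S m)) as [Hk|Hk].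
    2:{ rewrite !pc_zero by lia. ring. }
    destruct (Nat.eq_dec k (S m)) as [->|Hk1].
    + rewrite (pc_zero m), (pc_zero (S m)) by lia. rewrite !pc_lead.
      (* The factor a+b+m+2 may vanish, so the change of the Pochhammer argument is stated without
         dividing by it; the same factor stands on the left of the recurrence. *)
      assert (EA : ((a + b + INR m + 2) * poch (a + b + INR (S (S m)) + 1) (S (S m)) =
        poch (a + b + INR (S m) + 1) (S m) * (a + b + INR m + 2 + (INR m + 1)) *
          (a + b + INR m + 2 + (INR m + 2)))%C).
      { replace (a + b + INR (S (S m)) + 1)%C with (a + b + INR (S m) + 1 + 1)%C
          by (repeat rewrite RtoC_INR_S; ring).
        transitivity (poch (a + b + INR (S m) + 1) (S (S (S m)))).
        - rewrite (poch_S_l (a + b + INR (S m) + 1) (S (S m))). rewrite RtoC_INR_S. ring.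
        - rewrite !(poch_S (a + b + INR (S m) + 1)). repeat rewrite RtoC_INR_S. ring. }
      rewrite !Cpow_S.
      transitivity (2 * (2 * (INR m + 1) + a + b) * ((-(1)) * ((-(1)) * (-(1)) ^ m)) *
        ((a + b + INR m + 2) * poch (a + b + INR (S (S m)) + 1) (S (S m))))%C; [ring|].
      rewrite EA. ring.
    + assert (Em : RtoC (INR (S m)) = (INR m + 1)%C) by apply RtoC_INR_S.
      assert (EA : ((a + b + INR m + 2) * poch (a + b + INR (S (S m)) + 1) (S k) =
        poch (a + b + INR (S m) + 1) k * (a + b + INR m + 2 + INR k) * (a + b + INR m + 2 + (INR k + 1)))%C).
      { replace (a + b + INR (S (S m)) + 1)%C with (a + b + INR (S m) + 1 + 1)%C
          by (repeat rewrite RtoC_INR_S; ring).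
        transitivity (poch (a + b + INR (S m) + 1) (S (S k))).
        - rewrite (poch_S_l (a + b + INR (S m) + 1) (S k)). rewrite RtoC_INR_S. ring.
        - rewrite !(poch_S (a + b + INR (S m) + 1)). repeat rewrite RtoC_INR_S. ring. }
      destruct (Nat.eq_dec k m) as [->|Hk2].
      * rewrite (pc_zero m) by lia.
        rewrite (pc_explicit (S (S m)) a b (S m) 1) by lia.
        rewrite (pc_explicit (S m) a b (S m) 0) by lia.
        rewrite (pc_explicit (S m) a b m 1) by lia.
        rewrite (poch_S (a + b + INR (S m) + 1) m).
        simpl (fact 1). simpl (fact 0). change (INR 1) with 1.
        match goal with |- (?t * ?p * ?q * (?u * ?A * ?v) = _)%C =>
          transitivity (t * q * u * v * ((a + b + INR m + 2) * A))%C; [ring|] end.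
        rewrite EA. rewrite !poch_0, !poch_1. rewrite !RtoC_fact_S. repeat rewrite RtoC_INR_S.
        rewrite !Cpow_S.
        field. repeat split; try apply RtoC_fact_neq_0; try apply RtoC_INR_S_neq_0.
      * assert (Hr : exists r, m = (S k + r)%nat) by (exists (m - S k)%nat; lia).
        destruct Hr as [r Hr].
        assert (Er : RtoC (INR m) = (INR k + 1 + INR r)%C).
        { rewrite Hr, RtoC_INR_plus, RtoC_INR_S. reflexivity. }
        rewrite (pc_explicit (S (S m)) a b (S k) (S (S r))) by lia.
        rewrite (pc_explicit (S m) a b (S k) (S r)) by lia.
        rewrite (pc_explicit (S m) a b k (S (S r))) by lia.
        rewrite (pc_explicit m a b (S k) r) by lia.
        match goal with |- (?t * ?p * ?q * (?u * ?A * ?v) = _)%C =>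
          transitivity (t * q * u * v * ((a + b + INR m + 2) * A))%C; [ring|] end.
        rewrite EA.
        rewrite (poch_S (a + b + INR (S m) + 1) k), (poch_S_l (a + b + INR m + 1) k).
        rewrite (poch_S_l (a + INR k + 1) (S r)).
        rewrite !(poch_S (a + INR (S k) + 1)), (poch_S (a + INR k + 1 + 1)).
        replace (a + b + INR m + 1 + 1)%C with (a + b + INR (S m) + 1)%C by (rewrite RtoC_INR_S; ring).
        replace (a + INR (S k) + 1)%C with (a + INR k + 1 + 1)%C by (rewrite RtoC_INR_S; ring).
        set (X := poch (a + b + INR (S m) + 1) k). set (Y := poch (a + INR k + 1 + 1) r).
        rewrite !RtoC_fact_S. repeat rewrite RtoC_INR_S. rewrite !Er, !Cpow_S.
        field. repeat split; try apply RtoC_fact_neq_0; try apply RtoC_INR_S_neq_0.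
        rewrite <- RtoC_INR_S; apply RtoC_INR_S_neq_0.
Qed.

Lemma pfun_three_term (m : nat) (a b z : C) :
  let n := (INR m + 1)%C in
  (2 * (n + a + b + 1) * (2 * n + a + b) * pfun (S (S m)) a b z =
   (2 * n + a + b + 1) * (((2 * n + a + b + 2) * (2 * n + a + b) * (1 - 2 * z) + (a * a - b * b)))
      * pfun (S m) a b z
   - 2 * n * (n + a) * (n + b) * (2 * n + a + b + 2) * pfun m a b z)%C.
Proof.
  intros n.
  assert (Ez : (z * pfun (S m) a b z)%C =
    Csum (fun k => match k with O => RtoC 0 | S j => pc (S m) a b j end * z ^ k)%C (S (S m))).
  { rewrite Csum_shift. unfold pfun. rewrite <- Csum_scal.
    etransitivity; [|symmetry; etransitivity; [|apply Cplus_0_l]]; [|f_equal; ring].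
    apply Csum_ext. intros k _. simpl. cring. }
  transitivity ((2 * n + a + b + 1) * (((2 * n + a + b + 2) * (2 * n + a + b) + (a * a - b * b)))
      * pfun (S m) a b z -
      (2 * n + a + b + 1) * (2 * ((2 * n + a + b + 2) * (2 * n + a + b))) * (z * pfun (S m) a b z)
   - 2 * n * (n + a) * (n + b) * (2 * n + a + b + 2) * pfun m a b z)%C; [|ring].
  rewrite Ez, (pfun_extend (S m) (S (S m))), (pfun_extend m (S (S m))) by lia. unfold pfun.
  rewrite <- !Csum_scal. rewrite <- !Csum_minus. apply Csum_ext. intros k _.
  pose proof (pc_three_term m a b k) as H. cbv zeta in H. fold n in H.
  rewrite Cmult_assoc, H. destruct k; cring.
Qed.

(** * Growth of the polynomials *)

(** The constant does not depend on [u], as required for families indexed by the points of an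
    ellipse. It is a value of the extremal solution [Kp], only finitely many of whose factors exceed
    r q. *)
Lemma growth_uniform (e : nat -> R) (r q : R) :
  1 <= r -> 1 < q -> (forall n, 0 <= e n) -> is_lim_seq e 0 ->
  exists K, 0 < K /\ forall u : nat -> R, (forall n, 0 <= u n) ->
    (forall n, u (S n) <= (r + e n) * u n) -> forall n, u n <= K * u O * (r * q) ^ n.
Proof.
  intros Hr Hq He Hlim.
  set (Kp := fix Kp n := match n with O => 1 | S k => (r + e k) * Kp k end).
  assert (Kp1 : forall n, 1 <= Kp n).
  { induction n as [|n IH]; simpl; [lra|]. specialize (He n). nra. }
  assert (KpS : forall n, Kp n <= Kp (S n)).
  { intros n. simpl. specialize (He n). specialize (Kp1 n). nra. }
  (* From [N] on, r + e n stays below r q. *)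
  apply is_lim_seq_Reals in Hlim. destruct (Hlim (r * (q - 1))) as [N HN]; [nra|].
  assert (Hrq : 1 <= r * q) by nra.
  assert (Kb : forall n, Kp n <= Kp N * (r * q) ^ n).
  { intros n. destruct (le_lt_dec n N) as [Hn|Hn].
    - assert (Kp n <= Kp N) by (clear -KpS Hn; induction Hn as [|m Hn IH]; [lra|specialize (KpS m); lra]).
      pose proof (pow_R1_Rle (r * q) n Hrq). specialize (Kp1 N). nra.
    - assert (Hn' : (N <= n)%nat) by lia. clear Hn.
      induction Hn' as [|m Hm IH].
      + pose proof (pow_R1_Rle (r * q) N Hrq). specialize (Kp1 N). nra.
      + specialize (HN m Hm). unfold Rdist in HN. rewrite Rminus_0_r, Rabs_pos_eq in HN by apply He.
        change (Kp (S m)) with ((r + e m) * Kp m). specialize (Kp1 m).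
        change ((r * q) ^ S m) with (r * q * (r * q) ^ m).
        apply Rle_trans with ((r * q) * (Kp N * (r * q) ^ m)); [|right; ring].
        apply Rmult_le_compat; [specialize (He m); lra|lra|lra|exact IH]. }
  exists (Kp N). split; [specialize (Kp1 N); lra|]. intros u Hu Hrec n.
  assert (H : u n <= Kp n * u O).
  { induction n as [|n IH]; [simpl; lra|].
    eapply Rle_trans; [apply Hrec|]. change (Kp (S n)) with ((r + e n) * Kp n).
    rewrite Rmult_assoc. apply Rmult_le_compat_l; [specialize (He n); lra|exact IH]. }
  eapply Rle_trans; [exact H|]. specialize (Kb n). specialize (Hu O).
  apply Rle_trans with (Kp N * (r * q) ^ n * u O); [now apply Rmult_le_compat_r|right; ring].
Qed.

(* Follows [max ((1 - 1/r) |y_(m+1)|) |y_(m+1) - y_m / u|], which grows by at most [r + O(de m)] at each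
   step, uniformly in [1 <= |u| <= r]: the resonance [u = 1/u] at [u = 1, -1] costs nothing. *)
Lemma perturbed_growth (r q : R) (de : nat -> R) :
  1 < r -> 1 < q -> (forall n, 0 <= de n) -> is_lim_seq de 0 ->
  exists K, 0 < K /\ forall (u : C) (y : nat -> C), 1 <= Cmod u <= r ->
    (forall m, Cmod (y (S (S m)) - (u + / u) * y (S m) + y m) <= de m * (Cmod (y (S m)) + Cmod (y m))) ->
    forall n, Cmod (y n) <= K * (Cmod (y 0%nat) + Cmod (y 1%nat)) * (r * q) ^ n.
Proof.
  intros Hr Hq Hd Hlim.
  (* The weight [ka] solves 1 + ka r = r: up to the perturbation, ka |y_(m+2)| is at most ka
     |y_(m+1)| + ka |e_(m+1)|, hence at most M m + ka r M m, which is again r M m. *)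
  set (ka := 1 - / r).
  assert (Hinv : 0 < / r < 1).
  { split; [apply Rinv_0_lt_compat; lra|]. rewrite <- Rinv_1. apply Rinv_lt_contravar; lra. }
  assert (Hka : 0 < ka < 1) by (unfold ka; lra).
  assert (Hkr : ka * r = r - 1) by (unfold ka; field; lra).
  (* Chosen so that |y_(m+1)| + |y_m| is at most D M m, from |y_(m+1)| <= M m / ka and y_m = u
     (y_(m+1) - e m). *)
  set (D := (1 + r) * / ka + r).
  assert (Hik : 0 < / ka) by (apply Rinv_0_lt_compat; lra).
  assert (HD : 0 < D) by (unfold D; nra).
  destruct (growth_uniform (fun n => D * de n) r q) as [K [HK HKu]]; [lra|exact Hq| | |].
  { intros n. specialize (Hd n). nra. }
  { replace 0 with (D * 0) by ring. apply (is_lim_seq_scal_l de D 0 Hlim). }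
  exists (1 + K * / ka). split; [nra|]. intros u y Hu Hrec.
  assert (Hu0 : u <> 0) by (apply Cmod_gt_0; lra).
  assert (Hiu : Cmod (/ u) <= 1).
  { rewrite Cmod_inv by exact Hu0. rewrite <- Rinv_1. apply Rinv_le_contravar; lra. }
  set (e := fun m => (y (S m) - / u * y m)%C).
  set (M := fun m => Rmax (ka * Cmod (y (S m))) (Cmod (e m))).
  assert (M1 : forall m, Cmod (y (S m)) <= M m * / ka).
  { intros m. apply Rmult_le_reg_l with ka; [lra|].
    replace (ka * (M m * / ka)) with (M m) by (field; lra). apply Rmax_l. }
  assert (M2 : forall m, Cmod (e m) <= M m) by (intros m; apply Rmax_r).
  assert (M0 : forall m, 0 <= M m) by (intros m; eapply Rle_trans; [apply Cmod_ge_0|apply M2]).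
  assert (M3 : forall m, Cmod (y (S m)) + Cmod (y m) <= D * M m).
  { intros m. assert (E : y m = (u * (y (S m) - e m))%C) by (unfold e; field; exact Hu0).
    assert (Cmod (y m) <= r * (Cmod (y (S m)) + Cmod (e m))).
    { rewrite E at 1. rewrite Cmod_mult. apply Rmult_le_compat; try apply Cmod_ge_0; [lra|].
      apply Cmod_triangle_minus. }
    specialize (M1 m). specialize (M2 m). unfold D. nra. }
  assert (HM : forall m, M (S m) <= (r + D * de m) * M m).
  { intros m. specialize (Hrec m).
    assert (He1 : Cmod (e (S m)) <= (r + D * de m) * M m).
    { replace (e (S m)) with (u * e m + (y (S (S m)) - (u + / u) * y (S m) + y m))%C
        by (unfold e; field; exact Hu0).
      eapply Rle_trans; [apply Cmod_triangle|]. rewrite Cmod_mult.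
      specialize (M2 m). specialize (M3 m). specialize (Hd m). pose proof (Cmod_ge_0 (e m)).
      specialize (M0 m). nra. }
    apply Rmax_lub; [|exact He1].
    assert (Hy : Cmod (y (S (S m))) <= Cmod (y (S m)) + Cmod (e (S m))).
    { replace (y (S (S m))) with (/ u * y (S m) + e (S m))%C by (unfold e; ring).
      eapply Rle_trans; [apply Cmod_triangle|]. rewrite Cmod_mult.
      pose proof (Cmod_ge_0 (y (S m))). nra. }
    assert (Hm : ka * Cmod (y (S m)) <= M m) by apply Rmax_l.
    assert (Hde : 0 <= D * de m * M m) by (specialize (Hd m); specialize (M0 m); apply Rmult_le_pos; nra).
    assert (ka * Cmod (e (S m)) <= ka * ((r + D * de m) * M m)) by (apply Rmult_le_compat_l; lra).
    replace (ka * ((r + D * de m) * M m)) with ((ka * r) * M m + ka * (D * de m * M m)) in * by ring.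
    rewrite Hkr in *. nra. }
  intros n. pose proof (Cmod_ge_0 (y 0%nat)). pose proof (Cmod_ge_0 (y 1%nat)).
  assert (Hrq : 1 <= r * q) by nra.
  assert (HM0 : M O <= Cmod (y 0%nat) + Cmod (y 1%nat)).
  { apply Rmax_lub; [nra|]. unfold e. eapply Rle_trans; [apply Cmod_triangle_minus|].
    rewrite Cmod_mult. nra. }
  destruct n as [|n].
  - simpl. assert (0 < K * / ka) by nra. nra.
  - specialize (HKu M M0 HM n). eapply Rle_trans; [apply M1|].
    pose proof (pow_R1_Rle (r * q) n Hrq).
    apply Rle_trans with (K * M O * (r * q) ^ n * / ka); [now apply Rmult_le_compat_r; [lra|]|].
    apply Rle_trans with (K * / ka * (Cmod (y 0%nat) + Cmod (y 1%nat)) * (r * q) ^ n).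
    { replace (K * M O * (r * q) ^ n * / ka) with (K * / ka * (r * q) ^ n * M O) by ring.
      replace (K * / ka * (Cmod (y 0%nat) + Cmod (y 1%nat)) * (r * q) ^ n) with
        (K * / ka * (r * q) ^ n * (Cmod (y 0%nat) + Cmod (y 1%nat))) by ring.
      apply Rmult_le_compat_l; [|exact HM0]. apply Rmult_le_pos; [nra|lra]. }
    change ((r * q) ^ S n) with (r * q * (r * q) ^ n).
    apply Rmult_le_compat; [apply Rmult_le_pos; nra|lra| |nra].
    apply Rmult_le_compat_r; lra.
Qed.

(** * Subexponential comparison of Pochhammer symbols with factorials *)

Lemma INR_div_lim (a b : C) :
  (forall n, (INR n + b)%C <> 0) -> Ccv (fun n => (INR n + a) / (INR n + b))%C (RtoC 1).
Proof.
  intros Hb eps He. toC.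
  set (B := Cmod b). set (D := Cmod (a - b)).
  destruct (INR_unbounded (B + (D + 1) / eps)) as [N HN].
  exists N. intros n Hn.
  assert (HnN : INR N <= INR n) by now apply le_INR.
  replace ((INR n + a) / (INR n + b) - 1)%C with ((a - b) / (INR n + b))%C by (field; apply Hb).
  rewrite Cmod_div by apply Hb. fold D.
  assert (H1 : (D + 1) / eps < Cmod (INR n + b)).
  { pose proof (Cmod_le_minus (INR n) (INR n + b)) as H2.
    replace (INR n - (INR n + b))%C with (- b)%C in H2 by ring. rewrite Cmod_opp in H2.
    rewrite Cmod_R, Rabs_pos_eq in H2 by apply pos_INR. fold B in H2. lra. }
  assert (HD : 0 <= D) by apply Cmod_ge_0.
  assert (0 < (D + 1) / eps) by (apply Rdiv_lt_0_compat; lra).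
  apply Rmult_lt_reg_r with (Cmod (INR n + b)); [lra|].
  unfold Rdiv at 1. rewrite Rmult_assoc, Rinv_l by lra.
  apply Rlt_trans with (eps * ((D + 1) / eps)); [|nra].
  replace (eps * ((D + 1) / eps)) with (D + 1) by (field; lra). lra.
Qed.

Lemma INR_inv_lim (b : C) : (forall n, (INR n + b)%C <> 0) -> Ccv (fun n => / (INR n + b))%C (RtoC 0).
Proof.
  intros Hb. pose proof (Ccv_minus _ _ _ _ (INR_div_lim (b + 1) b Hb) (INR_div_lim b b Hb)) as H.
  replace (1 - 1)%C with (RtoC 0) in H by cring.
  eapply Ccv_ext; [|exact H]. intros n. simpl. cfield. apply Hb.
Qed.

(** Consecutive terms of (z)_n / n! have the quotient (n+z)/(n+1), which tends to 1, so the growth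
    is slower than any q^n. *)
Lemma poch_le_fact (z : C) (q : R) : 1 < q ->
  exists K, 0 < K /\ forall n, Cmod (poch z n) <= K * INR (fact n) * q ^ n.
Proof.
  intros Hq.
  destruct (growth_uniform (fun n => Cmod ((INR n + z) / (INR n + 1) - 1)) 1 q) as [K [HK H]];
    [lra|exact Hq|intros; apply Cmod_ge_0| |].
  { pose proof (Ccv_Cmod _ _ (Ccv_minus _ _ _ _ (INR_div_lim z 1 RtoC_INR_S_neq_0) (Ccv_const (RtoC 1)))) as L.
    replace (1 - RtoC 1)%C with (RtoC 0) in L by cring. rewrite Cmod_0 in L. exact L. }
  exists K. split; [exact HK|]. intros n.
  specialize (H (fun n => Cmod (poch z n) / INR (fact n))).
  assert (Hf : forall n, 0 < INR (fact n)) by (intros; apply INR_fact_lt_0).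
  assert (G : Cmod (poch z n) / INR (fact n) <= K * (Cmod (poch z 0) / INR (fact 0)) * (1 * q) ^ n).
  { apply H.
    - intros m. apply Rdiv_le_0_compat; [apply Cmod_ge_0|apply Hf].
    - intros m. rewrite poch_S, Cmod_mult, fact_simpl, mult_INR.
      assert (HS : 0 < INR (S m)) by (apply lt_0_INR; lia).
      replace (Cmod (poch z m) * Cmod (z + INR m) / (INR (S m) * INR (fact m))) with
        (Cmod (z + INR m) / INR (S m) * (Cmod (poch z m) / INR (fact m)))
        by (field; specialize (Hf m); split; lra).
      apply Rmult_le_compat_r; [apply Rdiv_le_0_compat; [apply Cmod_ge_0|apply Hf]|].
      replace (Cmod (z + INR m) / INR (S m)) with (Cmod ((INR m + z) / (INR m + 1))).
      + pose proof (Cmod_le_minus ((INR m + z) / (INR m + 1)) 1) as Q; rewrite Cmod_1 in Q; lra.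
      + rewrite Cmod_div by apply RtoC_INR_S_neq_0.
        rewrite <- RtoC_INR_S, Cmod_R, Rabs_pos_eq by lra. now rewrite Cplus_comm. }
  simpl poch in G. rewrite Cmod_1 in G. simpl fact in G. change (INR 1) with 1 in G.
  rewrite Rmult_1_l in G. specialize (Hf n).
  apply Rmult_le_reg_r with (/ INR (fact n)); [now apply Rinv_0_lt_compat|].
  unfold Rdiv in G. eapply Rle_trans; [exact G|]. right. field. lra.
Qed.

(** The same for the inverse quotients, which are defined because no factor of (z)_n vanishes. *)
Lemma fact_le_poch (z : C) (q : R) : (forall n, (INR n + z)%C <> 0) -> 1 < q ->
  exists K, 0 < K /\ forall n, INR (fact n) <= K * Cmod (poch z n) * q ^ n.
Proof.
  intros Hz Hq.
  destruct (growth_uniform (fun n => Cmod ((INR n + 1) / (INR n + z) - 1)) 1 q) as [K [HK H]];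
    [lra|exact Hq|intros; apply Cmod_ge_0| |].
  { pose proof (Ccv_Cmod _ _ (Ccv_minus _ _ _ _ (INR_div_lim 1 z Hz) (Ccv_const (RtoC 1)))) as L.
    replace (1 - RtoC 1)%C with (RtoC 0) in L by cring. rewrite Cmod_0 in L. exact L. }
  exists K. split; [exact HK|]. intros n.
  assert (Hp : forall n, 0 < Cmod (poch z n)).
  { intros m. apply Cmod_gt_0, poch_neq_0. intros k _. rewrite Cplus_comm. apply Hz. }
  assert (Hf : forall n, 0 < INR (fact n)) by (intros; apply INR_fact_lt_0).
  specialize (H (fun n => INR (fact n) / Cmod (poch z n))).
  assert (G : INR (fact n) / Cmod (poch z n) <= K * (INR (fact 0) / Cmod (poch z 0)) * (1 * q) ^ n).
  { apply H.
    - intros m. apply Rdiv_le_0_compat; [left; apply Hf|apply Hp].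
    - intros m. rewrite poch_S, Cmod_mult, fact_simpl, mult_INR.
      assert (HS : 0 < INR (S m)) by (apply lt_0_INR; lia).
      assert (Hzm : 0 < Cmod (z + INR m)) by (apply Cmod_gt_0; rewrite Cplus_comm; apply Hz).
      replace (INR (S m) * INR (fact m) / (Cmod (poch z m) * Cmod (z + INR m))) with
        (INR (S m) / Cmod (z + INR m) * (INR (fact m) / Cmod (poch z m)))
        by (field; specialize (Hp m); split; lra).
      apply Rmult_le_compat_r; [apply Rdiv_le_0_compat; [left; apply Hf|apply Hp]|].
      replace (INR (S m) / Cmod (z + INR m)) with (Cmod ((INR m + 1) / (INR m + z))).
      + pose proof (Cmod_le_minus ((INR m + 1) / (INR m + z)) 1) as Q; rewrite Cmod_1 in Q; lra.
      + rewrite Cmod_div by apply Hz.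
        rewrite <- RtoC_INR_S, Cmod_R, Rabs_pos_eq by lra. now rewrite Cplus_comm. }
  simpl poch in G. rewrite Cmod_1 in G. simpl fact in G. change (INR 1) with 1 in G.
  rewrite Rmult_1_l in G. specialize (Hp n).
  apply Rmult_le_reg_r with (/ Cmod (poch z n)); [now apply Rinv_0_lt_compat|].
  unfold Rdiv in G. eapply Rle_trans; [exact G|]. right. field. lra.
Qed.

(** * Growth of the polynomials on ellipses *)

Definition jouk (u : C) : C := ((2 + u + / u) / 4)%C.

Lemma Cmod_inv_le_1 (u : C) : 1 <= Cmod u -> Cmod (/ u) <= 1.
Proof.
  intros H. rewrite Cmod_inv by (apply Cmod_gt_0; lra).
  rewrite <- Rinv_1. apply Rinv_le_contravar; lra.
Qed.

Lemma RtoC_neq (x y : R) : x <> y -> RtoC x <> RtoC y.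
Proof. intros H E. apply RtoC_inj in E. contradiction. Qed.

Lemma jouk_bound (u : C) (r : R) : 1 <= Cmod u <= r -> Cmod (jouk u) <= r /\ Cmod (1 - 2 * jouk u) <= r.
Proof.
  intros H. pose proof (Cmod_inv_le_1 u (proj1 H)). split.
  - unfold jouk. rewrite Cmod_div by (apply RtoC_neq; lra).
    rewrite Cmod_R, Rabs_pos_eq by lra.
    pose proof (Cmod_triangle (2 + u) (/ u)). pose proof (Cmod_triangle 2 u).
    rewrite Cmod_R, Rabs_pos_eq in * by lra.
    apply Rmult_le_reg_r with 4; [lra|]. unfold Rdiv. rewrite Rmult_assoc, Rinv_l by lra. lra.
  - replace (1 - 2 * jouk u)%C with (- (u + / u) / 2)%C.
    + rewrite Cmod_div by (apply RtoC_neq; lra). rewrite Cmod_opp.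
      rewrite Cmod_R, Rabs_pos_eq by lra. pose proof (Cmod_triangle u (/ u)).
      apply Rmult_le_reg_r with 2; [lra|]. unfold Rdiv. rewrite Rmult_assoc, Rinv_l by lra. lra.
    + unfold jouk. field. apply Cmod_gt_0; lra.
Qed.

Lemma pfun_1 (a b z : C) : pfun 1 a b z = ((a + 1) - (a + b + 2) * z)%C.
Proof. unfold pfun; simpl. cring. Qed.

(** For y_n = p_n / n! the three-term recurrence tends to y_(m+2) = 2 (1-2z) y_(m+1) - y_m, and 2
    (1-2z) = -(u + 1/u) at z = [jouk u]. The limiting characteristic roots are thus -u and -1/u, and
    [perturbed_growth] applies to -u. The condition on a + b keeps the denominators nonzero. *)
Lemma pfun_growth (a b : C) (r q : R) :
  (forall k : nat, (a + b)%C <> RtoC (- INR (k + 2))) -> 1 < r -> 1 < q ->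
  exists K, 0 < K /\ forall (u : C) (n : nat), 1 <= Cmod u <= r ->
    Cmod (pfun n a b (jouk u)) <= K * INR (fact n) * (r * q) ^ n.
Proof.
  intros Hs Hr Hq.
  assert (Hs' : forall k : nat, (INR k + (a + b + 2))%C <> 0).
  { intros k E. apply (Hs k). rewrite plus_INR. simpl (INR 2).
    rewrite RtoC_opp, RtoC_plus. replace (1 + 1) with 2 by ring.
    transitivity (INR k + (a + b + 2) - (INR k + 2))%C; [ring|]. rewrite E. ring. }
  assert (Hs2 : forall k : nat, (INR k + (a + b + 2) / 2)%C <> 0).
  { intros k E. apply (Hs' (2 * k)%nat). rewrite RtoC_INR_mult. simpl (INR 2). replace (1 + 1) with 2 by ring.
    transitivity (2 * (INR k + (a + b + 2) / 2))%C; [field|]. rewrite E. ring. }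
  assert (H2 : RtoC 2 <> 0) by (apply RtoC_neq; lra).
  assert (Hn2 : forall k : nat, (INR k + 2)%C <> 0).
  { intros k. rewrite <- RtoC_plus. apply RtoC_neq. pose proof (pos_INR k). lra. }
  (* The coefficients of the recurrence for [y], written as products of factors with known limits,
     so that their own limits 2, 0 and 1 are immediate. *)
  set (An := fun m : nat => (2 * ((INR m + (a + b + 3) / 2) / (INR m + 2)) *
     ((INR m + (a + b + 4) / 2) / (INR m + (a + b + 2))))%C).
  set (Bn := fun m : nat => ((a * a - b * b) / 2 * ((INR m + (a + b + 3) / 2) / (INR m + 2)) *
     (/ (INR m + (a + b + 2)) * / (INR m + (a + b + 2) / 2)))%C).
  set (Cn := fun m : nat => (((INR m + (a + 1)) / (INR m + 2)) *
     ((INR m + (b + 1)) / (INR m + (a + b + 2))) * ((INR m + (a + b + 4) / 2) / (INR m + (a + b + 2) / 2)))%C).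
  assert (LA : Ccv (fun m => An m - 2)%C (RtoC 0)).
  { replace (RtoC 0) with (2 * 1 * 1 - 2)%C by ring. apply Ccv_minus; [|apply Ccv_const].
    apply Ccv_mult; [apply Ccv_scal|]; now apply INR_div_lim. }
  assert (LB : Ccv Bn (RtoC 0)).
  { replace (RtoC 0) with ((a * a - b * b) / 2 * 1 * (0 * 0))%C by ring.
    apply Ccv_mult; [apply Ccv_scal; now apply INR_div_lim|].
    apply Ccv_mult; now apply INR_inv_lim. }
  assert (LC : Ccv (fun m => Cn m - 1)%C (RtoC 0)).
  { replace (RtoC 0) with (1 * 1 * 1 - 1)%C by ring. apply Ccv_minus; [|apply Ccv_const].
    apply Ccv_mult; [apply Ccv_mult|]; now apply INR_div_lim. }
  set (de := fun m => r * Cmod (An m - 2) + Cmod (Bn m) + Cmod (Cn m - 1)).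
  destruct (perturbed_growth r q de Hr Hq) as [K [HK HG]].
  { intros m. unfold de. pose proof (Cmod_ge_0 (An m - 2)). pose proof (Cmod_ge_0 (Bn m)).
    pose proof (Cmod_ge_0 (Cn m - 1)). nra. }
  { unfold de. apply Ccv_Cmod in LA, LB, LC. rewrite Cmod_0 in *.
    replace 0 with (r * 0 + 0 + 0) by ring.
    apply is_lim_seq_plus'; [apply is_lim_seq_plus'|]; [|exact LB|exact LC].
    exact (is_lim_seq_scal_l _ r _ LA). }
  set (B1 := Cmod (a + 1) + Cmod (a + b + 2) * r).
  exists (K * (1 + B1)). split.
  { unfold B1. pose proof (Cmod_ge_0 (a + 1)). pose proof (Cmod_ge_0 (a + b + 2)).
    apply Rmult_lt_0_compat; [lra|]. nra. }
  intros u n Hu. destruct (jouk_bound u r Hu) as [J1 J2].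
  assert (Hu0 : u <> 0) by (apply Cmod_gt_0; lra).
  set (z := jouk u) in *.
  assert (Hz : (1 - 2 * z)%C = (- (u + / u) / 2)%C) by (unfold z, jouk; field; exact Hu0).
  set (y := fun k => (pfun k a b z / INR (fact k))%C).
  assert (Hy : forall m, (y (S (S m)) = (An m * (1 - 2 * z) + Bn m) * y (S m) - Cn m * y m)%C).
  { intros m. unfold y, An, Bn, Cn.
    pose proof (pfun_three_term m a b z) as T. cbv zeta in T.
    rewrite !RtoC_fact_S, !RtoC_INR_S.
    assert (Q1 := Hs' m). assert (Q2 := Hs2 m). assert (Q3 := Hn2 m). assert (Q4 := RtoC_fact_neq_0 m).
    assert (Q5 := RtoC_INR_S_neq_0 m).
    assert (Q6 : (2 * (INR m + 1) + a + b)%C <> 0).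
    { intros E. apply Q2. transitivity ((2 * (INR m + 1) + a + b) / 2)%C; [field|]. rewrite E. field. }
    assert (Q7 : (INR m + 1 + a + b + 1)%C <> 0).
    { intros E. apply Q1. rewrite <- E. ring. }
    transitivity ((2 * (INR m + 1 + a + b + 1) * (2 * (INR m + 1) + a + b) * pfun (S (S m)) a b z)
       / ((2 * (INR m + 1 + a + b + 1) * (2 * (INR m + 1) + a + b)) *
         ((INR m + 1 + 1) * ((INR m + 1) * INR (fact m)))))%C.
    - field. repeat split; try assumption.
      intros E. apply Q3. rewrite <- E. ring.
    - rewrite T. field. repeat split; try assumption.
      all: intros E; first [apply Q3; rewrite <- E; ring | apply Q1; rewrite <- E; ring
        | apply Q6; rewrite <- E; ring]. }
  specialize (HG (- u)%C y).
  assert (G : Cmod (y n) <= K * (Cmod (y 0%nat) + Cmod (y 1%nat)) * (r * q) ^ n).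
  { apply HG; [now rewrite Cmod_opp|]. intros m. rewrite Hy.
    replace (/ - u)%C with (- / u)%C by (field; exact Hu0).
    replace ((An m * (1 - 2 * z) + Bn m) * y (S m) - Cn m * y m - (- u + - / u) * y (S m) + y m)%C
      with (((An m - 2) * (1 - 2 * z) + Bn m) * y (S m) - (Cn m - 1) * y m)%C
      by (rewrite Hz; field; exact Hu0).
    eapply Rle_trans; [apply Cmod_triangle_minus|]. rewrite !Cmod_mult.
    pose proof (Cmod_triangle ((An m - 2) * (1 - 2 * z)) (Bn m)) as T1. rewrite Cmod_mult in T1.
    unfold de.
    pose proof (Cmod_ge_0 (An m - 2)). pose proof (Cmod_ge_0 (Bn m)).
    pose proof (Cmod_ge_0 (Cn m - 1)). pose proof (Cmod_ge_0 (y m)). pose proof (Cmod_ge_0 (y (S m))).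
    assert (T2 : Cmod ((An m - 2) * (1 - 2 * z) + Bn m) <= r * Cmod (An m - 2) + Cmod (Bn m)) by nra.
    apply Rle_trans with ((r * Cmod (An m - 2) + Cmod (Bn m)) * Cmod (y (S m)) + Cmod (Cn m - 1) * Cmod (y m)).
    - apply Rplus_le_compat_r. apply Rmult_le_compat_r; assumption.
    - assert (0 <= r * Cmod (An m - 2)) by nra. nra. }
  assert (Y0 : Cmod (y 0%nat) = 1).
  { unfold y. rewrite pfun_0. simpl. replace (1 / 1)%C with (RtoC 1) by field. apply Cmod_1. }
  assert (Y1 : Cmod (y 1%nat) <= B1).
  { unfold y. rewrite pfun_1. simpl fact. change (INR 1) with 1.
    replace ((a + 1 - (a + b + 2) * z) / 1)%C with (a + 1 - (a + b + 2) * z)%C by field.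
    eapply Rle_trans; [apply Cmod_triangle_minus|]. rewrite Cmod_mult. unfold B1.
    pose proof (Cmod_ge_0 (a + b + 2)). nra. }
  assert (Hpow : 0 < (r * q) ^ n) by (apply pow_lt; nra).
  assert (Hf := INR_fact_lt_0 n).
  replace (pfun n a b z) with (y n * INR (fact n))%C by (unfold y; field; apply RtoC_fact_neq_0).
  rewrite Cmod_mult, Cmod_R, Rabs_pos_eq by lra.
  apply Rle_trans with (K * (1 + B1) * (r * q) ^ n * INR (fact n)); [|right; ring].
  apply Rmult_le_compat_r; [lra|]. eapply Rle_trans; [exact G|].
  apply Rmult_le_compat_r; [lra|]. apply Rmult_le_compat_l; [lra|]. lra.
Qed.

(** * Weighted sums of the coefficients *)

Lemma binomial_term_le (s : R) (n k : nat) : 0 <= s -> (k <= n)%nat ->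
  INR (fact n) / (INR (fact k) * INR (fact (n - k))) * s ^ k <= (1 + s) ^ n.
Proof.
  intros Hs Hk. rewrite Rplus_comm, binomial.
  assert (Hpos : forall i, 0 <= Binomial.C n i * s ^ i * 1 ^ (n - i)).
  { intros i. rewrite pow1, Rmult_1_r. apply Rmult_le_pos; [|now apply pow_le].
    unfold Binomial.C. apply Rdiv_le_0_compat; [left; apply INR_fact_lt_0|].
    apply Rmult_lt_0_compat; apply INR_fact_lt_0. }
  replace (INR (fact n) / (INR (fact k) * INR (fact (n - k))) * s ^ k) with (Binomial.C n k * s ^ k * 1 ^ (n - k))
    by (rewrite pow1; unfold Binomial.C; ring).
  apply Rle_trans with (sum_f_R0 (fun i => Binomial.C n i * s ^ i * 1 ^ (n - i)) k).
  - destruct k as [|k]; [simpl; lra|].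
    pose proof (cond_pos_sum _ k Hpos). rewrite tech5. lra.
  - now apply sum_f_R0_nonneg_mono.
Qed.

Lemma Cmod_poch_le_fact (z : C) (N n : nat) :
  Cmod z <= INR N + 1 -> Cmod (poch z n) <= INR (fact (N + n)) / INR (fact N).
Proof.
  intros Hz. pose proof (INR_fact_lt_0 N). induction n as [|n IH].
  - rewrite Nat.add_0_r. simpl. rewrite Cmod_1. right. field. lra.
  - rewrite poch_S, Cmod_mult, Nat.add_succ_r, fact_simpl, mult_INR, S_INR, plus_INR.
    assert (Cmod (z + INR n) <= INR N + INR n + 1).
    { eapply Rle_trans; [apply Cmod_triangle|]. rewrite Cmod_R, Rabs_pos_eq by apply pos_INR. lra. }
    replace ((INR N + INR n + 1) * INR (fact (N + n)) / INR (fact N)) with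
      (INR (fact (N + n)) / INR (fact N) * (INR N + INR n + 1)) by (field; lra).
    apply Rmult_le_compat; try apply Cmod_ge_0; assumption.
Qed.

(* With [rho = s^2], each term of the explicit formula is a product of two binomial terms, one for each
   factor [s^k]. *)
Lemma pc_norm (q : R) : 1 < q -> exists rho0, 0 < rho0 /\ forall rho, 0 < rho <= rho0 ->
  forall a b : C, exists K, 0 < K /\ forall n,
    sum_f_R0 (fun k => Cmod (pc n a b k) * rho ^ k) n <= K * INR (fact n) * q ^ n.
Proof.
  intros Hq.
  (* The two binomial factors cost (1+s)^(3n) and the number n + 1 of terms another (1+s)^n; for s
     <= 1 one has (1+s)^4 <= 1 + 15 s. *)
  assert (Hs : exists s, 0 < s <= 1 /\ (1 + s) ^ 4 <= q).
  { exists (Rmin 1 ((q - 1) / 15)). pose proof (Rmin_l 1 ((q - 1) / 15)). pose proof (Rmin_r 1 ((q - 1) / 15)).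
    assert (0 < Rmin 1 ((q - 1) / 15)) by (apply Rmin_pos; lra).
    split; [lra|]. set (s := Rmin _ _) in *. simpl.
    assert (s * s <= s) by nra. assert (s * s * s <= s) by nra. assert (s * s * s * s <= s) by nra. nra. }
  destruct Hs as [s [Hs Hsq]].
  exists (s * s). split; [nra|]. intros rho Hrho a b.
  destruct (INR_unbounded (Rmax (Cmod a) (Cmod (a + b)))) as [A HA].
  assert (HA1 : Cmod a <= INR A) by (pose proof (Rmax_l (Cmod a) (Cmod (a + b))); lra).
  assert (HA2 : Cmod (a + b) <= INR A) by (pose proof (Rmax_r (Cmod a) (Cmod (a + b))); lra).
  (* The part of the bound that does not grow with [n]. The factor s^(-A) arises because the second
     binomial term carries s^(A+k), where only s^k is at hand. *)
  set (K0 := / s ^ A * (1 + s) ^ (2 * A)).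
  assert (HsA : 0 < s ^ A) by (apply pow_lt; lra).
  assert (HK0 : 0 < K0).
  { unfold K0. apply Rmult_lt_0_compat; [now apply Rinv_0_lt_compat|apply pow_lt; lra]. }
  exists (K0 * / s). assert (His : 0 < / s) by (apply Rinv_0_lt_compat; lra). split; [nra|].
  intros n. assert (Hf := INR_fact_lt_0).
  assert (Hterm : forall k, (k <= n)%nat -> Cmod (pc n a b k) * rho ^ k <= K0 * INR (fact n) * (1 + s) ^ (3 * n)).
  { intros k Hk. rewrite (pc_explicit n a b k (n - k)) by lia.
    rewrite !Cmod_mult, Cmod_div, !Cmod_mult, Cmod_pow, Cmod_opp, Cmod_1, pow1
      by (apply Cmult_neq_0; apply RtoC_fact_neq_0).
    rewrite !Cmod_R, !Rabs_pos_eq by apply pos_INR.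
    assert (P1 : Cmod (poch (a + b + INR n + 1) k) <= INR (fact ((A + n) + k)) / INR (fact (A + n))).
    { apply Cmod_poch_le_fact. rewrite plus_INR.
      eapply Rle_trans; [apply Cmod_triangle|]. pose proof (Cmod_triangle (a + b) (INR n)).
      rewrite Cmod_1. rewrite Cmod_R, Rabs_pos_eq in * by apply pos_INR. lra. }
    assert (P2 : Cmod (poch (a + INR k + 1) (n - k)) <= INR (fact ((A + k) + (n - k))) / INR (fact (A + k))).
    { apply Cmod_poch_le_fact. rewrite plus_INR.
      eapply Rle_trans; [apply Cmod_triangle|]. pose proof (Cmod_triangle a (INR k)).
      rewrite Cmod_1. rewrite Cmod_R, Rabs_pos_eq in * by apply pos_INR. lra. }
    pose proof (binomial_term_le s (A + n + k) k ltac:(lra) ltac:(lia)) as B1.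
    pose proof (binomial_term_le s (A + n) (A + k) ltac:(lra) ltac:(lia)) as B2.
    replace (A + n + k - k)%nat with (A + n)%nat in B1 by lia.
    replace (A + n - (A + k))%nat with (n - k)%nat in B2 by lia.
    replace (A + k + (n - k))%nat with (A + n)%nat in P2 by lia.
    assert (B1' : (1 + s) ^ (A + n + k) <= (1 + s) ^ (A + 2 * n)) by (apply Rle_pow; [lra|lia]).
    assert (Hr : rho ^ k <= s ^ k * s ^ k) by (rewrite <- Rpow_mult_distr; apply pow_incr; lra).
    set (X := INR (fact (A + n + k))) in *. set (Y := INR (fact (A + n))) in *.
    set (Z := INR (fact (A + k))) in *. set (W := INR (fact (n - k))) in *. set (V := INR (fact k)) in *.
    assert (HX : 0 < X) by apply Hf. assert (HY : 0 < Y) by apply Hf. assert (HZ : 0 < Z) by apply Hf.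
    assert (HW : 0 < W) by apply Hf. assert (HV : 0 < V) by apply Hf.
    assert (Hsk : 0 < s ^ k) by (apply pow_lt; lra).
    set (F := INR (fact n)) in *. assert (HF : 0 < F) by apply Hf.
    apply Rle_trans with (F / (V * W) * (X / Y) * (Y / Z) * (s ^ k * s ^ k)).
    - apply Rmult_le_compat; [| |  |exact Hr].
      + apply Rmult_le_pos; [apply Rmult_le_pos|]; try apply Cmod_ge_0.
        apply Rdiv_le_0_compat; [lra|nra].
      + apply pow_le; lra.
      + apply Rmult_le_compat; try apply Cmod_ge_0; [|apply Rmult_le_compat; try apply Cmod_ge_0; try lra|exact P2].
        * apply Rmult_le_pos; [apply Rdiv_le_0_compat; [lra|nra]|apply Cmod_ge_0].
        * apply Rdiv_le_0_compat; [lra|nra].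
    - replace (F / (V * W) * (X / Y) * (Y / Z) * (s ^ k * s ^ k)) with
        (F * / s ^ A * ((X / (V * Y) * s ^ k) * (Y / (Z * W) * s ^ (A + k)))).
      2:{ rewrite pow_add. field. repeat split; lra. }
      replace (K0 * F * (1 + s) ^ (3 * n)) with (F * / s ^ A * ((1 + s) ^ (A + 2 * n) * (1 + s) ^ (A + n))).
      2:{ unfold K0. rewrite <- pow_add. replace (A + 2 * n + (A + n))%nat with (2 * A + 3 * n)%nat by lia.
          rewrite pow_add. ring. }
      apply Rmult_le_compat_l; [apply Rmult_le_pos; [lra|left; now apply Rinv_0_lt_compat]|].
      apply Rmult_le_compat; [| |lra|exact B2].
      + apply Rmult_le_pos; [|lra]. apply Rdiv_le_0_compat; [lra|nra].
      + apply Rmult_le_pos; [|apply pow_le; lra]. apply Rdiv_le_0_compat; [lra|nra]. }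
  apply Rle_trans with (sum_f_R0 (fun _ => K0 * INR (fact n) * (1 + s) ^ (3 * n)) n).
  { apply sum_Rle. exact Hterm. }
  rewrite sum_cte.
  assert (Hn : INR (S n) <= / s * (1 + s) ^ n).
  { pose proof (poly n s (proj1 Hs)) as Hp.
    apply Rmult_le_reg_l with s; [lra|]. rewrite <- Rmult_assoc, Rinv_r by lra. rewrite S_INR. nra. }
  assert (Hpw : (1 + s) ^ n * (1 + s) ^ (3 * n) <= q ^ n).
  { rewrite <- pow_add. replace (n + 3 * n)%nat with (4 * n)%nat by lia. rewrite pow_mult.
    apply pow_incr. split; [apply pow_le; lra|exact Hsq]. }
  specialize (Hf n). pose proof (pow_lt (1 + s) (3 * n) ltac:(lra)).
  apply Rle_trans with (K0 * INR (fact n) * (1 + s) ^ (3 * n) * (/ s * (1 + s) ^ n)).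
  { apply Rmult_le_compat_l; [|exact Hn]. apply Rmult_le_pos; nra. }
  replace (K0 * INR (fact n) * (1 + s) ^ (3 * n) * (/ s * (1 + s) ^ n)) with
    (K0 * / s * INR (fact n) * ((1 + s) ^ n * (1 + s) ^ (3 * n))) by ring.
  apply Rmult_le_compat_l; [|exact Hpw]. apply Rmult_le_pos; nra.
Qed.

(** * Hadamard finite parts *)

Lemma INR_inv_bounded (b : C) : (forall n, (INR n + b)%C <> 0) ->
  exists B, 0 < B /\ forall n, Cmod (/ (INR n + b)) <= B.
Proof. intros H. exact (Ccv_bounded _ _ (INR_inv_lim b H)). Qed.

(* Radius of convergence at least [r], for [r > 0]. *)
Definition psr (c : nat -> C) (r : R) : Prop :=
  forall t, 0 <= t < r -> exists B, forall m, Cmod (c m) * t ^ m <= B.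

Definition PS (c : nat -> C) (t : R) : C :=
  (PSeries (fun m => fst (c m)) t, PSeries (fun m => snd (c m)) t).

Lemma psr_rep (c : nat -> C) (F : R -> C) (r : R) : series_rep c F r -> psr c r.
Proof.
  intros H t Ht. destruct (Cseries_terms_bounded _ _ (H t Ht)) as [B [_ HB]].
  exists B. intros m. specialize (HB m). change (Defs.Cpow (Defs.RtoC t) m) with (RtoC t ^ m)%C in HB. toC.
  rewrite Cmod_mult, <- RtoC_pow, Cmod_R, Rabs_pos_eq in HB by (apply pow_le; lra). exact HB.
Qed.

Lemma psr_radius (c : nat -> C) (p : C -> R) (r x : R) :
  (forall z, Rabs (p z) <= Cmod z) -> psr c r -> Rabs x < r ->
  Rbar_lt (Rabs x) (CV_radius (fun m => p (c m))).
Proof.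
  intros Hp H Hx. pose proof (Rabs_pos x).
  destruct (H ((Rabs x + r) / 2)) as [B HB]; [lra|].
  apply Rbar_lt_le_trans with (Finite ((Rabs x + r) / 2)); [simpl; lra|].
  destruct (CV_radius_bounded (fun m => p (c m))) as [Hub _]. apply Hub.
  exists B. intros m. rewrite Rabs_mult, (Rabs_pos_eq (_ ^ m)) by (apply pow_le; lra).
  eapply Rle_trans; [|apply (HB m)]. apply Rmult_le_compat_r; [apply pow_le; lra|apply Hp].
Qed.

Lemma PS_correct (c : nat -> C) (r x : R) :
  psr c r -> Rabs x < r -> Ccv_series (fun m => c m * RtoC x ^ m)%C (PS c x).
Proof.
  intros H Hx. apply Ccv_components.
  assert (K : forall p : C -> R, (forall z, Rabs (p z) <= Cmod z) ->
    is_lim_seq (fun n => sum_f_R0 (fun m => p (c m) * x ^ m) n) (PSeries (fun m => p (c m)) x)).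
  { intros p Hp. pose proof (PSeries_correct _ _ (CV_radius_inside _ _ (psr_radius c p r x Hp H Hx))) as L.
    apply is_pseries_R in L.
    apply is_lim_seq_ext with (2 := L). intros n. now rewrite sum_n_Reals. }
  split.
  - eapply is_lim_seq_ext; [|apply (K fst Rabs_fst_le)]. intros n. rewrite Re_Csum.
    apply sum_eq. intros i _. rewrite <- RtoC_pow. simpl. ring.
  - eapply is_lim_seq_ext; [|apply (K snd Rabs_snd_le)]. intros n. rewrite Im_Csum.
    apply sum_eq. intros i _. rewrite <- RtoC_pow. simpl. ring.
Qed.

Lemma derC_PS (c : nat -> C) (r x : R) :
  psr c r -> Rabs x < r -> derC (PS c) x (PS (fun m => INR (S m) * c (S m))%C x).
Proof.
  intros H Hx. split.
  - pose proof (is_derive_PSeries _ _ (psr_radius c fst r x Rabs_fst_le H Hx)) as D.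
    eapply is_derive_eq; [exact D|]. apply PSeries_ext. intros m. unfold PS_derive, Cmult, RtoC. cbn [fst snd]. ring.
  - pose proof (is_derive_PSeries _ _ (psr_radius c snd r x Rabs_snd_le H Hx)) as D.
    eapply is_derive_eq; [exact D|]. apply PSeries_ext. intros m. unfold PS_derive, Cmult, RtoC. cbn [fst snd]. ring.
Qed.

Lemma psr_derive (c : nat -> C) (r : R) : psr c r -> psr (fun m => INR (S m) * c (S m))%C r.
Proof.
  intros H t Ht.
  assert (L : exists B, forall m, Cmod (INR (S m) * c (S m)) * t ^ m <= B).
  { destruct (Req_dec t 0) as [->|Ht0].
    - exists (Cmod (INR 1 * c 1%nat)). intros [|m].
      + rewrite pow_O, Rmult_1_r. apply Rle_refl.
      + rewrite pow_ne_zero by lia. rewrite Rmult_0_r. apply Cmod_ge_0.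
    - set (t1 := (t + r) / 2). destruct (H t1) as [B HB]; [unfold t1; lra|].
      assert (Hq : 0 < t / t1 < 1).
      { unfold t1. split; [apply Rdiv_lt_0_compat; lra|]. apply Rmult_lt_reg_r with ((t + r) / 2); [lra|].
        unfold Rdiv at 1. rewrite Rmult_assoc, Rinv_l by lra. lra. }
      (* With 1 + s = t1 / t, Bernoulli's inequality bounds m + 1 by (t1/t)^(m+1) / s. *)
      set (s := t1 / t - 1).
      assert (Hs : 0 < s).
      { unfold s, t1. apply Rmult_lt_reg_r with t; [lra|]. unfold Rdiv. field_simplify; lra. }
      exists (B * / t * / s). intros m.
      assert (E : INR (S m) * s <= (t1 / t) ^ S m).
      { replace (t1 / t) with (1 + s) by (unfold s; ring). pose proof (poly (S m) s Hs). lra. }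
      rewrite Cmod_mult, Cmod_R, Rabs_pos_eq by apply pos_INR.
      specialize (HB (S m)).
      assert (Htp : 0 < t ^ S m) by (apply pow_lt; lra).
      assert (E2 : (t1 / t) ^ S m * t ^ S m = t1 ^ S m).
      { rewrite <- Rpow_mult_distr. f_equal. field. exact Ht0. }
      apply Rmult_le_reg_r with (t * s); [nra|].
      replace (B * / t * / s * (t * s)) with B by (field; lra).
      eapply Rle_trans; [|exact HB].
      replace (INR (S m) * Cmod (c (S m)) * t ^ m * (t * s)) with
        (Cmod (c (S m)) * (INR (S m) * s * t ^ S m)) by (simpl; ring).
      apply Rmult_le_compat_l; [apply Cmod_ge_0|]. rewrite <- E2.
      apply Rmult_le_compat_r; lra. }
  exact L.
Qed.

Lemma contC_PS (c : nat -> C) (r x : R) : psr c r -> Rabs x < r -> contC (PS c) x.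
Proof. intros H Hx. eapply derC_contC, derC_PS; eassumption. Qed.

Lemma PS_unique (c : nat -> C) (r x : R) (l : C) :
  psr c r -> Rabs x < r -> Ccv_series (fun m => c m * RtoC x ^ m)%C l -> PS c x = l.
Proof. intros H Hx Hl. exact (Ccv_unique _ _ _ (PS_correct c r x H Hx) Hl). Qed.

Lemma PS_0 (c : nat -> C) (r : R) : 0 < r -> psr c r -> PS c 0 = c O.
Proof.
  intros Hr H. apply (PS_unique c r); [exact H|now rewrite Rabs_R0|].
  replace (c O) with (Csum (fun m => c m * RtoC 0 ^ m)%C 0) by (simpl; cring).
  apply Ccv_series_finite. intros k Hk. destruct k; [lia|]. simpl. cring.
Qed.

(* [a] is not a negative integer, so that [H int_0 x^(m+a) dx] makes sense for all [m]. *)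
Definition fp_regular (a : C) : Prop := forall n, (INR n + (a + 1))%C <> 0.

(** The operator a + 1 + x d/dx multiplies the m-th coefficient by m + a + 1, and so undoes the
    division in the definition of the finite part. *)
Lemma Euler_operator_series (e : nat -> C) (a : C) (r x : R) :
  psr e r -> Rabs x < r ->
  Ccv_series (fun m => (INR m + (a + 1)) * e m * RtoC x ^ m)%C
    ((a + 1) * PS e x + x * PS (fun m => INR (S m) * e (S m)) x)%C.
Proof.
  intros H Hx. apply Ccv_series_ext with (fun m => (a + 1) * (e m * RtoC x ^ m) + INR m * e m * RtoC x ^ m)%C.
  { intros; cring. }
  apply Ccv_series_plus; [apply Ccv_series_scal; exact (PS_correct e r x H Hx)|].
  replace (x * PS (fun m => INR (S m) * e (S m)) x)%C with
    (INR 0 * e O * RtoC x ^ 0 + x * PS (fun m => INR (S m) * e (S m)) x)%C by (simpl; ring).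
  apply (Ccv_series_shift (fun m => INR m * e m * RtoC x ^ m)%C).
  apply Ccv_series_ext with (fun m => x * (INR (S m) * e (S m) * RtoC x ^ m))%C.
  { intros m. rewrite Cpow_S. cring. }
  apply Ccv_series_scal. exact (PS_correct _ r x (psr_derive e r H) Hx).
Qed.

(** Hence Hadamard's sum, as a function of its endpoint, is the primitive of x^a F(x) without a
    constant term. *)
Lemma derC_power_times_PS (e : nat -> C) (a : C) (r x l : R) (F : C) :
  psr e r -> 0 < x < r ->
  Ccv_series (fun m => (INR m + (a + 1)) * e m * RtoC x ^ m)%C F ->
  derC (fun t => Cpow_pos t (a + 1)%C * PS e t)%C x (Cpow_pos x a * F)%C.
Proof.
  intros H Hx HF. assert (Hx' : Rabs x < r) by (rewrite Rabs_pos_eq; lra).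
  rewrite (Ccv_unique _ _ _ HF (Euler_operator_series e a r x H Hx')).
  eapply derC_eq.
  - apply derC_mult; [apply derC_Cpow_pos; lra|apply (derC_PS e r); assumption].
  - cbv beta. replace (a + 1 - 1)%C with a by cring.
    rewrite Cpow_pos_plus, Cpow_pos_1_r by lra. cring.
Qed.

(* The half of [is_HInt] at 0; the other half is the same with the parameters exchanged and [h] reflected. *)
Definition half (a b : C) (h : R -> C) (V : C) : Prop :=
  exists (r x0 : R) (c : nat -> C) (S I : C),
    0 < x0 /\ x0 < r /\ x0 < 1/2 /\
    series_rep c (fun t => Cmul (Cpow_pos (1 - t) b) (h t)) r /\
    Ccv_series (fun m => Cmul (Cdiv (c m) (Cadd (Defs.RtoC (INR m)) (Cadd a C1)))
                              (Cpow_pos x0 (Cadd (Defs.RtoC (INR m)) (Cadd a C1)))) S /\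
    is_RIC (fun x => wt a b x * h x)%C x0 (1/2) I /\
    V = (S + I)%C.

(** * Independence of the finite part from the radius and the splitting point *)

Lemma psr_quotient (a : C) (c : nat -> C) (r : R) :
  fp_regular a -> psr c r -> psr (fun m => c m / (INR m + (a + 1)))%C r.
Proof.
  intros Ha H t Ht. destruct (H t Ht) as [B HB]. destruct (INR_inv_bounded (a + 1) Ha) as [D [HD HDb]].
  exists (D * B). intros m. unfold Complex.Cdiv. rewrite Cmod_mult.
  specialize (HB m). specialize (HDb m). pose proof (Cmod_ge_0 (c m)).
  assert (0 <= t ^ m) by (apply pow_le; lra).
  replace (Cmod (c m) * Cmod (/ (INR m + (a + 1))) * t ^ m) with
    (Cmod (/ (INR m + (a + 1))) * (Cmod (c m) * t ^ m)) by ring.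
  apply Rmult_le_compat; [apply Cmod_ge_0|nra|exact HDb|exact HB].
Qed.

Lemma finite_part_term (a : C) (c : nat -> C) (x0 : R) (m : nat) : 0 < x0 ->
  Cmul (Cdiv (c m) (Cadd (Defs.RtoC (INR m)) (Cadd a C1)))
       (Cpow_pos x0 (Cadd (Defs.RtoC (INR m)) (Cadd a C1))) =
  (Cpow_pos x0 (a + 1)%C * (c m / (INR m + (a + 1)) * RtoC x0 ^ m))%C.
Proof.
  intros Hx. toC. rewrite Cpow_pos_plus, Cpow_pos_nat, RtoC_pow by exact Hx. cring.
Qed.

Lemma finite_part_sum (a : C) (c : nat -> C) (r x0 : R) : fp_regular a -> psr c r -> 0 < x0 < r ->
  Ccv_series (fun m => Cmul (Cdiv (c m) (Cadd (Defs.RtoC (INR m)) (Cadd a C1)))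
                            (Cpow_pos x0 (Cadd (Defs.RtoC (INR m)) (Cadd a C1))))
    (Cpow_pos x0 (a + 1)%C * PS (fun m => c m / (INR m + (a + 1)))%C x0)%C.
Proof.
  intros Ha H Hx.
  apply Ccv_series_ext with (fun m => Cpow_pos x0 (a + 1)%C * (c m / (INR m + (a + 1)) * RtoC x0 ^ m))%C.
  { intros m. symmetry. apply finite_part_term. lra. }
  apply Ccv_series_scal. apply (PS_correct _ r); [now apply psr_quotient|]. rewrite Rabs_pos_eq; lra.
Qed.

(** The coefficients agree by uniqueness of power series. Between two splitting points Hadamard's
    sum is a true primitive of the integrand, so moving the point trades a piece of the sum for a
    piece of the integral. *)
Lemma half_unique (a b : C) (h : R -> C) (V V' : C) :
  fp_regular a -> half a b h V -> half a b h V' -> V = V'.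
Proof.
  intros Ha.
  assert (W : forall r x0 c S I r' x0' c' S' I',
    0 < x0 -> x0 < r -> x0 < 1/2 ->
    series_rep c (fun t => Cmul (Cpow_pos (1 - t) b) (h t)) r ->
    Ccv_series (fun m => Cmul (Cdiv (c m) (Cadd (Defs.RtoC (INR m)) (Cadd a C1)))
                              (Cpow_pos x0 (Cadd (Defs.RtoC (INR m)) (Cadd a C1)))) S ->
    is_RIC (fun x => wt a b x * h x)%C x0 (1/2) I ->
    0 < x0' -> x0' < r' -> x0' < 1/2 ->
    series_rep c' (fun t => Cmul (Cpow_pos (1 - t) b) (h t)) r' ->
    Ccv_series (fun m => Cmul (Cdiv (c' m) (Cadd (Defs.RtoC (INR m)) (Cadd a C1)))
                              (Cpow_pos x0' (Cadd (Defs.RtoC (INR m)) (Cadd a C1)))) S' ->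
    is_RIC (fun x => wt a b x * h x)%C x0' (1/2) I' ->
    x0 <= x0' -> (S + I)%C = (S' + I')%C).
  { intros r x0 c S I r' x0' c' S' I' H1 H2 H3 Hc HS HI H1' H2' H3' Hc' HS' HI' Hle.
    assert (Ecc : forall m, c m = c' m).
    { intros m. assert (E : (c m - c' m)%C = 0).
      { apply (power_series_unique (fun m => c m - c' m)%C (Rmin r r')).
        - apply Rmin_pos; lra.
        - intros t Ht. pose proof (Rmin_l r r'); pose proof (Rmin_r r r').
          pose proof (Ccv_minus _ _ _ _ (Hc t ltac:(lra)) (Hc' t ltac:(lra))) as D. cbv beta in D.
          assert (Z : forall w : C, (w - w)%C = 0) by (intros; ring). rewrite Z in D. eapply Ccv_ext; [|exact D]. intros n. cbv beta.
          rewrite <- Csum_minus. apply Csum_ext. intros k _.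
          change (Defs.Cpow (Defs.RtoC t) k) with (RtoC t ^ k)%C. cring. }
      transitivity (c m - (c m - c' m))%C; [rewrite E|]; cring. }
    set (d := fun m => (c' m / (INR m + (a + 1)))%C).
    assert (Hp : psr c' r') by (eapply psr_rep; exact Hc').
    assert (Hd : psr d r') by (apply psr_quotient; assumption).
    assert (ES' : S' = (Cpow_pos x0' (a + 1)%C * PS d x0')%C).
    { eapply Ccv_unique; [exact HS'|apply (finite_part_sum a c' r' x0'); [exact Ha|exact Hp|lra]]. }
    assert (ES : S = (Cpow_pos x0 (a + 1)%C * PS d x0)%C).
    { eapply Ccv_unique; [|apply (finite_part_sum a c' r' x0); [exact Ha|exact Hp|lra]].
      eapply Ccv_series_ext; [|exact HS]. intros m. cbv beta; now rewrite Ecc. }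
    assert (EJ : is_RIC (fun x => wt a b x * h x)%C x0 x0'
      (Cpow_pos x0' (a + 1)%C * PS d x0' - Cpow_pos x0 (a + 1)%C * PS d x0)%C).
    { apply (is_RIC_ext (fun x => Cpow_pos x a * PS c' x)%C).
      - intros x Hx. rewrite Rmin_left, Rmax_right in Hx by exact Hle.
        rewrite (PS_unique c' r' x (Cpow_pos (1 - x) b * h x)%C); [unfold wt; cring|exact Hp| |].
        + rewrite Rabs_pos_eq; lra.
        + apply (Hc' x); lra.
      - apply (is_RIC_derive (fun x => Cpow_pos x (a + 1)%C * PS d x)%C).
        + intros x Hx. rewrite Rmin_left, Rmax_right in Hx by exact Hle.
          apply (derC_power_times_PS d a r' x 0); [exact Hd|lra|].
          apply Ccv_series_ext with (fun m => c' m * RtoC x ^ m)%C.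
          * intros m. unfold d. cfield. apply Ha.
          * apply (PS_correct c' r' x Hp). rewrite Rabs_pos_eq; lra.
        + intros x Hx. rewrite Rmin_left, Rmax_right in Hx by exact Hle.
          apply contC_mult; [apply contC_Cpow_pos; lra|apply (contC_PS c' r' x Hp)].
          rewrite Rabs_pos_eq; lra. }
    rewrite (is_RIC_unique _ _ _ _ _ HI (is_RIC_Chasles _ _ _ _ _ _ EJ HI')), ES, ES'. cring. }
  intros [r [x0 [c [S [I [H1 [H2 [H3 [H4 [H5 [H6 ->]]]]]]]]]]]
         [r' [x0' [c' [S' [I' [H1' [H2' [H3' [H4' [H5' [H6' ->]]]]]]]]]]].
  destruct (Rle_dec x0 x0') as [Hle|Hle].
  - apply (W r x0 c S I r' x0' c' S' I'); assumption.
  - symmetry. apply (W r' x0' c' S' I' r x0 c S I); try assumption. lra.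
Qed.

Lemma is_HInt_half (al be : C) (h : C -> C) (V : C) :
  is_HInt al be h V -> exists V1 V2, half al be (fun t => h (RtoC t)) V1 /\
    half be al (fun t => h (RtoC (1 - t))) V2 /\ V = (V1 + V2)%C.
Proof.
  intros [r [x0 [cL [cR [SL [SR [IL [IR [Hr [H0 [Hr0 [Hx [HL [HR [HSL [HSR [HIL [HIR HV]]]]]]]]]]]]]]]]]].
  exists (SL + IL)%C, (SR + IR)%C. split; [|split; [|exact HV]].
  - exists r, x0, cL, SL, IL. repeat split; try assumption; apply is_RIC_iff in HIL; apply HIL.
  - exists r, x0, cR, SR, IR. split; [exact H0|]. split; [exact Hr0|]. split; [exact Hx|].
    split; [exact HR|]. split; [exact HSR|]. split; [|reflexivity].
    apply is_RIC_iff in HIR.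
    (* The substitution t -> 1 - t in the shape that [is_RIC_comp_lin] requires; the inner -1 is its
       Jacobian, the outer one offsets the exchange of the endpoints. *)
    apply (is_RIC_ext (fun t => (-(1)) * (RtoC (-1) * (wt al be (-1 * t + 1)%R * h (RtoC (-1 * t + 1)))))%C).
    + intros t _. replace (-1 * t + 1) with (1 - t) by ring. unfold wt. replace (1 - (1 - t)) with t by ring.
      cring.
    + apply is_RIC_eq with ((-(1)) * (- IR))%C; [|ring].
      apply is_RIC_scal.
      apply (is_RIC_comp_lin (fun x => wt al be x * h (RtoC x))%C (-1) 1).
      replace (-1 * x0 + 1) with (1 - x0) by ring. replace (-1 * (1 / 2) + 1) with (1 / 2) by field.
      apply is_RIC_swap. exact HIR.
Qed.

Lemma is_HInt_unique (al be : C) (h : C -> C) (V V' : C) :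
  fp_regular al -> fp_regular be -> is_HInt al be h V -> is_HInt al be h V' -> V = V'.
Proof.
  intros Ha Hb H H'. apply is_HInt_half in H, H'.
  destruct H as [V1 [V2 [H1 [H2 ->]]]]. destruct H' as [V1' [V2' [H1' [H2' ->]]]].
  now rewrite (half_unique _ _ _ _ _ Ha H1 H1'), (half_unique _ _ _ _ _ Hb H2 H2').
Qed.

(* [half] does not depend on its radius and splitting point; fixing them at [rho] and [rho / 2] makes it
   visibly linear and continuous in [h]. *)
Definition half_at (a b : C) (rho : R) (h : R -> C) (V : C) : Prop :=
  exists (c : nat -> C) (I : C),
    series_rep c (fun t => Cmul (Cpow_pos (1 - t) b) (h t)) rho /\
    is_RIC (fun x => wt a b x * h x)%C (rho / 2) (1/2) I /\
    V = (Cpow_pos (rho / 2) (a + 1)%C * PS (fun m => c m / (INR m + (a + 1)))%C (rho / 2) + I)%C.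

Definition fp_int (a b : C) (rho : R) (h : R -> C) (V : C) : Prop :=
  exists V1 V2, half_at a b rho h V1 /\ half_at b a rho (fun t => h (1 - t)) V2 /\ V = (V1 + V2)%C.

Lemma half_at_half (a b : C) (rho : R) (h : R -> C) (V : C) :
  fp_regular a -> 0 < rho <= 1 / 2 -> half_at a b rho h V -> half a b h V.
Proof.
  intros Ha Hr [c [I [H1 [H2 ->]]]].
  eexists rho, (rho / 2), c, _, I. repeat split; try lra; [exact H1| |apply H2|apply H2].
  apply (finite_part_sum a c rho); [exact Ha|eapply psr_rep; exact H1|lra].
Qed.

Lemma half_at_unique (a b : C) (rho : R) (h : R -> C) (V V' : C) :
  fp_regular a -> 0 < rho <= 1 / 2 -> half_at a b rho h V -> half_at a b rho h V' -> V = V'.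
Proof. intros Ha Hr H H'. apply (half_unique a b h); [exact Ha| |]; eapply half_at_half; eassumption. Qed.

Lemma fp_int_is_HInt (al be : C) (rho : R) (h : C -> C) (V : C) :
  fp_regular al -> fp_regular be -> 0 < rho <= 1 / 2 -> fp_int al be rho (fun t => h (RtoC t)) V -> is_HInt al be h V.
Proof.
  intros Ha Hb Hr [V1 [V2 [[c [I [H1 [H2 ->]]]] [[d [J [H3 [H4 ->]]]] ->]]]].
  eexists rho, (rho / 2), c, d, _, _, I, J.
  split; [lra|]. split; [lra|]. split; [lra|]. split; [lra|].
  split; [exact H1|]. split; [exact H3|].
  split; [apply (finite_part_sum al c rho); [exact Ha|eapply psr_rep; exact H1|lra]|].
  split; [apply (finite_part_sum be d rho); [exact Hb|eapply psr_rep; exact H3|lra]|].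
  split; [apply is_RIC_iff; exact H2|]. split; [|reflexivity].
  apply is_RIC_iff.
  apply (is_RIC_ext (fun t => (-(1)) * (RtoC (-1) * (wt be al (-1 * t + 1)%R * h (RtoC (1 - (-1 * t + 1))))))%C).
  - intros t _. replace (-1 * t + 1) with (1 - t) by ring. unfold wt. replace (1 - (1 - t)) with t by ring.
    cring.
  - apply is_RIC_eq with ((-(1)) * (- J))%C; [|ring]. apply is_RIC_scal.
    apply (is_RIC_comp_lin (fun x => wt be al x * h (RtoC (1 - x)))%C (-1) 1).
    replace (-1 * (1 - rho / 2) + 1) with (rho / 2) by ring. replace (-1 * (1 / 2) + 1) with (1 / 2) by field.
    apply is_RIC_swap. exact H4.
Qed.

(** [HInt] is a choice, so its value follows from uniqueness; the radius [rho] may be adapted to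
    each use. *)
Lemma HInt_eq (al be : C) (rho : R) (h : C -> C) (V : C) :
  fp_regular al -> fp_regular be -> 0 < rho <= 1 / 2 -> fp_int al be rho (fun t => h (RtoC t)) V -> HInt al be h = V.
Proof.
  intros Ha Hb Hr H. apply (is_HInt_unique al be h); [exact Ha|exact Hb| |].
  - unfold HInt. apply epsilon_spec. exists V. eapply fp_int_is_HInt; eassumption.
  - eapply fp_int_is_HInt; eassumption.
Qed.

Lemma fp_int_unique (a b : C) (rho : R) (h : R -> C) (V V' : C) :
  fp_regular a -> fp_regular b -> 0 < rho <= 1 / 2 -> fp_int a b rho h V -> fp_int a b rho h V' -> V = V'.
Proof.
  intros Ha Hb Hr [V1 [V2 [H1 [H2 ->]]]] [V1' [V2' [H1' [H2' ->]]]].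
  now rewrite (half_at_unique _ _ _ _ _ _ Ha Hr H1 H1'), (half_at_unique _ _ _ _ _ _ Hb Hr H2 H2').
Qed.

Lemma half_at_lin (a b : C) (rho : R) (h1 h2 : R -> C) (k V1 V2 : C) :
  fp_regular a -> 0 < rho <= 1 / 2 ->
  half_at a b rho h1 V1 -> half_at a b rho h2 V2 ->
  half_at a b rho (fun t => h1 t + k * h2 t)%C (V1 + k * V2)%C.
Proof.
  intros Ha Hr [c [I [H1 [H2 ->]]]] [d [J [H3 [H4 ->]]]].
  assert (Hc : psr c rho) by (eapply psr_rep; exact H1).
  assert (Hd : psr d rho) by (eapply psr_rep; exact H3).
  assert (Hrep : series_rep (fun m => c m + k * d m)%C
    (fun t => Cmul (Cpow_pos (1 - t) b) (h1 t + k * h2 t)%C) rho).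
  { intros t Ht. pose proof (Ccv_series_plus _ _ _ _ (H1 t Ht) (Ccv_series_scal k _ _ (H3 t Ht))) as L.
    cbv beta in L. toC.
    replace (Cpow_pos (1 - t) b * (h1 t + k * h2 t))%C with
      (Cpow_pos (1 - t) b * h1 t + k * (Cpow_pos (1 - t) b * h2 t))%C by cring.
    eapply Ccv_series_ext; [|exact L]. intros m. cring. }
  exists (fun m => c m + k * d m)%C, (I + k * J)%C. split; [exact Hrep|split].
  - apply (is_RIC_ext (fun x => wt a b x * h1 x + k * (wt a b x * h2 x))%C); [intros; cring|].
    apply is_RIC_plus; [exact H2|apply is_RIC_scal; exact H4].
  - assert (Hrr : Rabs (rho / 2) < rho) by (rewrite Rabs_pos_eq; lra).
    rewrite (PS_unique (fun m => (c m + k * d m) / (INR m + (a + 1)))%C rho (rho / 2)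
      (PS (fun m => c m / (INR m + (a + 1)))%C (rho / 2) + k * PS (fun m => d m / (INR m + (a + 1)))%C (rho / 2))%C);
      [cring| |exact Hrr|].
    + apply (psr_quotient a (fun m => c m + k * d m)%C); [exact Ha|eapply psr_rep; exact Hrep].
    + apply Ccv_series_ext with (fun m => c m / (INR m + (a + 1)) * RtoC (rho / 2) ^ m +
        k * (d m / (INR m + (a + 1)) * RtoC (rho / 2) ^ m))%C; [intros; cfield; apply Ha|].
      apply Ccv_series_plus; [|apply Ccv_series_scal].
      * apply (PS_correct _ rho); [now apply psr_quotient|exact Hrr].
      * apply (PS_correct _ rho); [now apply psr_quotient|exact Hrr].
Qed.

Lemma fp_int_lin (a b : C) (rho : R) (h1 h2 : R -> C) (k V1 V2 : C) :
  fp_regular a -> fp_regular b -> 0 < rho <= 1 / 2 ->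
  fp_int a b rho h1 V1 -> fp_int a b rho h2 V2 ->
  fp_int a b rho (fun t => h1 t + k * h2 t)%C (V1 + k * V2)%C.
Proof.
  intros Ha Hb Hr [L1 [R1 [H1 [H2 ->]]]] [L2 [R2 [H3 [H4 ->]]]].
  exists (L1 + k * L2)%C, (R1 + k * R2)%C. split; [now apply half_at_lin|]. split; [|ring].
  apply (half_at_lin b a rho (fun t => h1 (1 - t)) (fun t => h2 (1 - t))); assumption.
Qed.

Lemma half_at_ext (a b : C) (rho : R) (h1 h2 : R -> C) (V : C) :
  0 < rho <= 1 / 2 ->
  (forall t, 0 <= t <= 1 -> h1 t = h2 t) -> half_at a b rho h1 V -> half_at a b rho h2 V.
Proof.
  intros Hr H [c [I [H1 [H2 ->]]]]. exists c, I. split; [|split; [|reflexivity]].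
  - intros t Ht. specialize (H1 t Ht). cbv beta in *. rewrite <- H by lra. exact H1.
  - apply is_RIC_ext with (2 := H2). intros x Hx. rewrite Rmin_left, Rmax_right in Hx by lra.
    now rewrite H by lra.
Qed.

Lemma fp_int_ext (a b : C) (rho : R) (h1 h2 : R -> C) (V : C) :
  0 < rho <= 1 / 2 ->
  (forall t, 0 <= t <= 1 -> h1 t = h2 t) -> fp_int a b rho h1 V -> fp_int a b rho h2 V.
Proof.
  intros Hr H [V1 [V2 [H1 [H2 ->]]]]. exists V1, V2. split; [|split; [|reflexivity]].
  - apply half_at_ext with h1; assumption.
  - apply half_at_ext with (fun t => h1 (1 - t)); [exact Hr| |exact H2]. intros t Ht. apply H. lra.
Qed.

(** * Continuity of the finite part *)

Lemma contC_bounded (g : R -> C) (a b : R) :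
  a <= b -> (forall x, a <= x <= b -> contC g x) -> exists M, 0 < M /\ forall x, a <= x <= b -> Cmod (g x) <= M.
Proof.
  intros Hab H.
  destruct (continuity_ab_maj (fun x => Cmod (g x)) a b Hab) as [Mx [HM _]].
  - intros x Hx. apply continuity_pt_filterlim. apply continuous_R_eps.
    intros eps He. destruct (proj1 (contC_eps g x) (H x Hx) eps He) as [d [Hd K]].
    exists d. split; [exact Hd|]. intros y Hy. specialize (K y Hy).
    apply Rabs_def1.
    + pose proof (Cmod_le_minus (g y) (g x)). lra.
    + pose proof (Cmod_le_minus (g x) (g y)) as Q. rewrite Cmod_minus_sym in Q. lra.
  - exists (Cmod (g Mx) + 1). pose proof (Cmod_ge_0 (g Mx)). split; [lra|].
    intros x Hx. specialize (HM x Hx). simpl in HM. lra.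
Qed.

Lemma contC_wt (a b : C) (x : R) : 0 < x < 1 -> contC (wt a b) x.
Proof.
  intros Hx. apply contC_mult; [apply contC_Cpow_pos; lra|].
  apply (contC_comp (fun t => Cpow_pos t b) (fun t => 1 - t)); [|apply contC_Cpow_pos; lra].
  apply (ex_derive_continuous (V := R_NormedModule)). auto_derive. exact I.
Qed.

(** To be read as: the weighted sum is at most [nu]. As a relation it needs neither a distinguished
    coefficient sequence nor the value of an infinite sum. *)
Definition taylor_norm (rho : R) (F : R -> C) (nu : R) : Prop :=
  exists c, series_rep c F rho /\ forall M, sum_f_R0 (fun m => Cmod (c m) * rho ^ m) M <= nu.

(** Continuity inside (0,1) provides the integral beyond the splitting point, and the sup norm
    bounds it. *)
Definition half_norm (b : C) (rho : R) (h : R -> C) (nu : R) : Prop :=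
  taylor_norm rho (fun t => Cmul (Cpow_pos (1 - t) b) (h t)) nu /\
  (forall x, 0 < x < 1 -> contC h x) /\ (forall x, 0 <= x <= 1 -> Cmod (h x) <= nu).

(** Since no m + a + 1 vanishes, the inverses are bounded by some [D], so the division costs a
    constant factor; the integral from rho/2 to 1/2 is controlled by the sup norm and a bound [M] of
    the weight. *)
Lemma half_at_bound (a b : C) (rho : R) : fp_regular a -> 0 < rho <= 1 / 2 ->
  exists K, 0 < K /\ forall h nu, half_norm b rho h nu -> exists V, half_at a b rho h V /\ Cmod V <= K * nu.
Proof.
  intros Ha Hr. destruct (INR_inv_bounded (a + 1) Ha) as [D [HD HDb]].
  destruct (contC_bounded (wt a b) (rho / 2) (1 / 2)) as [M [HM HMb]]; [lra| |].
  { intros x Hx. apply contC_wt. lra. }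
  set (P := Cmod (Cpow_pos (rho / 2) (a + 1)%C)).
  assert (HP : 0 <= P) by apply Cmod_ge_0.
  exists (P * D + M). split; [nra|]. intros h nu [[c [Hc Hn]] [Hcont Hsup]].
  destruct (ex_RIC (fun x => wt a b x * h x)%C (rho / 2) (1 / 2)) as [I HI].
  { intros x Hx. rewrite Rmin_left, Rmax_right in Hx by lra.
    apply contC_mult; [apply contC_wt; lra|apply Hcont; lra]. }
  assert (Hrr : Rabs (rho / 2) < rho) by (rewrite Rabs_pos_eq; lra).
  assert (Hp : psr c rho) by (eapply psr_rep; exact Hc).
  exists (Cpow_pos (rho / 2) (a + 1)%C * PS (fun m => c m / (INR m + (a + 1)))%C (rho / 2) + I)%C.
  split; [exists c, I; auto|].
  assert (Hnu : 0 <= nu) by (pose proof (Hsup 0 ltac:(lra)); pose proof (Cmod_ge_0 (h 0)); lra).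
  eapply Rle_trans; [apply Cmod_triangle|]. rewrite Cmod_mult. fold P.
  assert (B1 : Cmod (PS (fun m => c m / (INR m + (a + 1)))%C (rho / 2)) <= D * nu).
  { apply (Cseries_bound _ _ (D * nu)) with
      (2 := PS_correct _ rho _ (psr_quotient a c rho Ha Hp) Hrr).
    intros k. apply Rle_trans with (sum_f_R0 (fun m => (Cmod (c m) * rho ^ m) * D) k).
    - apply sum_Rle. intros m _. unfold Complex.Cdiv. rewrite !Cmod_mult, <- RtoC_pow, Cmod_R.
      rewrite Rabs_pos_eq by (apply pow_le; lra).
      specialize (HDb m). pose proof (Cmod_ge_0 (c m)). pose proof (Cmod_ge_0 (/ (INR m + (a + 1)))).
      assert ((rho / 2) ^ m <= rho ^ m) by (apply pow_incr; lra).
      assert (0 <= (rho / 2) ^ m) by (apply pow_le; lra).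
      apply Rle_trans with (Cmod (c m) * D * (rho / 2) ^ m); [apply Rmult_le_compat_r; nra|].
      apply Rle_trans with (Cmod (c m) * D * rho ^ m); [apply Rmult_le_compat_l; nra|right; ring].
    - rewrite <- scal_sum. apply Rmult_le_compat_l; [lra|apply Hn]. }
  assert (B2 : Cmod I <= (1 / 2 - rho / 2) * (M * nu)).
  { apply (is_RIC_bound (fun x => wt a b x * h x)%C); [lra| |exact HI].
    intros x Hx. rewrite Cmod_mult. apply Rmult_le_compat; try apply Cmod_ge_0.
    - apply HMb; lra.
    - apply Hsup; lra. }
  assert (0 <= M * nu) by nra.
  assert (P * Cmod (PS (fun m => c m / (INR m + (a + 1)))%C (rho / 2)) <= P * (D * nu))
    by (apply Rmult_le_compat_l; lra).
  nra.
Qed.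

Lemma lim_sum_f_R0 (u : nat -> nat -> R) (v : nat -> R) (M : nat) :
  (forall m, is_lim_seq (fun j => u j m) (v m)) ->
  is_lim_seq (fun j => sum_f_R0 (u j) M) (sum_f_R0 v M).
Proof.
  intros H. induction M as [|M IH]; simpl; [apply H|].
  apply is_lim_seq_plus'; [exact IH|apply H].
Qed.

Lemma Ccv_Csum (u : nat -> nat -> C) (v : nat -> C) (K : nat) :
  (forall k, (k <= K)%nat -> Ccv (u k) (v k)) -> Ccv (fun n => Csum (fun k => u k n) K) (Csum v K).
Proof.
  induction K as [|K IH]; intros H; simpl; [apply (H O); lia|].
  apply Ccv_plus; [apply IH; intros; apply H; lia|apply H; lia].
Qed.

Lemma sum_le_lim (nu : nat -> R) (l : R) (n : nat) :
  (forall k, 0 <= nu k) -> is_lim_seq (sum_f_R0 nu) l -> sum_f_R0 nu n <= l.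
Proof.
  intros H Hl. apply (is_lim_seq_incr_compare (sum_f_R0 nu) l); [exact Hl|].
  intros k. simpl. specialize (H (S k)). lra.
Qed.

Lemma tail_dominated (u : nat -> C) (nu : nat -> R) (L : C) (l : R) (K : nat) :
  (forall k, Cmod (u k) <= nu k) -> Ccv_series u L -> is_lim_seq (sum_f_R0 nu) l ->
  Cmod (L - Csum u K) <= l - sum_f_R0 nu K.
Proof.
  intros H HL Hl.
  assert (Hp : forall k, 0 <= nu k) by (intros k; eapply Rle_trans; [apply Cmod_ge_0|apply H]).
  assert (HB : Ccv (fun j => Csum u (j + K) - Csum u K)%C (L - Csum u K)%C).
  { apply Ccv_minus; [|apply Ccv_const]. apply (Ccv_subseq_shift (Csum u)). exact HL. }
  apply (Ccv_Cmod_le _ _ _ HB). intros j.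
  pose proof (sum_le_lim nu l (j + K) Hp Hl) as H1.
  enough (Cmod (Csum u (j + K) - Csum u K) <= sum_f_R0 nu (j + K) - sum_f_R0 nu K) by lra.
  clear H1. induction j as [|j IH].
  - simpl. replace (Csum u K - Csum u K)%C with (RtoC 0) by cring. rewrite Cmod_0. lra.
  - change (S j + K)%nat with (S (j + K)). simpl. toC.
    replace (Csum u (j + K) + u (S (j + K)) - Csum u K)%C with
      ((Csum u (j + K) - Csum u K) + u (S (j + K)%nat))%C by cring.
    eapply Rle_trans; [apply Cmod_triangle|]. specialize (H (S (j + K))). lra.
Qed.

Lemma dominated_series_converges (u : nat -> C) (nu : nat -> R) (l : R) :
  (forall k, Cmod (u k) <= nu k) -> is_lim_seq (sum_f_R0 nu) l -> exists L, Ccv_series u L.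
Proof.
  intros H Hl. apply (Cseries_abs u l). intros n.
  eapply Rle_trans; [apply sum_Rle; intros k _; apply H|].
  apply sum_le_lim; [|exact Hl]. intros k. eapply Rle_trans; [apply Cmod_ge_0|apply H].
Qed.

Lemma small_tail (nu : nat -> R) (l eps : R) :
  is_lim_seq (sum_f_R0 nu) l -> 0 < eps -> exists N, forall K, (N <= K)%nat -> l - sum_f_R0 nu K < eps.
Proof.
  intros Hl He. apply is_lim_seq_Reals in Hl. destruct (Hl eps He) as [N HN].
  exists N. intros K HK. specialize (HN K HK). unfold Rdist in HN. apply Rabs_def2 in HN. lra.
Qed.

(** Completeness of the weighted l^1 space: the coefficients of the sum are the sums over [k] of
    those of [F k]. The interchange of the summations over [k] and [m] rests on the tail estimate
    [Claim]. *)
Lemma taylor_norm_series (rho l : R) (F : nat -> R -> C) (nu : nat -> R) (Gf : R -> C) :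
  0 < rho -> (forall k, taylor_norm rho (F k) (nu k)) -> is_lim_seq (sum_f_R0 nu) l ->
  (forall t, 0 <= t < rho -> Ccv_series (fun k => F k t) (Gf t)) -> taylor_norm rho Gf l.
Proof.
  intros Hr HF Hl HG.
  set (c := fun k => epsilon (inhabits (fun _ : nat => RtoC 0)) (fun c => series_rep c (F k) rho /\
    forall M, sum_f_R0 (fun m => Cmod (c m) * rho ^ m) M <= nu k)).
  assert (Hc : forall k, series_rep (c k) (F k) rho /\
    forall M, sum_f_R0 (fun m => Cmod (c k m) * rho ^ m) M <= nu k).
  { intros k. unfold c. apply epsilon_spec. apply HF. }
  assert (Hpow : forall m, 0 < rho ^ m) by (intros m; apply pow_lt, Hr).
  assert (Hterm : forall k m, Cmod (c k m) * rho ^ m <= nu k).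
  { intros k m. eapply Rle_trans; [|apply (proj2 (Hc k) m)]. destruct m; simpl; [lra|].
    pose proof (cond_pos_sum (fun m => Cmod (c k m) * rho ^ m) m
      (fun i => Rmult_le_pos _ _ (Cmod_ge_0 _) (Rlt_le _ _ (Hpow i)))). lra. }
  assert (Hnu : forall k, 0 <= nu k).
  { intros k. eapply Rle_trans; [|apply (Hterm k O)]. apply Rmult_le_pos; [apply Cmod_ge_0|left; apply Hpow]. }
  assert (Hd : forall m, exists L, Ccv_series (fun k => c k m) L).
  { intros m. apply (dominated_series_converges _ (fun k => nu k * / rho ^ m) (l * / rho ^ m)).
    - intros k. apply Rmult_le_reg_r with (rho ^ m); [apply Hpow|].
      rewrite Rmult_assoc, Rinv_l, Rmult_1_r by (specialize (Hpow m); lra). apply Hterm.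
    - apply is_lim_seq_ext with (fun n => / rho ^ m * sum_f_R0 nu n).
      + intros n. apply scal_sum.
      + rewrite Rmult_comm. exact (is_lim_seq_scal_l _ (/ rho ^ m) l Hl). }
  set (d := fun m => epsilon (inhabits (RtoC 0)) (fun L => Ccv_series (fun k => c k m) L)).
  assert (Hdm : forall m, Ccv_series (fun k => c k m) (d m)).
  { intros m. unfold d. apply epsilon_spec, Hd. }
  (* The tail after [K] in the weighted norm, for finitely many [m] at a time, so that the limit in
     [j] passes through the sum. *)
  assert (Claim : forall M K, sum_f_R0 (fun m => Cmod (d m - Csum (fun k => c k m) K) * rho ^ m) M
     <= l - sum_f_R0 nu K).
  { intros M K.
    assert (L1 : is_lim_seq (fun j => sum_f_R0 (fun m => Cmod (Csum (fun k => c k m) (j + K) -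
         Csum (fun k => c k m) K) * rho ^ m) M)
       (sum_f_R0 (fun m => Cmod (d m - Csum (fun k => c k m) K) * rho ^ m) M)).
    { apply (lim_sum_f_R0 (fun j m => Cmod (Csum (fun k => c k m) (j + K) -
         Csum (fun k => c k m) K) * rho ^ m)). intros m.
      rewrite Rmult_comm.
      apply is_lim_seq_ext with (fun j => rho ^ m * Cmod (Csum (fun k => c k m) (j + K) -
         Csum (fun k => c k m) K)); [intros; ring|].
      apply (is_lim_seq_scal_l _ (rho ^ m) (Cmod (d m - Csum (fun k => c k m) K))).
      apply Ccv_Cmod. apply Ccv_minus; [|apply Ccv_const].
      apply (Ccv_subseq_shift (Csum (fun k => c k m))). apply Hdm. }
    apply (is_lim_seq_le _ _ _ (Finite (l - sum_f_R0 nu K))) with (2 := L1) (3 := is_lim_seq_const _).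
    intros j.
    pose proof (sum_le_lim nu l (j + K) Hnu Hl) as H1.
    enough (sum_f_R0 (fun m => Cmod (Csum (fun k => c k m) (j + K) -
         Csum (fun k => c k m) K) * rho ^ m) M <= sum_f_R0 nu (j + K) - sum_f_R0 nu K) by lra.
    clear H1. induction j as [|j IH].
    - simpl. rewrite Rminus_diag. right.
      rewrite (sum_eq _ (fun _ => 0)); [rewrite sum_cte; ring|]. intros m _.
      replace (Csum (fun k => c k m) K - Csum (fun k => c k m) K)%C with (RtoC 0) by cring.
      rewrite Cmod_0. ring.
    - change (S j + K)%nat with (S (j + K)).
      apply Rle_trans with (sum_f_R0 (fun m => Cmod (Csum (fun k => c k m) (j + K) -
         Csum (fun k => c k m) K) * rho ^ m + Cmod (c (S (j + K)) m) * rho ^ m) M).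
      + apply sum_Rle. intros m _. rewrite <- Rmult_plus_distr_r.
        apply Rmult_le_compat_r; [left; apply Hpow|].
        simpl. toC.
        replace (Csum (fun k => c k m) (j + K) + c (S (j + K)) m - Csum (fun k => c k m) K)%C with
          ((Csum (fun k => c k m) (j + K) - Csum (fun k => c k m) K) + c (S (j + K)) m)%C by cring.
        apply Cmod_triangle.
      + rewrite sum_plus. simpl. pose proof (proj2 (Hc (S (j + K))) M). lra. }
  exists d. split.
  - intros t Ht.
    assert (Htr : forall m, t ^ m <= rho ^ m) by (intros; apply pow_incr; lra).
    assert (Htp : forall m, 0 <= t ^ m) by (intros; apply pow_le; lra).
    assert (HFk : forall k, Cmod (F k t) <= nu k).
    { intros k. apply (Cseries_bound _ _ (nu k)) with (2 := proj1 (Hc k) t Ht).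
      intros n. eapply Rle_trans; [|apply (proj2 (Hc k) n)]. apply sum_Rle. intros m _.
      change (Defs.Cpow (Defs.RtoC t) m) with (RtoC t ^ m)%C. toC.
      rewrite Cmod_mult, <- RtoC_pow, Cmod_R, Rabs_pos_eq by apply Htp.
      apply Rmult_le_compat_l; [apply Cmod_ge_0|apply Htr]. }
    intros eps He.
    destruct (small_tail nu l (eps / 3) Hl ltac:(lra)) as [K0 HK]. set (K := K0).
    specialize (HK K (le_n _)).
    assert (L2 : Ccv (fun n => Csum (fun k => Csum (fun m => c k m * RtoC t ^ m)%C n) K)
       (Csum (fun k => F k t) K)).
    { apply (Ccv_Csum (fun k n => Csum (fun m => c k m * RtoC t ^ m)%C n) (fun k => F k t)).
      intros k _. apply (proj1 (Hc k) t Ht). }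
    destruct (L2 (eps / 3) ltac:(lra)) as [N HN]. exists N. intros n Hn. specialize (HN n Hn).
    pose proof (tail_dominated _ nu (Gf t) l K HFk (HG t Ht) Hl) as T.
    change (Csum (fun m => Cmul (d m) (Defs.Cpow (Defs.RtoC t) m)) n) with
      (Csum (fun m => (d m * RtoC t ^ m)%C) n).
    toC.
    set (A1 := Csum (fun m => (d m * RtoC t ^ m)%C) n) in *.
    set (A2 := Csum (fun k => Csum (fun m => (c k m * RtoC t ^ m)%C) n) K) in *.
    set (A3 := Csum (fun k => F k t) K) in *.
    assert (T2 : Cmod (A1 - A2) <= l - sum_f_R0 nu K).
    { replace (A1 - A2)%C with (Csum (fun m => (d m - Csum (fun k => c k m) K) * RtoC t ^ m)%C n : C).
      - eapply Rle_trans; [apply Cmod_Csum|]. eapply Rle_trans; [|apply (Claim n K)].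
        apply sum_Rle. intros m _. rewrite Cmod_mult, <- RtoC_pow, Cmod_R, Rabs_pos_eq by apply Htp.
        apply Rmult_le_compat_l; [apply Cmod_ge_0|apply Htr].
      - unfold A1, A2. rewrite (Csum_swap (fun k m => c k m * RtoC t ^ m)%C).
        rewrite <- Csum_minus. apply Csum_ext. intros m _. rewrite Csum_scal_r. cring. }
    replace (A1 - Gf t)%C with ((A1 - A2) + ((A2 - A3) + (A3 - Gf t)))%C by cring.
    eapply Rle_lt_trans; [apply Cmod_triangle|].
    pose proof (Cmod_triangle (A2 - A3) (A3 - Gf t)). rewrite (Cmod_minus_sym A3) in *. lra.
  - intros M. specialize (Claim M O).
    apply Rle_trans with (sum_f_R0 (fun m => Cmod (d m - Csum (fun k => c k m) 0) * rho ^ m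
      + Cmod (c O m) * rho ^ m) M).
    + apply sum_Rle. intros m _. rewrite <- Rmult_plus_distr_r.
      apply Rmult_le_compat_r; [left; apply Hpow|]. simpl.
      pose proof (Cmod_le_minus (d m) (c O m)). lra.
    + rewrite sum_plus. pose proof (proj2 (Hc O) M). change (sum_f_R0 nu 0) with (nu O) in Claim. lra.
Qed.

Lemma half_norm_series (b : C) (rho l : R) (h : nat -> R -> C) (nu : nat -> R) (Gf : R -> C) :
  0 < rho <= 1 / 2 -> (forall k, half_norm b rho (h k) (nu k)) -> is_lim_seq (sum_f_R0 nu) l ->
  (forall t, 0 <= t <= 1 -> Ccv_series (fun k => h k t) (Gf t)) -> half_norm b rho Gf l.
Proof.
  intros Hr Hh Hl HG.
  assert (Hb : forall t k, 0 <= t <= 1 -> Cmod (h k t) <= nu k) by (intros t k Ht; now apply Hh).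
  assert (Hnu : forall k, 0 <= nu k).
  { intros k. eapply Rle_trans; [apply Cmod_ge_0|apply (Hb 0 k)]. lra. }
  assert (HT : forall t K, 0 <= t <= 1 -> Cmod (Gf t - Csum (fun k => h k t) K) <= l - sum_f_R0 nu K).
  { intros t K Ht. apply tail_dominated; [intros; now apply Hb|now apply HG|exact Hl]. }
  split; [|split].
  - apply (taylor_norm_series rho l (fun k t => Cmul (Cpow_pos (1 - t) b) (h k t)) nu); [lra|apply Hh|exact Hl|].
    intros t Ht. apply Ccv_series_scal. apply HG. lra.
  - intros x Hx. apply contC_eps. intros eps He.
    destruct (small_tail nu l (eps / 3) Hl ltac:(lra)) as [K HK]. specialize (HK K (le_n _)).
    assert (Hc : contC (fun t => Csum (fun k => h k t) K) x).
    { apply contC_Csum. intros k _. now apply Hh. }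
    destruct (proj1 (contC_eps _ _) Hc (eps / 3) ltac:(lra)) as [d [Hd HD]].
    exists (Rmin d (Rmin x (1 - x))). split; [repeat apply Rmin_pos; lra|]. intros y Hy.
    pose proof (Rmin_l d (Rmin x (1 - x))). pose proof (Rmin_r d (Rmin x (1 - x))).
    pose proof (Rmin_l x (1 - x)). pose proof (Rmin_r x (1 - x)).
    specialize (HD y ltac:(lra)). apply Rabs_def2 in Hy.
    pose proof (HT y K ltac:(lra)) as T1. pose proof (HT x K ltac:(lra)) as T2.
    set (Ay := Csum (fun k => h k y) K) in *. set (Ax := Csum (fun k => h k x) K) in *.
    replace (Gf y - Gf x)%C with ((Gf y - Ay) + ((Ay - Ax) + (Ax - Gf x)))%C by cring.
    eapply Rle_lt_trans; [apply Cmod_triangle|].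
    pose proof (Cmod_triangle (Ay - Ax) (Ax - Gf x)). rewrite (Cmod_minus_sym Ax (Gf x)) in *. lra.
  - intros x Hx. pose proof (HT x O Hx) as T. simpl in T.
    pose proof (Cmod_le_minus (Gf x) (h O x)). specialize (Hb x O Hx). lra.
Qed.

Definition fp_norm (a b : C) (rho : R) (h : R -> C) (nu : R) : Prop :=
  half_norm b rho h nu /\ half_norm a rho (fun t => h (1 - t)) nu.

Lemma fp_int_bound (a b : C) (rho : R) : fp_regular a -> fp_regular b -> 0 < rho <= 1 / 2 ->
  exists K, 0 < K /\ forall h nu, fp_norm a b rho h nu -> exists V, fp_int a b rho h V /\ Cmod V <= K * nu.
Proof.
  intros Ha Hb Hr. destruct (half_at_bound a b rho Ha Hr) as [K1 [HK1 H1]].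
  destruct (half_at_bound b a rho Hb Hr) as [K2 [HK2 H2]].
  exists (K1 + K2). split; [lra|]. intros h nu [N1 N2].
  destruct (H1 h nu N1) as [V1 [W1 B1]]. destruct (H2 _ nu N2) as [V2 [W2 B2]].
  exists (V1 + V2)%C. split; [now exists V1, V2|].
  eapply Rle_trans; [apply Cmod_triangle|]. lra.
Qed.

Lemma fp_int_Csum (a b : C) (rho : R) (h : nat -> R -> C) (V : nat -> C) (K : nat) :
  fp_regular a -> fp_regular b -> 0 < rho <= 1 / 2 -> (forall k, (k <= K)%nat -> fp_int a b rho (h k) (V k)) ->
  fp_int a b rho (fun t => Csum (fun k => h k t) K) (Csum V K).
Proof.
  intros Ha Hb Hr. induction K as [|K IH]; intros H; simpl; [apply (H O); lia|].
  apply (fp_int_ext _ _ _ (fun t => Csum (fun k => h k t) K + 1 * h (S K) t)%C); [exact Hr|intros; cring|].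
  replace (Cadd (Csum V K) (V (S K))) with (Csum V K + 1 * V (S K))%C by cring.
  apply fp_int_lin; try assumption; [apply IH; intros; apply H; lia|apply H; lia].
Qed.

Lemma fp_norm_tail (a b : C) (rho l : R) (h : nat -> R -> C) (nu : nat -> R) (Gf : R -> C) (K : nat) :
  0 < rho <= 1 / 2 -> (forall k, fp_norm a b rho (h k) (nu k)) -> is_lim_seq (sum_f_R0 nu) l ->
  (forall t, 0 <= t <= 1 -> Ccv_series (fun k => h k t) (Gf t)) ->
  fp_norm a b rho (fun t => Gf t - Csum (fun k => h k t) K)%C (l - sum_f_R0 nu K).
Proof.
  intros Hr Hh Hl HG.
  assert (L1 : is_lim_seq (sum_f_R0 (fun j => nu (S K + j)%nat)) (l - sum_f_R0 nu K)).
  { apply is_lim_seq_ext with (fun n => sum_f_R0 nu (n + S K) - sum_f_R0 nu K).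
    - intros n. rewrite (tech2 nu K (n + S K)) by lia. replace (n + S K - S K)%nat with n by lia. ring.
    - apply is_lim_seq_minus'; [|apply is_lim_seq_const].
      apply (is_lim_seq_incr_n (sum_f_R0 nu) (S K)). exact Hl. }
  assert (L2 : forall t, 0 <= t <= 1 ->
     Ccv_series (fun j => h (S K + j)%nat t) (Gf t - Csum (fun k => h k t) K)%C).
  { intros t Ht.
    apply Ccv_ext with (fun n => Csum (fun k => h k t) (n + S K) - Csum (fun k => h k t) K)%C.
    - intros n. induction n as [|n IH].
      + replace (0 + S K)%nat with (S K) by lia. cbn [Csum]. rewrite Nat.add_0_r. cring.
      + change (S n + S K)%nat with (S (n + S K)). cbn [Csum]. rewrite <- IH.
        replace (S K + S n)%nat with (S (n + S K)) by lia. cring.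
    - apply Ccv_minus; [|apply Ccv_const].
      apply (Ccv_subseq_shift (Csum (fun k => h k t))). now apply HG. }
  split.
  - apply (half_norm_series b rho _ (fun j => h (S K + j)%nat) (fun j => nu (S K + j)%nat)); try assumption.
    intros k. apply Hh.
  - apply (half_norm_series a rho _ (fun j t => h (S K + j)%nat (1 - t)) (fun j => nu (S K + j)%nat)); try assumption.
    + intros k. apply Hh.
    + intros t Ht. apply (L2 (1 - t)). lra.
Qed.

(** By linearity the finite part of [Gf] is, for each K, a partial sum of [V] plus the value on a
    remainder whose norm is a tail of [nu]; by uniqueness all these expressions are the same
    number. *)
Lemma fp_int_series (a b : C) (rho l : R) (h : nat -> R -> C) (nu : nat -> R) (V : nat -> C) (Gf : R -> C) :
  fp_regular a -> fp_regular b -> 0 < rho <= 1 / 2 -> (forall k, fp_norm a b rho (h k) (nu k)) ->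
  (forall k, fp_int a b rho (h k) (V k)) -> is_lim_seq (sum_f_R0 nu) l ->
  (forall t, 0 <= t <= 1 -> Ccv_series (fun k => h k t) (Gf t)) ->
  exists W, fp_int a b rho Gf W /\ Ccv_series V W.
Proof.
  intros Ha Hb Hr Hh HV Hl HG. destruct (fp_int_bound a b rho Ha Hb Hr) as [K0 [HK0 HB]].
  assert (Hrest : forall K, exists V', fp_int a b rho Gf (Csum V K + 1 * V')%C /\
    Cmod V' <= K0 * (l - sum_f_R0 nu K)).
  { intros K. destruct (HB _ _ (fp_norm_tail a b rho l h nu Gf K Hr Hh Hl HG)) as [V' [H1 H2]].
    exists V'. split; [|exact H2].
    apply (fp_int_ext _ _ _ (fun t => Csum (fun k => h k t) K + 1 * (Gf t - Csum (fun k => h k t) K))%C);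
      [exact Hr|intros; cring|].
    apply fp_int_lin; try assumption. apply fp_int_Csum; auto. }
  destruct (Hrest O) as [V0 [H0 _]].
  exists (Csum V 0 + 1 * V0)%C. split; [exact H0|].
  intros eps He. destruct (small_tail nu l (eps / K0) Hl) as [N HN']; [now apply Rdiv_lt_0_compat|].
  exists N. intros n Hn. specialize (HN' n Hn). destruct (Hrest n) as [V' [H1 H2]].
  rewrite (fp_int_unique _ _ _ _ _ _ Ha Hb Hr H0 H1). toC.
  replace (Csum V n - (Csum V n + 1 * V'))%C with (- V')%C by cring. rewrite Cmod_opp.
  eapply Rle_lt_trans; [exact H2|].
  apply Rmult_lt_reg_r with (/ K0); [now apply Rinv_0_lt_compat|].
  rewrite Rmult_comm, <- Rmult_assoc, Rinv_l, Rmult_1_l by lra. exact HN'.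
Qed.

(** * Norms of products of polynomials with a binomial factor *)

Lemma taylor_norm_ext (rho : R) (F Gf : R -> C) (nu : R) :
  (forall t, 0 <= t < rho -> F t = Gf t) -> taylor_norm rho F nu -> taylor_norm rho Gf nu.
Proof.
  intros H [c [H1 H2]]. exists c. split; [|exact H2]. intros t Ht. rewrite <- H by exact Ht. now apply H1.
Qed.

Lemma taylor_norm_weaken (rho : R) (F : R -> C) (nu nu' : R) : nu <= nu' -> taylor_norm rho F nu -> taylor_norm rho F nu'.
Proof. intros H [c [H1 H2]]. exists c. split; [exact H1|]. intros M. specialize (H2 M). lra. Qed.

Lemma taylor_norm_plus (rho : R) (F Gf : R -> C) (nu mu : R) : 0 < rho ->
  taylor_norm rho F nu -> taylor_norm rho Gf mu -> taylor_norm rho (fun t => F t + Gf t)%C (nu + mu).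
Proof.
  intros Hr [c [H1 H2]] [d [H3 H4]]. exists (fun m => c m + d m)%C. split.
  - intros t Ht. pose proof (Ccv_series_plus _ _ _ _ (H1 t Ht) (H3 t Ht)) as L.
    eapply Ccv_series_ext; [|exact L]. intros k. cbv beta. cring.
  - intros M. apply Rle_trans with (sum_f_R0 (fun m => Cmod (c m) * rho ^ m + Cmod (d m) * rho ^ m) M).
    + apply sum_Rle. intros m _. rewrite <- Rmult_plus_distr_r.
      apply Rmult_le_compat_r; [apply pow_le; lra|apply Cmod_triangle].
    + rewrite sum_plus. specialize (H2 M). specialize (H4 M). lra.
Qed.

Lemma taylor_norm_scal (rho : R) (k : C) (F : R -> C) (nu : R) :
  taylor_norm rho F nu -> taylor_norm rho (fun t => k * F t)%C (Cmod k * nu).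
Proof.
  intros [c [H1 H2]]. exists (fun m => k * c m)%C. split.
  - intros t Ht. eapply Ccv_series_ext; [|apply (Ccv_series_scal k), (H1 t Ht)]. intros m. cring.
  - intros M. rewrite (sum_eq _ (fun m => (Cmod (c m) * rho ^ m) * Cmod k)).
    + rewrite <- scal_sum. apply Rmult_le_compat_l; [apply Cmod_ge_0|apply H2].
    + intros m _. rewrite Cmod_mult. ring.
Qed.

Lemma taylor_norm_mult_t (rho : R) (F : R -> C) (nu : R) : 0 < rho ->
  taylor_norm rho F nu -> taylor_norm rho (fun t => RtoC t * F t)%C (rho * nu).
Proof.
  intros Hr [c [H1 H2]].
  exists (fun m => match m with O => RtoC 0 | S j => c j end). split.
  - intros t Ht.
    replace (RtoC t * F t)%C with (0 * RtoC t ^ 0 + RtoC t * F t)%C by (simpl; ring).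
    apply (Ccv_series_shift (fun m => match m with O => RtoC 0 | S j => c j end * RtoC t ^ m)%C).
    eapply Ccv_series_ext; [|apply (Ccv_series_scal (RtoC t)), (H1 t Ht)].
    intros m. change ((RtoC t * (c m * RtoC t ^ m))%C = (c m * (RtoC t * RtoC t ^ m))%C). cring.
  - intros [|M].
    + simpl. rewrite Cmod_0. specialize (H2 O). simpl in H2. pose proof (Cmod_ge_0 (c O)). nra.
    + rewrite decomp_sum by lia. simpl pred. rewrite Cmod_0, Rmult_0_l, Rplus_0_l.
      rewrite (sum_eq _ (fun m => (Cmod (c m) * rho ^ m) * rho)).
      * rewrite <- scal_sum. apply Rmult_le_compat_l; [lra|apply H2].
      * intros m _. simpl. ring.
Qed.

Lemma taylor_norm_mult_pow (rho : R) (F : R -> C) (nu : R) (j : nat) : 0 < rho ->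
  taylor_norm rho F nu -> taylor_norm rho (fun t => RtoC t ^ j * F t)%C (rho ^ j * nu).
Proof.
  intros Hr HF. induction j as [|j IH].
  - apply taylor_norm_ext with F; [intros; simpl; cring|]. simpl. now rewrite Rmult_1_l.
  - apply taylor_norm_ext with (fun t => RtoC t * (RtoC t ^ j * F t))%C; [intros; rewrite Cpow_S; cring|].
    simpl. rewrite Rmult_assoc. now apply taylor_norm_mult_t.
Qed.

(** Submultiplicativity for polynomial factors only, by repeated multiplication by t; Cauchy
    products of infinite series are avoided. *)
Lemma taylor_norm_poly (rho : R) (F : R -> C) (nu : R) (e : nat -> C) (n : nat) : 0 < rho ->
  taylor_norm rho F nu ->
  taylor_norm rho (fun t => Csum (fun j => e j * RtoC t ^ j)%C n * F t)%C
    (sum_f_R0 (fun j => Cmod (e j) * rho ^ j) n * nu).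
Proof.
  intros Hr HF.
  assert (Hj : forall j, taylor_norm rho (fun t => e j * RtoC t ^ j * F t)%C (Cmod (e j) * rho ^ j * nu)).
  { intros j. apply taylor_norm_ext with (fun t => e j * (RtoC t ^ j * F t))%C; [intros; cring|].
    rewrite Rmult_assoc. now apply taylor_norm_scal, taylor_norm_mult_pow. }
  induction n as [|n IH]; simpl.
  - exact (Hj O).
  - rewrite Rmult_plus_distr_r.
    apply taylor_norm_ext with (fun t => Csum (fun j => e j * RtoC t ^ j)%C n * F t + e (S n) * RtoC t ^ (S n) * F t)%C.
    { intros; simpl; cring. }
    apply taylor_norm_plus; [exact Hr|exact IH|]. apply (Hj (S n)).
Qed.

(** The Taylor coefficients of (1-t)^b at 0. *)
Definition binc (b : C) (m : nat) : C := (poch (- b) m / INR (fact m))%C.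

(** Any base strictly between 1 and 2 serves: it leaves a radius, here 2/3, above the largest [rho],
    which is 1/2. *)
Lemma binc_bound (b : C) : exists K, 0 < K /\ forall m, Cmod (binc b m) <= K * (3 / 2) ^ m.
Proof.
  destruct (poch_le_fact (- b) (3 / 2) ltac:(lra)) as [K [HK H]]. exists K. split; [exact HK|].
  intros m. unfold binc. rewrite Cmod_div by apply RtoC_fact_neq_0.
  rewrite Cmod_R, Rabs_pos_eq by apply pos_INR. pose proof (INR_fact_lt_0 m).
  apply Rmult_le_reg_r with (INR (fact m)); [lra|]. unfold Rdiv at 1. rewrite Rmult_assoc, Rinv_l by lra.
  specialize (H m). lra.
Qed.

Lemma binc_psr (b : C) : psr (binc b) (2 / 3).
Proof.
  destruct (binc_bound b) as [K [HK H]]. intros t Ht. exists K. intros m.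
  specialize (H m). pose proof (Cmod_ge_0 (binc b m)).
  assert (0 <= t ^ m) by (apply pow_le; lra).
  assert ((3 / 2) ^ m * t ^ m <= 1).
  { rewrite <- Rpow_mult_distr. rewrite <- (pow1 m). apply pow_incr. lra. }
  apply Rle_trans with (K * (3 / 2) ^ m * t ^ m); [now apply Rmult_le_compat_r|]. nra.
Qed.

(** The series S satisfies (1-x) S' + b S = 0, hence S (1-x)^(-b) is constant, with value 1 at 0. *)
Lemma binomial_series (b : C) (t : R) : 0 <= t < 2 / 3 -> PS (binc b) t = Cpow_pos (1 - t) b.
Proof.
  intros Ht.
  assert (E : forall x, 0 <= x <= t ->
    derC (fun x => PS (binc b) x * Cpow_pos (1 - x) (- b))%C x 0).
  { intros x Hx. assert (Hx' : Rabs x < 2 / 3) by (rewrite Rabs_pos_eq; lra).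
    assert (O : ((1 - x) * PS (fun m => INR (S m) * binc b (S m)) x + b * PS (binc b) x)%C = 0).
    (* The coefficient identity (m+1) e_(m+1) = (m-b) e_m, read as an instance of
       [Euler_operator_series] with a = -b - 1. *)
    { assert (U : PS (fun m => INR (S m) * binc b (S m))%C x =
        (- b * PS (binc b) x + x * PS (fun m => INR (S m) * binc b (S m)) x)%C).
      { apply (PS_unique _ (2 / 3)); [apply psr_derive, binc_psr|exact Hx'|].
        replace (- b)%C with (- b - 1 + 1)%C by ring.
        eapply Ccv_series_ext; [|exact (Euler_operator_series (binc b) (- b - 1) (2 / 3) x (binc_psr b) Hx')].
        intros m. unfold binc. rewrite RtoC_fact_S, RtoC_INR_S, poch_S. cfield.
        split; [apply RtoC_fact_neq_0|apply RtoC_INR_S_neq_0]. }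
      transitivity (PS (fun m => INR (S m) * binc b (S m))%C x -
        x * PS (fun m => INR (S m) * binc b (S m))%C x + b * PS (binc b) x)%C; [ring|].
      rewrite U at 1. ring. }
    eapply derC_eq.
    - apply derC_mult; [exact (derC_PS _ _ _ (binc_psr b) Hx')|].
      apply (derC_comp (fun t => Cpow_pos t (- b)%C) (fun t => 1 - t) x (-1)).
      + auto_derive; [exact I|ring].
      + apply derC_Cpow_pos. lra.
    - cbv beta. assert (Ep : Cpow_pos (1 - x) (- b)%C = (Cpow_pos (1 - x) (- b - 1)%C * (1 - x))%C).
      { replace (- b)%C with (- b - 1 + 1)%C at 1 by ring.
        rewrite Cpow_pos_plus, Cpow_pos_1_r by lra. now rewrite RtoC_minus. }
      rewrite Ep.
      transitivity (Cpow_pos (1 - x) (- b - 1)%C *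
        ((1 - x) * PS (fun m => INR (S m) * binc b (S m)) x + b * PS (binc b) x))%C; [cring|].
      rewrite O. cring. }
  pose proof (derC_zero_const _ 0 t (proj1 Ht) E) as Z. cbv beta in Z.
  rewrite (PS_0 (binc b) (2 / 3)), Rminus_0_r, Cpow_pos_1 in Z by (try lra; apply binc_psr).
  assert (E1 : (Cpow_pos (1 - t) b * Cpow_pos (1 - t) (- b)%C)%C = 1).
  { rewrite <- Cpow_pos_plus. unfold Cpow_pos. toC.
    replace ((b + - b) * ln (1 - t))%C with (RtoC 0) by ring. apply Cexp_0. }
  transitivity (PS (binc b) t * (Cpow_pos (1 - t) b * Cpow_pos (1 - t) (- b)%C))%C; [rewrite E1; ring|].
  transitivity ((PS (binc b) t * Cpow_pos (1 - t) (- b)%C) * Cpow_pos (1 - t) b)%C; [cring|].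
  rewrite <- Z. unfold binc; simpl. cfield.
Qed.

Lemma binomial_rep (b : C) (rho : R) : rho <= 1 / 2 ->
  series_rep (binc b) (fun t => Cpow_pos (1 - t) b) rho.
Proof.
  intros Hr t Ht. rewrite <- binomial_series by lra.
  apply (PS_correct _ (2 / 3)); [apply binc_psr|rewrite Rabs_pos_eq; lra].
Qed.

Lemma taylor_norm_binomial (b : C) : exists K, 0 < K /\ forall rho, 0 < rho <= 1 / 2 ->
  taylor_norm rho (fun t => Cpow_pos (1 - t) b) K.
Proof.
  destruct (binc_bound b) as [K [HK H]]. exists (K * 4). split; [lra|]. intros rho Hr.
  exists (binc b). split; [apply binomial_rep; lra|]. intros M.
  apply Rle_trans with (sum_f_R0 (fun m => (3 / 4) ^ m * K) M).
  - apply sum_Rle. intros m _. specialize (H m). pose proof (Cmod_ge_0 (binc b m)).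
    assert (0 <= rho ^ m) by (apply pow_le; lra).
    assert ((3 / 2) ^ m * rho ^ m <= (3 / 4) ^ m).
    { rewrite <- Rpow_mult_distr. apply pow_incr. lra. }
    apply Rle_trans with (K * (3 / 2) ^ m * rho ^ m); [now apply Rmult_le_compat_r|]. nra.
  - rewrite <- scal_sum. apply Rmult_le_compat_l; [lra|].
    eapply Rle_trans; [apply sum_geom_le; lra|]. lra.
Qed.

Lemma contC_poly (c : nat -> C) (n : nat) (x : R) : contC (fun t => Csum (fun j => c j * RtoC t ^ j)%C n) x.
Proof.
  apply contC_Csum. intros k _. apply contC_mult; [apply contC_const|]. apply contC_pow.
  apply (contC_RtoC (fun t => t)). apply continuous_id.
Qed.

(** [mp] and [mq] each bound two quantities, the weighted coefficient sum and the sup norm on [0,1].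
    The constant absorbs the norm of (1-t)^b, and the 1 added to it serves the sup norm. *)
Lemma half_norm_poly2 (b : C) : exists K, 0 < K /\ forall rho, 0 < rho <= 1 / 2 ->
  forall (n m : nat) (p q : nat -> C) (P Q : R -> C) (mp mq : R),
  (forall t, P t = Csum (fun j => p j * RtoC t ^ j)%C n) ->
  (forall t, Q t = Csum (fun j => q j * RtoC t ^ j)%C m) ->
  sum_f_R0 (fun j => Cmod (p j) * rho ^ j) n <= mp ->
  sum_f_R0 (fun j => Cmod (q j) * rho ^ j) m <= mq ->
  (forall x, 0 <= x <= 1 -> Cmod (P x) <= mp) ->
  (forall x, 0 <= x <= 1 -> Cmod (Q x) <= mq) ->
  half_norm b rho (fun t => P t * Q t)%C (K * (mp * mq)).
Proof.
  destruct (taylor_norm_binomial b) as [K [HK H]]. exists (K + 1). split; [lra|].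
  intros rho Hr n m p q P Q mp mq HP HQ Np Nq Sp Sq.
  assert (Hmp : 0 <= mp) by (pose proof (Sp 0 ltac:(lra)); pose proof (Cmod_ge_0 (P 0)); lra).
  assert (Hmq : 0 <= mq) by (pose proof (Sq 0 ltac:(lra)); pose proof (Cmod_ge_0 (Q 0)); lra).
  assert (Hpow : forall j, 0 <= rho ^ j) by (intros; apply pow_le; lra).
  split; [|split].
  - pose proof (taylor_norm_poly rho _ _ p n (proj1 Hr) (taylor_norm_poly rho _ _ q m (proj1 Hr) (H rho Hr))) as L.
    apply (taylor_norm_ext rho) with (Gf := fun t => Cmul (Cpow_pos (1 - t) b) (P t * Q t)%C) in L.
    + eapply taylor_norm_weaken; [|exact L].
      assert (0 <= sum_f_R0 (fun j => Cmod (q j) * rho ^ j) m)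
        by (apply cond_pos_sum; intros; apply Rmult_le_pos; [apply Cmod_ge_0|apply Hpow]).
      assert (0 <= sum_f_R0 (fun j => Cmod (p j) * rho ^ j) n)
        by (apply cond_pos_sum; intros; apply Rmult_le_pos; [apply Cmod_ge_0|apply Hpow]).
      apply Rle_trans with (mp * (mq * K)); [apply Rmult_le_compat; nra|].
      assert (0 <= mp * mq) by nra. nra.
    + intros t Ht. rewrite HP, HQ. cring.
  - intros x Hx. apply contC_mult.
    + apply contC_ext with (2 := contC_poly p n x). intros; now rewrite HP.
    + apply contC_ext with (2 := contC_poly q m x). intros; now rewrite HQ.
  - intros x Hx. rewrite Cmod_mult. apply Rle_trans with (mp * mq).
    + apply Rmult_le_compat; try apply Cmod_ge_0; [now apply Sp|now apply Sq].
    + assert (0 <= mp * mq) by nra. nra.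
Qed.

(** * The finite part of the weight and its moments *)

Lemma fp_norm_const (a b : C) (rho : R) : 0 < rho <= 1 / 2 -> exists nu, fp_norm a b rho (fun _ => RtoC 1) nu.
Proof.
  intros Hr.
  assert (K : forall c, exists nu, 0 < nu /\ half_norm c rho (fun _ => RtoC 1) nu).
  { intros c. destruct (taylor_norm_binomial c) as [K [HK H]]. exists (K + 1). split; [lra|].
    split; [|split].
    - apply taylor_norm_ext with (fun t => Cpow_pos (1 - t) c); [intros; cring|].
      apply taylor_norm_weaken with K; [lra|now apply H].
    - intros; apply contC_const.
    - intros. rewrite Cmod_1. lra. }
  assert (W : forall c nu nu', nu <= nu' -> half_norm c rho (fun _ => RtoC 1) nu -> half_norm c rho (fun _ => RtoC 1) nu').
  { intros c nu nu' Hle [H1 [H2 H3]]. split; [eapply taylor_norm_weaken; eassumption|]. split; [exact H2|].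
    intros x Hx. specialize (H3 x Hx). lra. }
  destruct (K a) as [na [Ha1 Ha2]]. destruct (K b) as [nb [Hb1 Hb2]].
  exists (na + nb). split; [apply (W b nb); [lra|exact Hb2]|apply (W a na); [lra|exact Ha2]].
Qed.

(* The finite part of [x^a (1-x)^b], i.e. the Beta function at [(a+1, b+1)]. *)
Definition hbeta (a b : C) (rho : R) : C := epsilon (inhabits (RtoC 0)) (fp_int a b rho (fun _ => RtoC 1)).

Lemma hbeta_spec (a b : C) (rho : R) : fp_regular a -> fp_regular b -> 0 < rho <= 1 / 2 ->
  fp_int a b rho (fun _ => RtoC 1) (hbeta a b rho).
Proof.
  intros Ha Hb Hr. unfold hbeta. apply epsilon_spec.
  destruct (fp_int_bound a b rho Ha Hb Hr) as [K [_ H]]. destruct (fp_norm_const a b rho Hr) as [nu Hn].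
  destruct (H _ _ Hn) as [V [HV _]]. now exists V.
Qed.

Lemma fp_regular_S (a : C) : fp_regular a -> fp_regular (a + 1).
Proof. intros H n E. apply (H (S n)). rewrite <- E, RtoC_INR_S. ring. Qed.

Lemma fp_regular_0 (a : C) : fp_regular a -> (a + 1)%C <> 0.
Proof. intros H E. apply (H O). simpl. rewrite E. ring. Qed.

Lemma fp_int_sym (a b : C) (rho : R) (h : R -> C) (V : C) : 0 < rho <= 1 / 2 ->
  fp_int a b rho h V -> fp_int b a rho (fun t => h (1 - t)) V.
Proof.
  intros Hr [V1 [V2 [H1 [H2 ->]]]]. exists V2, V1. split; [exact H2|]. split; [|ring].
  apply half_at_ext with h; [exact Hr| |exact H1]. intros t _. f_equal. ring.
Qed.

(** The factor t shifts the Taylor coefficients by one, and the denominators (m+1) + a + 1 are those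
    of the exponent a + 1, so Hadamard's sum is unchanged. *)
Lemma half_at_shift_l (a b : C) (rho : R) (h : R -> C) (V : C) : fp_regular a -> 0 < rho <= 1 / 2 ->
  half_at (a + 1) b rho h V -> half_at a b rho (fun t => RtoC t * h t)%C V.
Proof.
  intros Ha Hr [c [I [H1 [H2 ->]]]].
  assert (Hrep : series_rep (fun m => match m with O => RtoC 0 | S j => c j end)
     (fun t => Cmul (Cpow_pos (1 - t) b) (RtoC t * h t)%C) rho).
  { intros t Ht. cbv beta.
    replace (Cmul (Cpow_pos (1 - t) b) (RtoC t * h t)%C) with
      (0 * RtoC t ^ 0 + RtoC t * (Cpow_pos (1 - t) b * h t))%C by (simpl; cring).
    apply (Ccv_series_shift (fun m => match m with O => RtoC 0 | S j => c j end * RtoC t ^ m)%C).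
    eapply Ccv_series_ext; [|apply (Ccv_series_scal (RtoC t)), (H1 t Ht)].
    intros m. change ((RtoC t * (c m * RtoC t ^ m))%C = (c m * (RtoC t * RtoC t ^ m))%C). cring. }
  exists (fun m => match m with O => RtoC 0 | S j => c j end), I.
  split; [exact Hrep|split].
  - apply is_RIC_ext with (2 := H2). intros x Hx. rewrite Rmin_left in Hx by lra.
    unfold wt. rewrite Cpow_pos_plus, Cpow_pos_1_r by lra. cring.
  - f_equal.
    assert (Hrr : Rabs (rho / 2) < rho) by (rewrite Rabs_pos_eq; lra).
    assert (Hp : psr c rho) by (eapply psr_rep; exact H1).
    set (x0 := rho / 2) in *.
    rewrite (PS_unique (fun m => match m with O => RtoC 0 | S j => c j end / (INR m + (a + 1)))%C rho x0
      (0 + RtoC x0 * PS (fun m => c m / (INR m + (a + 1 + 1)))%C x0)%C).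
    + rewrite (Cpow_pos_plus x0 (a + 1)%C (RtoC 1)), Cpow_pos_1_r by (unfold x0; lra). cring.
    + apply (psr_quotient a (fun m => match m with O => RtoC 0 | S j => c j end)); [exact Ha|].
      eapply psr_rep; exact Hrep.
    + exact Hrr.
    + set (W := (RtoC x0 * PS (fun m => c m / (INR m + (a + 1 + 1))) x0)%C).
      replace (0 + W)%C with (0 / (INR 0 + (a + 1)) * RtoC x0 ^ 0 + W)%C
        by (f_equal; simpl; cfield; exact (fp_regular_0 a Ha)).
      apply (Ccv_series_shift (fun m => match m with O => RtoC 0 | S j => c j end / (INR m + (a + 1)) * RtoC x0 ^ m)%C).
      apply Ccv_series_ext with (fun m => RtoC x0 * (c m / (INR m + (a + 1 + 1)) * RtoC x0 ^ m))%C.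
      * intros m. rewrite Cpow_S, RtoC_INR_S.
        replace (INR m + 1 + (a + 1))%C with (INR m + (a + 1 + 1))%C by ring. cring.
      * apply Ccv_series_scal. apply (PS_correct _ rho); [|exact Hrr].
        apply (psr_quotient (a + 1)); [now apply fp_regular_S|exact Hp].
Qed.

Lemma half_at_shift_r (a b : C) (rho : R) (h : R -> C) (V : C) : 0 < rho <= 1 / 2 ->
  half_at a (b + 1) rho h V -> half_at a b rho (fun t => (1 - t) * h t)%C V.
Proof.
  intros Hr [c [I [H1 [H2 ->]]]]. exists c, I. split; [|split; [|reflexivity]].
  - intros t Ht. specialize (H1 t Ht). cbv beta in *.
    replace (Cmul (Cpow_pos (1 - t) b) ((1 - t) * h t)%C) with (Cmul (Cpow_pos (1 - t) (b + 1)%C) (h t)).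
    + exact H1.
    + rewrite Cpow_pos_plus, Cpow_pos_1_r, RtoC_minus by lra. cring.
  - apply is_RIC_ext with (2 := H2). intros x Hx. rewrite Rmax_right in Hx by lra.
    unfold wt. rewrite Cpow_pos_plus, Cpow_pos_1_r, RtoC_minus by lra. cring.
Qed.

Lemma fp_int_shift_l (a b : C) (rho : R) (h : R -> C) (V : C) : fp_regular a -> 0 < rho <= 1 / 2 ->
  fp_int (a + 1) b rho h V -> fp_int a b rho (fun t => RtoC t * h t)%C V.
Proof.
  intros Ha Hr [V1 [V2 [H1 [H2 ->]]]]. exists V1, V2.
  split; [now apply half_at_shift_l|]. split; [|reflexivity].
  apply half_at_ext with (fun t : R => (1 - t) * h (1 - t)%R)%C; [exact Hr| |now apply half_at_shift_r].
  intros t _. now rewrite RtoC_minus.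
Qed.

Lemma fp_int_shift_r (a b : C) (rho : R) (h : R -> C) (V : C) : fp_regular b -> 0 < rho <= 1 / 2 ->
  fp_int a (b + 1) rho h V -> fp_int a b rho (fun t => (1 - t) * h t)%C V.
Proof.
  intros Hb Hr H. apply fp_int_sym in H; [|exact Hr]. apply fp_int_shift_l in H; [|exact Hb|exact Hr].
  apply fp_int_sym in H; [|exact Hr]. apply fp_int_ext with (3 := H); [exact Hr|].
  intros t _. cbv beta. replace (1 - (1 - t)) with t by ring. now rewrite RtoC_minus.
Qed.

(* Times the weight, the integrand is the derivative of [x^(a+1) (1-x)^(b+1)]. *)
Lemma half_at_exact (a b : C) (rho : R) : fp_regular a -> 0 < rho <= 1 / 2 ->
  half_at a b rho (fun t => (a + 1) - (a + b + 2) * RtoC t)%C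
    (Cpow_pos (1 / 2) (a + 1)%C * Cpow_pos (1 / 2) (b + 1)%C)%C.
Proof.
  intros Ha Hr. set (e := binc (b + 1)%C).
  assert (He : psr e (2 / 3)) by apply binc_psr.
  assert (HD : forall t, 0 < t < 2 / 3 -> PS (fun m => INR (S m) * e (S m))%C t = (- (b + 1) * Cpow_pos (1 - t) b)%C).
  { intros t Ht. apply (derC_unique (PS e) t).
    - apply (derC_PS e (2 / 3)); [exact He|rewrite Rabs_pos_eq; lra].
    - apply (derC_ext_loc (fun t => Cpow_pos (1 - t) (b + 1)%C) _ _ (Rmin t (2 / 3 - t))).
      + apply Rmin_pos; lra.
      + intros y Hy. pose proof (Rmin_l t (2 / 3 - t)). pose proof (Rmin_r t (2 / 3 - t)).
        apply Rabs_def2 in Hy. symmetry. apply binomial_series. lra.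
      + eapply derC_eq.
        * apply (derC_comp (fun t => Cpow_pos t (b + 1)%C) (fun t => 1 - t) t (-1)).
          -- auto_derive; [exact Logic.I|ring].
          -- apply derC_Cpow_pos. lra.
        * cbv beta. replace (b + 1 - 1)%C with b by cring. cring. }
  exists (fun m => (INR m + (a + 1)) * e m)%C,
    (Cpow_pos (1 / 2) (a + 1)%C * Cpow_pos (1 / 2) (b + 1)%C -
     Cpow_pos (rho / 2) (a + 1)%C * Cpow_pos (1 - rho / 2) (b + 1)%C)%C.
  split; [|split].
  - intros t Ht. cbv beta.
    replace (Cmul (Cpow_pos (1 - t) b) ((a + 1) - (a + b + 2) * RtoC t)%C) with
      ((a + 1) * PS e t + t * PS (fun m => INR (S m) * e (S m)) t)%C.
    + apply (Euler_operator_series e a (2 / 3)); [exact He|rewrite Rabs_pos_eq; lra].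
    + unfold e at 1. rewrite binomial_series by lra.
      rewrite Cpow_pos_plus, Cpow_pos_1_r, RtoC_minus by lra.
      (* [HD] is known for t > 0 only, because it compares derivatives on a two-sided neighbourhood;
         at 0 the factor t removes the derivative. *)
      destruct (Req_dec t 0) as [->|Ht0].
      * cring.
      * rewrite HD by lra. cring.
  - replace (1 / 2) with (1 - 1 / 2) at 3 by field.
    apply (is_RIC_ext (fun x => ((a + 1) * (1 - x)%R - (b + 1) * x) * wt a b x)%C).
    { intros x _. rewrite RtoC_minus. unfold wt. cring. }
    apply (is_RIC_derive (wt (a + 1)%C (b + 1)%C)).
    + intros x Hx. rewrite Rmin_left, Rmax_right in Hx by lra. apply derC_wt. lra.
    + intros x Hx. rewrite Rmin_left, Rmax_right in Hx by lra.
      apply contC_mult; [|apply contC_wt; lra].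
      apply contC_minus; (apply contC_mult; [apply contC_const|apply contC_RtoC]).
      * apply (ex_derive_continuous (V := R_NormedModule)). auto_derive. exact Logic.I.
      * apply continuous_id.
  - rewrite (PS_unique _ rho (rho / 2) (Cpow_pos (1 - rho / 2) (b + 1)%C)).
    + cring.
    + apply (psr_quotient a (fun m => (INR m + (a + 1)) * e m)%C); [exact Ha|].
      apply (psr_rep _ (fun t => (a + 1) * PS e t + t * PS (fun m => INR (S m) * e (S m)) t)%C).
      intros t Ht. apply (Euler_operator_series e a (2 / 3)); [exact He|rewrite Rabs_pos_eq; lra].
    + rewrite Rabs_pos_eq; lra.
    + rewrite <- binomial_series by lra.
      apply Ccv_series_ext with (fun m => e m * RtoC (rho / 2) ^ m)%C.
      * intros m. cfield. apply Ha.
      * apply (PS_correct e (2 / 3)); [exact He|rewrite Rabs_pos_eq; lra].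
Qed.

Lemma fp_int_exact (a b : C) (rho : R) : fp_regular a -> fp_regular b -> 0 < rho <= 1 / 2 ->
  fp_int a b rho (fun t => (a + 1) - (a + b + 2) * RtoC t)%C 0.
Proof.
  intros Ha Hb Hr. pose proof (half_at_exact a b rho Ha Hr) as L. pose proof (half_at_exact b a rho Hb Hr) as R.
  eexists _, _. split; [exact L|]. split.
  (* The reflected integrand is minus the exact one for exchanged parameters, so the two halves
     cancel at 1/2; -h is written as h + (-2) h to fit [half_at_lin]. *)
  - pose proof (half_at_lin b a rho _ _ (-2) _ _ Hb Hr R R) as R2.
    apply half_at_ext with (3 := R2); [exact Hr|]. intros t _. cbv beta. rewrite RtoC_minus. ring.
  - cring.
Qed.

(** Integration by parts without boundary terms: the finite part of the derivative of x^(a+1)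
    (1-x)^(b+1) is 0. *)
Lemma hbeta_rec_l (a b : C) (rho : R) : fp_regular a -> fp_regular b -> 0 < rho <= 1 / 2 ->
  ((a + 1) * hbeta a b rho = (a + b + 2) * hbeta (a + 1) b rho)%C.
Proof.
  intros Ha Hb Hr.
  pose proof (hbeta_spec a b rho Ha Hb Hr) as H0.
  pose proof (fp_int_shift_l a b rho _ _ Ha Hr (hbeta_spec (a + 1)%C b rho (fp_regular_S _ Ha) Hb Hr)) as H1.
  assert (H5 : fp_int a b rho (fun t => (a + 1) - (a + b + 2) * RtoC t +
      (- (a + 1)) * RtoC 1 + (a + b + 2) * (RtoC t * 1))%C
      (0 + (- (a + 1)) * hbeta a b rho + (a + b + 2) * hbeta (a + 1) b rho)%C).
  { apply fp_int_lin; try assumption. apply fp_int_lin; try assumption. now apply fp_int_exact. }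
  (* The zero function, represented as 1 + (-1) 1, has finite part 0. *)
  assert (H6 : fp_int a b rho (fun t => RtoC 1 + (-(1)) * RtoC 1)%C (hbeta a b rho + (-(1)) * hbeta a b rho)%C).
  { now apply fp_int_lin. }
  apply fp_int_ext with (h2 := fun t => ((a + 1) - (a + b + 2) * RtoC t +
      (- (a + 1)) * RtoC 1 + (a + b + 2) * (RtoC t * 1))%C) in H6; [|exact Hr|intros; ring].
  pose proof (fp_int_unique _ _ _ _ _ _ Ha Hb Hr H5 H6) as E.
  transitivity ((a + 1) * hbeta a b rho + (0 + - (a + 1) * hbeta a b rho + (a + b + 2) * hbeta (a + 1) b rho))%C;
    [rewrite E|]; ring.
Qed.

(** From 1 = t + (1-t) and the recurrence in the other parameter. *)
Lemma hbeta_rec_r (a b : C) (rho : R) : fp_regular a -> fp_regular b -> 0 < rho <= 1 / 2 ->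
  ((b + 1) * hbeta a b rho = (a + b + 2) * hbeta a (b + 1) rho)%C.
Proof.
  intros Ha Hb Hr.
  pose proof (hbeta_spec a b rho Ha Hb Hr) as H0.
  pose proof (fp_int_shift_l a b rho _ _ Ha Hr (hbeta_spec (a + 1)%C b rho (fp_regular_S _ Ha) Hb Hr)) as H1.
  pose proof (fp_int_shift_r a b rho _ _ Hb Hr (hbeta_spec a (b + 1)%C rho Ha (fp_regular_S _ Hb) Hr)) as H2.
  pose proof (fp_int_lin a b rho _ _ 1 _ _ Ha Hb Hr H1 H2) as H3.
  apply fp_int_ext with (h2 := fun _ => RtoC 1) in H3; [|exact Hr|intros; ring].
  pose proof (fp_int_unique _ _ _ _ _ _ Ha Hb Hr H0 H3) as E.
  pose proof (hbeta_rec_l a b rho Ha Hb Hr) as L.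
  transitivity ((a + b + 2) * hbeta a b rho - (a + 1) * hbeta a b rho)%C; [ring|]. rewrite L.
  rewrite E. ring.
Qed.

Lemma fp_regular_plus_nat (a : C) (j : nat) : fp_regular a -> fp_regular (a + INR j).
Proof. intros H n E. apply (H (n + j)%nat). rewrite <- E, RtoC_INR_plus. ring. Qed.

Lemma fp_int_pow (b : C) (rho : R) (j : nat) : forall a : C, fp_regular a -> fp_regular b -> 0 < rho <= 1 / 2 ->
  fp_int a b rho (fun t => RtoC t ^ j)%C (hbeta (a + INR j) b rho).
Proof.
  induction j as [|j IH]; intros a Ha Hb Hr.
  - simpl. replace (a + 0)%C with a by ring. now apply hbeta_spec.
  - replace (a + INR (S j))%C with (a + 1 + INR j)%C by (rewrite RtoC_INR_S; ring).
    apply (fp_int_shift_l a b rho (fun t => RtoC t ^ j)%C); [exact Ha|exact Hr|].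
    apply IH; [now apply fp_regular_S|exact Hb|exact Hr].
Qed.

Lemma hbeta_moment_rec (a b : C) (rho : R) : fp_regular a -> fp_regular b -> 0 < rho <= 1 / 2 ->
  moment_rec a b (fun j => hbeta (a + INR j) b rho).
Proof.
  intros Ha Hb Hr j. rewrite RtoC_INR_S.
  pose proof (hbeta_rec_l (a + INR j) b rho (fp_regular_plus_nat a j Ha) Hb Hr) as E.
  replace (a + (INR j + 1))%C with (a + INR j + 1)%C by ring.
  replace (INR j + a + b + 2)%C with (a + INR j + b + 2)%C by ring. rewrite <- E. ring.
Qed.

Lemma fp_int_scal (a b : C) (rho : R) (h : R -> C) (k V : C) : fp_regular a -> fp_regular b -> 0 < rho <= 1 / 2 ->
  fp_int a b rho h V -> fp_int a b rho (fun t => k * h t)%C (k * V)%C.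
Proof.
  intros Ha Hb Hr H. pose proof (fp_int_lin a b rho _ _ (k - 1) _ _ Ha Hb Hr H H) as L.
  replace (k * V)%C with (V + (k - 1) * V)%C by ring.
  apply fp_int_ext with (3 := L); [exact Hr|]. intros; ring.
Qed.

Lemma fp_int_pfun_pow (a b : C) (rho : R) (n j : nat) : fp_regular a -> fp_regular b -> 0 < rho <= 1 / 2 ->
  fp_int a b rho (fun t => pfun n a b (RtoC t) * RtoC t ^ j)%C
    (pmoment n a b (fun i => hbeta (a + INR i) b rho) j).
Proof.
  intros Ha Hb Hr.
  apply (fp_int_ext _ _ _ (fun t => Csum (fun k => pc n a b k * RtoC t ^ (k + j))%C n)); [exact Hr| |].
  { intros t _. unfold pfun. rewrite <- Csum_scal_r. apply Csum_ext. intros k _. rewrite Cpow_add_r. cring. }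
  apply (fp_int_Csum a b rho (fun k t => pc n a b k * RtoC t ^ (k + j))%C); try assumption.
  intros k _. apply fp_int_scal; try assumption. now apply fp_int_pow.
Qed.

Lemma fp_int_pfun_poly (a b : C) (rho : R) (n m : nat) (q : nat -> C) : fp_regular a -> fp_regular b -> 0 < rho <= 1 / 2 ->
  fp_int a b rho (fun t => Csum (fun j => q j * RtoC t ^ j) m * pfun n a b (RtoC t))%C
    (Csum (fun j => q j * pmoment n a b (fun i => hbeta (a + INR i) b rho) j) m)%C.
Proof.
  intros Ha Hb Hr.
  apply (fp_int_ext _ _ _ (fun t => Csum (fun j => q j * (pfun n a b (RtoC t) * RtoC t ^ j))%C m)); [exact Hr| |].
  { intros t _. rewrite <- Csum_scal_r. apply Csum_ext. intros k _. cring. }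
  apply (fp_int_Csum a b rho (fun j t => q j * (pfun n a b (RtoC t) * RtoC t ^ j))%C); try assumption.
  intros j _. apply fp_int_scal; try assumption. now apply fp_int_pfun_pow.
Qed.

Lemma fp_int_poly_orth (a b : C) (rho : R) (n m : nat) (q : nat -> C) : fp_regular a -> fp_regular b -> 0 < rho <= 1 / 2 ->
  (m < n)%nat ->
  fp_int a b rho (fun t => Csum (fun j => q j * RtoC t ^ j) m * pfun n a b (RtoC t))%C 0.
Proof.
  intros Ha Hb Hr Hm. pose proof (fp_int_pfun_poly a b rho n m q Ha Hb Hr) as H.
  rewrite Csum_0 in H; [exact H|]. intros j Hj.
  rewrite pmoment_orth; [ring|now apply hbeta_moment_rec|lia].
Qed.

Lemma fp_int_poly_diag (a b : C) (rho : R) (n : nat) (q : nat -> C) : fp_regular a -> fp_regular b -> 0 < rho <= 1 / 2 ->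
  fp_int a b rho (fun t => Csum (fun j => q j * RtoC t ^ j) n * pfun n a b (RtoC t))%C
    (q n * pmoment n a b (fun i => hbeta (a + INR i) b rho) n)%C.
Proof.
  intros Ha Hb Hr. pose proof (fp_int_pfun_poly a b rho n n q Ha Hb Hr) as H.
  rewrite (Csum_single _ n n) in H; [exact H|lia|]. intros j Hj Hne.
  rewrite pmoment_orth; [ring|now apply hbeta_moment_rec|lia].
Qed.

(** * The Gamma and Beta functions *)

(** The bound gives |u_n| <= |u_0| exp M, so the increments u_n e_n are absolutely summable. *)
Lemma infinite_product_converges (u e : nat -> C) (M : R) :
  (forall m, u (S m) = (u m * (1 + e m))%C) ->
  (forall n, sum_f_R0 (fun m => Cmod (e m)) n <= M) -> exists l, Ccv u l.
Proof.
  intros Hu HM.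
  assert (HM0 : 0 <= M) by (eapply Rle_trans; [apply (Cmod_ge_0 (e O))|apply (HM O)]).
  assert (B : forall n, Cmod (u (S n)) <= Cmod (u O) * exp (sum_f_R0 (fun m => Cmod (e m)) n)).
  { assert (St : forall n, Cmod (u (S n)) <= Cmod (u n) * exp (Cmod (e n))).
    { intros n. rewrite Hu, Cmod_mult. apply Rmult_le_compat_l; [apply Cmod_ge_0|].
      eapply Rle_trans; [apply Cmod_triangle|]. rewrite Cmod_1.
      apply exp_ineq1_le. }
    induction n as [|n IH]; [apply St|].
    eapply Rle_trans; [apply St|]. simpl. rewrite exp_plus, <- Rmult_assoc.
    apply Rmult_le_compat_r; [left; apply exp_pos|exact IH]. }
  assert (B' : forall n, Cmod (u n) <= Cmod (u O) * exp M).
  { pose proof (Cmod_ge_0 (u O)). intros [|n].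
    - pose proof (exp_ineq1_le M). nra.
    - eapply Rle_trans; [apply B|]. apply Rmult_le_compat_l; [lra|].
      destruct (HM n) as [Hlt|Heq]; [left; now apply exp_increasing|rewrite Heq; lra]. }
  destruct (Cseries_abs (fun m => u m * e m)%C (Cmod (u O) * exp M * M)) as [l Hl].
  { intros n. apply Rle_trans with (sum_f_R0 (fun m => Cmod (e m) * (Cmod (u O) * exp M)) n).
    - apply sum_Rle. intros m _. rewrite Cmod_mult, Rmult_comm.
      apply Rmult_le_compat_l; [apply Cmod_ge_0|apply B'].
    - rewrite <- scal_sum. apply Rmult_le_compat_l; [|apply HM].
      apply Rmult_le_pos; [apply Cmod_ge_0|left; apply exp_pos]. }
  exists (u O + l)%C. apply (Ccv_unshift _ _ 1).
  eapply Ccv_ext; [|apply Ccv_plus; [apply Ccv_const|exact Hl]].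
  intros n. cbv beta. rewrite Nat.add_1_r. induction n as [|n IH].
  - rewrite Hu. simpl. cring.
  - rewrite (Hu (S n)). simpl. toC. rewrite <- IH. cring.
Qed.

Lemma sum_inv_sqr_bound (n : nat) : sum_f_R0 (fun m => / ((INR m + 1) * (INR m + 1))) n <= 2.
Proof.
  enough (H : sum_f_R0 (fun m => / ((INR m + 1) * (INR m + 1))) n <= 2 - / (INR n + 1)).
  { pose proof (pos_INR n). assert (0 < / (INR n + 1)) by (apply Rinv_0_lt_compat; lra). lra. }
  induction n as [|n IH].
  - simpl. replace (/ ((0 + 1) * (0 + 1))) with 1 by field. replace (/ (0 + 1)) with 1 by field. lra.
  - rewrite tech5. rewrite S_INR. pose proof (pos_INR n).
    assert (E : / ((INR n + 1 + 1) * (INR n + 1 + 1)) <= / (INR n + 1) - / (INR n + 1 + 1)).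
    { replace (/ (INR n + 1) - / (INR n + 1 + 1)) with (/ ((INR n + 1) * (INR n + 1 + 1))) by (field; lra).
      apply Rinv_le_contravar; nra. }
    lra.
Qed.

(** The convergence criterion also applies to the reciprocals, whose factors are 1 + f with f =
    -e/(1+e). The two limits multiply to 1, so neither is 0. *)
Lemma infinite_product_nonzero (u e : nat -> C) (K : R) :
  (forall m, u m <> 0) -> (forall m, u (S m) = (u m * (1 + e m))%C) ->
  (forall m, Cmod (e m) <= K / ((INR m + 1) * (INR m + 1))) -> exists l, Ccv u l /\ l <> RtoC 0.
Proof.
  intros Hu0 Hu He.
  assert (HK : 0 <= K).
  { specialize (He O). simpl in He. replace (K / ((0 + 1) * (0 + 1))) with K in He by field.
    eapply Rle_trans; [apply Cmod_ge_0|exact He]. }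
  assert (Hsum : forall (f : nat -> C) c, 0 <= c -> (forall m, Cmod (f m) <= c / ((INR m + 1) * (INR m + 1))) ->
     forall n, sum_f_R0 (fun m => Cmod (f m)) n <= c * 2).
  { intros f c Hc Hf n. apply Rle_trans with (sum_f_R0 (fun m => / ((INR m + 1) * (INR m + 1)) * c) n).
    - apply sum_Rle. intros m _. specialize (Hf m). unfold Rdiv in Hf. lra.
    - rewrite <- scal_sum. apply Rmult_le_compat_l; [exact Hc|apply sum_inv_sqr_bound]. }
  destruct (infinite_product_converges u e (K * 2) Hu (Hsum e K HK He)) as [l Hl].
  assert (Hne : forall m, (1 + e m)%C <> 0).
  { intros m E. apply (Hu0 (S m)). rewrite Hu, E. ring. }
  (* Beyond [N] all |e| are at most 1/2, so passing from [e] to [f] at most doubles the bound. *)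
  destruct (INR_unbounded (2 * K)) as [N HN].
  set (v := fun m => (/ u (m + N)%nat)%C).
  set (f := fun m => (- e (m + N)%nat / (1 + e (m + N)%nat))%C).
  assert (Hv : forall m, v (S m) = (v m * (1 + f m))%C).
  { intros m. unfold v, f. change (S m + N)%nat with (S (m + N)). rewrite Hu. field.
    split; [apply Hne|apply Hu0]. }
  assert (Hf : forall m, Cmod (f m) <= 2 * K / ((INR m + 1) * (INR m + 1))).
  { intros m. unfold f. rewrite Cmod_div, Cmod_opp by apply Hne.
    specialize (He (m + N)%nat). rewrite plus_INR in He. pose proof (pos_INR m). pose proof (pos_INR N).
    set (A := INR m + INR N + 1) in *.
    assert (HA : INR m + 1 <= A) by (unfold A; lra). assert (HA2 : 2 * K <= A) by (unfold A; lra).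
    assert (HeA : Cmod (e (m + N)%nat) <= 1 / 2).
    { eapply Rle_trans; [exact He|]. apply Rmult_le_reg_r with (A * A); [nra|].
      unfold Rdiv at 1. rewrite Rmult_assoc, Rinv_l by nra. nra. }
    assert (H1 : 1 / 2 <= Cmod (1 + e (m + N)%nat)).
    { pose proof (Cmod_le_minus 1 (1 + e (m + N)%nat)) as Q. rewrite Cmod_1 in Q.
      replace (1 - (1 + e (m + N)%nat))%C with (- e (m + N)%nat)%C in Q by ring. rewrite Cmod_opp in Q. lra. }
    apply Rle_trans with (2 * Cmod (e (m + N)%nat)).
    - apply Rmult_le_reg_r with (Cmod (1 + e (m + N)%nat)); [lra|].
      unfold Rdiv. rewrite Rmult_assoc, Rinv_l by lra. pose proof (Cmod_ge_0 (e (m + N)%nat)). nra.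
    - replace (2 * K / ((INR m + 1) * (INR m + 1))) with (2 * (K / ((INR m + 1) * (INR m + 1)))) by (field; lra).
      apply Rmult_le_compat_l; [lra|]. eapply Rle_trans; [exact He|].
      apply Rmult_le_compat_l; [exact HK|]. apply Rinv_le_contravar; nra. }
  destruct (infinite_product_converges v f (2 * K * 2) Hv (Hsum f (2 * K) ltac:(lra) Hf)) as [l' Hl'].
  exists l. split; [exact Hl|]. intros ->.
  pose proof (Ccv_mult _ _ _ _ (Ccv_subseq_shift _ _ N Hl) Hl') as P.
  replace (0 * l')%C with (RtoC 0) in P by ring.
  assert (E : RtoC 1 = RtoC 0).
  { apply (Ccv_unique (fun _ => RtoC 1)); [apply Ccv_const|].
    eapply Ccv_ext; [|exact P]. intros n. unfold v. cbv beta. field. apply Hu0. }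
  apply RtoC_inj in E. lra.
Qed.

(** Two applications of the mean value inequality along t -> t w; the constant 3 bounds e. *)
Lemma Cexp_taylor2 (w : C) : Cmod w <= 1 -> Cmod (Cexp w - 1 - w) <= 3 * (Cmod w * Cmod w).
Proof.
  intros Hw.
  assert (D1 : forall t, derC (fun t => Cexp (t * w))%C t (w * Cexp (t * w))%C).
  { intros t. eapply derC_eq; [apply derC_Cexp; apply derC_mult; [apply derC_id|apply derC_const]|].
    cbv beta. cring. }
  assert (E1 : forall t, 0 <= t <= 1 -> Cmod (Cexp (t * w)%C) <= 3).
  { intros t Ht. rewrite Cmod_Cexp. simpl. rewrite Rmult_0_l, Rminus_0_r.
    apply Rle_trans with (exp 1); [|apply exp_le_3].
    pose proof (Rabs_fst_le w). pose proof (Rle_abs (fst w)).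
    destruct (Rle_lt_or_eq_dec (t * fst w) 1) as [Hl|He]; [nra|left; now apply exp_increasing|rewrite He; lra]. }
  assert (B1 : forall t, 0 <= t <= 1 -> Cmod (Cexp (t * w)%C - 1) <= 3 * Cmod w).
  { intros t Ht.
    pose proof (derC_mean_value (fun t => Cexp (t * w))%C (fun t => w * Cexp (t * w))%C
      (fun s => 3 * Cmod w * s) (fun _ => 3 * Cmod w) 0 t (proj1 Ht)) as MV. cbv beta in MV.
    replace (Cexp (RtoC 0 * w)%C) with (RtoC 1) in MV
      by (replace (RtoC 0 * w)%C with (RtoC 0) by ring; symmetry; apply Cexp_0).
    eapply Rle_trans; [apply MV|].
    - intros x _. apply D1.
    - intros x _. auto_derive; [exact Logic.I|ring].
    - intros x Hx. rewrite Cmod_mult. specialize (E1 x ltac:(lra)). pose proof (Cmod_ge_0 w). nra.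
    - pose proof (Cmod_ge_0 w). nra. }
  pose proof (derC_mean_value (fun t => Cexp (t * w) - t * w)%C (fun t => w * (Cexp (t * w) - 1))%C
      (fun s => 3 * (Cmod w * Cmod w) * s) (fun _ => 3 * (Cmod w * Cmod w)) 0 1 ltac:(lra)) as MV.
  cbv beta in MV.
  replace (Cexp (RtoC 0 * w)%C) with (RtoC 1) in MV
      by (replace (RtoC 0 * w)%C with (RtoC 0) by ring; symmetry; apply Cexp_0).
  replace (RtoC 1 * w)%C with w in MV by ring.
  replace (Cexp w - 1 - w)%C with (Cexp w - w - (1 - 0 * w))%C by cring.
  eapply Rle_trans; [apply MV|].
  - intros x _. eapply derC_eq; [apply derC_minus; [apply D1|apply derC_mult; [apply derC_id|apply derC_const]]|].
    cbv beta. cring.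
  - intros x _. auto_derive; [exact Logic.I|ring].
  - intros x Hx. rewrite Cmod_mult. specialize (B1 x Hx). pose proof (Cmod_ge_0 w). nra.
  - lra.
Qed.

Lemma ln_1p_bounds (x : R) : 0 <= x -> x - x * x <= ln (1 + x) <= x.
Proof.
  intros Hx. split.
  (* With [Phi] zero the mean value inequality expresses the monotonicity of a real function. *)
  - pose proof (derC_mean_value (fun t => RtoC 0) (fun _ => RtoC 0) (fun t => ln (1 + t) - (t - t * t))
      (fun t => / (1 + t) - (1 - 2 * t)) 0 x Hx) as MV. cbv beta in MV.
    assert (H : Cmod (0 - 0) <= ln (1 + x) - (x - x * x) - (ln (1 + 0) - (0 - 0 * 0))).
    { apply MV.
      - intros; apply derC_const.
      - intros t Ht. auto_derive; [lra|field; lra].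
      - intros t Ht. rewrite Cmod_0.
        replace (/ (1 + t) - (1 - 2 * t)) with ((t + 2 * t * t) * / (1 + t)) by (field; lra).
        apply Rmult_le_pos; [nra|left; apply Rinv_0_lt_compat; lra]. }
    replace (0 - 0)%C with (RtoC 0) in H by ring. rewrite Cmod_0, Rplus_0_r, ln_1 in H. lra.
  - pose proof (exp_ineq1_le x) as H. rewrite <- (ln_exp x) at 2.
    destruct H as [H|H]; [left; apply ln_increasing; lra|rewrite H; lra].
Qed.

(** * Convergence of Gauss' product and the functional equation *)

Definition gam_ok (z : C) : Prop := forall n : nat, (INR n + z)%C <> 0.

Lemma Cprod_poch (z : C) (m : nat) :
  Cprod (fun j => Cadd z (Defs.RtoC (INR j))) m = poch z (S m).
Proof.
  induction m as [|m IH].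
  - simpl. cring.
  - cbn [Cprod]. rewrite IH, (poch_S z (S m)). reflexivity.
Qed.

Lemma gauss_seq_eq (z : C) (m : nat) :
  gauss_seq z m = (INR (fact m) * Cpow_pos (INR m) z / poch z (S m))%C.
Proof. unfold gauss_seq. rewrite Cprod_poch. reflexivity. Qed.

Lemma poch_gam_ok (z : C) (n : nat) : gam_ok z -> poch z n <> 0.
Proof. intros H. apply poch_neq_0. intros k _. rewrite Cplus_comm. apply H. Qed.

Lemma INR_S_pos (m : nat) : 0 < INR (S m).
Proof. apply lt_0_INR. lia. Qed.

(** The quotient of consecutive terms of Gauss' sequence is (1+1/x)^z (x+1)/(x+1+z) with x = m+1;
    the contributions of order 1/x cancel, which makes the product converge absolutely. *)
Lemma gauss_ratio_bound (z : C) : gam_ok z -> exists K, forall m,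
  Cmod (Cpow_pos (1 + / INR (S m)) z * (INR (S (S m))) / (INR (S (S m)) + z) - 1)
    <= K / ((INR m + 1) * (INR m + 1)).
Proof.
  intros Hz.
  destruct (Ccv_bounded _ _ (INR_div_lim 0 z Hz)) as [B [HB HBb]].
  set (Z := Cmod z). assert (HZ : 0 <= Z) by apply Cmod_ge_0.
  destruct (INR_unbounded Z) as [N HN].
  assert (Hlarge : forall m, Z <= INR (S m) ->
    Cmod (Cpow_pos (1 + / INR (S m)) z * (INR (S (S m))) / (INR (S (S m)) + z) - 1)
      <= (B * (2 * (Z + 3 * Z * Z) + Z)) / ((INR m + 1) * (INR m + 1))).
  { intros m Hm. rewrite <- S_INR. set (x := INR (S m)) in *.
    assert (Hx : 0 < x) by apply INR_S_pos.
    assert (Hx1 : 1 <= x) by (unfold x; rewrite S_INR; pose proof (pos_INR m); lra).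
    assert (Hix : 0 < / x) by (now apply Rinv_0_lt_compat).
    set (w := (z * ln (1 + / x))%C).
    pose proof (ln_1p_bounds (/ x) (Rlt_le _ _ Hix)) as [L1 L2].
    assert (Hix1 : / x <= 1) by (rewrite <- Rinv_1; apply Rinv_le_contravar; lra).
    assert (L0 : 0 <= ln (1 + / x)) by nra.
    assert (Hw : Cmod w <= Z * / x).
    { unfold w. rewrite Cmod_mult, Cmod_R, Rabs_pos_eq by lra. apply Rmult_le_compat_l; lra. }
    assert (Hzx : Z * / x <= 1).
    { apply Rmult_le_reg_r with x; [lra|]. rewrite Rmult_assoc, Rinv_l by lra. lra. }
    assert (T : Cmod (Cexp w - 1 - w) <= 3 * (Cmod w * Cmod w)) by (apply Cexp_taylor2; lra).
    assert (T2 : Cmod (Cexp w - 1 - z * / x) <= (Z + 3 * Z * Z) * (/ x * / x)).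
    { replace (Cexp w - 1 - z * / x)%C with ((Cexp w - 1 - w) + z * (ln (1 + / x) - / x))%C
        by (unfold w; cring).
      eapply Rle_trans; [apply Cmod_triangle|]. rewrite Cmod_mult, <- RtoC_inv, <- RtoC_minus, Cmod_R by lra.
      rewrite Rabs_left1 by lra. fold Z. pose proof (Cmod_ge_0 w).
      assert (Cmod w * Cmod w <= (Z * / x) * (Z * / x)) by (apply Rmult_le_compat; lra).
      assert (- (ln (1 + / x) - / x) <= / x * / x) by lra. nra. }
    assert (Ex : RtoC (INR (S (S m))) = (x + 1)%C) by (unfold x; now rewrite RtoC_INR_S).
    rewrite Ex.
    assert (Hd : (x + 1 + z)%C <> 0) by (rewrite <- Ex; apply Hz).
    assert (Hxc : RtoC x <> 0) by (apply RtoC_neq_0; lra).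
    replace (Cpow_pos (1 + / x) z) with (Cexp w : C) by reflexivity.
    (* In this numerator the terms of order 1 have cancelled: what is left is x + 1 times a
       second-order remainder of the exponential, and z/x. *)
    replace (Cexp w * (x + 1) / (x + 1 + z) - 1)%C with
      (((x + 1) * (Cexp w - 1 - z * / x) + z * / x) / (x + 1 + z))%C.
    2:{ cfield. split; assumption. }
    unfold Complex.Cdiv. rewrite Cmod_mult.
    assert (HB2 : Cmod (/ (x + 1 + z)) <= B * / x).
    { specialize (HBb (S (S m))). rewrite Ex in HBb.
      replace ((x + 1 + 0) / (x + 1 + z))%C with ((x + 1) * / (x + 1 + z))%C in HBb by (field; exact Hd).
      set (J := (/ (x + 1 + z))%C) in *.
      rewrite Cmod_mult, <- RtoC_plus, Cmod_R, Rabs_pos_eq in HBb by lra.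
      pose proof (Cmod_ge_0 J).
      apply Rmult_le_reg_l with x; [lra|]. replace (x * (B * / x)) with B by (field; lra). nra. }
    assert (HN2 : Cmod ((x + 1) * (Cexp w - 1 - z * / x) + z * / x) <= (2 * (Z + 3 * Z * Z) + Z) * / x).
    { eapply Rle_trans; [apply Cmod_triangle|]. rewrite !Cmod_mult, <- RtoC_plus, <- RtoC_inv, !Cmod_R by lra.
      rewrite !Rabs_pos_eq by lra. fold Z.
      replace (RtoC (/ x)) with (/ x)%C by (symmetry; apply RtoC_inv; lra).
      assert ((x + 1) * Cmod (Cexp w - 1 - z * / x) <= 2 * x * ((Z + 3 * Z * Z) * (/ x * / x))).
      { apply Rmult_le_compat; [lra|apply Cmod_ge_0|lra|exact T2]. }
      replace (2 * x * ((Z + 3 * Z * Z) * (/ x * / x))) with (2 * (Z + 3 * Z * Z) * / x) in * by (field; lra).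
      lra. }
    apply Rle_trans with ((2 * (Z + 3 * Z * Z) + Z) * / x * (B * / x)).
    - apply Rmult_le_compat; try apply Cmod_ge_0; assumption.
    - right. field. lra. }
  (* The finitely many indices up to [N] are absorbed by the sum of their weighted values. *)
  set (K2 := sum_f_R0 (fun m => Cmod (Cpow_pos (1 + / INR (S m)) z * (INR (S (S m))) / (INR (S (S m)) + z) - 1)
      * ((INR m + 1) * (INR m + 1))) N).
  set (K1 := B * (2 * (Z + 3 * Z * Z) + Z)).
  assert (HK1 : 0 <= K1) by (unfold K1; apply Rmult_le_pos; nra).
  assert (Hpos : forall m, 0 <= Cmod (Cpow_pos (1 + / INR (S m)) z * (INR (S (S m))) / (INR (S (S m)) + z) - 1)
      * ((INR m + 1) * (INR m + 1))).
  { intros m. pose proof (pos_INR m). apply Rmult_le_pos; [apply Cmod_ge_0|nra]. }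
  assert (HK2 : 0 <= K2) by (apply cond_pos_sum; exact Hpos).
  exists (K1 + K2). intros m. pose proof (pos_INR m).
  destruct (le_lt_dec m N) as [Hm|Hm].
  - apply Rmult_le_reg_r with ((INR m + 1) * (INR m + 1)); [nra|].
    replace ((K1 + K2) / ((INR m + 1) * (INR m + 1)) * ((INR m + 1) * (INR m + 1))) with (K1 + K2) by (field; lra).
    pose proof (sum_f_R0_nonneg_mono _ m N Hpos Hm) as Hs. fold K2 in Hs.
    assert (Hs2 : Cmod (Cpow_pos (1 + / INR (S m)) z * (INR (S (S m))) / (INR (S (S m)) + z) - 1)
      * ((INR m + 1) * (INR m + 1)) <= sum_f_R0 (fun m => Cmod (Cpow_pos (1 + / INR (S m)) z * (INR (S (S m)))
        / (INR (S (S m)) + z) - 1) * ((INR m + 1) * (INR m + 1))) m).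
    { clear Hs Hm. destruct m as [|m]; [apply Rle_refl|]. rewrite tech5. pose proof (cond_pos_sum _ m Hpos). lra. }
    lra.
  - eapply Rle_trans; [apply Hlarge|].
    + apply Rlt_le. eapply Rlt_trans; [exact HN|]. apply lt_INR. lia.
    + apply Rmult_le_compat_r; [left; apply Rinv_0_lt_compat; nra|fold K1; lra].
Qed.

Lemma CGamma_spec (z : C) : gam_ok z -> Ccv (gauss_seq z) (CGamma z) /\ CGamma z <> RtoC 0.
Proof.
  intros Hz. destruct (gauss_ratio_bound z Hz) as [K HK].
  (* The product starts at index 1, because the ratio of the terms m and m + 1 involves
     (1+1/m)^z. *)
  destruct (infinite_product_nonzero (fun m => gauss_seq z (S m))
    (fun m => Cpow_pos (1 + / INR (S m)) z * (INR (S (S m))) / (INR (S (S m)) + z) - 1)%C K) as [l [Hl Hl0]].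
  - intros m. rewrite gauss_seq_eq. unfold Complex.Cdiv. apply Cmult_neq_0.
    + apply Cmult_neq_0; [apply RtoC_fact_neq_0|apply Cpow_pos_neq_0].
    + intros E. apply (f_equal Cmod) in E. rewrite Cmod_inv, Cmod_0 in E by now apply poch_gam_ok.
      pose proof (proj1 (Cmod_gt_0 _) (poch_gam_ok z (S (S m)) Hz)) as P.
      apply Rinv_0_lt_compat in P. lra.
  - intros m. rewrite !gauss_seq_eq. rewrite (poch_S z (S (S m))), fact_simpl, RtoC_INR_mult.
    pose proof (INR_S_pos m).
    assert (E : INR (S (S m)) = INR (S m) * (1 + / INR (S m))) by (rewrite (S_INR (S m)); field; lra).
    rewrite E at 2. rewrite Cpow_pos_mult; [|lra|].
    + pose proof (poch_gam_ok z (S (S m)) Hz). specialize (Hz (S (S m))).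
      cfield. split; [|assumption]. intros Q. apply Hz. rewrite <- Q. ring.
    + assert (0 < / INR (S m)) by (now apply Rinv_0_lt_compat). lra.
  - exact HK.
  - assert (H : Ccv (gauss_seq z) l).
    { apply (Ccv_unshift _ _ 1). eapply Ccv_ext; [|exact Hl]. intros n. cbv beta. now rewrite Nat.add_1_r. }
    assert (H2 : Ccv (gauss_seq z) (CGamma z)) by (unfold CGamma; apply epsilon_spec; now exists l).
    split; [exact H2|]. rewrite (Ccv_unique _ _ _ H2 H). exact Hl0.
Qed.

Lemma gam_ok_S (z : C) : gam_ok z -> gam_ok (z + 1).
Proof. intros H n E. apply (H (S n)). rewrite <- E, RtoC_INR_S. ring. Qed.

Lemma CGamma_S (z : C) : gam_ok z -> CGamma (z + 1)%C = (z * CGamma z)%C.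
Proof.
  intros Hz. destruct (CGamma_spec z Hz) as [H1 _]. destruct (CGamma_spec _ (gam_ok_S z Hz)) as [H2 _].
  apply (Ccv_unique _ _ _ H2).
  pose proof (Ccv_mult _ _ _ _ (Ccv_scal z _ _ H1) (INR_div_lim 0 (z + 1) (gam_ok_S z Hz))) as P.
  replace (z * CGamma z)%C with (z * CGamma z * 1)%C by cring.
  apply Ccv_ext_loc with (N := 1%nat) (2 := P). intros [|n] Hn; [lia|].
  rewrite !gauss_seq_eq. rewrite Cpow_pos_plus, Cpow_pos_1_r by apply INR_S_pos.
  rewrite (poch_S_l z (S n)), (poch_S (z + 1) (S n)).
  assert (Hz0 : z <> 0) by (intros E; apply (Hz O); rewrite E; simpl; ring).
  pose proof (poch_gam_ok (z + 1) (S n) (gam_ok_S z Hz)) as Hp.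
  pose proof (gam_ok_S z Hz (S n)) as Hp3.
  cfield. repeat split; try assumption. intros E; apply Hp3; rewrite <- E; ring.
Qed.

Lemma CGamma_poch (z : C) (n : nat) : gam_ok z -> CGamma (z + INR n)%C = (poch z n * CGamma z)%C.
Proof.
  intros Hz. induction n as [|n IH].
  - simpl. replace (z + 0)%C with z by ring. cring.
  - rewrite RtoC_INR_S. replace (z + (INR n + 1))%C with (z + INR n + 1)%C by ring.
    rewrite CGamma_S, IH, poch_S; [cring|].
    intros k E. apply (Hz (k + n)%nat). rewrite <- E, RtoC_INR_plus. ring.
Qed.

(** * Finite parts as improper integrals, and the Beta function *)

Lemma half_at_move (a b : C) (rho : R) (h : R -> C) (V : C) : fp_regular a -> 0 < rho <= 1 / 2 ->
  half_at a b rho h V -> exists d, psr d rho /\ forall x1, 0 < x1 <= rho / 2 ->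
    exists J, is_RIC (fun x => wt a b x * h x)%C x1 (1 / 2) J /\ V = (Cpow_pos x1 (a + 1)%C * PS d x1 + J)%C.
Proof.
  intros Ha Hr [c [I [H1 [H2 ->]]]].
  assert (Hc : psr c rho) by (eapply psr_rep; exact H1).
  exists (fun m => c m / (INR m + (a + 1)))%C. split; [now apply psr_quotient|]. intros x1 Hx1.
  set (d := fun m => (c m / (INR m + (a + 1)))%C).
  assert (Hd : psr d rho) by (now apply psr_quotient).
  assert (EJ : is_RIC (fun x => wt a b x * h x)%C x1 (rho / 2)
      (Cpow_pos (rho / 2) (a + 1)%C * PS d (rho / 2) - Cpow_pos x1 (a + 1)%C * PS d x1)%C).
  { apply (is_RIC_ext (fun x => Cpow_pos x a * PS c x)%C).
    - intros x Hx. rewrite Rmin_left, Rmax_right in Hx by lra.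
      rewrite (PS_unique c rho x (Cpow_pos (1 - x) b * h x)%C); [unfold wt; cring|exact Hc| |].
      + rewrite Rabs_pos_eq; lra.
      + apply (H1 x); lra.
    - apply (is_RIC_derive (fun x => Cpow_pos x (a + 1)%C * PS d x)%C).
      + intros x Hx. rewrite Rmin_left, Rmax_right in Hx by lra.
        apply (derC_power_times_PS d a rho x 0); [exact Hd|lra|].
        apply Ccv_series_ext with (fun m => c m * RtoC x ^ m)%C.
        * intros m. unfold d. cfield. apply Ha.
        * apply (PS_correct c rho x Hc). rewrite Rabs_pos_eq; lra.
      + intros x Hx. rewrite Rmin_left, Rmax_right in Hx by lra.
        apply contC_mult; [apply contC_Cpow_pos; lra|apply (contC_PS c rho x Hc)].
        rewrite Rabs_pos_eq; lra. }
  eexists. split; [exact (is_RIC_Chasles _ _ _ _ _ _ EJ H2)|]. fold d. cring.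
Qed.

Lemma Rpower_small (s eps : R) : 0 < s -> 0 < eps ->
  exists d, 0 < d /\ forall x, 0 < x < d -> Rpower x s < eps.
Proof.
  intros Hs He. exists (Rpower eps (/ s)). split; [apply exp_pos|]. intros x Hx.
  apply Rlt_le_trans with (Rpower (Rpower eps (/ s)) s).
  - apply Rlt_Rpower_l; [exact Hs|lra].
  - rewrite Rpower_mult, Rinv_l, Rpower_1 by lra. lra.
Qed.

(** For Re a > -1 the boundary term, x1^(a+1) times a power series, tends to 0, so the finite part
    is the improper integral. In this range estimates by absolute values are possible. *)
Lemma half_at_improper (a b : C) (rho : R) (h : R -> C) (V : C) : fp_regular a -> -1 < fst a -> 0 < rho <= 1 / 2 ->
  half_at a b rho h V -> forall eps, 0 < eps -> exists d, 0 < d /\ forall x1, 0 < x1 < d ->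
    exists J, is_RIC (fun x => wt a b x * h x)%C x1 (1 / 2) J /\ Cmod (V - J) < eps.
Proof.
  intros Ha Hre Hr HV eps He.
  destruct (half_at_move a b rho h V Ha Hr HV) as [d [Hd HJ]].
  assert (Hc : contC (PS d) 0) by (apply (contC_PS d rho 0 Hd); rewrite Rabs_R0; lra).
  destruct (proj1 (contC_eps _ _) Hc 1 ltac:(lra)) as [d1 [Hd1 HB]].
  set (B := Cmod (PS d 0) + 1). assert (HB1 : 1 <= B) by (unfold B; pose proof (Cmod_ge_0 (PS d 0)); lra).
  destruct (Rpower_small (fst a + 1) (eps / B)) as [d2 [Hd2 HR]]; [lra|apply Rdiv_lt_0_compat; lra|].
  exists (Rmin (rho / 2) (Rmin d1 d2)). split; [repeat apply Rmin_pos; lra|]. intros x1 Hx1.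
  pose proof (Rmin_l (rho / 2) (Rmin d1 d2)). pose proof (Rmin_r (rho / 2) (Rmin d1 d2)).
  pose proof (Rmin_l d1 d2). pose proof (Rmin_r d1 d2).
  destruct (HJ x1 ltac:(lra)) as [J [HJ1 HJ2]]. exists J. split; [exact HJ1|].
  rewrite HJ2. replace (Cpow_pos x1 (a + 1)%C * PS d x1 + J - J)%C with (Cpow_pos x1 (a + 1)%C * PS d x1)%C by cring.
  rewrite Cmod_mult, Cmod_Cpow_pos. simpl fst.
  specialize (HR x1 ltac:(lra)). specialize (HB x1). rewrite Rminus_0_r, Rabs_pos_eq in HB by lra.
  specialize (HB ltac:(lra)). pose proof (Cmod_le_minus (PS d x1) (PS d 0)) as Q.
  assert (HBx : Cmod (PS d x1) <= B) by (unfold B; lra).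
  assert (HP : 0 < Rpower x1 (fst a + 1)) by apply exp_pos.
  apply Rle_lt_trans with (Rpower x1 (fst a + 1) * B); [apply Rmult_le_compat_l; lra|].
  apply Rmult_lt_reg_r with (/ B); [apply Rinv_0_lt_compat; lra|].
  rewrite Rmult_assoc, Rinv_r, Rmult_1_r by lra. exact HR.
Qed.

Lemma fp_int_improper (a b : C) (rho : R) (h : R -> C) (V : C) :
  fp_regular a -> fp_regular b -> -1 < fst a -> -1 < fst b -> 0 < rho <= 1 / 2 ->
  fp_int a b rho h V -> forall eps, 0 < eps -> exists d, 0 < d /\ forall x, 0 < x < d ->
    exists J, is_RIC (fun x => wt a b x * h x)%C x (1 - x) J /\ Cmod (V - J) < eps.
Proof.
  intros Ha Hb Hra Hrb Hr [V1 [V2 [H1 [H2 ->]]]] eps He.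
  destruct (half_at_improper a b rho h V1 Ha Hra Hr H1 (eps / 2)) as [d1 [Hd1 K1]]; [lra|].
  destruct (half_at_improper b a rho _ V2 Hb Hrb Hr H2 (eps / 2)) as [d2 [Hd2 K2]]; [lra|].
  exists (Rmin d1 d2). split; [now apply Rmin_pos|]. intros x Hx.
  pose proof (Rmin_l d1 d2). pose proof (Rmin_r d1 d2).
  destruct (K1 x ltac:(lra)) as [J1 [I1 E1]]. destruct (K2 x ltac:(lra)) as [J2 [I2 E2]].
  exists (J1 + J2)%C. split.
  - apply is_RIC_Chasles with (1 / 2); [exact I1|].
    apply (is_RIC_ext (fun t => (-(1)) * (RtoC (-1) * (wt b a (-1 * t + 1)%R * h (1 - (-1 * t + 1))%R)))%C).
    + intros t _. replace (-1 * t + 1) with (1 - t) by ring. unfold wt. replace (1 - (1 - t)) with t by ring.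
      cring.
    + apply is_RIC_eq with ((-(1)) * (- J2))%C; [|ring]. apply is_RIC_scal.
      apply (is_RIC_comp_lin (fun x => wt b a x * h (1 - x)%R)%C (-1) 1).
      replace (-1 * (1 - x) + 1) with x by ring. replace (-1 * (1 / 2) + 1) with (1 / 2) by field.
      apply is_RIC_swap. exact I2.
  - replace (V1 + V2 - (J1 + J2))%C with ((V1 - J1) + (V2 - J2))%C by ring.
    eapply Rle_lt_trans; [apply Cmod_triangle|]. lra.
Qed.

Lemma is_RIC_le (g : R -> C) (Gr : R -> R) (a b : R) (I : C) (IG : R) :
  a <= b -> (forall x, a < x < b -> Cmod (g x) <= Gr x) -> is_RIC g a b I -> is_RInt Gr a b IG ->
  Cmod I <= IG.
Proof.
  intros Hab HM HI HG. destruct (Cunit_align I) as [c [Hc HD]].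
  pose proof (proj1 (is_RIC_scal c _ _ _ _ HI)) as H1.
  rewrite HD in H1. simpl in H1.
  eapply is_RInt_le; [exact Hab|exact H1|exact HG|].
  intros x Hx. pose proof (Rabs_fst_le (c * g x)%C) as H3. rewrite Cmod_mult in H3.
  pose proof (Rle_abs (fst (c * g x)%C)). pose proof (HM x ltac:(lra)).
  pose proof (Cmod_ge_0 (g x)). simpl in *. nra.
Qed.

(** For Re g >= 1 the modulus of (1-t)^(g-1) is at most 1, so the derivative of (1-t)^g is bounded
    by |g|. *)
Lemma Cpow_pos_near_1 (g : C) (x : R) : 1 <= fst g -> 0 <= x < 1 ->
  Cmod (Cpow_pos (1 - x) g - 1) <= Cmod g * x.
Proof.
  intros Hg Hx.
  pose proof (derC_mean_value (fun t => Cpow_pos (1 - t) g) (fun t => RtoC (-1) * (g * Cpow_pos (1 - t) (g - 1)%C))%C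
    (fun t => Cmod g * t) (fun _ => Cmod g) 0 x (proj1 Hx)) as MV. cbv beta in MV.
  rewrite Rminus_0_r, Cpow_pos_1 in MV. eapply Rle_trans; [apply MV|].
  - intros t Ht. apply (derC_comp (fun t => Cpow_pos t g) (fun t => 1 - t) t (-1)).
    + auto_derive; [exact Logic.I|ring].
    + apply derC_Cpow_pos. lra.
  - intros t _. auto_derive; [exact Logic.I|ring].
  - intros t Ht. rewrite !Cmod_mult, Cmod_R, Cmod_Cpow_pos. simpl fst.
    rewrite Rabs_left by lra.
    assert (Rpower (1 - t) (fst g + - (1)) <= 1).
    { unfold Rpower. rewrite <- exp_0 at 3.
      assert (ln (1 - t) <= 0).
      { rewrite <- ln_1. destruct (Req_dec t 0) as [->|Hne]; [rewrite Rminus_0_r; lra|].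
        left. apply ln_increasing; lra. }
      destruct (Rle_lt_or_eq_dec ((fst g + - (1)) * ln (1 - t)) 0) as [Hl|Hl]; [nra| |].
      - left. now apply exp_increasing.
      - rewrite Hl. lra. }
    pose proof (Cmod_ge_0 g). simpl in *. nra.
  - lra.
Qed.

Lemma fp_regular_Re (a : C) : -1 < fst a -> fp_regular a.
Proof.
  intros H n E. apply (f_equal fst) in E. simpl in E. pose proof (pos_INR n). lra.
Qed.

Lemma wt_nat_0 (a : C) (x : R) : 0 < x < 1 -> wt a (RtoC 0) x = Cpow_pos x a.
Proof.
  intros Hx. unfold wt. change (RtoC 0) with (RtoC (INR 0)). rewrite Cpow_pos_nat by lra. simpl. cring.
Qed.

(** The recurrences determine the Beta function only up to a normalisation; this value, the integral
    of x^a over (0,1), fixes it. *)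
Lemma hbeta_0 (a : C) (rho : R) : 0 <= fst a -> 0 < rho <= 1 / 2 -> hbeta a (RtoC 0) rho = (/ (a + 1))%C.
Proof.
  intros Hre Hr. assert (Ha : fp_regular a) by (apply fp_regular_Re; lra). assert (Hb : fp_regular 0) by (apply fp_regular_Re; simpl; lra).
  pose proof (fp_regular_0 a Ha) as Ha0.
  enough (E : (hbeta a 0 rho - / (a + 1))%C = 0).
  { transitivity (hbeta a 0 rho - (hbeta a 0 rho - / (a + 1)))%C; [rewrite E|]; ring. }
  apply Cmod_le_eps_0. intros eps He.
  assert (HA : 0 < Cmod (a + 1)) by (now apply Cmod_gt_0).
  destruct (fp_int_improper a 0 rho _ _ Ha Hb ltac:(lra) ltac:(simpl; lra) Hr (hbeta_spec a 0 rho Ha Hb Hr) (eps / 3))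
    as [d [Hd HJ]]; [lra|].
  destruct (Rpower_small (fst a + 1) (eps / 3 * Cmod (a + 1))) as [d2 [Hd2 HR]]; [lra|nra|].
  (* A third of [eps] each for the defect of the improper integral, the upper endpoint and the lower
     endpoint. *)
  set (x := Rmin (Rmin (d / 2) (d2 / 2)) (Rmin (1 / 4) (eps / 3))).
  assert (Hx : 0 < x) by (unfold x; repeat apply Rmin_pos; lra).
  pose proof (Rmin_l (Rmin (d / 2) (d2 / 2)) (Rmin (1 / 4) (eps / 3))) as M1.
  pose proof (Rmin_r (Rmin (d / 2) (d2 / 2)) (Rmin (1 / 4) (eps / 3))) as M2.
  pose proof (Rmin_l (d / 2) (d2 / 2)). pose proof (Rmin_r (d / 2) (d2 / 2)).
  pose proof (Rmin_l (1 / 4) (eps / 3)). pose proof (Rmin_r (1 / 4) (eps / 3)).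
  fold x in M1, M2.
  destruct (HJ x ltac:(lra)) as [J [HJ1 HJ2]]. specialize (HR x ltac:(lra)).
  assert (EJ : J = ((Cpow_pos (1 - x) (a + 1)%C - Cpow_pos x (a + 1)%C) / (a + 1))%C).
  { eapply is_RIC_unique; [exact HJ1|].
    apply (is_RIC_ext (fun t => (/ (a + 1) * ((a + 1) * Cpow_pos t (a + 1 - 1)%C))%C)).
    - intros t Ht. rewrite Rmin_left, Rmax_right in Ht by lra. rewrite wt_nat_0 by lra.
      replace (a + 1 - 1)%C with a by ring. cfield. exact Ha0.
    - eapply is_RIC_eq; [apply is_RIC_scal; apply (is_RIC_derive (fun t => Cpow_pos t (a + 1)%C))|].
      + intros t Ht. rewrite Rmin_left, Rmax_right in Ht by lra. apply derC_Cpow_pos. lra.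
      + intros t Ht. rewrite Rmin_left, Rmax_right in Ht by lra.
        apply contC_mult; [apply contC_const|apply contC_Cpow_pos; lra].
      + cfield. exact Ha0. }
  replace (hbeta a 0 rho - / (a + 1))%C with
    ((hbeta a 0 rho - J) + ((Cpow_pos (1 - x) (a + 1)%C - 1) * / (a + 1) - Cpow_pos x (a + 1)%C * / (a + 1)))%C
    by (rewrite EJ; cfield; exact Ha0).
  eapply Rle_trans; [apply Cmod_triangle|].
  pose proof (Cmod_triangle_minus ((Cpow_pos (1 - x) (a + 1)%C - 1) * / (a + 1)) (Cpow_pos x (a + 1)%C * / (a + 1))) as T.
  rewrite !Cmod_mult, Cmod_inv, Cmod_Cpow_pos in T by exact Ha0. simpl fst in T.
  pose proof (Cpow_pos_near_1 (a + 1) x ltac:(simpl; lra) ltac:(lra)) as P.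
  assert (T1 : Cmod (Cpow_pos (1 - x) (a + 1)%C - 1) * / Cmod (a + 1) <= eps / 3).
  { apply Rmult_le_reg_r with (Cmod (a + 1)); [lra|]. rewrite Rmult_assoc, Rinv_l, Rmult_1_r by lra. nra. }
  assert (T2 : Rpower x (fst a + 1) * / Cmod (a + 1) <= eps / 3).
  { apply Rmult_le_reg_r with (Cmod (a + 1)); [lra|]. rewrite Rmult_assoc, Rinv_l, Rmult_1_r by lra. lra. }
  lra.
Qed.

(** Multiplied by m^(a+1), this Beta value is the m-th term of Gauss' sequence at a + 1. *)
Lemma hbeta_nat (a : C) (rho : R) (m : nat) : 0 <= fst a -> 0 < rho <= 1 / 2 ->
  (hbeta a (RtoC (INR m)) rho * poch (a + 1) (S m))%C = INR (fact m).
Proof.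
  intros Hre Hr. assert (Ha : fp_regular a) by (apply fp_regular_Re; lra).
  induction m as [|m IH].
  - simpl (INR 0). rewrite hbeta_0 by assumption. simpl poch. simpl. field. now apply fp_regular_0.
  - assert (Hb : fp_regular (INR m)) by (apply fp_regular_Re; simpl; pose proof (pos_INR m); lra).
    pose proof (hbeta_rec_r a (INR m) rho Ha Hb Hr) as E.
    rewrite poch_S, RtoC_fact_S, RtoC_INR_S, <- IH.
    transitivity ((a + INR m + 2) * hbeta a (INR m + 1) rho * poch (a + 1) (S m))%C; [ring|].
    rewrite <- E. ring.
Qed.

(** All finite parts here are convergent integrals, and |(1-t)^(be+1) - 1| <= |be+1| t; the factor t
    raises the first exponent of the majorant by one. *)
Lemma hbeta_compare (al be : C) (rho : R) (m : nat) : 0 <= fst al -> 0 <= fst be -> 0 < rho <= 1 / 2 ->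
  Cmod (hbeta al (be + 1 + INR m) rho - hbeta al (RtoC (INR m)) rho) <=
  Cmod (be + 1) * Cmod (hbeta (RtoC (fst al + 1)) (RtoC (INR m)) rho).
Proof.
  intros Hal Hbe Hr. pose proof (pos_INR m) as Hm.
  assert (N1 : fp_regular al) by (apply fp_regular_Re; lra).
  assert (N2 : fp_regular (be + 1 + INR m)) by (apply fp_regular_Re; simpl; lra).
  assert (N3 : fp_regular (INR m)) by (apply fp_regular_Re; simpl; lra).
  assert (N4 : fp_regular (RtoC (fst al + 1))) by (apply fp_regular_Re; simpl; lra).
  pose proof (hbeta_spec al (be + 1 + INR m) rho N1 N2 Hr) as S1.
  pose proof (hbeta_spec al (INR m) rho N1 N3 Hr) as S2.
  pose proof (hbeta_spec (RtoC (fst al + 1)) (INR m) rho N4 N3 Hr) as S3.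
  set (V1 := hbeta al (be + 1 + INR m) rho) in *. set (V2 := hbeta al (INR m) rho) in *.
  set (V3 := hbeta (RtoC (fst al + 1)) (INR m) rho) in *.
  set (g := Cmod (be + 1)). assert (Hg : 0 <= g) by apply Cmod_ge_0.
  enough (HE : forall eps, 0 < eps -> Cmod (V1 - V2) <= g * Cmod V3 + eps).
  { destruct (Rle_lt_dec (Cmod (V1 - V2)) (g * Cmod V3)) as [Hc|Hc]; [exact Hc|].
    specialize (HE ((Cmod (V1 - V2) - g * Cmod V3) / 2) ltac:(lra)). lra. }
  intros eps He.
  (* The three integrals are replaced at the cost of [eta] twice and g times [eta] once. *)
  set (eta := eps / (g + 3)). assert (Heta : 0 < eta) by (apply Rdiv_lt_0_compat; lra).
  assert (Eeta : eps = (g + 3) * eta) by (unfold eta; field; lra).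
  destruct (fp_int_improper _ _ _ _ _ N1 N2 ltac:(lra) ltac:(simpl; lra) Hr S1 eta Heta) as [d1 [Hd1 P1]].
  destruct (fp_int_improper _ _ _ _ _ N1 N3 ltac:(lra) ltac:(simpl; lra) Hr S2 eta Heta) as [d2 [Hd2 P2]].
  destruct (fp_int_improper _ _ _ _ _ N4 N3 ltac:(simpl; lra) ltac:(simpl; lra) Hr S3 eta Heta) as [d3 [Hd3 P3]].
  set (x := Rmin (d1 / 2) (Rmin (d2 / 2) (Rmin (d3 / 2) (1 / 4)))).
  assert (Hx : 0 < x) by (unfold x; repeat apply Rmin_pos; lra).
  pose proof (Rmin_l (d1 / 2) (Rmin (d2 / 2) (Rmin (d3 / 2) (1 / 4)))) as M1.
  pose proof (Rmin_r (d1 / 2) (Rmin (d2 / 2) (Rmin (d3 / 2) (1 / 4)))) as M2. fold x in M1, M2.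
  pose proof (Rmin_l (d2 / 2) (Rmin (d3 / 2) (1 / 4))). pose proof (Rmin_r (d2 / 2) (Rmin (d3 / 2) (1 / 4))).
  pose proof (Rmin_l (d3 / 2) (1 / 4)). pose proof (Rmin_r (d3 / 2) (1 / 4)).
  destruct (P1 x ltac:(lra)) as [J1 [I1 E1]]. destruct (P2 x ltac:(lra)) as [J2 [I2 E2]].
  destruct (P3 x ltac:(lra)) as [J3 [I3 E3]].
  assert (HJ : Cmod (J1 - J2) <= g * fst J3).
  { apply (is_RIC_le (fun t => wt al (be + 1 + INR m)%C t * 1 - wt al (RtoC (INR m)) t * 1)%C
      (fun t => g * fst (wt (RtoC (fst al + 1)) (RtoC (INR m)) t * 1)%C) x (1 - x)); [lra| | |].
    - intros t Ht.
      assert (Et : (wt al (be + 1 + INR m)%C t * 1 - wt al (RtoC (INR m)) t * 1)%C =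
        (wt al (RtoC (INR m)) t * (Cpow_pos (1 - t) (be + 1)%C - 1))%C).
      { unfold wt. rewrite (Cpow_pos_plus (1 - t)). cring. }
      rewrite Et, Cmod_mult.
      assert (Ew : fst (wt (RtoC (fst al + 1)) (RtoC (INR m)) t * 1)%C = Cmod (wt al (RtoC (INR m)) t) * t).
      { unfold wt. toC. rewrite Cmod_mult, !Cpow_pos_nat, Cmod_R, Cmod_Cpow_pos by lra.
        assert (Ep : Cpow_pos t (RtoC (fst al + 1)) = RtoC (Rpower t (fst al) * t)).
        { unfold Cpow_pos. toC. rewrite <- RtoC_mult, Cexp_RtoC. f_equal.
          rewrite <- (Rpower_1 t) at 3 by lra. rewrite <- Rpower_plus. reflexivity. }
        rewrite Ep, <- RtoC_mult. simpl. rewrite Rabs_pos_eq by (apply pow_le; lra). ring. }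
      rewrite Ew.
      pose proof (Cpow_pos_near_1 (be + 1) t ltac:(simpl; lra) ltac:(lra)) as Q. fold g in Q.
      pose proof (Cmod_ge_0 (wt al (RtoC (INR m)) t)).
      apply Rle_trans with (Cmod (wt al (RtoC (INR m)) t) * (g * t)); [now apply Rmult_le_compat_l|right; ring].
    - now apply is_RIC_minus.
    - exact (is_RInt_scal _ _ _ g _ (proj1 I3)). }
  pose proof (Rabs_fst_le J3) as F3. pose proof (Rle_abs (fst J3)) as F4.
  pose proof (Cmod_le_minus J3 V3) as F5. rewrite Cmod_minus_sym in F5.
  replace (V1 - V2)%C with ((V1 - J1) + ((J1 - J2) + (J2 - V2)))%C by ring.
  eapply Rle_trans; [apply Cmod_triangle|].
  pose proof (Cmod_triangle (J1 - J2) (J2 - V2)) as T. rewrite (Cmod_minus_sym J2) in T.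
  assert (fst J3 <= Cmod V3 + eta) by lra.
  assert (g * fst J3 <= g * (Cmod V3 + eta)) by (apply Rmult_le_compat_l; lra). nra.
Qed.

Lemma fp_regular_gam_ok (a : C) : fp_regular a -> gam_ok (a + 1).
Proof. intros H n. apply H. Qed.

(* [m^(al+1) B(al+1, m+1)] is Gauss' sequence, and moving the second parameter by [be + 1] changes
   it by a relative [O(1/m)]. *)
Lemma gauss_hbeta_limit (al be : C) (rho : R) : 0 <= fst al -> 0 <= fst be -> 0 < rho <= 1 / 2 ->
  Ccv (fun m => Cpow_pos (INR m) (al + 1)%C * hbeta al (be + 1 + INR m) rho)%C (CGamma (al + 1)%C).
Proof.
  intros Hal Hbe Hr.
  assert (G1 : gam_ok (al + 1)) by (apply fp_regular_gam_ok, fp_regular_Re; lra).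
  assert (G2 : gam_ok (RtoC (fst al + 1) + 1)) by (apply fp_regular_gam_ok, fp_regular_Re; simpl; lra).
  destruct (CGamma_spec _ G1) as [L1 _]. destruct (CGamma_spec _ G2) as [L2 _].
  destruct (Ccv_bounded _ _ L2) as [B [HB HBb]].
  set (g := Cmod (be + 1)). assert (Hg : 0 <= g) by apply Cmod_ge_0.
  assert (E1 : forall m, (Cpow_pos (INR m) (al + 1)%C * hbeta al (RtoC (INR m)) rho)%C = gauss_seq (al + 1)%C m).
  { intros m. rewrite gauss_seq_eq, <- (hbeta_nat al rho m Hal Hr).
    pose proof (poch_gam_ok _ (S m) G1). cfield. assumption. }
  assert (L3 : Ccv (fun m => Cpow_pos (INR m) (al + 1)%C * (hbeta al (be + 1 + INR m) rho - hbeta al (RtoC (INR m)) rho))%C (RtoC 0)).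
  { intros eps He. destruct (INR_unbounded (g * B / eps)) as [N HN].
    exists (S N). intros m Hm. toC.
    assert (HmN : INR N < INR m) by (apply lt_INR; lia). pose proof (pos_INR N).
    assert (Hm0 : 0 < INR m) by lra.
    replace (_ - RtoC 0)%C with (Cpow_pos (INR m) (al + 1)%C * (hbeta al (be + 1 + INR m) rho - hbeta al (RtoC (INR m)) rho))%C
      by cring.
    rewrite Cmod_mult, Cmod_Cpow_pos.
    pose proof (hbeta_compare al be rho m Hal Hbe Hr) as Q. fold g in Q.
    pose proof (hbeta_nat (RtoC (fst al + 1)) rho m ltac:(simpl; lra) Hr) as W.
    assert (EK : Rpower (INR m) (fst (al + 1)%C) * Cmod (hbeta (RtoC (fst al + 1)) (INR m) rho) =
      Cmod (gauss_seq (RtoC (fst al + 1) + 1)%C m) * / INR m).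
    { rewrite gauss_seq_eq, <- W. pose proof (poch_gam_ok _ (S m) G2) as Hp.
      rewrite Cpow_pos_plus, Cpow_pos_1_r by exact Hm0.
      replace (hbeta (RtoC (fst al + 1)) (INR m) rho * poch (RtoC (fst al + 1) + 1) (S m) *
        (Cpow_pos (INR m) (RtoC (fst al + 1)) * INR m) / poch (RtoC (fst al + 1) + 1) (S m))%C with
        (hbeta (RtoC (fst al + 1)) (INR m) rho * Cpow_pos (INR m) (RtoC (fst al + 1)) * INR m)%C
        by (cfield; exact Hp).
      rewrite !Cmod_mult, Cmod_Cpow_pos, Cmod_R, Rabs_pos_eq by lra. simpl fst. field. lra. }
    assert (HP : 0 < Rpower (INR m) (fst (al + 1)%C)) by apply exp_pos.
    apply Rle_lt_trans with (g * (B * / INR m)).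
    - apply Rle_trans with (Rpower (INR m) (fst (al + 1)%C) * (g * Cmod (hbeta (RtoC (fst al + 1)) (INR m) rho))).
      + apply Rmult_le_compat_l; [lra|exact Q].
      + replace (Rpower (INR m) (fst (al + 1)%C) * (g * Cmod (hbeta (RtoC (fst al + 1)) (INR m) rho))) with
          (g * (Rpower (INR m) (fst (al + 1)%C) * Cmod (hbeta (RtoC (fst al + 1)) (INR m) rho))) by ring.
        rewrite EK. apply Rmult_le_compat_l; [exact Hg|]. apply Rmult_le_compat_r; [|apply HBb].
        left. now apply Rinv_0_lt_compat.
    - apply Rmult_lt_reg_r with (INR m / eps); [apply Rdiv_lt_0_compat; lra|].
      replace (g * (B * / INR m) * (INR m / eps)) with (g * B / eps) by (field; lra).
      replace (eps * (INR m / eps)) with (INR m) by (field; lra). lra. }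
  pose proof (Ccv_plus _ _ _ _ L1 L3) as P. replace (CGamma (al + 1)%C + RtoC 0)%C with (CGamma (al + 1)%C : C) in P by cring.
  eapply Ccv_ext; [|exact P]. intros m. cbv beta. rewrite <- E1. cring.
Qed.

Lemma hbeta_iter_r (a b : C) (rho : R) (n : nat) : fp_regular a -> fp_regular b -> 0 < rho <= 1 / 2 ->
  (poch (b + 1) n * hbeta a b rho = poch (a + b + 2) n * hbeta a (b + INR n) rho)%C.
Proof.
  intros Ha Hb Hr. induction n as [|n IH].
  - simpl. replace (b + 0)%C with b by ring. ring.
  - rewrite !poch_S, RtoC_INR_S.
    transitivity ((b + 1 + INR n) * (poch (b + 1) n * hbeta a b rho))%C; [ring|]. rewrite IH.
    pose proof (hbeta_rec_r a (b + INR n) rho Ha (fp_regular_plus_nat b n Hb) Hr) as E.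
    replace (b + (INR n + 1))%C with (b + INR n + 1)%C by ring.
    transitivity (poch (a + b + 2) n * ((b + INR n + 1) * hbeta a (b + INR n) rho))%C; [ring|].
    rewrite E. ring.
Qed.

(** By [hbeta_iter_r], m^(al+1) B(al+1, be+m+2) times Gauss' sequence at be+1 equals B(al+1, be+1)
    times Gauss' sequence at al+be+2; then m tends to infinity. *)
Lemma Beta_Re (al be : C) (rho : R) : 0 <= fst al -> 0 <= fst be -> 0 < rho <= 1 / 2 ->
  (hbeta al be rho * CGamma (al + be + 2)%C)%C = (CGamma (al + 1)%C * CGamma (be + 1)%C)%C.
Proof.
  intros Hal Hbe Hr.
  assert (Na : fp_regular al) by (apply fp_regular_Re; lra). assert (Nb : fp_regular be) by (apply fp_regular_Re; lra).
  assert (G2 : gam_ok (be + 1)) by (now apply fp_regular_gam_ok).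
  assert (G3 : gam_ok (al + be + 2)).
  { intros n E. apply (f_equal fst) in E. simpl in E. pose proof (pos_INR n). lra. }
  destruct (CGamma_spec _ G2) as [L2 _]. destruct (CGamma_spec _ G3) as [L3 _].
  pose proof (gauss_hbeta_limit al be rho Hal Hbe Hr) as L1.
  apply (Ccv_unique (fun m => hbeta al be rho * gauss_seq (al + be + 2)%C m)%C).
  - now apply Ccv_scal.
  - apply Ccv_ext_loc with (N := 1%nat) (2 := Ccv_mult _ _ _ _ L1 L2).
    intros m Hm. assert (Hm0 : 0 < INR m) by (apply lt_0_INR; lia).
    rewrite !gauss_seq_eq. pose proof (hbeta_iter_r al be rho (S m) Na Nb Hr) as E.
    pose proof (poch_gam_ok _ (S m) G2) as P2. pose proof (poch_gam_ok _ (S m) G3) as P3.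
    replace (be + INR (S m))%C with (be + 1 + INR m)%C in E by (rewrite RtoC_INR_S; ring).
    assert (E' : hbeta al (be + 1 + INR m) rho = (poch (be + 1) (S m) * hbeta al be rho / poch (al + be + 2) (S m))%C).
    { rewrite E. field. exact P3. }
    rewrite E'.
    replace (al + be + 2)%C with ((al + 1) + (be + 1))%C in * by ring.
    rewrite (Cpow_pos_plus _ (al + 1)%C (be + 1)%C). cfield. split; assumption.
Qed.

Lemma Beta_step_l (al be : C) (rho : R) : fp_regular al -> fp_regular be -> gam_ok (al + be + 2) -> 0 < rho <= 1 / 2 ->
  (hbeta (al + 1) be rho * CGamma (al + 1 + be + 2)%C)%C = (CGamma (al + 1 + 1)%C * CGamma (be + 1)%C)%C ->
  (hbeta al be rho * CGamma (al + be + 2)%C)%C = (CGamma (al + 1)%C * CGamma (be + 1)%C)%C.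
Proof.
  intros Na Nb Ng Hr H. pose proof (fp_regular_0 al Na) as Ha0.
  replace (al + 1 + be + 2)%C with (al + be + 2 + 1)%C in H by ring.
  rewrite (CGamma_S (al + be + 2) Ng), (CGamma_S (al + 1) (fp_regular_gam_ok al Na)) in H.
  pose proof (hbeta_rec_l al be rho Na Nb Hr) as E.
  transitivity (((al + 1) * hbeta al be rho) * CGamma (al + be + 2)%C / (al + 1))%C; [cfield; exact Ha0|].
  rewrite E.
  transitivity ((hbeta (al + 1) be rho * ((al + be + 2) * CGamma (al + be + 2)%C)) / (al + 1))%C; [cfield; exact Ha0|].
  rewrite H. cfield. exact Ha0.
Qed.

Lemma Beta_step_r (al be : C) (rho : R) : fp_regular al -> fp_regular be -> gam_ok (al + be + 2) -> 0 < rho <= 1 / 2 ->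
  (hbeta al (be + 1) rho * CGamma (al + (be + 1) + 2)%C)%C = (CGamma (al + 1)%C * CGamma (be + 1 + 1)%C)%C ->
  (hbeta al be rho * CGamma (al + be + 2)%C)%C = (CGamma (al + 1)%C * CGamma (be + 1)%C)%C.
Proof.
  intros Na Nb Ng Hr H. pose proof (fp_regular_0 be Nb) as Hb0.
  replace (al + (be + 1) + 2)%C with (al + be + 2 + 1)%C in H by ring.
  rewrite (CGamma_S (al + be + 2) Ng), (CGamma_S (be + 1) (fp_regular_gam_ok be Nb)) in H.
  pose proof (hbeta_rec_r al be rho Na Nb Hr) as E.
  transitivity (((be + 1) * hbeta al be rho) * CGamma (al + be + 2)%C / (be + 1))%C; [cfield; exact Hb0|].
  rewrite E.
  transitivity ((hbeta al (be + 1) rho * ((al + be + 2) * CGamma (al + be + 2)%C)) / (be + 1))%C; [cfield; exact Hb0|].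
  rewrite H. cfield. exact Hb0.
Qed.

(** The finite part obeys the same recurrences as the quotient of Gamma values, so the formula
    descends by unit shifts from nonnegative real parts. The inductions count the shifts still
    needed, in [al] for [W1] and in [be] for [W2]. *)
Lemma Beta_Gamma (al be : C) (rho : R) : fp_regular al -> fp_regular be -> gam_ok (al + be + 2) -> 0 < rho <= 1 / 2 ->
  (hbeta al be rho * CGamma (al + be + 2)%C)%C = (CGamma (al + 1)%C * CGamma (be + 1)%C)%C.
Proof.
  intros Na Nb Ng Hr.
  assert (W1 : forall (n : nat) (al be : C), fp_regular al -> fp_regular be -> gam_ok (al + be + 2) ->
    0 <= fst al + INR n -> 0 <= fst be ->
    (hbeta al be rho * CGamma (al + be + 2)%C)%C = (CGamma (al + 1)%C * CGamma (be + 1)%C)%C).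
  { clear al be Na Nb Ng. induction n as [|n IH]; intros al be Na Nb Ng H1 H2.
    - simpl in H1. rewrite Rplus_0_r in H1. now apply Beta_Re.
    - apply Beta_step_l; try assumption. apply IH; try assumption.
      + now apply fp_regular_S.
      + replace (al + 1 + be + 2)%C with (al + be + 2 + 1)%C by ring. now apply gam_ok_S.
      + rewrite S_INR in H1. simpl. lra. }
  assert (W2 : forall (n : nat) (al be : C), fp_regular al -> fp_regular be -> gam_ok (al + be + 2) ->
    0 <= fst be + INR n ->
    (hbeta al be rho * CGamma (al + be + 2)%C)%C = (CGamma (al + 1)%C * CGamma (be + 1)%C)%C).
  { clear al be Na Nb Ng. induction n as [|n IH]; intros al be Na Nb Ng H1.
    - destruct (INR_unbounded (- fst al)) as [N HN].
      simpl in H1. rewrite Rplus_0_r in H1. apply (W1 N); try assumption. lra.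
    - apply Beta_step_r; try assumption. apply IH; try assumption.
      + now apply fp_regular_S.
      + replace (al + (be + 1) + 2)%C with (al + be + 2 + 1)%C by ring. now apply gam_ok_S.
      + rewrite S_INR in H1. simpl. lra. }
  destruct (INR_unbounded (- fst be)) as [N HN]. apply (W2 N); try assumption. lra.
Qed.

(* The finite part of [p_n^2 w]. *)
Definition sqnorm (al be : C) (rho : R) (n : nat) : C :=
  (pc n al be n * pmoment n al be (fun i => hbeta (al + INR i) be rho) n)%C.

(** * The square norms of the polynomials *)

Lemma hbeta_neq_0 (al be : C) (rho : R) : fp_regular al -> fp_regular be -> gam_ok (al + be + 2) -> 0 < rho <= 1 / 2 ->
  hbeta al be rho <> 0.
Proof.
  intros Na Nb Ng Hr E. pose proof (Beta_Gamma al be rho Na Nb Ng Hr) as H. rewrite E in H.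
  pose proof (proj2 (CGamma_spec _ (fp_regular_gam_ok al Na))) as H1.
  pose proof (proj2 (CGamma_spec _ (fp_regular_gam_ok be Nb))) as H2.
  apply (Cmult_neq_0 _ _ H1 H2). rewrite <- H. cring.
Qed.

(** The middle factor is, up to sign, the leading coefficient of p_(n+1), so it cancels in the
    square norm. *)
Lemma poch_split (s : C) (n : nat) :
  poch (s + 2) (2 * S n) = (poch (s + 2) n * (poch (s + INR (S n) + 1) (S n) * (s + 2 * INR (S n) + 1)))%C.
Proof.
  replace (2 * S n)%nat with (n + S (S n))%nat by lia. rewrite poch_add, (poch_S _ (S n)).
  replace (s + 2 + INR n)%C with (s + INR (S n) + 1)%C by (rewrite RtoC_INR_S; ring). ring.
Qed.

Lemma sqnorm_0 (al be : C) (rho : R) : sqnorm al be rho 0 = hbeta al be rho.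
Proof.
  unfold sqnorm, pmoment; simpl. replace (al + 0)%C with al by ring. cring.
Qed.

(** Index 0 is set apart because 2n + al + be + 1 may vanish there; for larger n this is excluded by
    the condition on al + be. *)
Lemma sqnorm_S (al be : C) (rho : R) (n : nat) : fp_regular al -> fp_regular be -> gam_ok (al + be + 2) -> 0 < rho <= 1 / 2 ->
  sqnorm al be rho (S n) =
  (INR (fact (S n)) * poch (al + 1) (S n) * poch (be + 1) (S n) * hbeta al be rho /
    (poch (al + be + 2) n * (al + be + 2 * INR (S n) + 1)))%C /\
  (al + be + 2 * INR (S n) + 1)%C <> 0.
Proof.
  intros Na Nb Ng Hr. unfold sqnorm.
  pose proof (pmoment_diag (S n) al be _ (hbeta_moment_rec al be rho Na Nb Hr)) as D.
  rewrite poch_split in D. simpl (INR 0) in D. replace (al + 0)%C with al in D by ring.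
  pose proof (poch_gam_ok _ n Ng) as P1.
  assert (P2 : poch (al + be + INR (S n) + 1) (S n) <> 0).
  { apply poch_neq_0. intros k _ E. apply (Ng (n + k)%nat). rewrite <- E, RtoC_INR_plus, RtoC_INR_S. ring. }
  assert (P3 : (al + be + 2 * INR (S n) + 1)%C <> 0).
  { intros E. apply (Ng (n + S n)%nat). rewrite <- E, RtoC_INR_plus, RtoC_INR_S. ring. }
  split; [|exact P3].
  rewrite pc_lead.
  set (M := pmoment (S n) al be (fun i => hbeta (al + INR i) be rho) (S n)) in *.
  assert (S1 : ((-(1)) ^ S n * (-(1)) ^ S n)%C = 1).
  { rewrite <- Cpow_mult_l. replace ((-(1)) * (-(1)))%C with (RtoC 1) by ring. apply Cpow_1_l. }
  transitivity ((-(1)) ^ S n * (poch (al + be + 2) n * (poch (al + be + INR (S n) + 1) (S n) *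
     (al + be + 2 * INR (S n) + 1)) * M) / (poch (al + be + 2) n * (al + be + 2 * INR (S n) + 1)))%C.
  - field. split; assumption.
  - rewrite D.
    transitivity (((-(1)) ^ S n * (-(1)) ^ S n) * (INR (fact (S n)) * poch (al + 1) (S n) * poch (be + 1) (S n) * hbeta al be rho) /
    (poch (al + be + 2) n * (al + be + 2 * INR (S n) + 1)))%C; [field; split; assumption|].
    rewrite S1. field. split; assumption.
Qed.

Lemma a_coef_eq (al be : C) (rho : R) (n : nat) : fp_regular al -> fp_regular be -> gam_ok (al + be + 2) -> 0 < rho <= 1 / 2 ->
  a_coef al be n = sqnorm al be rho n.
Proof.
  intros Na Nb Ng Hr.
  pose proof (Beta_Gamma al be rho Na Nb Ng Hr) as HB.
  pose proof (proj2 (CGamma_spec _ Ng)) as HG0.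
  assert (HK : hbeta al be rho = (CGamma (al + 1)%C * CGamma (be + 1)%C / CGamma (al + be + 2)%C)%C).
  { rewrite <- HB. cfield. exact HG0. }
  assert (Main : (al + be + INR (2 * n + 1))%C <> 0 ->
    (INR (fact n) * (CGamma (al + INR (n + 1))%C * CGamma (be + INR (n + 1))%C) /
      ((al + be + INR (2 * n + 1)) * CGamma (al + be + INR (n + 1))%C))%C = sqnorm al be rho n).
  { intros Hs.
    assert (Ea : CGamma (al + INR (n + 1))%C = (poch (al + 1) n * CGamma (al + 1)%C)%C).
    { rewrite <- CGamma_poch by (now apply fp_regular_gam_ok). f_equal. rewrite RtoC_INR_plus. simpl. ring. }
    assert (Eb : CGamma (be + INR (n + 1))%C = (poch (be + 1) n * CGamma (be + 1)%C)%C).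
    { rewrite <- CGamma_poch by (now apply fp_regular_gam_ok). f_equal. rewrite RtoC_INR_plus. simpl. ring. }
    rewrite Ea, Eb. destruct n as [|n].
    - rewrite sqnorm_0, HK. simpl (INR (2 * 0 + 1)) in *. simpl (INR (0 + 1)).
      assert (G1 : gam_ok (al + be + 1)).
      { intros [|k] E; [apply Hs; rewrite <- E; simpl; ring|].
        apply (Ng k). rewrite <- E, RtoC_INR_S. ring. }
      pose proof (CGamma_S _ G1) as E2. replace (al + be + 1 + 1)%C with (al + be + 2)%C in E2 by ring.
      pose proof (proj2 (CGamma_spec _ G1)) as HG1.
      rewrite E2. simpl. cfield. split; assumption.
    - destruct (sqnorm_S al be rho n Na Nb Ng Hr) as [-> P3]. rewrite HK.
      assert (E2 : CGamma (al + be + INR (S n + 1))%C = (poch (al + be + 2) n * CGamma (al + be + 2)%C)%C).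
      { rewrite <- CGamma_poch by exact Ng. f_equal. rewrite RtoC_INR_plus, RtoC_INR_S. simpl. ring. }
      assert (E3 : (al + be + INR (2 * S n + 1))%C = (al + be + 2 * INR (S n) + 1)%C).
      { rewrite RtoC_INR_plus, RtoC_INR_mult. replace (INR 2) with 2 by (simpl; ring). change (INR 1) with 1. ring. }
      rewrite E2, E3. pose proof (poch_gam_ok _ n Ng). cfield. repeat split; assumption. }
  unfold a_coef. cbv zeta. toC.
  (* The branch where 2n + al + be + 1 is 0 forces n = 0; its value is B(al+1, be+1), in agreement
     with [sqnorm_0]. *)
  destruct (Req_EM_T (fst (al + be + INR (2 * n + 1))%C) 0) as [H1|H1].
  - destruct (Req_EM_T (snd (al + be + INR (2 * n + 1))%C) 0) as [H2|H2].
    + assert (Hn : n = O).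
      { destruct n as [|n]; [reflexivity|]. exfalso. apply (Ng (n + S n)%nat).
        transitivity (al + be + INR (2 * S n + 1))%C.
        - rewrite !RtoC_INR_plus, RtoC_INR_mult, RtoC_INR_S. replace (INR 2) with 2 by (simpl; ring).
          change (INR 1) with 1. ring.
        - apply injective_projections; [exact H1|exact H2]. }
      subst n. rewrite sqnorm_0, HK. reflexivity.
    + apply Main. intros E. apply H2. rewrite E. reflexivity.
  - apply Main. intros E. apply H1. rewrite E. reflexivity.
Qed.

Lemma root_gt_1 (q : R) (k : nat) : 1 < q -> exists p, 1 < p /\ p ^ (S k) = q.
Proof.
  intros Hq. pose proof (INR_S_pos k) as Hk.
  exists (Rpower q (/ INR (S k))). split.
  - rewrite <- (Rpower_O q) by lra. apply Rpower_lt; [exact Hq|now apply Rinv_0_lt_compat].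
  - rewrite <- Rpower_pow by apply exp_pos. rewrite Rpower_mult, Rinv_l, Rpower_1 by lra. reflexivity.
Qed.

(** In [sqnorm_S] the numerator has n! and two Pochhammer symbols of size n!, the denominator one of
    size (n-1)! and a linear factor. So the square norm has the size n!^2 up to subexponential
    factors, and it is nonzero because the Beta value is. *)
Lemma sqnorm_lower (al be : C) (rho q : R) : fp_regular al -> fp_regular be -> gam_ok (al + be + 2) -> 0 < rho <= 1 / 2 -> 1 < q ->
  exists K, 0 < K /\ forall n, sqnorm al be rho n <> 0 /\
    INR (fact n) * INR (fact n) <= K * Cmod (sqnorm al be rho n) * q ^ n.
Proof.
  intros Na Nb Ng Hr Hq.
  (* Each of the three Pochhammer estimates loses p^n, and q = p^3. *)
  destruct (root_gt_1 q 2 Hq) as [p [Hp Epq]].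
  destruct (fact_le_poch (al + 1) p (fp_regular_gam_ok al Na) Hp) as [Ka [HKa Ba]].
  destruct (fact_le_poch (be + 1) p (fp_regular_gam_ok be Nb) Hp) as [Kb [HKb Bb]].
  destruct (poch_le_fact (al + be + 2) p Hp) as [Ks [HKs Bs]].
  pose proof (hbeta_neq_0 al be rho Na Nb Ng Hr) as HK. pose proof (proj1 (Cmod_gt_0 _) HK) as HKp.
  set (k := Cmod (hbeta al be rho)) in *. set (s := Cmod (al + be)).
  assert (Hs : 0 <= s) by apply Cmod_ge_0.
  set (K' := Ka * Kb * (Ks * (s + 3)) / k).
  assert (HK' : 0 < K') by (unfold K'; apply Rdiv_lt_0_compat; [repeat apply Rmult_lt_0_compat; lra|exact HKp]).
  assert (Hik : 0 < / k) by (now apply Rinv_0_lt_compat).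
  exists (K' + / k). split; [lra|]. intros [|n].
  - rewrite sqnorm_0. split; [exact HK|]. fold k. simpl.
    replace ((K' + / k) * k * 1) with (K' * k + 1) by (field; lra).
    assert (0 < K' * k) by nra. lra.
  - destruct (sqnorm_S al be rho n Na Nb Ng Hr) as [E P3].
    pose proof (poch_gam_ok _ n Ng) as P1.
    pose proof (poch_gam_ok _ (S n) (fp_regular_gam_ok al Na)) as P4.
    pose proof (poch_gam_ok _ (S n) (fp_regular_gam_ok be Nb)) as P5.
    assert (HD : (poch (al + be + 2) n * (al + be + 2 * INR (S n) + 1))%C <> 0) by (now apply Cmult_neq_0).
    assert (E1 : Cmod (sqnorm al be rho (S n)) * (Cmod (poch (al + be + 2) n) * Cmod (al + be + 2 * INR (S n) + 1)) =
      INR (fact (S n)) * Cmod (poch (al + 1) (S n)) * Cmod (poch (be + 1) (S n)) * k).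
    { transitivity (Cmod (INR (fact (S n)) * poch (al + 1) (S n) * poch (be + 1) (S n) * hbeta al be rho)).
      - rewrite <- !Cmod_mult, E. f_equal. field. split; assumption.
      - rewrite !Cmod_mult, Cmod_R, Rabs_pos_eq by apply pos_INR. reflexivity. }
    split.
    { rewrite E. unfold Complex.Cdiv. apply Cmult_neq_0.
      - apply Cmult_neq_0; [apply Cmult_neq_0; [apply Cmult_neq_0|]|]; try assumption. apply RtoC_fact_neq_0.
      - intros Z. apply (f_equal Cmod) in Z. rewrite Cmod_inv, Cmod_0 in Z by exact HD.
        apply Cmod_gt_0 in HD. apply Rinv_0_lt_compat in HD. lra. }
    specialize (Ba (S n)). specialize (Bb (S n)). specialize (Bs n).
    apply Cmod_gt_0 in P1, P3, P4, P5.
    set (x := Cmod (sqnorm al be rho (S n))) in *. set (pa := Cmod (poch (al + 1) (S n))) in *.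
    set (pb := Cmod (poch (be + 1) (S n))) in *. set (ps := Cmod (poch (al + be + 2) n)) in *.
    set (F := INR (fact (S n))) in *. assert (HF : 0 < F) by apply INR_fact_lt_0.
    assert (BD : Cmod (al + be + 2 * INR (S n) + 1) <= (s + 3) * INR (S n)).
    { pose proof (Cmod_triangle (al + be + 2 * INR (S n)) 1) as T1.
      pose proof (Cmod_triangle (al + be) (2 * INR (S n))) as T2.
      rewrite Cmod_1 in T1. rewrite Cmod_mult, !Cmod_R, !Rabs_pos_eq in T2 by (try apply pos_INR; lra).
      fold s in T2. assert (1 <= INR (S n)) by (rewrite S_INR; pose proof (pos_INR n); lra). nra. }
    set (dd := Cmod (al + be + 2 * INR (S n) + 1)) in *.
    assert (Hpn : 0 < p ^ S n) by (apply pow_lt; lra).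
    assert (Hpn' : p ^ n <= p ^ S n) by (apply Rle_pow; [lra|lia]).
    assert (BPS : ps * dd <= Ks * (s + 3) * F * p ^ S n).
    { apply Rle_trans with ((Ks * INR (fact n) * p ^ S n) * ((s + 3) * INR (S n))).
      - apply Rmult_le_compat; try lra. eapply Rle_trans; [exact Bs|].
        apply Rmult_le_compat_l; [|exact Hpn']. apply Rmult_le_pos; [lra|apply pos_INR].
      - right. unfold F. rewrite fact_simpl, mult_INR. ring. }
    assert (Hq' : q ^ S n = p ^ S n * p ^ S n * p ^ S n).
    { rewrite <- Epq, <- pow_mult. replace (3 * S n)%nat with (S n + S n + S n)%nat by lia.
      now rewrite !pow_add. }
    assert (Hpd : 0 < ps * dd) by nra.
    assert (Hx : 0 <= x) by apply Cmod_ge_0.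
    apply Rle_trans with (K' * x * q ^ S n).
    + apply Rmult_le_reg_r with (ps * dd); [exact Hpd|].
      apply Rle_trans with ((Ka * pa * p ^ S n) * (Kb * pb * p ^ S n) * (Ks * (s + 3) * F * p ^ S n)).
      * apply Rmult_le_compat; [nra|lra| |exact BPS]. apply Rmult_le_compat; lra.
      * right. rewrite Hq'. unfold K'.
        replace (Ka * Kb * (Ks * (s + 3)) / k * x * (p ^ S n * p ^ S n * p ^ S n) * (ps * dd)) with
          (Ka * Kb * (Ks * (s + 3)) / k * (p ^ S n * p ^ S n * p ^ S n) * (x * (ps * dd))) by ring.
        rewrite E1. field. lra.
    + apply Rmult_le_compat_r; [rewrite Hq'; nra|]. nra.
Qed.

(** * Goursat's theorem *)

Definition ccont (F : C -> C) (z : C) : Prop :=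
  forall eps, 0 < eps -> exists del, 0 < del /\ forall u, Cmod (u - z) < del -> Cmod (F u - F z) < eps.

(* Caratheodory's form of differentiability, for which the chain rule is immediate. *)
Definition cdiff (F : C -> C) (z : C) : Prop :=
  exists Phi : C -> C, ccont Phi z /\ forall u, F u = (F z + Phi u * (u - z))%C.

Lemma ccont_const (c z : C) : ccont (fun _ => c) z.
Proof.
  intros eps He. exists 1. split; [lra|]. intros u _.
  replace (c - c)%C with (RtoC 0) by ring. now rewrite Cmod_0.
Qed.

Lemma ccont_id (z : C) : ccont (fun u => u) z.
Proof. intros eps He. exists eps. split; [exact He|auto]. Qed.

Lemma ccont_plus (F G : C -> C) (z : C) : ccont F z -> ccont G z -> ccont (fun u => F u + G u)%C z.
Proof.
  intros HF HG eps He. destruct (HF (eps / 2) ltac:(lra)) as [d1 [Hd1 H1]].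
  destruct (HG (eps / 2) ltac:(lra)) as [d2 [Hd2 H2]].
  exists (Rmin d1 d2). split; [now apply Rmin_pos|]. intros u Hu.
  specialize (H1 u (Rlt_le_trans _ _ _ Hu (Rmin_l _ _))). specialize (H2 u (Rlt_le_trans _ _ _ Hu (Rmin_r _ _))).
  replace (F u + G u - (F z + G z))%C with ((F u - F z) + (G u - G z))%C by ring.
  eapply Rle_lt_trans; [apply Cmod_triangle|]. lra.
Qed.

Lemma ccont_mult (F G : C -> C) (z : C) : ccont F z -> ccont G z -> ccont (fun u => F u * G u)%C z.
Proof.
  intros HF HG eps He.
  pose proof (Cmod_ge_0 (F z)) as PF. pose proof (Cmod_ge_0 (G z)) as PG.
  set (A := Cmod (F z) + 1). set (B := Cmod (G z) + 1).
  destruct (HF (Rmin 1 (eps / (2 * B)))) as [d1 [Hd1 H1]].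
  { apply Rmin_pos; [lra|apply Rdiv_lt_0_compat; unfold B; lra]. }
  destruct (HG (eps / (2 * A))) as [d2 [Hd2 H2]].
  { apply Rdiv_lt_0_compat; unfold A; lra. }
  exists (Rmin d1 d2). split; [now apply Rmin_pos|]. intros u Hu.
  specialize (H1 u (Rlt_le_trans _ _ _ Hu (Rmin_l _ _))). specialize (H2 u (Rlt_le_trans _ _ _ Hu (Rmin_r _ _))).
  pose proof (Rmin_l 1 (eps / (2 * B))). pose proof (Rmin_r 1 (eps / (2 * B))).
  replace (F u * G u - F z * G z)%C with (F u * (G u - G z) + (F u - F z) * G z)%C by ring.
  eapply Rle_lt_trans; [apply Cmod_triangle|]. rewrite !Cmod_mult.
  assert (HA : Cmod (F u) <= A) by (pose proof (Cmod_le_minus (F u) (F z)); unfold A; lra).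
  assert (Cmod (F u) * Cmod (G u - G z) <= A * Cmod (G u - G z))
    by (apply Rmult_le_compat_r; [apply Cmod_ge_0|exact HA]).
  assert (A * Cmod (G u - G z) < A * (eps / (2 * A))) by (apply Rmult_lt_compat_l; unfold A in *; lra).
  replace (A * (eps / (2 * A))) with (eps / 2) in * by (field; unfold A; lra).
  assert (Cmod (F u - F z) * Cmod (G z) <= Cmod (F u - F z) * B)
    by (apply Rmult_le_compat_l; [apply Cmod_ge_0|unfold B; lra]).
  assert (Cmod (F u - F z) * B < eps / (2 * B) * B) by (apply Rmult_lt_compat_r; unfold B in *; lra).
  replace (eps / (2 * B) * B) with (eps / 2) in * by (field; unfold B; lra). lra.
Qed.

Lemma ccont_comp (F G : C -> C) (z : C) : ccont G z -> ccont F (G z) -> ccont (fun u => F (G u)) z.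
Proof.
  intros HG HF eps He. destruct (HF eps He) as [d1 [Hd1 H1]]. destruct (HG d1 Hd1) as [d2 [Hd2 H2]].
  exists d2. split; [exact Hd2|]. intros u Hu. apply H1, H2, Hu.
Qed.

Lemma cdiff_ccont (F : C -> C) (z : C) : cdiff F z -> ccont F z.
Proof.
  intros [Phi [HP E]].
  assert (H : ccont (fun u => F z + Phi u * (u + - z))%C z).
  { apply ccont_plus; [apply ccont_const|]. apply ccont_mult; [exact HP|].
    apply ccont_plus; [apply ccont_id|apply ccont_const]. }
  intros eps He. destruct (H eps He) as [d [Hd Hu]]. exists d. split; [exact Hd|].
  intros u Hud. specialize (Hu u Hud). cbv beta in Hu.
  replace (F u - F z)%C with (F z + Phi u * (u + - z) - (F z + Phi z * (z + - z)))%C; [exact Hu|].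
  rewrite (E u). ring.
Qed.

Lemma cdiff_const (c z : C) : cdiff (fun _ => c) z.
Proof. exists (fun _ => RtoC 0). split; [apply ccont_const|]. intros; ring. Qed.

Lemma cdiff_id (z : C) : cdiff (fun u => u) z.
Proof. exists (fun _ => RtoC 1). split; [apply ccont_const|]. intros; ring. Qed.

Lemma cdiff_plus (F G : C -> C) (z : C) : cdiff F z -> cdiff G z -> cdiff (fun u => F u + G u)%C z.
Proof.
  intros [P [HP EP]] [Q [HQ EQ]]. exists (fun u => P u + Q u)%C. split; [now apply ccont_plus|].
  intros u. rewrite (EP u), (EQ u). ring.
Qed.

Lemma cdiff_mult (F G : C -> C) (z : C) : cdiff F z -> cdiff G z -> cdiff (fun u => F u * G u)%C z.
Proof.
  intros HF HG. pose proof (cdiff_ccont G z HG) as CG.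
  destruct HF as [P [HP EP]]. destruct HG as [Q [HQ EQ]].
  exists (fun u => P u * G u + F z * Q u)%C. split.
  - apply ccont_plus; apply ccont_mult; try assumption. apply ccont_const.
  - intros u. rewrite (EP u), (EQ u). ring.
Qed.

Lemma cdiff_comp (F G : C -> C) (z : C) : cdiff G z -> cdiff F (G z) -> cdiff (fun u => F (G u)) z.
Proof.
  intros HG. pose proof (cdiff_ccont G z HG) as CG.
  destruct HG as [Q [HQ EQ]]. intros [P [HP EP]].
  exists (fun u => P (G u) * Q u)%C. split.
  - apply ccont_mult; [|exact HQ]. now apply ccont_comp.
  - intros u. rewrite (EP (G u)), (EQ u). ring.
Qed.

Lemma cdiff_intro (F : C -> C) (z l : C) :
  (forall eps, 0 < eps -> exists del, 0 < del /\ forall u, u <> z -> Cmod (u - z) < del ->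
     Cmod ((F u - F z) / (u - z) - l) < eps) -> cdiff F z.
Proof.
  intros H. exists (fun u => if excluded_middle_informative (u = z) then l else ((F u - F z) / (u - z))%C).
  split.
  - intros eps He. destruct (H eps He) as [d [Hd Hu]]. exists d. split; [exact Hd|]. intros u Hud.
    destruct (excluded_middle_informative (z = z)) as [_|N]; [|now elim N].
    destruct (excluded_middle_informative (u = z)) as [E|N].
    + replace (l - l)%C with (RtoC 0) by ring. now rewrite Cmod_0.
    + now apply Hu.
  - intros u. destruct (excluded_middle_informative (u = z)) as [->|N]; [ring|].
    field. intros E. apply N. transitivity ((u - z) + z)%C; [ring|]. rewrite E. ring.
Qed.

Lemma cdiff_Cexp (z : C) : cdiff Cexp z.
Proof.
  apply (cdiff_intro Cexp z (Cexp z)). intros eps He.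
  pose proof (proj1 (Cmod_gt_0 _) (Cexp_neq_0 z)) as HE. set (E := Cmod (Cexp z)) in *.
  exists (Rmin 1 (eps / (3 * E))). split; [apply Rmin_pos; [lra|apply Rdiv_lt_0_compat; lra]|].
  intros u Hne Hu. pose proof (Rmin_l 1 (eps / (3 * E))). pose proof (Rmin_r 1 (eps / (3 * E))).
  set (h := (u - z)%C) in *.
  assert (Hh : h <> 0).
  { intros Eh. apply Hne. transitivity (h + z)%C; [unfold h; ring|]. rewrite Eh. ring. }
  assert (Eu : Cexp u = (Cexp z * Cexp h)%C) by (rewrite <- Cexp_plus; f_equal; unfold h; ring).
  rewrite Eu.
  replace ((Cexp z * Cexp h - Cexp z) / h - Cexp z)%C with (Cexp z * ((Cexp h - 1 - h) / h))%C
    by (cfield; exact Hh).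
  rewrite Cmod_mult, Cmod_div by exact Hh. fold E.
  pose proof (Cexp_taylor2 h ltac:(lra)) as T. apply Cmod_gt_0 in Hh.
  apply Rle_lt_trans with (E * (3 * Cmod h)).
  - apply Rmult_le_compat_l; [lra|]. apply Rmult_le_reg_r with (Cmod h); [exact Hh|].
    unfold Rdiv. rewrite Rmult_assoc, Rinv_l by lra. lra.
  - apply Rlt_le_trans with (E * (3 * (eps / (3 * E)))).
    + apply Rmult_lt_compat_l; lra.
    + right. field. lra.
Qed.

Lemma ccont_horizontal (F : C -> C) (x y : R) : ccont F (x, y) -> contC (fun t => F (t, y)) x.
Proof.
  intros H. apply contC_eps. intros eps He. destruct (H eps He) as [d [Hd Hu]].
  exists d. split; [exact Hd|]. intros t Ht. apply Hu.
  eapply Rle_lt_trans; [apply Cmod_le_sum|]. simpl.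
  replace (y + - y) with 0 by ring. rewrite Rabs_R0. unfold Rminus in Ht. lra.
Qed.

Lemma ccont_vertical (F : C -> C) (x y : R) : ccont F (x, y) -> contC (fun t => F (x, t)) y.
Proof.
  intros H. apply contC_eps. intros eps He. destruct (H eps He) as [d [Hd Hu]].
  exists d. split; [exact Hd|]. intros t Ht. apply Hu.
  eapply Rle_lt_trans; [apply Cmod_le_sum|]. simpl.
  replace (x + - x) with 0 by ring. rewrite Rabs_R0. unfold Rminus in Ht. lra.
Qed.

(** * Integrals over the boundary of a rectangle *)

Definition RIC (g : R -> C) (a b : R) : C := (RInt (fun t => fst (g t)) a b, RInt (fun t => snd (g t)) a b).

Lemma RIC_unique (g : R -> C) (a b : R) (I : C) : is_RIC g a b I -> RIC g a b = I.
Proof.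
  intros [H1 H2]. unfold RIC. rewrite (is_RInt_unique _ _ _ _ H1), (is_RInt_unique _ _ _ _ H2).
  now destruct I.
Qed.

Lemma RIC_correct (g : R -> C) (a b : R) : a <= b ->
  (forall x, a <= x <= b -> contC g x) -> is_RIC g a b (RIC g a b).
Proof.
  intros Hab H. destruct (ex_RIC g a b) as [I HI].
  - intros x Hx. rewrite Rmin_left, Rmax_right in Hx by exact Hab. now apply H.
  - now rewrite (RIC_unique _ _ _ _ HI).
Qed.

Definition Rect (F : C -> C) (a b c d : R) : C :=
  (RIC (fun x => F (x, c)) a b + Ci * RIC (fun y => F (b, y)) c d
   - RIC (fun x => F (x, d)) a b - Ci * RIC (fun y => F (a, y)) c d)%C.

Definition cont_rect (F : C -> C) (a b c d : R) : Prop :=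
  forall x y, a <= x <= b -> c <= y <= d -> ccont F (x, y).

Lemma RIC_Chasles (g : R -> C) (a m b : R) : a <= m <= b ->
  (forall x, a <= x <= b -> contC g x) -> RIC g a b = (RIC g a m + RIC g m b)%C.
Proof.
  intros Hm H. apply RIC_unique. apply is_RIC_Chasles with m; apply RIC_correct; try lra;
    intros x Hx; apply H; lra.
Qed.

Lemma Rect_split_x (F : C -> C) (a m b c d : R) : a <= m <= b -> c <= d -> cont_rect F a b c d ->
  Rect F a b c d = (Rect F a m c d + Rect F m b c d)%C.
Proof.
  intros Hm Hcd H. unfold Rect.
  rewrite (RIC_Chasles (fun x => F (x, c)) a m b), (RIC_Chasles (fun x => F (x, d)) a m b); [ring| | | |];
    try exact Hm; intros x Hx; apply ccont_horizontal; apply H; lra.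
Qed.

Lemma Rect_split_y (F : C -> C) (a b c m d : R) : a <= b -> c <= m <= d -> cont_rect F a b c d ->
  Rect F a b c d = (Rect F a b c m + Rect F a b m d)%C.
Proof.
  intros Hab Hm H. unfold Rect.
  rewrite (RIC_Chasles (fun y => F (a, y)) c m d), (RIC_Chasles (fun y => F (b, y)) c m d); [ring| | | |];
    try exact Hm; intros y Hy; apply ccont_vertical; apply H; lra.
Qed.

Lemma Rect_quarter (F : C -> C) (a b c d : R) : a <= b -> c <= d -> cont_rect F a b c d ->
  exists a' b' c' d', a <= a' /\ b' <= b /\ c <= c' /\ d' <= d /\
    b' - a' = (b - a) / 2 /\ d' - c' = (d - c) / 2 /\
    Cmod (Rect F a b c d) <= 4 * Cmod (Rect F a' b' c' d').
Proof.
  intros Hab Hcd H. set (m := (a + b) / 2). set (n := (c + d) / 2).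
  assert (Hm : a <= m <= b) by (unfold m; lra). assert (Hn : c <= n <= d) by (unfold n; lra).
  assert (E : Rect F a b c d = (Rect F a m c n + Rect F a m n d + (Rect F m b c n + Rect F m b n d))%C).
  { rewrite (Rect_split_x F a m b c d Hm Hcd H).
    rewrite (Rect_split_y F a m c n d), (Rect_split_y F m b c n d); [reflexivity|lra|exact Hn| |lra|exact Hn|];
      intros x y Hx Hy; apply H; lra. }
  pose proof (Cmod_triangle (Rect F a m c n + Rect F a m n d) (Rect F m b c n + Rect F m b n d)) as T1.
  pose proof (Cmod_triangle (Rect F a m c n) (Rect F a m n d)) as T2.
  pose proof (Cmod_triangle (Rect F m b c n) (Rect F m b n d)) as T3.
  rewrite <- E in T1.
  set (X := Cmod (Rect F a b c d)) in *.
  destruct (Rle_dec X (4 * Cmod (Rect F a m c n))) as [H1|H1];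
    [exists a, m, c, n; unfold m, n in *; repeat split; try lra; exact H1|].
  destruct (Rle_dec X (4 * Cmod (Rect F a m n d))) as [H2|H2];
    [exists a, m, n, d; unfold m, n in *; repeat split; try lra; exact H2|].
  destruct (Rle_dec X (4 * Cmod (Rect F m b c n))) as [H3|H3];
    [exists m, b, c, n; unfold m, n in *; repeat split; try lra; exact H3|].
  exists m, b, n, d. unfold m, n in *. repeat split; lra.
Qed.

Lemma nested_intervals (a b : nat -> R) :
  (forall n, a n <= a (S n)) -> (forall n, b (S n) <= b n) -> (forall n, a n <= b n) ->
  exists p, forall n, a n <= p <= b n.
Proof.
  intros Ha Hb Hab.
  assert (Ma : forall n m, (n <= m)%nat -> a n <= a m).
  { intros n m H. induction H as [|m H IH]; [lra|]. specialize (Ha m). lra. }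
  assert (Mb : forall n m, (n <= m)%nat -> b m <= b n).
  { intros n m H. induction H as [|m H IH]; [lra|]. specialize (Hb m). lra. }
  assert (Hall : forall n m, a n <= b m).
  { intros n m. specialize (Ma n (max n m) ltac:(lia)). specialize (Mb m (max n m) ltac:(lia)).
    specialize (Hab (max n m)). lra. }
  destruct (ex_finite_lim_seq_incr a (b O) Ha) as [p Hp]; [intros; apply Hall|].
  exists p. intros n. split.
  - now apply (is_lim_seq_incr_compare a p).
  - apply (is_lim_seq_le a (fun _ => b n) p (b n)); [intros; apply Hall|exact Hp|apply is_lim_seq_const].
Qed.

(** An affine function has the primitive [G], whose increments along the four sides cancel. *)
Lemma Rect_affine (al be : C) (a b c d : R) : a <= b -> c <= d ->
  Rect (fun z => al * z + be)%C a b c d = 0.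
Proof.
  intros Hab Hcd.
  set (G := fun z : C => (al * z * z / 2 + be * z)%C).
  assert (DX : forall x y, derC (fun t => ((t, y) : C)) x 1).
  { intros x y. split; simpl; [exact (is_derive_id x)|apply @is_derive_const]. }
  assert (DY : forall x y, derC (fun t => ((x, t) : C)) y Ci).
  { intros x y. split; simpl; [apply @is_derive_const|exact (is_derive_id y)]. }
  assert (DG : forall (g : R -> C) t l, derC g t l -> derC (fun s => G (g s)) t (l * (al * g t + be))%C).
  { intros g t l Hg. unfold G. eapply derC_eq.
    - apply derC_plus; [|apply derC_scal, Hg].
      apply (derC_ext (fun s => al / 2 * (g s * g s))%C); [intros; field|].
      apply derC_scal. apply derC_mult; exact Hg.
    - field. }
  assert (CG : forall (g : R -> C) t, contC g t -> contC (fun s => al * g s + be)%C t).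
  { intros g t Hg. apply contC_plus; [apply contC_mult; [apply contC_const|exact Hg]|apply contC_const]. }
  assert (EH : forall y, RIC (fun x => al * (x, y) + be)%C a b = (G (b, y) - G (a, y))%C).
  { intros y. apply RIC_unique. apply (is_RIC_derive (fun x => G (x, y))).
    - intros x _. eapply derC_eq; [apply (DG (fun t => (t, y)) x 1), DX|]. ring.
    - intros x _. apply (CG (fun t => (t, y))). eapply derC_contC, DX. }
  assert (EV : forall x, (Ci * RIC (fun y => al * (x, y) + be) c d)%C = (G (x, d) - G (x, c))%C).
  { intros x. symmetry. rewrite <- (RIC_unique (fun y => Ci * (al * (x, y) + be))%C c d (G (x, d) - G (x, c))%C).
    - apply RIC_unique. apply is_RIC_scal. apply RIC_correct; [exact Hcd|].
      intros y _. apply (CG (fun t => (x, t))). eapply derC_contC, DY.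
    - apply (is_RIC_derive (fun y => G (x, y))).
      + intros y _. apply (DG (fun t => (x, t)) y Ci), DY.
      + intros y _. apply contC_mult; [apply contC_const|].
        apply (CG (fun t => (x, t))). eapply derC_contC, DY. }
  unfold Rect. rewrite !EH, !EV. ring.
Qed.

Lemma Rect_minus (F G : C -> C) (a b c d : R) : a <= b -> c <= d ->
  cont_rect F a b c d -> cont_rect G a b c d ->
  Rect (fun z => F z - G z)%C a b c d = (Rect F a b c d - Rect G a b c d)%C.
Proof.
  intros Hab Hcd HF HG. unfold Rect.
  rewrite (RIC_unique (fun x => F (x, c) - G (x, c))%C a b (RIC (fun x => F (x, c)) a b - RIC (fun x => G (x, c)) a b)%C),
    (RIC_unique (fun x => F (x, d) - G (x, d))%C a b (RIC (fun x => F (x, d)) a b - RIC (fun x => G (x, d)) a b)%C),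
    (RIC_unique (fun y => F (a, y) - G (a, y))%C c d (RIC (fun y => F (a, y)) c d - RIC (fun y => G (a, y)) c d)%C),
    (RIC_unique (fun y => F (b, y) - G (b, y))%C c d (RIC (fun y => F (b, y)) c d - RIC (fun y => G (b, y)) c d)%C);
    [ring| | | |];
    apply is_RIC_minus; apply RIC_correct; try assumption; intros t Ht;
    (apply ccont_horizontal || apply ccont_vertical); (apply HF || apply HG); lra.
Qed.

Lemma Rect_bound (F : C -> C) (a b c d M : R) : a <= b -> c <= d -> cont_rect F a b c d ->
  (forall x y, a <= x <= b -> c <= y <= d -> Cmod (F (x, y)) <= M) ->
  Cmod (Rect F a b c d) <= 2 * ((b - a) + (d - c)) * M.
Proof.
  intros Hab Hcd H HM. unfold Rect.
  assert (B1 : forall y, c <= y <= d -> Cmod (RIC (fun x => F (x, y)) a b) <= (b - a) * M).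
  { intros y Hy. apply (is_RIC_bound (fun x => F (x, y)) a b); [exact Hab|intros; apply HM; lra|].
    apply RIC_correct; [exact Hab|]. intros x Hx. apply ccont_horizontal, H; lra. }
  assert (B2 : forall x, a <= x <= b -> Cmod (Ci * RIC (fun y => F (x, y)) c d) <= (d - c) * M).
  { intros x Hx. rewrite Cmod_mult, Cmod_Ci, Rmult_1_l.
    apply (is_RIC_bound (fun y => F (x, y)) c d); [exact Hcd|intros; apply HM; lra|].
    apply RIC_correct; [exact Hcd|]. intros y Hy. apply ccont_vertical, H; lra. }
  pose proof (B1 c ltac:(lra)). pose proof (B1 d ltac:(lra)). pose proof (B2 a ltac:(lra)). pose proof (B2 b ltac:(lra)).
  eapply Rle_trans; [apply Cmod_triangle_minus|].
  pose proof (Cmod_triangle_minus (RIC (fun x => F (x, c)) a b + Ci * RIC (fun y => F (b, y)) c d)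
    (RIC (fun x => F (x, d)) a b)).
  pose proof (Cmod_triangle (RIC (fun x => F (x, c)) a b) (Ci * RIC (fun y => F (b, y)) c d)). lra.
Qed.

Lemma Goursat (F : C -> C) (a b c d : R) : a <= b -> c <= d ->
  (forall x y, a <= x <= b -> c <= y <= d -> cdiff F (x, y)) -> Rect F a b c d = 0.
Proof.
  intros Hab Hcd HF.
  assert (HC : cont_rect F a b c d) by (intros x y Hx Hy; now apply cdiff_ccont, HF).
  (* Rectangles are quadruples: [ok] means contained in the given one, [good] relates a rectangle to
     a half-size one inside it that carries at least a quarter of its boundary integral. *)
  set (ok := fun q : R * R * R * R => let '(a', b', c', d') := q in
     a <= a' /\ a' <= b' /\ b' <= b /\ c <= c' /\ c' <= d' /\ d' <= d).
  set (good := fun q q' : R * R * R * R =>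
     let '(a1, b1, c1, d1) := q in let '(a2, b2, c2, d2) := q' in
     a1 <= a2 /\ b2 <= b1 /\ c1 <= c2 /\ d2 <= d1 /\
     b2 - a2 = (b1 - a1) / 2 /\ d2 - c2 = (d1 - c1) / 2 /\
     Cmod (Rect F a1 b1 c1 d1) <= 4 * Cmod (Rect F a2 b2 c2 d2)).
  assert (Hex : forall q, ok q -> exists q', good q q').
  { intros [[[a1 b1] c1] d1] [H1 [H2 [H3 [H4 [H5 H6]]]]].
    destruct (Rect_quarter F a1 b1 c1 d1 H2 H5) as [a2 [b2 [c2 [d2 Hq]]]].
    - intros x y Hx Hy. apply HC; lra.
    - now exists (a2, b2, c2, d2). }
  assert (Hok : forall q q', ok q -> good q q' -> ok q').
  { intros [[[a1 b1] c1] d1] [[[a2 b2] c2] d2] H1 H2. unfold ok, good in *.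
    destruct H1 as [? [? [? [? [? ?]]]]]. destruct H2 as [? [? [? [? [? [? ?]]]]]]. repeat split; lra. }
  set (step := fun q => epsilon (inhabits q) (good q)).
  assert (Hstep : forall q, ok q -> good q (step q)) by (intros q Hq; unfold step; apply epsilon_spec, Hex, Hq).
  set (s := fix s n := match n with O => (a, b, c, d) | S k => step (s k) end).
  assert (Sok : forall n, ok (s n)).
  { induction n as [|n IH]; [simpl; repeat split; lra|]. apply (Hok (s n)); [exact IH|apply Hstep, IH]. }
  assert (Sgood : forall n, good (s n) (s (S n))) by (intros n; apply Hstep, Sok).
  set (an := fun n => fst (fst (fst (s n)))). set (bn := fun n => snd (fst (fst (s n)))).
  set (cn := fun n => snd (fst (s n))). set (dn := fun n => snd (s n)).
  assert (Sg : forall n, an n <= an (S n) /\ bn (S n) <= bn n /\ cn n <= cn (S n) /\ dn (S n) <= dn n /\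
     bn (S n) - an (S n) = (bn n - an n) / 2 /\ dn (S n) - cn (S n) = (dn n - cn n) / 2 /\
     Cmod (Rect F (an n) (bn n) (cn n) (dn n)) <= 4 * Cmod (Rect F (an (S n)) (bn (S n)) (cn (S n)) (dn (S n)))).
  { intros n. specialize (Sgood n). unfold an, bn, cn, dn.
    destruct (s n) as [[[a1 b1] c1] d1]. destruct (s (S n)) as [[[a2 b2] c2] d2]. exact Sgood. }
  assert (So : forall n, a <= an n /\ an n <= bn n /\ bn n <= b /\ c <= cn n /\ cn n <= dn n /\ dn n <= d).
  { intros n. specialize (Sok n). unfold an, bn, cn, dn. destruct (s n) as [[[a1 b1] c1] d1]. exact Sok. }
  clear Sgood Sok.
  destruct (nested_intervals an bn) as [px Hpx]; [intros; apply Sg|intros; apply Sg|intros; apply So|].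
  destruct (nested_intervals cn dn) as [py Hpy]; [intros; apply Sg|intros; apply Sg|intros; apply So|].
  set (w := (b - a) + (d - c)).
  assert (Hw : forall n, (bn n - an n) + (dn n - cn n) = w * (/ 2) ^ n).
  { induction n as [|n IH]; [change ((b - a) + (d - c) = w * 1); unfold w; ring|].
    destruct (Sg n) as [_ [_ [_ [_ [E1 [E2 _]]]]]]. rewrite E1, E2. simpl.
    replace (w * (/ 2 * (/ 2) ^ n)) with (/ 2 * (w * (/ 2) ^ n)) by ring. rewrite <- IH. field. }
  assert (HR : forall n, Cmod (Rect F a b c d) * (/ 2) ^ n * (/ 2) ^ n <= Cmod (Rect F (an n) (bn n) (cn n) (dn n))).
  { induction n as [|n IH]; [change (Cmod (Rect F a b c d) * 1 * 1 <= Cmod (Rect F a b c d)); lra|].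
    destruct (Sg n) as [_ [_ [_ [_ [_ [_ E]]]]]]. simpl. lra. }
  assert (Hin : a <= px <= b /\ c <= py <= d).
  { specialize (Hpx O). specialize (Hpy O). specialize (So O). lra. }
  destruct (HF px py (proj1 Hin) (proj2 Hin)) as [Phi [HP EP]].
  assert (Hw0 : 0 <= w) by (unfold w; lra).
  apply Cmod_le_eps_0. intros eps He.
  (* After N halvings the integral is at least t^2 times the original one and at most 2 (w t) eta (w
     t) in modulus; t^2 cancels, and this [eta] makes 2 eta w^2 at most [eps]. *)
  set (eta := eps / (2 * (w + 1) * (w + 1))).
  assert (Heta : 0 < eta) by (apply Rdiv_lt_0_compat; [exact He|nra]).
  destruct (HP eta Heta) as [del [Hdel Hu]].
  destruct (pow_lt_1_zero (/ 2) ltac:(rewrite Rabs_pos_eq; lra) (del / (w + 1))) as [N HN];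
    [apply Rdiv_lt_0_compat; lra|].
  specialize (HN N (le_n _)). rewrite Rabs_pos_eq in HN by (apply pow_le; lra).
  set (t := (/ 2) ^ N) in *. assert (Ht : 0 < t) by (apply pow_lt; lra).
  assert (Hwt : w * t < del).
  { apply Rle_lt_trans with ((w + 1) * t); [nra|].
    apply Rlt_le_trans with ((w + 1) * (del / (w + 1))); [apply Rmult_lt_compat_l; lra|right; field; lra]. }
  specialize (Hw N). fold t in Hw. specialize (HR N). fold t in HR. specialize (Hpx N). specialize (Hpy N).
  destruct (So N) as [O1 [O2 [O3 [O4 [O5 O6]]]]].
  set (a1 := an N) in *. set (b1 := bn N) in *. set (c1 := cn N) in *. set (d1 := dn N) in *.
  set (p := ((px, py) : C)) in *.
  (* The affine part of [F] at [p] integrates to 0, and by Caratheodory's form the rest is (Phi z -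
     Phi p) (z - p), small compared with |z - p|. *)
  set (Lf := fun z : C => (Phi p * z + (F p - Phi p * p))%C).
  assert (HL : forall z, ccont Lf z).
  { intros z. apply ccont_plus; [apply ccont_mult; [apply ccont_const|apply ccont_id]|apply ccont_const]. }
  assert (HC1 : cont_rect F a1 b1 c1 d1) by (intros x y Hx Hy; apply HC; lra).
  assert (HD : cont_rect (fun z => F z - Lf z)%C a1 b1 c1 d1).
  { intros x y Hx Hy. apply (ccont_plus F (fun z => - Lf z)%C); [now apply HC1|].
    intros e Hep. destruct (HL (x, y) e Hep) as [dd [Hdd HH]]. exists dd. split; [exact Hdd|].
    intros u Huu. replace (- Lf u - - Lf (x, y))%C with (- (Lf u - Lf (x, y)))%C by ring.
    rewrite Cmod_opp. now apply HH. }
  assert (EF : Rect F a1 b1 c1 d1 = Rect (fun z => F z - Lf z)%C a1 b1 c1 d1).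
  { rewrite Rect_minus by (try assumption; intros x y _ _; apply HL).
    unfold Lf at 1. rewrite Rect_affine by assumption. ring. }
  assert (BF : Cmod (Rect F a1 b1 c1 d1) <= 2 * (w * t) * (eta * (w * t))).
  { rewrite EF, <- Hw. apply Rect_bound; try assumption. intros x y Hx Hy.
    assert (Hd : Cmod ((x, y) - p) <= (b1 - a1) + (d1 - c1)).
    { eapply Rle_trans; [apply Cmod_le_sum|]. simpl.
      assert (Rabs (x + - px) <= b1 - a1) by (apply Rabs_le; lra).
      assert (Rabs (y + - py) <= d1 - c1) by (apply Rabs_le; lra). lra. }
    replace (F (x, y) - Lf (x, y))%C with ((Phi (x, y) - Phi p) * ((x, y) - p))%C
      by (unfold Lf; rewrite (EP (x, y)); fold p; ring).
    rewrite Cmod_mult. apply Rmult_le_compat; try apply Cmod_ge_0; [|exact Hd].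
    left. apply Hu. rewrite Hw in Hd. lra. }
  assert (Hfin : Cmod (Rect F a b c d) * (t * t) <= 2 * eta * w * w * (t * t)) by lra.
  assert (Hf2 : Cmod (Rect F a b c d) <= 2 * eta * w * w) by (apply Rmult_le_reg_r with (t * t); [nra|exact Hfin]).
  eapply Rle_trans; [exact Hf2|].
  replace eps with (2 * eta * ((w + 1) * (w + 1))) by (unfold eta; field; lra).
  replace (2 * eta * w * w) with (2 * eta * (w * w)) by ring.
  apply Rmult_le_compat_l; [lra|]. nra.
Qed.

(** * Fourier series *)

Lemma ccont_inv (z : C) : z <> 0 -> ccont Complex.Cinv z.
Proof.
  intros Hz eps He. pose proof (proj1 (Cmod_gt_0 z) Hz) as Hm.
  exists (Rmin (Cmod z / 2) (eps * (Cmod z * Cmod z) / 4)). split.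
  { apply Rmin_pos; [lra|]. apply Rdiv_lt_0_compat; [|lra]. apply Rmult_lt_0_compat; [exact He|]. now apply Rmult_lt_0_compat. }
  intros u Hu. pose proof (Rmin_l (Cmod z / 2) (eps * (Cmod z * Cmod z) / 4)).
  pose proof (Rmin_r (Cmod z / 2) (eps * (Cmod z * Cmod z) / 4)).
  assert (Hu2 : Cmod z / 2 < Cmod u).
  { pose proof (Cmod_le_minus z u) as Q. rewrite Cmod_minus_sym in Q. lra. }
  assert (Hu0 : u <> 0) by (apply Cmod_gt_0; lra).
  replace (/ u - / z)%C with ((z - u) / (u * z))%C by (field; auto).
  rewrite Cmod_div, Cmod_mult, Cmod_minus_sym by (now apply Cmult_neq_0).
  apply Rmult_lt_reg_r with (Cmod u * Cmod z); [nra|].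
  unfold Rdiv. rewrite Rmult_assoc, Rinv_l by nra.
  assert (Cmod z * Cmod z / 2 < Cmod u * Cmod z) by nra. nra.
Qed.

Lemma contC_ccont (F : C -> C) (g : R -> C) (t : R) : ccont F (g t) -> contC g t -> contC (fun s => F (g s)) t.
Proof.
  intros HF Hg. apply contC_eps. intros eps He. destruct (HF eps He) as [d [Hd HdF]].
  destruct (proj1 (contC_eps g t) Hg d Hd) as [e [He' Hee]]. exists e. split; [exact He'|].
  intros s Hs. apply HdF, Hee, Hs.
Qed.

Lemma contC_div (f g : R -> C) (t : R) : g t <> 0 -> contC f t -> contC g t -> contC (fun s => f s / g s)%C t.
Proof.
  intros H0 Hf Hg. apply contC_mult; [exact Hf|]. apply (contC_ccont Complex.Cinv g); [now apply ccont_inv|exact Hg].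
Qed.

Definition slope (f : R -> C) (l : C) (t : R) : C :=
  if Req_EM_T t 0 then l else ((f t - f 0) / t)%C.

Lemma contC_slope (f : R -> C) (l : C) (t : R) :
  derC f 0 l -> (t <> 0 -> contC f t) -> contC (slope f l) t.
Proof.
  intros Hd Hc. destruct (Req_dec t 0) as [->|Ht].
  - apply contC_eps. intros eps He. apply derC_iff in Hd. destruct (Hd eps He) as [d [Hd1 Hd2]].
    exists d. split; [exact Hd1|]. intros y Hy. rewrite Rminus_0_r in Hy. unfold slope.
    destruct (Req_EM_T 0 0) as [_|N]; [|now elim N].
    destruct (Req_EM_T y 0) as [E|N].
    + replace (l - l)%C with (RtoC 0) by ring. now rewrite Cmod_0.
    + specialize (Hd2 y N Hy). toC. rewrite Rplus_0_l in Hd2.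
      replace ((f y - f 0) / y)%C with (RtoC (/ y) * (f y - f 0))%C; [exact Hd2|].
      rewrite RtoC_inv by exact N. unfold Complex.Cdiv. ring.
  - apply (contC_ext_loc (fun s => (f s - f 0) / s)%C _ t (Rabs t)).
    + now apply Rabs_pos_lt.
    + intros y Hy. unfold slope. destruct (Req_EM_T y 0) as [->|N]; [|reflexivity].
      rewrite Rminus_0_l, Rabs_Ropp in Hy. lra.
    + apply contC_div.
      * now apply RtoC_neq_0.
      * apply contC_minus; [now apply Hc|apply contC_const].
      * apply (contC_RtoC (fun s => s)). apply continuous_id.
Qed.

(** The function e^(-ikt): with this sign its integral against phi is the k-th Fourier coefficient
    up to the factor 2 pi, and e^(it) is [ek (-1)]. *)
Definition ek (k : Z) (t : R) : C := Cexp (0, - (IZR k * t)).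

Lemma Cmod_ek (k : Z) (t : R) : Cmod (ek k t) = 1.
Proof. unfold ek. rewrite Cmod_Cexp. simpl. apply exp_0. Qed.

Lemma derC_ek (k : Z) (t : R) : derC (ek k) t ((0, (- IZR k)%R) * ek k t)%C.
Proof.
  unfold ek. apply (derC_Cexp (fun t => (0, - (IZR k * t)))). split; simpl.
  - apply @is_derive_const.
  - auto_derive; [exact Logic.I|ring].
Qed.

Lemma contC_ek (k : Z) (t : R) : contC (ek k) t.
Proof. eapply derC_contC, derC_ek. Qed.

Lemma ek_0 (t : R) : ek 0 t = RtoC 1.
Proof. unfold ek. replace (0, - (0 * t)) with (RtoC 0) by (unfold RtoC; f_equal; ring). apply Cexp_0. Qed.

Lemma ek_plus (k l : Z) (t : R) : ek (k + l) t = (ek k t * ek l t)%C.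
Proof.
  unfold ek. rewrite <- Cexp_plus. f_equal. unfold Cplus; simpl. rewrite plus_IZR. f_equal; ring.
Qed.

Lemma ek_add (k : Z) (s t : R) : ek k (s + t) = (ek k s * ek k t)%C.
Proof. unfold ek. rewrite <- Cexp_plus. f_equal. unfold Cplus; simpl. f_equal; ring. Qed.

Lemma Cexp_2PI : Cexp (0, 2 * PI) = RtoC 1.
Proof. unfold Cexp; simpl. rewrite exp_0, cos_2PI, sin_2PI. unfold RtoC. f_equal; ring. Qed.

Lemma ek_2PI (k : Z) : ek k (2 * PI) = RtoC 1.
Proof.
  assert (H : forall n : nat, ek (- Z.of_nat n) (2 * PI) = RtoC 1).
  { intros n. unfold ek. replace (0, - (IZR (- Z.of_nat n) * (2 * PI))) with (INR n * (0, (2 * PI)%R))%C.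
    - rewrite Cexp_nat, Cexp_2PI. apply Cpow_1_l.
    - rewrite opp_IZR, <- INR_IZR_INZ. unfold Cmult; simpl. f_equal; ring. }
  destruct (Z_le_dec k 0) as [Hk|Hk].
  - rewrite <- (H (Z.to_nat (- k))). f_equal. rewrite Z2Nat.id; lia.
  - pose proof (H (Z.to_nat k)) as E. rewrite Z2Nat.id in E by lia.
    transitivity (ek k (2 * PI) * ek (- k) (2 * PI))%C; [rewrite E; cring|].
    rewrite <- ek_plus, Z.add_opp_diag_r. apply ek_0.
Qed.

Lemma ek_period_integral (k : Z) (a d : R) : (k <> 0)%Z -> ek k d = RtoC 1 -> is_RIC (ek k) a (a + d) (RtoC 0).
Proof.
  intros Hk Hd.
  assert (Hk' : ((0, (- IZR k)%R) : C) <> 0).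
  { intros E. apply (f_equal snd) in E. simpl in E. apply Hk, eq_IZR. lra. }
  apply (is_RIC_ext (fun t => / (0, (- IZR k)%R) * ((0, (- IZR k)%R) * ek k t))%C).
  { intros t _. cfield. exact Hk'. }
  eapply is_RIC_eq.
  - apply is_RIC_scal. apply (is_RIC_derive (ek k)).
    + intros t _. apply derC_ek.
    + intros t _. apply contC_mult; [apply contC_const|apply contC_ek].
  - rewrite ek_add, Hd. cring.
Qed.

Lemma contC_uniform (g : R -> C) (a b eps : R) : a <= b ->
  (forall x, a <= x <= b -> contC g x) -> 0 < eps ->
  exists d, 0 < d /\ forall x y, a <= x <= b -> a <= y <= b -> Rabs (x - y) < d -> Cmod (g x - g y) < eps.
Proof.
  intros Hab H He.
  assert (P : forall p : C -> R, (forall x, a <= x <= b -> continuous (fun t => p (g t)) x) ->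
    exists d, 0 < d /\ forall x y, a <= x <= b -> a <= y <= b -> Rabs (x - y) < d -> Rabs (p (g x) - p (g y)) < eps / 2).
  { intros p Hp.
    assert (Hcp : forall x, a <= x <= b -> continuity_pt (fun t => p (g t)) x).
    { intros x Hx. apply continuity_pt_filterlim. now apply Hp. }
    assert (He2 : 0 < eps / 2) by lra.
    destruct (Heine_cor2 Hcp (mkposreal (eps / 2) He2)) as [d Hd].
    exists d. split; [apply cond_pos|exact Hd]. }
  destruct (P fst) as [d1 [Hd1 K1]]; [intros x Hx; apply (H x Hx)|].
  destruct (P snd) as [d2 [Hd2 K2]]; [intros x Hx; apply (H x Hx)|].
  exists (Rmin d1 d2). split; [now apply Rmin_pos|]. intros x y Hx Hy Hxy.
  specialize (K1 x y Hx Hy (Rlt_le_trans _ _ _ Hxy (Rmin_l _ _))).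
  specialize (K2 x y Hx Hy (Rlt_le_trans _ _ _ Hxy (Rmin_r _ _))).
  eapply Rle_lt_trans; [apply Cmod_le_sum|]. simpl. unfold Rminus in *. lra.
Qed.

(* Compare [h] with step functions on subintervals of length [2 pi / |k|], where [ek k] integrates to 0. *)
Lemma Riemann_Lebesgue (h : R -> C) : (forall x, - PI <= x <= PI -> contC h x) ->
  forall eps, 0 < eps -> exists N : nat, forall (k : Z) (I : C), (N <= Z.abs_nat k)%nat ->
    is_RIC (fun t => h t * ek k t)%C (- PI) PI I -> Cmod I <= eps.
Proof.
  intros Hh eps He. pose proof PI_RGT_0 as HPI.
  destruct (contC_uniform h (- PI) PI (eps / (2 * PI))) as [d [Hd Hu]]; [lra|exact Hh|apply Rdiv_lt_0_compat; lra|].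
  destruct (INR_unbounded (2 * PI / d)) as [N HN].
  exists (S N). intros k I Hk HI.
  set (n := Z.abs_nat k) in *. assert (Hn0 : 0 < INR n) by (apply lt_0_INR; lia).
  assert (HnN : INR N < INR n) by (apply lt_INR; lia).
  set (de := 2 * PI / INR n).
  assert (Hde : 0 < de) by (apply Rdiv_lt_0_compat; lra).
  assert (Hdd : de < d).
  { unfold de. apply Rmult_lt_reg_r with (INR n / d); [apply Rdiv_lt_0_compat; lra|].
    replace (2 * PI / INR n * (INR n / d)) with (2 * PI / d) by (field; lra).
    replace (d * (INR n / d)) with (INR n) by (field; lra). lra. }
  assert (Hk0 : (k <> 0)%Z) by (intros ->; simpl in n; unfold n in Hk; lia).
  assert (Hek : ek k de = RtoC 1).
  { assert (HIn : INR n = IZR (Z.abs k)) by (unfold n; rewrite INR_IZR_INZ, Zabs2Nat.id_abs; reflexivity).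
    assert (Hkn : IZR k * de = 2 * PI \/ IZR k * de = - (2 * PI)).
    { unfold de. rewrite HIn in *. destruct (Z_le_dec 0 k).
      - left. rewrite Z.abs_eq in * by lia. field. lra.
      - right. rewrite Z.abs_neq in * by lia. rewrite opp_IZR in *. field. lra. }
    unfold ek. destruct Hkn as [->| ->].
    - transitivity (ek 1 (2 * PI)); [unfold ek; rewrite Rmult_1_l; reflexivity|apply ek_2PI].
    - transitivity (ek (-1) (2 * PI)); [unfold ek; f_equal; f_equal; ring|apply ek_2PI]. }
  assert (HnD : INR n * de = 2 * PI) by (unfold de; field; lra).
  assert (Step : forall j, (j <= n)%nat -> exists J,
     is_RIC (fun t => h t * ek k t)%C (- PI) (- PI + INR j * de) J /\ Cmod J <= INR j * (de * (eps / (2 * PI)))).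
  { induction j as [|j IH]; intros Hj.
    - exists (RtoC 0). split.
      + simpl INR. rewrite Rmult_0_l, Rplus_0_r.
        split; simpl; apply (is_RInt_point (V := R_NormedModule)).
      + rewrite Cmod_0. simpl. lra.
    - destruct IH as [J [HJ1 HJ2]]; [lia|].
      assert (Hjn : INR (S j) <= INR n) by (apply le_INR; lia). rewrite S_INR in Hjn.
      pose proof (pos_INR j) as Hj0.
      set (a := - PI + INR j * de) in *.
      assert (Ha : - PI <= a /\ a + de <= PI) by (unfold a; split; nra).
      destruct (ex_RIC (fun t => (h t - h a) * ek k t)%C a (a + de)) as [J' HJ'].
      { intros t Ht. rewrite Rmin_left, Rmax_right in Ht by lra.
        apply contC_mult; [apply contC_minus; [apply Hh; lra|apply contC_const]|apply contC_ek]. }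
      assert (BJ : Cmod J' <= (a + de - a) * (eps / (2 * PI))).
      { apply (is_RIC_bound (fun t => (h t - h a) * ek k t)%C); [lra| |exact HJ'].
        intros t Ht. rewrite Cmod_mult, Cmod_ek, Rmult_1_r. left. apply Hu; try lra.
        rewrite Rabs_pos_eq; lra. }
      exists (J + (J' + h a * 0))%C. split.
      + rewrite S_INR. replace (- PI + (INR j + 1) * de) with (a + de) by (unfold a; ring).
        apply is_RIC_Chasles with a; [exact HJ1|].
        apply (is_RIC_ext (fun t => (h t - h a) * ek k t + h a * ek k t)%C); [intros; cring|].
        apply is_RIC_plus; [exact HJ'|]. apply is_RIC_scal. now apply ek_period_integral.
      + rewrite S_INR. replace (J + (J' + h a * 0))%C with (J + J')%C by ring.
        eapply Rle_trans; [apply Cmod_triangle|]. lra. }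
  destruct (Step n (le_n _)) as [J [HJ1 HJ2]].
  replace (- PI + INR n * de) with PI in HJ1 by lra.
  rewrite (is_RIC_unique _ _ _ _ _ HI HJ1). eapply Rle_trans; [exact HJ2|].
  rewrite <- Rmult_assoc, HnD. right. field. lra.
Qed.

(** The real part of e^(it) - 1 is -2 sin^2(t/2), which vanishes in this range only at 0. *)
Lemma Cexp_i_neq_1 (t : R) : - PI <= t <= PI -> t <> 0 -> (ek (-1) t - 1)%C <> 0.
Proof.
  intros Ht H0 E. unfold ek in E. apply (f_equal fst) in E. simpl in E.
  rewrite exp_0 in E. replace (- (-1 * t)) with t in E by ring.
  assert (Hc : cos t = 1) by lra.
  assert (Hs : sin (t / 2) * sin (t / 2) = 0).
  { replace t with (2 * (t / 2)) in Hc by field. rewrite cos_2a_sin in Hc. lra. }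
  assert (Hs0 : sin (t / 2) = 0) by nra.
  pose proof PI_RGT_0. destruct (Rlt_le_dec 0 t) as [Hp|Hn].
  - pose proof (sin_gt_0 (t / 2) ltac:(lra) ltac:(lra)). lra.
  - pose proof (sin_gt_0 (- (t / 2)) ltac:(lra) ltac:(lra)) as Q. rewrite sin_neg in Q. lra.
Qed.

(* Chernoff: with [h = (phi - phi 0) / (e^{it} - 1)] the symmetric partial sums telescope to
   a difference of two Fourier coefficients of [h]. *)
Lemma Fourier_pointwise (phi : R -> C) (l : C) (ga : Z -> C) :
  (forall x, - PI <= x <= PI -> contC phi x) -> derC phi 0 l ->
  (forall k, is_RIC (fun t => phi t * ek k t)%C (- PI) PI (RtoC (2 * PI) * ga k)%C) ->
  Ccv (fun N => Csum (fun k => ga (Z.of_nat k) + ga (- Z.of_nat k)%Z) N - ga 0%Z)%C (phi 0).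
Proof.
  intros Hc Hd Hga. pose proof PI_RGT_0 as HPI.
  assert (H2pi : RtoC (2 * PI) <> 0) by (apply RtoC_neq_0; lra).
  set (e1 := fun t => ek (-1) t).
  assert (De : derC e1 0 Ci).
  { eapply derC_eq; [apply derC_ek|]. unfold ek. simpl IZR.
    replace (0, - (-1 * 0)) with (RtoC 0) by (unfold RtoC; f_equal; ring). rewrite Cexp_0.
    unfold Ci, Cmult, RtoC; simpl. f_equal; ring. }
  assert (E10 : e1 0 = RtoC 1).
  { unfold e1, ek. replace (0, - (-1 * 0)) with (RtoC 0) by (unfold RtoC; f_equal; ring). apply Cexp_0. }
  (* As a quotient of two extended difference quotients [h] is continuous at 0, since the slope of
     e^(it) there is i. *)
  set (h := fun t => (slope phi l t / slope e1 Ci t)%C).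
  assert (Hne : forall t, - PI <= t <= PI -> slope e1 Ci t <> 0).
  { intros t Ht. unfold slope. destruct (Req_EM_T t 0) as [_|N].
    - intros E. apply (f_equal snd) in E. simpl in E. lra.
    - rewrite E10. pose proof (Cexp_i_neq_1 t Ht N) as Q. fold (e1 t) in Q.
      unfold Complex.Cdiv. apply Cmult_neq_0; [exact Q|].
      rewrite <- RtoC_inv by exact N. apply RtoC_neq_0. now apply Rinv_neq_0_compat. }
  assert (Hh : forall t, - PI <= t <= PI -> contC h t).
  { intros t Ht. apply contC_div; [now apply Hne| |].
    - apply contC_slope; [exact Hd|intros _; now apply Hc].
    - apply contC_slope; [exact De|intros _; apply contC_ek]. }
  assert (Hhe : forall t, - PI <= t <= PI -> (h t * (e1 t - 1))%C = (phi t - phi 0)%C).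
  { intros t Ht. pose proof (Hne t Ht) as Q. unfold h. unfold slope in *.
    destruct (Req_EM_T t 0) as [->|N].
    - rewrite E10. replace (l / Ci * (1 - 1))%C with (RtoC 0) by ring. ring.
    - rewrite E10 in *. pose proof (Cexp_i_neq_1 t Ht N) as Q2. fold (e1 t) in Q2.
      field. split; [now apply RtoC_neq_0|exact Q2]. }
  set (D := fun k : Z => RIC (fun t => h t * ek k t)%C (- PI) PI).
  assert (HD : forall k, is_RIC (fun t => h t * ek k t)%C (- PI) PI (D k)).
  { intros k. apply RIC_correct; [lra|]. intros t Ht. apply contC_mult; [now apply Hh|apply contC_ek]. }
  (* Multiplication by e^(it) lowers the index by one, so each coefficient of phi - phi 0 is a
     difference of consecutive coefficients of [h]. *)
  assert (Tel : forall k, (RtoC (2 * PI) * ga k - phi 0 * RIC (ek k) (- PI) PI)%C = (D (k - 1)%Z - D k)%C).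
  { intros k. eapply is_RIC_unique.
    - apply is_RIC_minus; [apply Hga|]. apply is_RIC_scal. apply RIC_correct; [lra|intros; apply contC_ek].
    - apply (is_RIC_ext (fun t => h t * ek (k - 1) t - h t * ek k t)%C).
      + intros t Ht. rewrite Rmin_left, Rmax_right in Ht by lra.
        replace (k - 1)%Z with (-1 + k)%Z by ring. rewrite ek_plus. fold (e1 t).
        transitivity ((h t * (e1 t - 1)) * ek k t)%C; [cring|]. rewrite Hhe by lra. cring.
      + apply is_RIC_minus; apply HD. }
  assert (E0 : RIC (ek 0) (- PI) PI = RtoC (2 * PI)).
  { apply RIC_unique. apply (is_RIC_ext (fun _ => RtoC 1)); [intros; now rewrite ek_0|].
    eapply is_RIC_eq; [apply is_RIC_const|]. replace (PI - - PI) with (2 * PI) by ring. ring. }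
  assert (Ek : forall k, (k <> 0)%Z -> RIC (ek k) (- PI) PI = RtoC 0).
  { intros k Hk. apply RIC_unique. replace PI with (- PI + 2 * PI) at 2 by ring.
    apply ek_period_integral; [exact Hk|apply ek_2PI]. }
  (* Pairing k with -k counts the index 0 twice, whence the subtracted [ga 0]; the differences
     telescope over -N <= k <= N. *)
  assert (Sum : forall N, (RtoC (2 * PI) * (Csum (fun k => ga (Z.of_nat k) + ga (- Z.of_nat k)%Z) N - ga 0%Z - phi 0))%C
     = (D (- Z.of_nat N - 1)%Z - D (Z.of_nat N))%C).
  { induction N as [|N IH].
    - simpl Csum. simpl (Z.of_nat 0). simpl (- 0)%Z. rewrite <- (Tel 0%Z), E0. cring.
    - cbn [Csum]. toC.
      set (SN := Csum (fun k => ga (Z.of_nat k) + ga (- Z.of_nat k)%Z)%C N) in *.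
      pose proof (Tel (Z.of_nat (S N))) as T1. rewrite Ek in T1 by lia.
      pose proof (Tel (- Z.of_nat (S N))%Z) as T2. rewrite Ek in T2 by lia.
      replace (Z.of_nat (S N) - 1)%Z with (Z.of_nat N) in T1 by lia.
      replace (- Z.of_nat N - 1)%Z with (- Z.of_nat (S N))%Z in IH by lia.
      transitivity (RtoC (2 * PI) * (SN - ga 0%Z - phi 0) +
         (RtoC (2 * PI) * ga (Z.of_nat (S N)) - phi 0 * 0) +
         (RtoC (2 * PI) * ga (- Z.of_nat (S N))%Z - phi 0 * 0))%C; [cring|].
      rewrite T1, T2, IH. ring. }
  intros eps He.
  destruct (Riemann_Lebesgue h Hh (eps * PI / 2)) as [N HN]; [nra|].
  exists (S N). intros n Hn. toC.
  set (X := (Csum (fun k => ga (Z.of_nat k) + ga (- Z.of_nat k)%Z) n - ga 0%Z - phi 0)%C).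
  assert (EX : Cmod (RtoC (2 * PI) * X) <= eps * PI / 2 + eps * PI / 2).
  { unfold X. rewrite Sum. eapply Rle_trans; [apply Cmod_triangle_minus|].
    apply Rplus_le_compat; eapply HN; try apply HD; lia. }
  rewrite Cmod_mult, Cmod_R, Rabs_pos_eq in EX by lra.
  change (Cmod X < eps). nra.
Qed.

(** * Chebyshev expansion on an ellipse *)

Lemma Cexp_surj (w : C) : w <> 0 -> exists z, Cexp z = w.
Proof.
  intros Hw. apply Cmod_gt_0 in Hw. set (r := Cmod w) in *.
  assert (Hr2 : r ^ 2 = fst w ^ 2 + snd w ^ 2) by (unfold r; rewrite Cmod2_alt; reflexivity).
  set (c := fst w / r).
  assert (Hc2 : 1 - c² = (snd w / r)²).
  { unfold c, Rsqr. replace 1 with (r ^ 2 / r ^ 2) by (field; lra). rewrite Hr2 at 1. field. lra. }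
  assert (Hc : -1 <= c <= 1) by (pose proof (Rle_0_sqr (snd w / r)); unfold Rsqr in *; nra).
  pose proof (cos_acos c Hc) as C1. pose proof (sin_acos c Hc) as S1.
  rewrite Hc2, sqrt_Rsqr_abs in S1.
  destruct (Rle_lt_dec 0 (snd w)) as [Hy|Hy].
  - exists (ln r, acos c). unfold Cexp; simpl. rewrite exp_ln, C1, S1 by exact Hw.
    rewrite Rabs_pos_eq by (apply Rdiv_le_0_compat; lra). unfold c. destruct w; simpl in *. f_equal; field; lra.
  - exists (ln r, - acos c). unfold Cexp; simpl. rewrite exp_ln, cos_neg, sin_neg, C1, S1 by exact Hw.
    rewrite Rabs_left.
    + unfold c. destruct w; simpl in *. f_equal; field; lra.
    + apply Rmult_lt_reg_r with r; [exact Hw|]. unfold Rdiv. rewrite Rmult_assoc, Rinv_l by lra. lra.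
Qed.

Lemma Csqrt_exists (w : C) : exists s, (s * s)%C = w.
Proof.
  destruct (excluded_middle_informative (w = 0)) as [->|Hw].
  - exists 0. ring.
  - destruct (Cexp_surj w Hw) as [z Hz]. exists (Cexp (z / 2)%C). rewrite <- Cexp_plus, <- Hz.
    f_equal. field.
Qed.

(** The roots y + s and y - s of u^2 - 2yu + 1, with y = 2z - 1, have product 1, so one of them has
    modulus at least 1. *)
Lemma jouk_surj (z : C) : exists u, 1 <= Cmod u /\ jouk u = z.
Proof.
  set (y := (2 * z - 1)%C). destruct (Csqrt_exists (y * y - 1)%C) as [s Hs].
  assert (P : ((y + s) * (y - s))%C = 1).
  { transitivity (y * y - s * s)%C; [ring|]. rewrite Hs. ring. }
  assert (N1 : (y + s)%C <> 0).
  { intros E. rewrite E in P. apply (f_equal fst) in P. simpl in P. lra. }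
  assert (N2 : (y - s)%C <> 0).
  { intros E. rewrite E in P. apply (f_equal fst) in P. simpl in P. lra. }
  assert (PM : Cmod (y + s) * Cmod (y - s) = 1) by (rewrite <- Cmod_mult, P; apply Cmod_1).
  assert (J : forall u v : C, u <> 0 -> (u * v)%C = 1 -> (u + v)%C = (2 * y)%C -> jouk u = z).
  { intros u v Hu Huv Hs'. unfold jouk.
    assert (Ev : (/ u)%C = v).
    { transitivity (/ u * (u * v))%C; [rewrite Huv; ring|]. field. exact Hu. }
    rewrite Ev. transitivity ((2 + (u + v)) / 4)%C; [field|]. rewrite Hs'. unfold y. field. }
  pose proof (Cmod_ge_0 (y + s)). pose proof (Cmod_ge_0 (y - s)).
  destruct (Rle_lt_dec 1 (Cmod (y + s))) as [H1|H1].
  - exists (y + s)%C. split; [exact H1|]. apply (J _ (y - s)%C N1 P). ring.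
  - exists (y - s)%C. split; [nra|]. apply (J _ (y + s)%C N2); [rewrite Cmult_comm; exact P|ring].
Qed.

(** [jouk u] is (1+u)^2 / (4u) and [jouk u - 1] is (1-u)^2 / (4u); the parallelogram law adds the
    two moduli. *)
Lemma jouk_ellipse (u : C) : u <> 0 -> Cmod (jouk u) + Cmod (jouk u - 1) = (Cmod u + / Cmod u) / 2.
Proof.
  intros Hu. pose proof (proj1 (Cmod_gt_0 u) Hu) as Hp.
  assert (E1 : jouk u = ((1 + u) * (1 + u) / (4 * u))%C) by (unfold jouk; field; exact Hu).
  assert (E2 : (jouk u - 1)%C = ((1 - u) * (1 - u) / (4 * u))%C) by (unfold jouk; field; exact Hu).
  assert (H4 : RtoC 4 <> 0) by (apply RtoC_neq_0; lra).
  rewrite E2, E1, !Cmod_div, !Cmod_mult by (now apply Cmult_neq_0).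
  rewrite Cmod_R, Rabs_pos_eq by lra.
  assert (P : Cmod (1 + u) * Cmod (1 + u) + Cmod (1 - u) * Cmod (1 - u) = 2 + 2 * (Cmod u * Cmod u)).
  { assert (Q : forall z, Cmod z * Cmod z = fst z ^ 2 + snd z ^ 2).
    { intros z. replace (Cmod z * Cmod z) with (Cmod z ^ 2) by ring. rewrite Cmod2_alt. reflexivity. }
    rewrite !Q. simpl. ring. }
  apply Rmult_eq_reg_r with (4 * Cmod u); [|lra].
  replace ((Cmod (1 + u) * Cmod (1 + u) / (4 * Cmod u) + Cmod (1 - u) * Cmod (1 - u) / (4 * Cmod u)) * (4 * Cmod u))
    with (Cmod (1 + u) * Cmod (1 + u) + Cmod (1 - u) * Cmod (1 - u)) by (field; lra).
  rewrite P. field. lra.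
Qed.

Lemma ellipse_jouk (rho : R) (u : C) : u <> 0 ->
  (ellipse_interior rho (jouk u) <-> Cmod u + / Cmod u < 2 * rho).
Proof.
  intros Hu. unfold ellipse_interior. toC. rewrite (jouk_ellipse u Hu). lra.
Qed.

Lemma holomorphic_cdiff (rho : R) (f : C -> C) (z : C) :
  holomorphic_on (ellipse_interior rho) f -> ellipse_interior rho z -> cdiff f z.
Proof.
  intros Hf Hz. destruct (Hf z Hz) as [l Hl]. apply (cdiff_intro f z l). intros eps He.
  destruct (Hl eps He) as [d [Hd HH]]. unfold ellipse_interior in Hz. toC.
  (* Half of the slack: a displacement shorter than [g] changes the sum of the focal distances by
     less than 2 g. *)
  set (g := (rho - (Cmod z + Cmod (z - C1))) / 2). assert (Hg : 0 < g) by (unfold g; toC; lra).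
  exists (Rmin d g). split; [now apply Rmin_pos|]. intros u Hne Hu.
  pose proof (Rmin_l d g). pose proof (Rmin_r d g).
  apply HH; [|exact Hne|toC; lra]. unfold ellipse_interior. toC.
  pose proof (Cmod_le_minus u z). pose proof (Cmod_triangle (z - 1) (u - z)) as T.
  replace (z - 1 + (u - z))%C with (u - 1)%C in T by ring. unfold g in *. toC. lra.
Qed.

Lemma exp_sum_mono (x s : R) : 0 <= x <= s -> exp x + exp (- x) <= exp s + exp (- s).
Proof.
  intros H.
  assert (E1 : 1 <= exp x) by (pose proof (exp_ineq1_le x); lra).
  assert (E2 : exp x <= exp s) by (destruct (Req_dec x s) as [->|N]; [lra|left; apply exp_increasing; lra]).
  rewrite !exp_Ropp. set (a := exp x) in *. set (b := exp s) in *.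
  assert (P : b + / b - (a + / a) = (b - a) * (a * b - 1) * / (a * b)) by (field; lra).
  assert (0 <= (b - a) * (a * b - 1)) by (apply Rmult_le_pos; nra).
  assert (0 < / (a * b)) by (apply Rinv_0_lt_compat; nra). nra.
Qed.

Lemma RIC_periodic_shift (g : R -> C) (th : R) : (forall x, contC g x) -> (forall x, g (x + 2 * PI) = g x) ->
  RIC (fun t => g (th + t)) (- PI) PI = RIC g (- PI) PI.
Proof.
  intros Hc Hp. pose proof PI_RGT_0.
  assert (HR : forall a b, exists I, is_RIC g a b I) by (intros a b; apply ex_RIC; intros; apply Hc).
  assert (Sh : forall c a b I, is_RIC g (a + c) (b + c) I -> is_RIC (fun t => g (t + c)) a b I).
  { intros c a b I HI. apply (is_RIC_ext (fun t => RtoC 1 * g (1 * t + c)%R)%C).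
    - intros t _. rewrite Rmult_1_l. ring.
    - apply is_RIC_comp_lin. rewrite !Rmult_1_l. exact HI. }
  destruct (HR (- PI) PI) as [I0 H0]. destruct (HR (- PI + th) (- PI)) as [I1 H1].
  rewrite (RIC_unique _ _ _ _ H0). apply RIC_unique.
  apply (is_RIC_ext (fun t => g (t + th))); [intros t _; f_equal; ring|].
  apply Sh.
  assert (H2 : is_RIC g PI (PI + th) (- I1)%C).
  { apply is_RIC_swap in H1. apply (is_RIC_ext (fun t => g (t + - (2 * PI)))).
    - intros t _. rewrite <- (Hp (t + - (2 * PI))). f_equal. ring.
    - apply Sh. replace (PI + - (2 * PI)) with (- PI) by ring. replace (PI + th + - (2 * PI)) with (- PI + th) by ring.
      exact H1. }
  eapply is_RIC_eq; [apply is_RIC_Chasles with PI; [apply is_RIC_Chasles with (- PI); [exact H1|exact H0]|exact H2]|].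
  ring.
Qed.

(** Supplies the derivative at one point of a vertical line that [Fourier_pointwise] asks for. *)
Lemma cdiff_vertical (F : C -> C) (x y : R) : cdiff F (x, y) -> exists l, derC (fun t => F (x, y + t)) 0 l.
Proof.
  intros [Phi [HP E]]. exists (Phi (x, y) * Ci)%C. apply derC_iff. intros eps He.
  destruct (HP eps He) as [d [Hd Hu]]. exists d. split; [exact Hd|]. intros h Hh Hhd. toC.
  rewrite Rplus_0_l, Rplus_0_r, (E (x, y + h)).
  assert (Ed : ((x, (y + h)%R) - (x, y))%C = (h * Ci)%C).
  { unfold Cminus, Complex.Copp, Cplus, Cmult, Ci, RtoC; simpl. f_equal; ring. }
  assert (Hd2 : Cmod ((x, (y + h)%R) - (x, y)) < d).
  { rewrite Ed, Cmod_mult, Cmod_R, Cmod_Ci, Rmult_1_r. exact Hhd. }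
  specialize (Hu _ Hd2). rewrite Ed.
  replace (RtoC (/ h) * (F (x, y) + Phi (x, (y + h)%R) * (h * Ci) - F (x, y)) - Phi (x, y) * Ci)%C with
    ((Phi (x, (y + h)%R) - Phi (x, y)) * Ci)%C.
  - rewrite Cmod_mult, Cmod_Ci, Rmult_1_r. exact Hu.
  - rewrite RtoC_inv by exact Hh. field. now apply RtoC_neq_0.
Qed.

Definition gz (f : C -> C) (z : C) : C := f (jouk (Cexp z)).

Lemma Cexp_period (x y : R) : Cexp (x, y + 2 * PI) = Cexp (x, y).
Proof. unfold Cexp; simpl. now rewrite cos_plus, sin_plus, cos_2PI, sin_2PI, !Rmult_0_r, !Rmult_1_r, Rminus_0_r, Rplus_0_r. Qed.

Lemma jouk_inv (u : C) : u <> 0 -> jouk (/ u) = jouk u.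
Proof. intros Hu. unfold jouk. field. exact Hu. Qed.

Lemma gz_even (f : C -> C) (z : C) : gz f (- z) = gz f z.
Proof. unfold gz. rewrite Cexp_opp. f_equal. apply jouk_inv, Cexp_neq_0. Qed.

Lemma cdiff_gz (rho : R) (f : C -> C) (z : C) :
  holomorphic_on (ellipse_interior rho) f -> exp (fst z) + exp (- fst z) < 2 * rho -> cdiff (gz f) z.
Proof.
  intros Hf Hz. unfold gz. apply (cdiff_comp f (fun z => jouk (Cexp z))).
  - assert (Hj : forall w, jouk (Cexp w) = (/ 4 * (2 + (Cexp w + Cexp (- (1) * w))))%C).
    { intros w. replace (- (1) * w)%C with (- w)%C by ring. rewrite Cexp_opp. unfold jouk.
      cfield. apply Cexp_neq_0. }
    assert (Hd : cdiff (fun w => / 4 * (2 + (Cexp w + Cexp (- (1) * w))))%C z).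
    { apply (cdiff_mult (fun _ => (/ 4)%C)); [apply cdiff_const|].
      apply (cdiff_plus (fun _ => RtoC 2)); [apply cdiff_const|].
      apply cdiff_plus; [apply cdiff_Cexp|].
      apply (cdiff_comp Cexp (fun w => (- (1) * w)%C)); [|apply cdiff_Cexp].
      apply (cdiff_mult (fun _ => (- (1))%C)); [apply cdiff_const|apply cdiff_id]. }
    destruct Hd as [Phi [HP EP]]. exists Phi. split; [exact HP|]. intros u. rewrite !Hj. apply EP.
  - apply (holomorphic_cdiff rho); [exact Hf|]. apply ellipse_jouk; [apply Cexp_neq_0|].
    rewrite Cmod_Cexp, <- exp_Ropp. exact Hz.
Qed.

Definition fou (f : C -> C) (k : Z) : C := (RIC (fun t => gz f (0, t)%R * ek k t)%C (- PI) PI / RtoC (2 * PI))%C.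

(** The holomorphic extension e^(-kz) of [ek k] from the imaginary axis. *)
Definition ekz (k : Z) (z : C) : C := Cexp (- RtoC (IZR k) * z)%C.

Lemma ekz_pair (k : Z) (x y t : R) : ekz k (x, y + t) = (ekz k (x, y) * ek k t)%C.
Proof.
  unfold ekz, ek. rewrite <- Cexp_plus. f_equal.
  unfold Cplus, Cmult, Complex.Copp, RtoC; simpl. f_equal; ring.
Qed.

(* Goursat on a rectangle of height [2 pi] with periodicity makes the Fourier integral independent of the
   abscissa, up to the factor [ekz]. *)
Lemma fou_shift (rho : R) (f : C -> C) (k : Z) (x y : R) :
  holomorphic_on (ellipse_interior rho) f -> 0 <= x -> exp x + exp (- x) < 2 * rho ->
  is_RIC (fun t => gz f (x, y + t)%R * ek k t)%C (- PI) PI (RtoC (2 * PI) * (fou f k / ekz k (x, y)))%C.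
Proof.
  intros Hf Hx Hr. pose proof PI_RGT_0 as HPI.
  assert (H2pi : RtoC (2 * PI) <> 0) by (apply RtoC_neq_0; lra).
  assert (Hdg : forall s t, 0 <= s <= x -> cdiff (gz f) (s, t)).
  { intros s t Hs. apply (cdiff_gz rho); [exact Hf|]. simpl.
    pose proof (exp_sum_mono s x ltac:(lra)). lra. }
  set (Gk := fun z => (gz f z * ekz k z)%C).
  assert (HdG : forall s t, 0 <= s <= x -> cdiff Gk (s, t)).
  { intros s t Hs. apply cdiff_mult; [now apply Hdg|].
    apply (cdiff_comp Cexp (fun z => (- RtoC (IZR k) * z)%C)); [|apply cdiff_Cexp].
    apply (cdiff_mult (fun _ => (- RtoC (IZR k))%C)); [apply cdiff_const|apply cdiff_id]. }
  assert (Per : forall s t, Gk (s, t + 2 * PI) = Gk (s, t)).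
  { intros s t. unfold Gk, gz. rewrite Cexp_period, ekz_pair, ek_2PI. cring. }
  pose proof (Goursat Gk 0 x (- PI) PI Hx ltac:(lra) (fun s t Hs _ => HdG s t Hs)) as GR.
  unfold Rect in GR.
  assert (Ehor : RIC (fun s => Gk (s, PI)) 0 x = RIC (fun s => Gk (s, - PI)) 0 x).
  { apply RIC_unique. apply (is_RIC_ext (fun s => Gk (s, - PI))).
    - intros s _. rewrite <- (Per s (- PI)). f_equal. f_equal. ring.
    - apply RIC_correct; [exact Hx|]. intros s Hs. apply ccont_horizontal, cdiff_ccont, HdG. lra. }
  rewrite Ehor in GR.
  assert (Ever : RIC (fun t => Gk (x, t)) (- PI) PI = RIC (fun t => Gk (0, t)) (- PI) PI).
  { set (A := RIC (fun s => Gk (s, - PI)) 0 x) in *. set (B1 := RIC (fun t => Gk (x, t)) (- PI) PI) in *.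
    set (B0 := RIC (fun t => Gk (0, t)) (- PI) PI) in *.
    transitivity (B0 + - Ci * (A + Ci * B1 - A - Ci * B0))%C.
    - transitivity (B0 - (Ci * Ci) * (B1 - B0))%C; [|ring].
      replace (Ci * Ci)%C with (- (1))%C by (unfold Ci, Cmult, Complex.Copp, RtoC; simpl; f_equal; ring). ring.
    - rewrite GR. ring. }
  assert (E0 : RIC (fun t => Gk (0, t)) (- PI) PI = (RtoC (2 * PI) * fou f k)%C).
  { unfold fou. transitivity (RIC (fun t => gz f (0, t)%R * ek k t)%C (- PI) PI); [|field; exact H2pi].
    assert (Efun : forall t, Gk (0, t) = (gz f (0, t)%R * ek k t)%C).
    { intros t. unfold Gk. f_equal. replace t with (0 + t) at 1 by ring. rewrite ekz_pair. unfold ekz.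
      replace (- IZR k * (0, 0))%C with (RtoC 0)
        by (unfold Cmult, Complex.Copp, RtoC; simpl; f_equal; ring).
      rewrite Cexp_0. cring. }
    symmetry. apply RIC_unique. apply (is_RIC_ext (fun t => Gk (0, t))); [intros; apply Efun|].
    apply RIC_correct; [lra|]. intros t _. apply ccont_vertical, cdiff_ccont, HdG. lra. }
  assert (Hcx : forall t, contC (fun t => Gk (x, t)) t)
    by (intros t; apply ccont_vertical, cdiff_ccont, HdG; lra).
  pose proof (RIC_periodic_shift (fun t => Gk (x, t)) y Hcx (Per x)) as Sh. cbv beta in Sh.
  assert (HI : is_RIC (fun t => Gk (x, y + t)) (- PI) PI (RtoC (2 * PI) * fou f k)%C).
  { rewrite <- E0, <- Ever, <- Sh. apply RIC_correct; [lra|]. intros t _.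
    apply (contC_comp (fun t => Gk (x, t)) (fun t => y + t)); [|apply Hcx].
    apply (ex_derive_continuous (V := R_NormedModule)). auto_derive. exact Logic.I. }
  assert (Hek : ekz k (x, y) <> RtoC 0) by apply Cexp_neq_0.
  apply (is_RIC_ext (fun t => / ekz k (x, y) * Gk (x, (y + t)%R))%C).
  { intros t _. unfold Gk. rewrite ekz_pair. cfield. exact Hek. }
  eapply is_RIC_eq; [apply is_RIC_scal; exact HI|]. field. exact Hek.
Qed.

Lemma fou_even (rho : R) (f : C -> C) (k : Z) : 1 < rho ->
  holomorphic_on (ellipse_interior rho) f -> fou f (- k) = fou f k.
Proof.
  intros Hrho Hf. pose proof PI_RGT_0 as HPI. unfold fou. f_equal.
  assert (Hc : forall j t, contC (fun t => gz f (0, t)%R * ek j t)%C t).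
  { intros j t. apply contC_mult; [|apply contC_ek]. apply ccont_vertical, cdiff_ccont, (cdiff_gz rho); [exact Hf|].
    simpl. rewrite Ropp_0, exp_0. lra. }
  apply RIC_unique.
  apply (is_RIC_ext (fun t => (-(1)) * (RtoC (-1) * (gz f (0%R, (-1 * t + 0)%R) * ek k (-1 * t + 0))))%C).
  - intros t _. replace (-1 * t + 0) with (- t) by ring.
    replace (gz f (0, - t)) with (gz f (0, t)).
    + replace (ek (- k) t) with (ek k (- t)); [cring|]. unfold ek. rewrite opp_IZR. f_equal. f_equal. ring.
    + rewrite <- gz_even. f_equal. unfold Complex.Copp; simpl. f_equal. ring.
  - apply is_RIC_eq with ((-(1)) * (- RIC (fun t => gz f (0, t)%R * ek k t)%C (- PI) PI))%C; [|ring].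
    apply is_RIC_scal.
    apply (is_RIC_comp_lin (fun t => gz f (0, t)%R * ek k t)%C (-1) 0).
    replace (-1 * - PI + 0) with PI by ring. replace (-1 * PI + 0) with (- PI) by ring.
    apply is_RIC_swap. apply RIC_correct; [lra|]. intros; apply Hc.
Qed.

Lemma ekz_nat (n : nat) (z : C) : ekz (- Z.of_nat n) z = (Cexp z ^ n)%C.
Proof.
  unfold ekz. rewrite opp_IZR, <- INR_IZR_INZ, RtoC_opp.
  replace (- - RtoC (INR n) * z)%C with (INR n * z)%C by ring. apply Cexp_nat.
Qed.

Lemma ekz_opp (k : Z) (z : C) : (/ ekz k z)%C = ekz (- k) z.
Proof. unfold ekz. rewrite <- Cexp_opp. f_equal. rewrite opp_IZR, RtoC_opp. ring. Qed.

(** The decay comes from evaluating the k-th coefficient on the vertical line of abscissa ln s. The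
    expansion at u = e^(x+iy) is the Fourier series at t = 0 of [gz f] along the vertical line
    through x + iy. *)
Lemma chebyshev_expansion (rho : R) (f : C -> C) :
  1 < rho -> holomorphic_on (ellipse_interior rho) f ->
  exists c : nat -> C,
    (forall s, 1 <= s -> s + / s < 2 * rho -> exists M, 0 < M /\ forall k, Cmod (c k) * s ^ k <= M) /\
    (forall u, 1 <= Cmod u -> Cmod u + / Cmod u < 2 * rho ->
       Ccv_series (fun k => c k * (u ^ k + (/ u) ^ k))%C (f (jouk u))).
Proof.
  intros Hrho Hf. pose proof PI_RGT_0 as HPI.
  assert (H2pi : RtoC (2 * PI) <> 0) by (apply RtoC_neq_0; lra).
  (* The term of index 0 carries u^0 + u^0 = 2, so its coefficient is halved. *)
  exists (fun k => match k with O => fou f 0 / 2 | S _ => fou f (Z.of_nat k) end)%C. split.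
  - intros s Hs Hr.
    set (x := ln s). assert (Ex : exp x = s) by (apply exp_ln; lra).
    assert (Ex' : exp (- x) = / s) by (rewrite exp_Ropp, Ex; reflexivity).
    assert (Hx : 0 <= x).
    { unfold x. destruct (Req_dec s 1) as [->|N]; [rewrite ln_1; lra|]. rewrite <- ln_1. left. apply ln_increasing; lra. }
    assert (Hcx : forall t, contC (fun t => gz f (x, t)) t).
    { intros t. apply ccont_vertical, cdiff_ccont, (cdiff_gz rho); [exact Hf|]. simpl. rewrite Ex, Ex'. exact Hr. }
    destruct (contC_bounded (fun t => gz f (x, t)) (- PI) PI) as [M [HM HMb]]; [lra|intros; apply Hcx|].
    assert (B : forall n : nat, Cmod (fou f (Z.of_nat n)) * s ^ n <= M).
    { intros n. pose proof (fou_shift rho f (Z.of_nat n) x 0 Hf Hx ltac:(rewrite Ex, Ex'; exact Hr)) as FS.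
      assert (Hb : forall t, - PI <= t <= PI -> Cmod (gz f (x, 0 + t)%R * ek (Z.of_nat n) t) <= M).
      { intros t Ht. rewrite Cmod_mult, Cmod_ek, Rmult_1_r, Rplus_0_l. now apply HMb. }
      assert (Hle : - PI <= PI) by lra.
      pose proof (is_RIC_bound _ _ _ M _ Hle Hb FS) as BF. unfold Complex.Cdiv in BF. rewrite ekz_opp, ekz_nat in BF.
      rewrite !Cmod_mult, Cmod_pow, Cmod_Cexp, Cmod_R, Rabs_pos_eq in BF by lra. simpl fst in BF. rewrite Ex in BF.
      apply Rmult_le_reg_l with (2 * PI); lra. }
    exists M. split; [exact HM|]. intros [|k]; [|apply B].
    specialize (B O). simpl in B. simpl.
    rewrite Cmod_div by (apply RtoC_neq_0; lra). rewrite Cmod_R, Rabs_pos_eq by lra.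
    pose proof (Cmod_ge_0 (fou f 0)). unfold Rdiv. lra.
  - intros u Hu Hr. assert (Hu0 : u <> 0) by (apply Cmod_gt_0; lra).
    destruct (Cexp_surj u Hu0) as [[x y] Ez].
    assert (Ex : exp x = Cmod u) by (rewrite <- Ez, Cmod_Cexp; reflexivity).
    assert (Ex' : exp (- x) = / Cmod u) by (rewrite exp_Ropp, Ex; reflexivity).
    assert (Hx : 0 <= x).
    { destruct (Rle_lt_dec 0 x) as [Hl|Hl]; [exact Hl|]. apply exp_increasing in Hl. rewrite exp_0 in Hl. lra. }
    assert (Hr' : exp x + exp (- x) < 2 * rho) by (rewrite Ex, Ex'; exact Hr).
    assert (Hd : forall t, cdiff (gz f) (x, t)) by (intros t; apply (cdiff_gz rho); [exact Hf|exact Hr']).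
    destruct (cdiff_vertical _ _ _ (Hd y)) as [l Hl].
    pose proof (Fourier_pointwise (fun t => gz f (x, y + t)) l (fun k => fou f k / ekz k (x, y))%C) as FP.
    cbv beta in FP. rewrite Rplus_0_r in FP.
    assert (Hc1 : forall t, - PI <= t <= PI -> contC (fun t => gz f (x, y + t)) t).
    { intros t _. apply (contC_comp (fun t => gz f (x, t)) (fun t => y + t)).
      - apply (ex_derive_continuous (V := R_NormedModule)). auto_derive. exact Logic.I.
      - apply ccont_vertical, cdiff_ccont, Hd. }
    pose proof (FP Hc1 Hl (fun k => fou_shift rho f k x y Hf Hx Hr')) as FC.
    unfold gz in FC. rewrite Ez in FC.
    eapply Ccv_ext; [|exact FC]. intros n. cbv beta. induction n as [|n IH].
    + simpl. replace (ekz 0 (x, y)) with (RtoC 1).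
      * cfield.
      * unfold ekz. replace (- RtoC 0 * (x, y))%C with (RtoC 0) by ring. symmetry. apply Cexp_0.
    + cbn [Csum]. rewrite <- IH. toC.
      unfold Complex.Cdiv. rewrite !ekz_opp, Z.opp_involutive, ekz_nat, Ez, (fou_even rho) by assumption.
      assert (En : ekz (Z.of_nat (S n)) (x, y) = ((/ u) ^ S n)%C).
      { rewrite <- (Z.opp_involutive (Z.of_nat (S n))), <- ekz_opp, ekz_nat, Ez. symmetry. now apply Cpow_inv. }
      rewrite En. cring.
Qed.

(** * Expansion in Rodrigues polynomials *)

Definition mhalf : C := RtoC (- (1 / 2)).

(* Normalises the Rodrigues polynomial with [alpha = beta = -1/2] so that its value at [jouk u] is
   [u^k + u^-k]; thus [tch 0] is the constant 2. *)
Definition tcoef (k : nat) : C := (2 * (-(1)) ^ k / poch (1 / 2) k)%C.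

(** Treating the Chebyshev polynomials as Rodrigues polynomials makes [pc_norm] and [pfun_reflect]
    available for them. *)
Definition tch (k : nat) (z : C) : C := (tcoef k * pfun k mhalf mhalf z)%C.

Lemma gam_ok_half : gam_ok (1 / 2)%C.
Proof.
  intros n E. rewrite <- RtoC_div, <- RtoC_plus in E by lra. apply RtoC_inj in E. pose proof (pos_INR n). lra.
Qed.

Lemma mhalf_eq : mhalf = (- (1 / 2))%C.
Proof. unfold mhalf. rewrite RtoC_opp, RtoC_div by lra. reflexivity. Qed.

Lemma tch_rec (m : nat) (z : C) : tch (S (S m)) z = (- 2 * (1 - 2 * z) * tch (S m) z - tch m z)%C.
Proof.
  unfold tch, tcoef.
  pose proof (pfun_three_term m mhalf mhalf z) as T. cbv zeta in T. rewrite mhalf_eq in *.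
  pose proof (poch_gam_ok _ m gam_ok_half) as P0.
  pose proof (gam_ok_half m) as P1. pose proof (gam_ok_half (S m)) as P2.
  rewrite RtoC_INR_S in P2.
  rewrite !poch_S, !Cpow_S, RtoC_INR_S.
  set (x := RtoC (INR m)) in *.
  assert (Q1 : (2 * x + 1)%C <> 0).
  { intros E. apply P1. transitivity ((2 * x + 1) / 2)%C; [field|]. rewrite E. field. }
  assert (Q3 : (x + 1)%C <> 0) by apply RtoC_INR_S_neq_0.
  assert (T' : pfun (S (S m)) (- (1 / 2)) (- (1 / 2)) z =
    ((2 * x + 3) * (1 - 2 * z) * pfun (S m) (- (1 / 2)) (- (1 / 2)) z -
     (x + 1 / 2) * (x + 1 + 1 / 2) * pfun m (- (1 / 2)) (- (1 / 2)) z)%C).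
  { transitivity ((2 * (x + 1 + - (1 / 2) + - (1 / 2) + 1) * (2 * (x + 1) + - (1 / 2) + - (1 / 2)) *
       pfun (S (S m)) (- (1 / 2)) (- (1 / 2)) z) / (2 * (x + 1) * (2 * x + 1)))%C.
    - field. split; assumption.
    - rewrite T. field. split; assumption. }
  rewrite T'. field. repeat split; try assumption.
  - intros E. apply P1. transitivity ((1 + x * 2) / 2)%C; [field|]. rewrite E. field.
  - intros E. apply P2. transitivity ((1 + (x + 1) * 2) / 2)%C; [field|]. rewrite E. field.
Qed.

Lemma tch_jouk (u : C) (k : nat) : u <> 0 -> tch k (jouk u) = (u ^ k + (/ u) ^ k)%C.
Proof.
  intros Hu.
  enough (H : tch k (jouk u) = (u ^ k + (/ u) ^ k)%C /\ tch (S k) (jouk u) = (u ^ S k + (/ u) ^ S k)%C) by apply H.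
  induction k as [|k [IH1 IH2]].
  - split.
    + unfold tch, tcoef. rewrite pfun_0. simpl. field.
    + unfold tch, tcoef. rewrite pfun_1, mhalf_eq. simpl. unfold jouk. field. exact Hu.
  - split; [exact IH2|]. rewrite tch_rec, IH1, IH2, !Cpow_S. unfold jouk. field. exact Hu.
Qed.

(** The segment [0,1] is the degenerate ellipse: m + 1/m = 2 forces m = 1. *)
Lemma unit_interval_jouk (x : R) : 0 <= x <= 1 -> exists u, Cmod u = 1 /\ jouk u = x.
Proof.
  intros Hx. destruct (jouk_surj x) as [u [Hu E]]. exists u. split; [|exact E].
  assert (Hu0 : u <> 0) by (apply Cmod_gt_0; lra).
  pose proof (jouk_ellipse u Hu0) as J. rewrite E, <- RtoC_minus, !Cmod_R in J.
  rewrite Rabs_pos_eq in J by lra. rewrite Rabs_left1 in J by lra.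
  set (m := Cmod u) in *.
  assert (m + / m = 2) by lra. assert (m * m + 1 = 2 * m).
  { transitivity (m * (m + / m)); [field; lra|]. rewrite H. ring. }
  nra.
Qed.

Lemma tch_bound (u : C) (k : nat) : 1 <= Cmod u -> Cmod (tch k (jouk u)) <= 2 * Cmod u ^ k.
Proof.
  intros Hu. assert (Hu0 : u <> 0) by (apply Cmod_gt_0; lra). rewrite tch_jouk by exact Hu0.
  eapply Rle_trans; [apply Cmod_triangle|]. rewrite !Cmod_pow.
  pose proof (Cmod_inv_le_1 u Hu). pose proof (pow_R1_Rle (Cmod u) k Hu).
  pose proof (pow_incr (Cmod (/ u)) 1 k (conj (Cmod_ge_0 _) H)) as Q. rewrite pow1 in Q.
  lra.
Qed.

(** The leading coefficient of p_n is (al+be+n+1)_n up to sign, and the hypothesis keeps it nonzero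
    for n >= 1. So p_n has degree exactly n, and the leading term can be removed at each step. *)
Lemma poly_basis (al be : C) (k : nat) : gam_ok (al + be + 2) -> forall c : nat -> C,
  exists b : nat -> C, forall z, Csum (fun j => c j * z ^ j)%C k = Csum (fun n => b n * pfun n al be z)%C k.
Proof.
  intros Hg. induction k as [|k IH]; intros c.
  - exists c. intros z. simpl. rewrite pfun_0. cring.
  - assert (HL : pc (S k) al be (S k) <> 0).
    { rewrite pc_lead. apply Cmult_neq_0; [apply sgn_neq_0|]. apply poch_neq_0. intros j _ E.
      apply (Hg (k + j)%nat). rewrite <- E, RtoC_INR_plus, RtoC_INR_S. ring. }
    set (d := (c (S k) / pc (S k) al be (S k))%C).
    destruct (IH (fun j => c j - d * pc (S k) al be j)%C) as [b Hb].
    exists (fun n => if Nat.eq_dec n (S k) then d else b n). intros z.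
    cbn [Csum]. destruct (Nat.eq_dec (S k) (S k)) as [_|N]; [|now elim N].
    rewrite (Csum_ext (fun n => (if Nat.eq_dec n (S k) then d else b n) * pfun n al be z)%C
      (fun n => b n * pfun n al be z)%C k).
    2:{ intros n Hn. destruct (Nat.eq_dec n (S k)); [lia|reflexivity]. }
    rewrite <- Hb.
    rewrite (Csum_ext (fun j => (c j - d * pc (S k) al be j) * z ^ j)%C
      (fun j => c j * z ^ j - d * (pc (S k) al be j * z ^ j))%C) by (intros; cring).
    rewrite Csum_minus, Csum_scal. unfold pfun. cbn [Csum].
    assert (Ed : (c (S k)) = (d * pc (S k) al be (S k))%C) by (unfold d; field; exact HL).
    rewrite Ed. cring.
Qed.

Lemma fp_int_pfun_pfun (al be : C) (rho : R) (m n : nat) : fp_regular al -> fp_regular be -> 0 < rho <= 1 / 2 ->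
  fp_int al be rho (fun t => pfun m al be (RtoC t) * pfun n al be (RtoC t))%C
    (if Nat.eq_dec m n then sqnorm al be rho n else RtoC 0).
Proof.
  intros Na Nb Hr. destruct (Nat.eq_dec m n) as [->|N].
  - apply fp_int_poly_diag; assumption.
  - destruct (lt_dec m n) as [Hl|Hl].
    + apply fp_int_poly_orth; assumption.
    + apply fp_int_ext with (h1 := fun t => (pfun n al be (RtoC t) * pfun m al be (RtoC t))%C); [exact Hr|intros; ring|].
      apply fp_int_poly_orth; try assumption. lia.
Qed.

Lemma fp_int_coefficient (al be : C) (rho : R) (k n : nat) (b : nat -> C) : fp_regular al -> fp_regular be -> 0 < rho <= 1 / 2 ->
  (n <= k)%nat ->
  fp_int al be rho (fun t => Csum (fun m => b m * pfun m al be (RtoC t)) k * pfun n al be (RtoC t))%C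
    (b n * sqnorm al be rho n)%C.
Proof.
  intros Na Nb Hr Hn.
  pose proof (fp_int_Csum al be rho (fun m t => b m * (pfun m al be (RtoC t) * pfun n al be (RtoC t)))%C
    (fun m => b m * (if Nat.eq_dec m n then sqnorm al be rho n else RtoC 0))%C k Na Nb Hr) as H.
  rewrite (Csum_single _ k n Hn) in H.
  - destruct (Nat.eq_dec n n) as [_|N]; [|now elim N].
    apply fp_int_ext with (3 := H ltac:(intros; apply fp_int_scal; try assumption; now apply fp_int_pfun_pfun)); [exact Hr|].
    intros t _. rewrite <- Csum_scal_r. apply Csum_ext. intros; cring.
  - intros m _ Hm. destruct (Nat.eq_dec m n); [contradiction|cring].
Qed.

Lemma geometric_poly (th : R) : 0 <= th < 1 -> exists B th1, 0 < B /\ 0 < th1 < 1 /\ th <= th1 /\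
  forall k, (INR k + 1) * th ^ k <= B * th1 ^ k.
Proof.
  intros Ht. set (d := (1 - th) / 2). assert (Hd : 0 < d <= 1 / 2) by (unfold d; lra).
  (* Bernoulli's inequality bounds k + 1 by (1+d)^k / d; the summand d/4 keeps the new ratio
     positive when [th] is 0. *)
  exists (/ d), (th * (1 + d) + d / 4).
  assert (E : th * (1 + d) + d / 4 < 1) by (unfold d; nra).
  assert (Hid : 0 < / d) by (apply Rinv_0_lt_compat; lra).
  split; [exact Hid|]. split; [split; [nra|exact E]|]. split; [nra|].
  intros k. pose proof (poly k d (proj1 Hd)) as P. pose proof (pos_INR k).
  assert (H1 : INR k + 1 <= / d * (1 + d) ^ k).
  { apply Rmult_le_reg_l with d; [lra|]. rewrite <- Rmult_assoc, Rinv_r by lra. nra. }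
  assert (H2 : (1 + d) ^ k * th ^ k <= (th * (1 + d) + d / 4) ^ k).
  { rewrite <- Rpow_mult_distr. apply pow_incr. nra. }
  pose proof (pow_le th k (proj1 Ht)).
  apply Rle_trans with (/ d * (1 + d) ^ k * th ^ k); [now apply Rmult_le_compat_r|].
  rewrite Rmult_assoc. apply Rmult_le_compat_l; lra.
Qed.

Lemma sum_tail_geom (x : nat -> C) (B th : R) (N : nat) (L : C) : 0 <= B -> 0 < th < 1 ->
  (forall k, (k < N)%nat -> x k = 0) -> (forall k, Cmod (x k) <= B * th ^ k) -> Ccv_series x L ->
  Cmod L <= B / (1 - th) * th ^ N.
Proof.
  intros HB Ht H0 Hx HL.
  assert (Hpow : forall j, 0 < th ^ j) by (intros; apply pow_lt; lra).
  assert (Hi : 0 < / (1 - th)) by (apply Rinv_0_lt_compat; lra).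
  apply (Ccv_Cmod_le _ _ _ (Ccv_subseq_shift _ _ N HL)). intros j. cbv beta.
  assert (E : Cmod (Csum x (j + N)) <= B * th ^ N * sum_f_R0 (pow th) j).
  { induction j as [|j IH].
    - simpl. rewrite (Csum_single x N N) by (try lia; intros; apply H0; lia). specialize (Hx N). lra.
    - change (S j + N)%nat with (S (j + N)). cbn [Csum]. eapply Rle_trans; [apply Cmod_triangle|].
      rewrite tech5, Rmult_plus_distr_l. apply Rplus_le_compat; [exact IH|].
      eapply Rle_trans; [apply Hx|]. right.
      replace (S (j + N)) with (N + S j)%nat by lia. rewrite pow_add. ring. }
  eapply Rle_trans; [exact E|]. pose proof (sum_geom_le th j ltac:(lra)) as G.
  unfold Rdiv. replace (B * / (1 - th) * th ^ N) with (B * th ^ N * / (1 - th)) by ring.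
  apply Rmult_le_compat_l; [|exact G]. specialize (Hpow N). nra.
Qed.

(* In [Fv - sum_(n <= N) fc n P n] the terms with [k <= N] cancel, so only [N < n <= k] remain. *)
Lemma triangular_rearrangement (B th : R) : 0 <= B -> 0 <= th < 1 ->
  exists B2 th1, 0 < B2 /\ 0 < th1 < 1 /\
  forall (c tau P fc : nat -> C) (ph : nat -> nat -> C) (Fv : C),
    Ccv_series (fun k => c k * tau k)%C Fv ->
    (forall k, tau k = Csum (fun n => ph k n * P n)%C k) ->
    (forall k n, (k < n)%nat -> ph k n = 0) ->
    (forall n, Ccv_series (fun k => c k * ph k n)%C (fc n)) ->
    (forall k n, (n <= k)%nat -> Cmod (c k * ph k n * P n) <= B * th ^ k) ->
    (forall n, Cmod (fc n * P n) <= B2 * th1 ^ n) /\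
    (forall N, Cmod (Csum (fun n => fc n * P n)%C N - Fv) <= B2 * th1 ^ N).
Proof.
  intros HB Ht. destruct (geometric_poly th Ht) as [B1 [th1 [HB1 [Ht1 [Hle Hgp]]]]].
  assert (Hi : 0 < / (1 - th1)) by (apply Rinv_0_lt_compat; lra).
  assert (Hpow : forall j, 0 < th1 ^ j) by (intros; apply pow_lt; lra).
  (* The summand [B1] accounts for sums of up to k + 1 terms bounded by B th^k, the summand 1 for a
     single such term. *)
  set (B3 := B * (B1 + 1)). assert (HB3 : 0 <= B3) by (unfold B3; nra).
  set (B2 := B3 * / (1 - th1) * / th1 + 1).
  assert (Hit : 1 < / th1) by (rewrite <- Rinv_1; apply Rinv_lt_contravar; lra).
  assert (HX : 0 <= B3 * / (1 - th1)) by nra.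
  exists B2, th1. split; [unfold B2; nra|]. split; [exact Ht1|].
  intros c tau P fc ph Fv H1 H2 H3 H4 H5.
  assert (Hth : forall k, B * th ^ k <= B3 * th1 ^ k).
  { intros k. unfold B3. rewrite Rmult_assoc. apply Rmult_le_compat_l; [exact HB|].
    assert (th ^ k <= th1 ^ k) by (apply pow_incr; lra). specialize (Hpow k). nra. }
  assert (HB2 : B3 / (1 - th1) <= B2).
  { unfold B2, Rdiv. nra. }
  split.
  - intros n.
    assert (HS : Ccv_series (fun k => c k * ph k n * P n)%C (fc n * P n)%C).
    { apply Ccv_series_ext with (fun k => P n * (c k * ph k n))%C; [intros; ring|].
      replace (fc n * P n)%C with (P n * fc n)%C by ring. apply Ccv_series_scal, H4. }
    apply Rle_trans with (B3 / (1 - th1) * th1 ^ n); [|apply Rmult_le_compat_r; [left; apply Hpow|exact HB2]].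
    apply (sum_tail_geom (fun k => c k * ph k n * P n)%C); [exact HB3|exact Ht1| | |exact HS].
    + intros k Hk. rewrite H3 by exact Hk. ring.
    + intros k. destruct (le_lt_dec n k) as [Hk|Hk].
      * eapply Rle_trans; [now apply H5|apply Hth].
      * rewrite H3 by exact Hk. replace (c k * 0 * P n)%C with (RtoC 0) by ring. rewrite Cmod_0.
        specialize (Hpow k). nra.
  - intros N. rewrite Cmod_minus_sym.
    set (x := fun k => (c k * tau k - Csum (fun n => c k * ph k n * P n)%C N)%C).
    assert (HxS : Ccv_series x (Fv - Csum (fun n => fc n * P n)%C N)%C).
    { apply Ccv_ext with (fun K => Csum (fun k => c k * tau k)%C K -
        Csum (fun n => Csum (fun k => c k * ph k n * P n)%C K) N)%C.
      - intros K. unfold x. rewrite Csum_minus. f_equal. apply (Csum_swap (fun n k => c k * ph k n * P n)%C).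
      - apply Ccv_minus; [exact H1|].
        apply (Ccv_Csum (fun n K => Csum (fun k => c k * ph k n * P n)%C K) (fun n => fc n * P n)%C).
        intros n _. apply (Ccv_series_ext (fun k => P n * (c k * ph k n))%C); [intros; ring|].
        replace (fc n * P n)%C with (P n * fc n)%C by ring. apply Ccv_series_scal, H4. }
    assert (Ex : forall k, x k = (Csum (fun n => c k * ph k n * P n)%C k - Csum (fun n => c k * ph k n * P n)%C N)%C).
    { intros k. unfold x. f_equal. rewrite H2, <- Csum_scal. apply Csum_ext. intros; cring. }
    assert (Hz : forall k n, (k < n)%nat -> (c k * ph k n * P n)%C = 0).
    { intros k n Hk. rewrite H3 by exact Hk. ring. }
    apply Rle_trans with (B3 / (1 - th1) * th1 ^ S N).
    + apply (sum_tail_geom x); [exact HB3|exact Ht1| | |exact HxS].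
      * intros k Hk. rewrite Ex. rewrite (Csum_extend _ k N) by (try lia; intros; apply Hz; lia). cring.
      * intros k. destruct (le_lt_dec k N) as [Hk|Hk].
        -- rewrite Ex. rewrite (Csum_extend _ k N) by (try lia; intros; apply Hz; lia).
           replace (_ - _)%C with (RtoC 0) by cring. rewrite Cmod_0. specialize (Hpow k). nra.
        -- rewrite Ex. eapply Rle_trans; [apply Csum_diff_le; lia|].
           pose proof (cond_pos_sum (fun n => Cmod (c k * ph k n * P n)) N (fun n => Cmod_ge_0 _)) as HP.
           apply Rle_trans with (sum_f_R0 (fun _ => B * th ^ k) k).
           ++ apply Rle_trans with (sum_f_R0 (fun n => Cmod (c k * ph k n * P n)) k); [lra|].
              apply sum_Rle. intros n Hn. now apply H5.
           ++ rewrite sum_cte, S_INR. unfold B3. specialize (Hgp k). specialize (Hpow k).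
              apply Rle_trans with (B * (B1 * th1 ^ k)); [|nra].
              replace (B * th ^ k * (INR k + 1)) with (B * ((INR k + 1) * th ^ k)) by ring.
              now apply Rmult_le_compat_l.
    + apply Rle_trans with (B2 * th1 ^ S N); [apply Rmult_le_compat_r; [left; apply Hpow|exact HB2]|].
      apply Rmult_le_compat_l; [unfold B2; nra|]. simpl. specialize (Hpow N). nra.
Qed.

(** * The norm of the products of Chebyshev and Rodrigues polynomials *)

Lemma half_norm_weaken (b : C) (rho : R) (h : R -> C) (nu nu' : R) : nu <= nu' -> half_norm b rho h nu -> half_norm b rho h nu'.
Proof.
  intros Hle [H1 [H2 H3]]. split; [eapply taylor_norm_weaken; eassumption|]. split; [exact H2|].
  intros x Hx. specialize (H3 x Hx). lra.
Qed.

Lemma half_norm_scal (b : C) (rho : R) (k : C) (h : R -> C) (nu : R) :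
  half_norm b rho h nu -> half_norm b rho (fun t => k * h t)%C (Cmod k * nu).
Proof.
  intros [H1 [H2 H3]]. split; [|split].
  - apply taylor_norm_ext with (2 := taylor_norm_scal _ k _ _ H1). intros t _. cring.
  - intros x Hx. apply contC_mult; [apply contC_const|now apply H2].
  - intros x Hx. rewrite Cmod_mult. apply Rmult_le_compat_l; [apply Cmod_ge_0|now apply H3].
Qed.

Lemma Cmod_sgn (k : nat) : Cmod ((-(1)) ^ k) = 1.
Proof. rewrite Cmod_pow, Cmod_opp, Cmod_1. apply pow1. Qed.

(** The radius is produced after [q]: the Taylor part of the norm loses no more than q^n only when
    [rho] is small enough for [pc_norm]. At the right endpoint [pfun_reflect] supplies the expansion
    in powers of 1 - x. *)
Lemma fp_norm_tch_pfun (al be : C) (q : R) :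
  (forall k : nat, (al + be)%C <> RtoC (- INR (k + 2))) -> 1 < q ->
  exists rho K, 0 < rho <= 1 / 2 /\ 0 < K /\ forall k n,
    fp_norm al be rho (fun t => tch k (RtoC t) * pfun n al be (RtoC t))%C (K * (q ^ k * (INR (fact n) * q ^ n))).
Proof.
  (* The Chebyshev part loses p^k twice, in the coefficient sum and in the normalisation by (1/2)_k;
     hence q = p^2. *)
  intros Hs Hq. destruct (root_gt_1 q 1 Hq) as [p [Hp Epq]].
  assert (Ep : forall k, p ^ k * p ^ k = q ^ k).
  { intros k. rewrite <- Rpow_mult_distr. f_equal. rewrite <- Epq. ring. }
  assert (Epp : p * p = q) by (rewrite <- Epq; ring).
  assert (Hpq : p <= q) by nra.
  assert (Hpk : forall k, 0 < p ^ k <= q ^ k).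
  { intros k. split; [apply pow_lt; lra|apply pow_incr; lra]. }
  destruct (pc_norm p Hp) as [rho0 [Hrho0 HPN]].
  set (rho := Rmin rho0 (1 / 2)).
  assert (Hr : 0 < rho <= rho0) by (unfold rho; split; [apply Rmin_pos; lra|apply Rmin_l]).
  assert (Hr2 : 0 < rho <= 1 / 2) by (split; [apply Hr|apply Rmin_r]).
  destruct (HPN rho Hr mhalf mhalf) as [K1 [HK1 N1]].
  destruct (HPN rho Hr al be) as [K3 [HK3 N3]]. destruct (HPN rho Hr be al) as [K4 [HK4 N4]].
  destruct (fact_le_poch (1 / 2)%C p gam_ok_half Hp) as [K2 [HK2 N2]].
  (* On [0,1] the parameter u has modulus 1, but the growth bound needs a radius above 1; with
     radius [p] the total rate is p p = q. *)
  destruct (pfun_growth al be p p Hs Hp Hp) as [K5 [HK5 N5]]. rewrite Epp in N5.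
  destruct (half_norm_poly2 be) as [K6 [HK6 N6]]. destruct (half_norm_poly2 al) as [K7 [HK7 N7]].
  set (KT := 2 * K1 * K2 + 2). set (KP := K3 + K4 + K5).
  assert (HKT : 0 < KT) by (unfold KT; nra). assert (HKP : 0 < KP) by (unfold KP; lra).
  exists rho, ((K6 + K7) * (KT * KP)). split; [exact Hr2|]. split; [repeat apply Rmult_lt_0_compat; lra|]. intros k n.
  pose proof (INR_fact_lt_0 n) as HF. pose proof (INR_fact_lt_0 k) as HFk.
  destruct (Hpk k) as [Hp1 Hp2]. destruct (Hpk n) as [Hp3 Hp4].
  assert (Hq1 : 1 <= q ^ k) by (apply pow_R1_Rle; lra).
  set (mt := KT * q ^ k). set (mp := KP * (INR (fact n) * q ^ n)).
  assert (Hmt : 0 <= mt) by (unfold mt; nra).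
  assert (HFq : 0 < INR (fact n) * q ^ n) by nra.
  assert (Hmp : 0 <= mp) by (unfold mp; nra).
  assert (Pk : poch (1 / 2) k <> 0) by apply (poch_gam_ok _ k gam_ok_half).
  assert (Pkp := proj1 (Cmod_gt_0 _) Pk).
  assert (Tc : Cmod (tcoef k) = 2 / Cmod (poch (1 / 2) k)).
  { unfold tcoef. rewrite Cmod_div, Cmod_mult, Cmod_sgn, Cmod_R, Rabs_pos_eq by (try exact Pk; lra). f_equal. ring. }
  assert (T0 : sum_f_R0 (fun j => Cmod (tcoef k * pc k mhalf mhalf j) * rho ^ j) k <= mt).
  { rewrite (sum_eq _ (fun j => (Cmod (pc k mhalf mhalf j) * rho ^ j) * Cmod (tcoef k)))
      by (intros j _; rewrite Cmod_mult; ring).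
    rewrite <- scal_sum, Tc. specialize (N1 k). specialize (N2 k).
    apply Rle_trans with (2 / Cmod (poch (1 / 2) k) * (K1 * INR (fact k) * p ^ k)).
    { apply Rmult_le_compat_l; [apply Rdiv_le_0_compat; lra|exact N1]. }
    apply Rle_trans with (2 / Cmod (poch (1 / 2) k) * (K1 * (K2 * Cmod (poch (1 / 2) k) * p ^ k) * p ^ k)).
    { apply Rmult_le_compat_l; [apply Rdiv_le_0_compat; lra|]. apply Rmult_le_compat_r; [lra|].
      apply Rmult_le_compat_l; lra. }
    replace (2 / Cmod (poch (1 / 2) k) * (K1 * (K2 * Cmod (poch (1 / 2) k) * p ^ k) * p ^ k)) with
      (2 * K1 * K2 * (p ^ k * p ^ k)) by (field; lra).
    rewrite Ep. unfold mt, KT. nra. }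
  assert (TS : forall x, 0 <= x <= 1 -> Cmod (tch k (RtoC x)) <= mt).
  { intros x Hx. destruct (unit_interval_jouk x Hx) as [u [Hu Eu]]. rewrite <- Eu.
    eapply Rle_trans; [apply tch_bound; lra|]. rewrite Hu, pow1. unfold mt, KT.
    assert (0 < K1 * K2) by nra. nra. }
  assert (PSup : forall x, 0 <= x <= 1 -> Cmod (pfun n al be (RtoC x)) <= mp).
  { intros x Hx. destruct (unit_interval_jouk x Hx) as [u [Hu Eu]]. rewrite <- Eu.
    eapply Rle_trans; [apply N5; lra|]. unfold mp, KP. rewrite Rmult_assoc. apply Rmult_le_compat_r; lra. }
  assert (P0 : sum_f_R0 (fun j => Cmod (pc n al be j) * rho ^ j) n <= mp).
  { eapply Rle_trans; [apply N3|]. unfold mp, KP. rewrite Rmult_assoc.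
    apply Rmult_le_compat; try lra; [nra|]. apply Rmult_le_compat_l; lra. }
  assert (P1 : sum_f_R0 (fun j => Cmod ((-(1)) ^ n * pc n be al j) * rho ^ j) n <= mp).
  { rewrite (sum_eq _ (fun j => Cmod (pc n be al j) * rho ^ j))
      by (intros j _; rewrite Cmod_mult, Cmod_sgn, Rmult_1_l; reflexivity).
    eapply Rle_trans; [apply N4|]. unfold mp, KP. rewrite Rmult_assoc.
    apply Rmult_le_compat; try lra; [nra|]. apply Rmult_le_compat_l; lra. }
  assert (T1 : sum_f_R0 (fun j => Cmod ((-(1)) ^ k * (tcoef k * pc k mhalf mhalf j)) * rho ^ j) k <= mt).
  { rewrite (sum_eq _ (fun j => Cmod (tcoef k * pc k mhalf mhalf j) * rho ^ j)); [exact T0|].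
    intros j _. rewrite Cmod_mult, Cmod_sgn, Rmult_1_l. reflexivity. }
  assert (Etot : forall K', 0 < K' <= K6 + K7 ->
    K' * (mt * mp) <= (K6 + K7) * (KT * KP) * (q ^ k * (INR (fact n) * q ^ n))).
  { intros K' HK'. replace ((K6 + K7) * (KT * KP) * (q ^ k * (INR (fact n) * q ^ n))) with ((K6 + K7) * (mt * mp))
      by (unfold mt, mp; ring). apply Rmult_le_compat_r; [nra|lra]. }
  assert (Epoly : forall m a b (z : R), pfun m a b z = Csum (fun j => pc m a b j * RtoC z ^ j)%C m) by reflexivity.
  split.
  - eapply half_norm_weaken; [apply (Etot K6); lra|].
    apply (N6 rho Hr2 k n (fun j => tcoef k * pc k mhalf mhalf j)%C (pc n al be)); try assumption.
    + intros t. unfold tch. rewrite Epoly, <- Csum_scal. apply Csum_ext. intros; cring.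
    + intros t. apply Epoly.
  - eapply half_norm_weaken; [apply (Etot K7); lra|].
    apply (N7 rho Hr2 k n (fun j => (-(1)) ^ k * (tcoef k * pc k mhalf mhalf j))%C
      (fun j => (-(1)) ^ n * pc n be al j)%C (fun t => tch k (RtoC (1 - t))) (fun t => pfun n al be (RtoC (1 - t))));
      try assumption.
    + intros t. unfold tch. rewrite RtoC_minus, pfun_reflect.
      replace (1 - (1 - t))%C with (RtoC t) by ring. rewrite Epoly, <- !Csum_scal. apply Csum_ext. intros; cring.
    + intros t. rewrite RtoC_minus, pfun_reflect.
      replace (1 - (1 - t))%C with (RtoC t) by ring. rewrite Epoly, <- !Csum_scal. apply Csum_ext. intros; cring.
    + intros x Hx. apply TS. lra.
    + intros x Hx. apply PSup. lra.
Qed.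

(** * Geometric convergence on smaller ellipses *)

Lemma add_inv_lt (a b : R) : 1 <= a -> a < b -> a + / a < b + / b.
Proof.
  intros Ha Hab.
  assert (P : b + / b - (a + / a) = (b - a) * (a * b - 1) * / (a * b)) by (field; lra).
  assert (0 < (b - a) * (a * b - 1)) by (apply Rmult_lt_0_compat; nra).
  assert (0 < / (a * b)) by (apply Rinv_0_lt_compat; nra). nra.
Qed.

Lemma jouk_radius (x : R) : 1 < x -> exists r, 1 < r /\ r + / r = 2 * x.
Proof.
  intros Hx. set (w := sqrt (x * x - 1)).
  assert (Hw : 0 < w) by (apply sqrt_lt_R0; nra).
  assert (Hww : w * w = x * x - 1) by (apply sqrt_sqrt; nra).
  exists (x + w). split; [lra|].
  assert (E : / (x + w) = x - w).
  { apply Rmult_eq_reg_l with (x + w); [|lra]. rewrite Rinv_r by lra. nra. }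
  rewrite E. ring.
Qed.

Lemma bounded_positive_sum_lim (nu : nat -> R) (M : R) :
  (forall k, 0 <= nu k) -> (forall n, sum_f_R0 nu n <= M) -> exists l : R, is_lim_seq (sum_f_R0 nu) l.
Proof.
  intros H0 HM. destruct (ex_finite_lim_seq_incr (sum_f_R0 nu) M) as [l Hl]; [|exact HM|now exists l].
  intros n. simpl. specialize (H0 (S n)). lra.
Qed.

(** A single geometric rate on a closed smaller ellipse yields pointwise, uniform and absolute
    convergence at once. *)
Lemma jacobi_expansion_rate (al be : C) (rho rho' : R) (f : C -> C) :
  fp_regular al -> fp_regular be -> (forall k : nat, (al + be)%C <> RtoC (- INR (k + 2))) ->
  1 < rho' -> rho' < rho -> holomorphic_on (ellipse_interior rho) f ->
  exists B th, 0 < B /\ 0 < th < 1 /\ forall z, Cmod z + Cmod (z - 1) <= rho' ->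
    (forall n, Cmod (fcoef al be f n * pn al be n z) <= B * th ^ n) /\
    (forall N, Cmod (Csum (fun n => fcoef al be f n * pn al be n z)%C N - f z) <= B * th ^ N).
Proof.
  intros Na Nb Hs Hr1 Hr2 Hf.
  assert (Ng : gam_ok (al + be + 2)).
  { intros k E. apply (Hs k). rewrite plus_INR. simpl (INR 2). replace (1 + 1) with 2 by ring.
    rewrite RtoC_opp, RtoC_plus. transitivity (INR k + (al + be + 2) - (INR k + 2))%C; [ring|]. rewrite E. ring. }
  (* [r] belongs to the closed ellipse of focal sum rho', and [s] to an ellipse strictly between it
     and the boundary of the domain, where the Chebyshev coefficients are still O(s^(-k)). *)
  destruct (jouk_radius rho' Hr1) as [r [Hr Er]].
  destruct (jouk_radius ((rho' + rho) / 2)) as [s [Hs1 Es]]; [lra|].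
  assert (Hrs : r < s).
  { destruct (Rlt_le_dec r s) as [H|H]; [exact H|]. destruct H as [H|H].
    - pose proof (add_inv_lt s r ltac:(lra) H). lra.
    - subst. lra. }
  assert (Hq0 : 1 < s / r).
  { apply Rmult_lt_reg_r with r; [lra|]. unfold Rdiv. rewrite Rmult_assoc, Rinv_l by lra. lra. }
  (* Four losses occur: q^k and q^n in the finite part of T_k p_n, q^n in n!^2 / a_n, and q^n in the
     growth of p_n. With s = q^5 r one factor q is left over, and the final ratio is 1/q. *)
  destruct (root_gt_1 (s / r) 4 Hq0) as [q [Hq Eq]].
  assert (Eqs : s = q ^ 5 * r) by (rewrite Eq; field; lra).
  destruct (fp_norm_tch_pfun al be q Hs Hq) as [rh [KN [Hrh [HKN HNk]]]].
  destruct (fp_int_bound al be rh Na Nb Hrh) as [KH [HKH HIb]].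
  set (La := fun k n => epsilon (inhabits (RtoC 0)) (fun V =>
     fp_int al be rh (fun t => tch k (RtoC t) * pfun n al be (RtoC t))%C V)).
  assert (HLa : forall k n, fp_int al be rh (fun t => tch k (RtoC t) * pfun n al be (RtoC t))%C (La k n) /\
     Cmod (La k n) <= KH * (KN * (q ^ k * (INR (fact n) * q ^ n)))).
  { intros k n. destruct (HIb _ _ (HNk k n)) as [V [HV1 HV2]].
    assert (HL : fp_int al be rh (fun t => tch k (RtoC t) * pfun n al be (RtoC t))%C (La k n))
      by (unfold La; apply epsilon_spec; now exists V).
    split; [exact HL|]. now rewrite (fp_int_unique _ _ _ _ _ _ Na Nb Hrh HL HV1). }
  destruct (sqnorm_lower al be rh q Na Nb Ng Hrh Hq) as [KS [HKS HSq]].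
  destruct (pfun_growth al be r q Hs Hr Hq) as [KP [HKP HPg]].
  destruct (chebyshev_expansion rho f ltac:(lra) Hf) as [c [Hc1 Hc2]].
  destruct (Hc1 s ltac:(lra)) as [Mc [HMc HcB]]; [lra|].
  set (ph := fun k n => (La k n / sqnorm al be rh n)%C).
  assert (Etch : forall k z, tch k z = Csum (fun j => tcoef k * pc k mhalf mhalf j * z ^ j)%C k).
  { intros k z. unfold tch, pfun. rewrite <- Csum_scal. apply Csum_ext. intros; cring. }
  (* Orthogonality to polynomials of degree k < n makes the array triangular. *)
  assert (Hph0 : forall k n, (k < n)%nat -> ph k n = 0).
  { intros k n Hkn. unfold ph.
    pose proof (fp_int_poly_orth al be rh n k (fun j => tcoef k * pc k mhalf mhalf j)%C Na Nb Hrh Hkn) as HO.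
    apply fp_int_ext with (h2 := fun t => (tch k (RtoC t) * pfun n al be (RtoC t))%C) in HO;
      [|exact Hrh|intros t _; now rewrite Etch].
    rewrite (fp_int_unique _ _ _ _ _ _ Na Nb Hrh (proj1 (HLa k n)) HO).
    field. apply HSq. }
  (* A finite expansion exists by degrees; pairing it with p_n identifies its coefficients. *)
  assert (Htau : forall k z, tch k z = Csum (fun n => ph k n * pfun n al be z)%C k).
  { intros k z. destruct (poly_basis al be k Ng (fun j => tcoef k * pc k mhalf mhalf j)%C) as [b Hb].
    rewrite Etch, Hb. apply Csum_ext. intros n Hn. f_equal. unfold ph.
    pose proof (fp_int_coefficient al be rh k n b Na Nb Hrh Hn) as HO.
    apply fp_int_ext with (h2 := fun t => (tch k (RtoC t) * pfun n al be (RtoC t))%C) in HO;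
      [|exact Hrh|intros t _; now rewrite Etch, Hb].
    rewrite (fp_int_unique _ _ _ _ _ _ Na Nb Hrh (proj1 (HLa k n)) HO).
    field. apply HSq. }
  assert (Hq5 : q < s).
  { rewrite Eqs. assert (1 <= q ^ 4) by (apply pow_R1_Rle; lra).
    replace (q ^ 5 * r) with (q * (q ^ 4 * r)) by ring. nra. }
  (* The finite part applied term by term to p_n times the Chebyshev series of [f], whose norms are
     summable because q < s. *)
  assert (Hfc : forall n, Ccv_series (fun k => c k * ph k n)%C (fcoef al be f n)).
  { intros n.
    set (D := KN * (INR (fact n) * q ^ n)).
    assert (HD : 0 < D) by (unfold D; apply Rmult_lt_0_compat; [exact HKN|];
      apply Rmult_lt_0_compat; [apply INR_fact_lt_0|apply pow_lt; lra]).
    set (nu := fun k => Cmod (c k) * (KN * (q ^ k * (INR (fact n) * q ^ n)))).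
    assert (Hnu : forall k, 0 <= nu k <= Mc * D * (q / s) ^ k).
    { intros k. unfold nu. pose proof (Cmod_ge_0 (c k)).
      assert (Hqk : 0 < q ^ k) by (apply pow_lt; lra). assert (Hsk : 0 < s ^ k) by (apply pow_lt; lra).
      replace (Cmod (c k) * (KN * (q ^ k * (INR (fact n) * q ^ n)))) with (Cmod (c k) * s ^ k * D * (q / s) ^ k).
      - assert (0 < (q / s) ^ k) by (apply pow_lt, Rdiv_lt_0_compat; lra). specialize (HcB k).
        assert (0 <= Cmod (c k) * s ^ k) by nra.
        split; [apply Rmult_le_pos; [apply Rmult_le_pos|]; lra|].
        apply Rmult_le_compat_r; [lra|]. apply Rmult_le_compat_r; lra.
      - unfold D, Rdiv. rewrite Rpow_mult_distr, pow_inv. field. lra. }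
    destruct (bounded_positive_sum_lim nu (Mc * D * / (1 - q / s))) as [l Hl]; [apply Hnu| |].
    { intros m. apply Rle_trans with (sum_f_R0 (fun k => (q / s) ^ k * (Mc * D)) m).
      - apply sum_Rle. intros k _. rewrite Rmult_comm. apply Hnu.
      - rewrite <- scal_sum. apply Rmult_le_compat_l; [nra|]. apply sum_geom_le. split.
        + apply Rdiv_le_0_compat; lra.
        + apply Rmult_lt_reg_r with s; [lra|]. unfold Rdiv. rewrite Rmult_assoc, Rinv_l by lra. lra. }
    destruct (fp_int_series al be rh l (fun k t => c k * (tch k (RtoC t) * pfun n al be (RtoC t)))%C nu
      (fun k => c k * La k n)%C (fun t => f (RtoC t) * pn al be n (RtoC t))%C Na Nb Hrh) as [W [HW1 HW2]].
    - intros k. destruct (HNk k n) as [X1 X2]. split; unfold nu; now apply half_norm_scal.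
    - intros k. apply fp_int_scal; try assumption. apply HLa.
    - exact Hl.
    - intros t Ht. destruct (unit_interval_jouk t Ht) as [u [Hu Eu]].
      assert (Hu0 : u <> 0) by (apply Cmod_gt_0; lra).
      rewrite pn_eq. rewrite <- Eu.
      apply Ccv_series_ext with (fun k => pfun n al be (jouk u) * (c k * (u ^ k + (/ u) ^ k)))%C.
      + intros k. rewrite (tch_jouk u k Hu0). ring.
      + rewrite Cmult_comm. apply Ccv_series_scal. apply Hc2; rewrite Hu; [lra|]. rewrite Rinv_1. lra.
    - unfold fcoef. rewrite (HInt_eq al be rh _ W Na Nb Hrh HW1), (a_coef_eq al be rh n Na Nb Ng Hrh). toC.
      apply Ccv_series_ext with (fun k => / sqnorm al be rh n * (c k * La k n))%C.
      + intros k. unfold ph. field. apply HSq.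
      + now apply Ccv_series_scal. }
  set (KB := Mc * (KH * KN) * KP * KS).
  assert (HKB : 0 < KB) by (unfold KB; repeat apply Rmult_lt_0_compat; assumption).
  assert (Hiq : 0 < / q < 1).
  { split; [apply Rinv_0_lt_compat; lra|]. rewrite <- Rinv_1. apply Rinv_lt_contravar; lra. }
  destruct (triangular_rearrangement KB (/ q)) as [B2 [th1 [HB2 [Hth1 HT]]]]; [lra|lra|].
  exists B2, th1. split; [exact HB2|]. split; [exact Hth1|]. intros z Hz.
  destruct (jouk_surj z) as [u [Hu Eu]].
  assert (Hu0 : u <> 0) by (apply Cmod_gt_0; lra).
  pose proof (jouk_ellipse u Hu0) as Je. rewrite Eu in Je.
  assert (Hur : Cmod u <= r).
  { destruct (Rle_lt_dec (Cmod u) r) as [H|H]; [exact H|].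
    pose proof (add_inv_lt r (Cmod u) ltac:(lra) H). lra. }
  destruct (HT c (fun k => tch k z) (fun n => pfun n al be z) (fcoef al be f) ph (f z)) as [HA HB].
  - apply Ccv_series_ext with (fun k => c k * (u ^ k + (/ u) ^ k))%C.
    + intros k. rewrite <- Eu, tch_jouk by exact Hu0. reflexivity.
    + rewrite <- Eu. apply Hc2; [exact Hu|]. lra.
  - intros k. apply Htau.
  - exact Hph0.
  - exact Hfc.
  - intros k n Hnk. unfold ph.
    destruct (HSq n) as [Sn0 Sn]. pose proof (proj1 (Cmod_gt_0 _) Sn0) as Snp.
    rewrite !Cmod_mult. unfold Complex.Cdiv. rewrite Cmod_mult, Cmod_inv by exact Sn0.
    pose proof (proj2 (HLa k n)) as L1. specialize (HcB k).
    pose proof (HPg u n (conj Hu Hur)) as L2. rewrite Eu in L2.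
    set (X := Cmod (sqnorm al be rh n)) in *. set (F := INR (fact n)) in *.
    assert (HF : 0 < F) by apply INR_fact_lt_0.
    assert (Hqk : 0 < q ^ k) by (apply pow_lt; lra). assert (Hqn : 0 < q ^ n) by (apply pow_lt; lra).
    assert (Hsk : 0 < s ^ k) by (apply pow_lt; lra).
    assert (Hrq : 0 < (r * q) ^ n) by (apply pow_lt; nra).
    pose proof (Cmod_ge_0 (c k)) as C0. pose proof (Cmod_ge_0 (La k n)) as C1'. pose proof (Cmod_ge_0 (pfun n al be z)) as C2.
    apply Rmult_le_reg_r with (X * s ^ k); [nra|].
    replace (Cmod (c k) * (Cmod (La k n) * / X) * Cmod (pfun n al be z) * (X * s ^ k)) with
      (Cmod (c k) * s ^ k * Cmod (La k n) * Cmod (pfun n al be z)) by (field; lra).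
    apply Rle_trans with (Mc * (KH * (KN * (q ^ k * (F * q ^ n)))) * (KP * F * (r * q) ^ n)).
    { apply Rmult_le_compat; [apply Rmult_le_pos; nra|exact C2| |exact L2].
      apply Rmult_le_compat; [nra|exact C1'|exact HcB|exact L1]. }
    replace (Mc * (KH * (KN * (q ^ k * (F * q ^ n)))) * (KP * F * (r * q) ^ n)) with
      (Mc * (KH * KN) * KP * (q ^ k * q ^ n * (r * q) ^ n) * (F * F)) by ring.
    apply Rle_trans with (Mc * (KH * KN) * KP * (q ^ k * q ^ n * (r * q) ^ n) * (KS * X * q ^ n)).
    { apply Rmult_le_compat_l; [|exact Sn]. repeat apply Rmult_le_pos; lra. }
    replace (Mc * (KH * KN) * KP * (q ^ k * q ^ n * (r * q) ^ n) * (KS * X * q ^ n)) with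
      (KB * (q ^ k * (q ^ n * (r * q) ^ n * q ^ n)) * X) by (unfold KB; ring).
    replace (KB * (/ q) ^ k * (X * s ^ k)) with (KB * ((/ q) ^ k * s ^ k) * X) by ring.
    apply Rmult_le_compat_r; [lra|]. apply Rmult_le_compat_l; [lra|].
    rewrite <- !Rpow_mult_distr.
    (* The product of the three factors raised to the power n. Since y >= 1 and n <= k, the exponent
       may be raised to k, and q y = s / q. *)
    set (y := q * (r * q) * q). assert (Hy : 1 <= y).
    { assert (1 <= q * q) by nra. unfold y. replace (q * (r * q) * q) with (r * (q * (q * q))) by ring.
      assert (1 <= q * (q * q)) by nra. nra. }
    apply Rle_trans with (q ^ k * y ^ k).
    { apply Rmult_le_compat_l; [lra|]. now apply Rle_pow. }
    rewrite <- Rpow_mult_distr. right. f_equal. unfold y. rewrite Eqs. field. lra.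
  - split.
    + intros n. rewrite pn_eq. apply HA.
    + intros N. rewrite (Csum_ext _ (fun n => fcoef al be f n * pfun n al be z)%C) by (intros; now rewrite pn_eq).
      apply HB.
Qed.

Lemma pow_small (B th eps : R) : 0 < B -> 0 < th < 1 -> 0 < eps ->
  exists N, forall n, (N <= n)%nat -> B * th ^ n < eps.
Proof.
  intros HB Ht He. destruct (pow_lt_1_zero th ltac:(rewrite Rabs_pos_eq; lra) (eps / B)) as [N HN];
    [now apply Rdiv_lt_0_compat|].
  exists N. intros n Hn. specialize (HN n Hn). rewrite Rabs_pos_eq in HN by (apply pow_le; lra).
  apply Rmult_lt_reg_r with (/ B); [now apply Rinv_0_lt_compat|].
  replace (B * th ^ n * / B) with (th ^ n) by (field; lra). exact HN.
Qed.

Lemma Rsum_range_geom (g : nat -> R) (B th : R) (m len : nat) : 0 < B -> 0 < th < 1 ->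
  (forall n, g n <= B * th ^ n) -> Rsum_range g m len <= B / (1 - th) * th ^ m.
Proof.
  intros HB Ht Hg.
  assert (E : Rsum_range g m len <= B * th ^ m * sum_f_R0 (pow th) len).
  { induction len as [|l IH]; simpl.
    - specialize (Hg m). lra.
    - specialize (Hg (m + S l)%nat). rewrite pow_add in Hg. simpl in Hg. nra. }
  eapply Rle_trans; [exact E|]. pose proof (sum_geom_le th len ltac:(lra)) as G.
  unfold Rdiv. replace (B * / (1 - th) * th ^ m) with (B * th ^ m * / (1 - th)) by ring.
  apply Rmult_le_compat_l; [|exact G]. pose proof (pow_lt th m ltac:(lra)). nra.
Qed.

(** Otherwise some points of [K] would have focal sums tending to [rho]; a limit point in [K] would
    then have a focal sum of at least [rho], outside the open ellipse. *)
Lemma compact_in_smaller_ellipse (K : C -> Prop) (rho : R) : 1 < rho -> compact_C K ->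
  (forall z, K z -> ellipse_interior rho z) ->
  exists rho', 1 < rho' < rho /\ forall z, K z -> Cmod z + Cmod (z - 1) <= rho'.
Proof.
  intros Hrho HK Hin.
  set (g := fun z : C => Cmod z + Cmod (z - 1)).
  destruct (excluded_middle_informative (exists rho', 1 < rho' < rho /\ forall z, K z -> g z <= rho')) as [H|H];
    [exact H|].
  exfalso.
  (* The denominator k + 2 keeps the threshold strictly above 1, as is required of rho'. *)
  assert (Hk : forall k : nat, exists z, K z /\ rho - (rho - 1) / (INR k + 2) < g z).
  { intros k. pose proof (pos_INR k).
    destruct (excluded_middle_informative (exists z, K z /\ rho - (rho - 1) / (INR k + 2) < g z)) as [E|E]; [exact E|].
    exfalso. apply H. exists (rho - (rho - 1) / (INR k + 2)).
    assert (H1 : 0 < (rho - 1) / (INR k + 2) < rho - 1).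
    { split; [apply Rdiv_lt_0_compat; lra|].
      apply Rmult_lt_reg_r with (INR k + 2); [lra|]. unfold Rdiv. rewrite Rmult_assoc, Rinv_l by lra. nra. }
    split; [lra|]. intros z Hz. destruct (Rle_lt_dec (g z) (rho - (rho - 1) / (INR k + 2))) as [L|L]; [exact L|].
    exfalso. apply E. now exists z. }
  set (u := fun k => epsilon (inhabits (RtoC 0)) (fun z => K z /\ rho - (rho - 1) / (INR k + 2) < g z)).
  assert (Hu : forall k, K (u k) /\ rho - (rho - 1) / (INR k + 2) < g (u k)).
  { intros k. unfold u. apply epsilon_spec, Hk. }
  destruct (HK u (fun k => proj1 (Hu k))) as [phi [l [Hphi [Hl Hcv]]]].
  specialize (Hin l Hl). unfold ellipse_interior in Hin. toC. fold (g l) in Hin.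
  assert (Hge : forall k, (k <= phi k)%nat) by (induction k as [|k IH]; [lia|specialize (Hphi k); lia]).
  set (e := (rho - g l) / 4). assert (He : 0 < e) by (unfold e; lra).
  destruct (Hcv e He) as [N1 HN1].
  destruct (INR_unbounded ((rho - 1) / e)) as [N2 HN2].
  set (n := max N1 N2). specialize (HN1 n ltac:(lia)). toC.
  pose proof (proj2 (Hu (phi n))) as Q.
  assert (Hn2 : INR N2 <= INR (phi n)) by (apply le_INR; specialize (Hge n); lia).
  assert (Hsm : (rho - 1) / (INR (phi n) + 2) < e).
  { pose proof (pos_INR (phi n)).
    apply Rmult_lt_reg_r with (INR (phi n) + 2); [lra|]. unfold Rdiv at 1. rewrite Rmult_assoc, Rinv_l by lra.
    assert ((rho - 1) / e < INR (phi n) + 2) by lra.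
    replace ((rho - 1) * 1) with (e * ((rho - 1) / e)) by (field; lra).
    now apply Rmult_lt_compat_l. }
  pose proof (Cmod_le_minus (u (phi n)) l) as T1.
  pose proof (Cmod_triangle (l - 1) (u (phi n) - l)) as T2.
  replace (l - 1 + (u (phi n) - l))%C with (u (phi n) - 1)%C in T2 by cring.
  unfold g in *. unfold e in *. lra.
Qed.

(* Coquelicot shadows some names of [Defs], such as [RtoC]. *)
Require Import Defs.

Theorem theorem1p2 (al be : Cplx) (rho : R) (f : Cplx -> Cplx) :
  (forall k : nat, al <> RtoC (- INR k)) ->
  (forall k : nat, be <> RtoC (- INR k)) ->
  (forall k : nat, Cadd al be <> RtoC (- INR (k + 2))) ->
  1 < rho ->
  holomorphic_on (ellipse_interior rho) f ->
  (forall z, ellipse_interior rho z ->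
     Ccv_series (fun n => Cmul (fcoef al be f n) (pn al be n z)) (f z)) /\
  (forall K : Cplx -> Prop, compact_C K -> (forall z, K z -> ellipse_interior rho z) ->
     (forall eps, 0 < eps -> exists N, forall n z, (N <= n)%nat -> K z ->
        Cnorm (Csub (Csum (fun k => Cmul (fcoef al be f k) (pn al be k z)) n) (f z)) < eps) /\
     (forall eps, 0 < eps -> exists N, forall m len z, (N <= m)%nat -> K z ->
        Rsum_range (fun k => Cnorm (Cmul (fcoef al be f k) (pn al be k z))) m len < eps)).

Proof.
  intros Ha Hb Hs Hrho Hf.
  assert (Hnd : forall g : Cplx, (forall k : nat, g <> RtoC (- INR k)) -> fp_regular g).
  { intros g Hg k E. apply (Hg (S k)). rewrite S_INR.
    apply injective_projections; [apply (f_equal fst) in E|apply (f_equal snd) in E]; simpl in *; lra. }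
  pose proof (Hnd al Ha) as Na. pose proof (Hnd be Hb) as Nb.
  split.
  - intros z Hz. unfold ellipse_interior in Hz.
    set (g := Cnorm z + Cnorm (Csub z C1)) in *.
    (* Both arguments lie below [rho]; the first exceeds the focal sum of [z], the second exceeds
       1. *)
    set (rho' := Rmax ((g + rho) / 2) ((1 + rho) / 2)).
    assert (Hr1 : 1 < rho') by (eapply Rlt_le_trans; [|apply Rmax_r]; lra).
    assert (Hr2 : rho' < rho) by (apply Rmax_lub_lt; lra).
    assert (Hg : g <= rho') by (eapply Rle_trans; [|apply Rmax_l]; lra).
    destruct (jacobi_expansion_rate al be rho rho' f Na Nb Hs Hr1 Hr2 Hf) as [B [th [HB [Hth HE]]]].
    intros eps He. destruct (pow_small B th eps HB Hth He) as [N HN].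
    exists N. intros n Hn. eapply Rle_lt_trans; [apply (HE z Hg)|]. now apply HN.
  - intros K HK Hin.
    destruct (compact_in_smaller_ellipse K rho Hrho HK Hin) as [rho' [[Hr1 Hr2] HK']].
    destruct (jacobi_expansion_rate al be rho rho' f Na Nb Hs Hr1 Hr2 Hf) as [B [th [HB [Hth HE]]]].
    split; intros eps He.
    + destruct (pow_small B th eps HB Hth He) as [N HN].
      exists N. intros n z Hn Hz. eapply Rle_lt_trans; [apply (HE z (HK' z Hz))|]. now apply HN.
    + assert (HB' : 0 < B / (1 - th)) by (apply Rdiv_lt_0_compat; lra).
      destruct (pow_small (B / (1 - th)) th eps HB' Hth He) as [N HN].
      exists N. intros m len z Hm Hz. eapply Rle_lt_trans; [|apply HN, Hm].
      apply Rsum_range_geom; [exact HB|exact Hth|]. intros n. apply (HE z (HK' z Hz)).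
Qed.
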